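(* Let $\alpha\in(0,1)$ and $n\ge2$. There exists a constant $c_{n,\alpha}>0$ such that $$\|f\|_{L^{\frac{n}{n-\alpha}}(\mathbb R^n)}\le c_{n,\alpha}\,|D^\alpha f|(\mathbb R^n)$$ for every $f\in BV^\alpha(\mathbb R^n)$. As a consequence, $BV^\alpha(\mathbb R^n)$ is continuously embedded in $L^q(\mathbb R^n)$ for every $q\in\big[1,\tfrac{n}{n-\alpha}\big]$.
   Context: For $\alpha\in(0,1)$ let $\mu_{n,\alpha}:=2^\alpha\pi^{-n/2}\,\Gamma\big(\tfrac{n+\alpha+1}{2}\big)/\Gamma\big(\tfrac{1-\alpha}{2}\big)$. For $\varphi\in C^\infty_c(\mathbb R^n;\mathbb R^n)$ the fractional $\alpha$-divergence is $$\mathrm{div}^\alpha\varphi(x):=\mu_{n,\alpha}\int_{\mathbb R^n}\frac{(y-x)\cdot(\varphi(y)-\varphi(x))}{|y-x|^{n+\alpha+1}}\,dy,$$ which is a function in $L^1(\mathbb R^n)\cap L^\infty(\mathbb R^n)$. For $f\in L^1(\mathbb R^n)$ the fractional variation is $$|D^\alpha f|(\mathbb R^n):=\sup\Big\{\int_{\mathbb R^n}f\,\mathrm{div}^\alpha\varphi\,dx:\ \varphi\in C^\infty_c(\mathbb R^n;\mathbb R^n),\ \|\varphi\|_{L^\infty(\mathbb R^n;\mathbb R^n)}\le1\Big\}.$$ The space $BV^\alpha(\mathbb R^n)$ consists of all $f\in L^1(\mathbb R^n)$ with $|D^\alpha f|(\mathbb R^n)<+\infty$, with norm $\|f\|_{BV^\alpha(\mathbb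 R^n)}:=\|f\|_{L^1(\mathbb R^n)}+|D^\alpha f|(\mathbb R^n)$. *)

(* Defs.v *)
From HB Require Import structures.
From mathcomp Require Import all_boot all_order all_algebra.
From mathcomp Require Import all_classical all_reals all_analysis.

Set Implicit Arguments.
Unset Strict Implicit.
Unset Printing Implicit Defensive.

Import Order.TTheory GRing.Theory Num.Theory.
Import numFieldNormedType.Exports.

Local Open Scope classical_set_scope.
Local Open Scope ring_scope.

(* R^n is the normed space 'rV[R]_n. Its library norm `|x| is the max norm; it
   is used below only through the topology and the derivatives, which do not
   depend on the choice of the norm. Lengths are measured with the Euclidean
   norm [enorm]. *)

Section rV_measurable.
Context (R : realType) (n : nat).

Definition rV_coord (i : 'I_n) (x : 'rV[R]_n) : R := x ord0 i.

(* The sigma-algebra generated by the n coordinates: the Borel one. *)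
HB.instance Definition _ :=
  @isMeasurable.Build default_measure_display
    'rV[R]_n (g_sigma_preimage rV_coord)
    (@sigma_algebra0 _ _ _) (@sigma_algebraC _ _)
    (@sigma_algebra_bigcup _ _ _).

Lemma measurable_rV_coord (i : 'I_n) :
  measurable_fun [set: 'rV[R]_n] (rV_coord i).
Proof.
move=> _ Y mY; rewrite setTI; apply: sub_sigma_algebra => /=.
rewrite -bigcup_seq/=; exists i => /=; first by rewrite mem_index_enum.
by exists Y => //; rewrite setTI.
Qed.

End rV_measurable.

Lemma measurable_fun_rVP d (T : measurableType d) (R : realType) n
    (f : T -> 'rV[R]_n) :
  measurable_fun [set: T] f <->
  forall i, measurable_fun [set: T] (fun x => f x ord0 i).
Proof.
split=> [mf i|mf].
  exact: (measurableT_comp (measurable_rV_coord i) mf).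
suff pS : g_sigma_preimage (fun i => @rV_coord R n i \o f) `<=` measurable.
  move=> _ A mA; rewrite setTI; apply: pS.
  by rewrite g_sigma_preimage_comp; exists A; rewrite ?setTI.
apply: smallest_sub; first exact: sigma_algebra_measurable.
move=> A; rewrite -bigcup_seq => -[i _ [B mB <-]].
exact: mf.
Qed.

Section lebesgue_rV.
Context (R : realType).

Definition rV_cons n (p : measurableTypeR R * 'rV[R]_n) : 'rV[R]_n.+1 :=
  @row_mx R 1 1 n (p.1)%:M p.2.

Lemma rV_cons0 n p : @rV_cons n p ord0 ord0 = p.1.
Proof.
have -> : ord0 = lshift n (ord0 : 'I_1) :> 'I_n.+1 by exact/val_inj.
by rewrite /rV_cons (@row_mxEl R 1 1 n) mxE eqxx mulr1n.
Qed.

Lemma rV_consS n p i : @rV_cons n p ord0 (lift ord0 i) = p.2 ord0 i.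
Proof.
have -> : lift ord0 i = rshift 1 i :> 'I_n.+1 by exact/val_inj.
by rewrite /rV_cons (@row_mxEr R 1 1 n).
Qed.

Lemma measurable_rV_cons n : measurable_fun setT (@rV_cons n).
Proof.
apply/measurable_fun_rVP => i.
have [j ->|->] := unliftP ord0 i.
  under eq_fun do rewrite rV_consS.
  exact: (measurableT_comp (measurable_rV_coord j) measurable_snd).
under eq_fun do rewrite rV_cons0.
exact: measurable_fst.
Qed.

Definition rV_uncons n (x : 'rV[R]_n.+1) : measurableTypeR R * 'rV[R]_n :=
  (x ord0 ord0, \row_j x ord0 (lift ord0 j)).

Lemma rV_consK n : cancel (@rV_cons n) (@rV_uncons n).
Proof.
move=> [r v]; rewrite /rV_uncons rV_cons0; congr pair.
by apply/rowP => j; rewrite mxE rV_consS.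
Qed.

Lemma measurable_rV_uncons n : measurable_fun setT (@rV_uncons n).
Proof.
apply/measurable_fun_pairP; split.
  exact: (measurable_rV_coord ord0).
apply/measurable_fun_rVP => i; rewrite /rV_uncons/=.
under eq_fun do rewrite mxE.
exact: (measurable_rV_coord (lift ord0 i)).
Qed.

Section cons_measure.
Context (n : nat) (m : {sigma_finite_measure set 'rV[R]_n -> \bar R}).

Definition cons_measure : set 'rV[R]_n.+1 -> \bar R :=
  pushforward (@lebesgue_measure R \x m)%E (@rV_cons n).

Let cons_measure0 : cons_measure set0 = 0%E.
Proof. by rewrite /cons_measure /pushforward preimage_set0 measure0. Qed.

Let cons_measure_ge0 A : (0 <= cons_measure A)%E.
Proof. by rewrite /cons_measure /pushforward measure_ge0. Qed.

Let cons_measure_sigma_additive : semi_sigma_additive cons_measure.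
Proof.
move=> F mF tF mUF; rewrite /cons_measure /pushforward preimage_bigcup.
apply: measure_semi_sigma_additive.
- by move=> k; rewrite -[X in measurable X]setTI; exact: measurable_rV_cons.
- apply/trivIsetP => /= i j _ _ ij; rewrite -preimage_setI.
  by move/trivIsetP : tF => /(_ _ _ _ _ ij) ->//; rewrite preimage_set0.
- rewrite -preimage_bigcup -[X in measurable X]setTI.
  exact: measurable_rV_cons.
Qed.

HB.instance Definition _ := isMeasure.Build _ _ _ cons_measure
  cons_measure0 cons_measure_ge0 cons_measure_sigma_additive.

Let cons_measure_sigma_finite : sigma_finite setT cons_measure.
Proof.
have /sigma_finiteP[F [TF ndF Foo]] := sigma_finiteT (@lebesgue_measure R).
have /sigma_finiteP[G [TG ndG Goo]] := sigma_finiteT m.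
exists (fun k => @rV_uncons n @^-1` (F k `*` G k)).
  apply/esym; rewrite -subTset => x _.
  have [i _ Fi] : (\bigcup_i F i) (x ord0 ord0) by rewrite -TF.
  have [j _ Gj] : (\bigcup_j G j) (rV_uncons x).2 by rewrite -TG.
  exists (maxn i j) => //; split => /=.
    by move: Fi; exact/subsetPset/ndF/leq_maxl.
  by move: Gj; exact/subsetPset/ndG/leq_maxr.
move=> k; have [mF Fk] := Foo k; have [mG Gk] := Goo k; split.
  rewrite -[X in measurable X]setTI; apply: measurable_rV_uncons => //.
  exact: measurableX.
rewrite /cons_measure /pushforward -comp_preimage.
rewrite (_ : _ \o _ = idfun); last by apply/funext => x /=; rewrite rV_consK.
by rewrite preimage_id product_measure1E// lte_mul_pinfty// ge0_fin_numE.
Qed.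

HB.instance Definition _ := Measure_isSigmaFinite.Build _ _ _ cons_measure
  cons_measure_sigma_finite.

End cons_measure.

(* Lebesgue measure on R^n (on Borel sets), as an iterated product measure. *)
Fixpoint lebesgue_rV n : {sigma_finite_measure set 'rV[R]_n -> \bar R} :=
  match n with
  | 0 => \d_(0 : 'rV[R]_0)
  | m.+1 => cons_measure (lebesgue_rV m)
  end.

Lemma measurable_rV_box n (A : 'I_n -> set R) :
  (forall i, measurable (A i)) ->
  measurable [set x : 'rV[R]_n | forall i, A i (x ord0 i)].
Proof.
move=> mA.
rewrite (_ : mkset _ = \big[setI/setT]_(i < n) (rV_coord i @^-1` A i)).
  apply: bigsetI_measurable => i _.
  by rewrite -[X in measurable X]setTI; exact: measurable_rV_coord.
rewrite -bigcap_seq; apply/seteqP; split=> [x Ax i _|x Ax i]; first exact: Ax.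
by apply: (Ax i) => /=; rewrite mem_index_enum.
Qed.

Lemma lebesgue_rV_box n (A : 'I_n -> set R) :
  (forall i, measurable (A i)) ->
  lebesgue_rV n [set x | forall i, A i (x ord0 i)] =
  (\prod_(i < n) lebesgue_measure (A i))%E.
Proof.
elim: n A => [|n IHn] A mA.
  by rewrite big_ord0 /= diracE mem_set// => -[].
rewrite big_ord_recl -IHn//= /cons_measure /pushforward.
apply: etrans (@product_measure1E _ _ (measurableTypeR R) _ R
  lebesgue_measure (lebesgue_rV n) _ _ (mA ord0)
  (measurable_rV_box (fun j => mA (lift ord0 j)))).
congr product_measure1; apply/seteqP; split=> -[r v] /=.
  move=> h; split=> [|i]; first by have := h ord0; rewrite rV_cons0.
  by have := h (lift ord0 i); rewrite rV_consS.
move=> [h0 h] i; have [j ->|->] := unliftP ord0 i.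
  by rewrite rV_consS; exact: h.
by rewrite rV_cons0.
Qed.

End lebesgue_rV.

Section test_fields.
Context (R : realType).

Definition dotv n (x y : 'rV[R]_n) : R := \sum_(i < n) x ord0 i * y ord0 i.

Definition enorm n (x : 'rV[R]_n) : R := Num.sqrt (dotv x x).

Fixpoint class_C (k n m : nat) (f : 'rV[R]_n -> 'rV[R]_m) : Prop :=
  continuous f /\
  if k is k'.+1 then
    forall i : 'I_n, (forall x, derivable f x (delta_mx ord0 i)) /\
                     class_C k' ('D_(delta_mx ord0 i) f)
  else True.

Definition smooth n m (f : 'rV[R]_n -> 'rV[R]_m) := forall k, class_C k f.

Definition support n m (f : 'rV[R]_n -> 'rV[R]_m) : set 'rV[R]_n :=
  closure [set x | f x != 0].

(* C^oo_c(R^n; R^n) *)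
Definition test_field n : set ('rV[R]_n -> 'rV[R]_n) :=
  [set phi | smooth phi /\ compact (support phi)].

End test_fields.

Section fractional_variation.
Context (R : realType).

(* Euler's integral, used only for s > 0. *)
Definition Gamma (s : R) : R :=
  \int[lebesgue_measure]_(t in `]0, +oo[) (t `^ (s - 1) * expR (- t)).

Definition frac_cst (n : nat) (alpha : R) : R :=
  2 `^ alpha * pi `^ (- (n%:R / 2)) *
  Gamma ((n%:R + alpha + 1) / 2) / Gamma ((1 - alpha) / 2).

(* The integrand vanishes at y = x. *)
Definition frac_div n (alpha : R) (phi : 'rV[R]_n -> 'rV[R]_n)
    (x : 'rV[R]_n) : R :=
  frac_cst n alpha *
  \int[lebesgue_rV R n]_y
    (dotv (y - x) (phi y - phi x) / enorm (y - x) `^ (n%:R + alpha + 1)).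

Local Open Scope ereal_scope.

Definition frac_variation n (alpha : R) (f : 'rV[R]_n -> R) : \bar R :=
  ereal_sup [set \int[lebesgue_rV R n]_x (f x * frac_div alpha phi x)%:E |
    phi in [set phi | test_field phi /\
      'N[lebesgue_rV R n]_+oo[EFin \o (fun x => enorm (phi x))] <= 1]].

(* Functions are not identified up to null sets; every quantity below is
   invariant under modification on a null set. *)
Definition BV n (alpha : R) : set ('rV[R]_n -> R) :=
  [set f | f \in Lfun (lebesgue_rV R n) 1 /\ frac_variation alpha f < +oo].

Arguments BV n alpha _ : clear implicits.

Definition BV_norm n (alpha : R) (f : 'rV[R]_n -> R) : \bar R :=
  'N[lebesgue_rV R n]_1[EFin \o f] + frac_variation alpha f.

Definition BV_continuously_embedded n (alpha q : R) : Prop :=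
  (forall f, BV n alpha f -> f \in Lfun (lebesgue_rV R n) q%:E) /\
  exists C : R, (0 < C)%R /\
    forall f, BV n alpha f ->
      'N[lebesgue_rV R n]_(q%:E)[EFin \o f] <= C%:E * BV_norm alpha f.

End fractional_variation.
Arguments BV {R} n alpha _.
Arguments BV_continuously_embedded {R} n alpha q.

(* Main.v *)
(** By duality it suffices to bound the integral of [|f| g] for bounded [g >= 0] with
    [int g^(n/alpha) <= 1]. Put [s = 1 - alpha], [a = s/2] and let [U = I_s f] be the Riesz
    potential of (a mollification of) [f]. Testing the fractional variation [V] of [f] with
    [phi = (k * g) e_i], where [k] is a mollifier integrated over a segment of direction [e_i]
    and [g] is minus the sign of a difference quotient, shows that [U] has ordinary
    variation at most [C V]: [int |U(x+h) - U(x)| <= C V |h|]. Inverting the potential along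
    the heat semigroup [P_t] gives [c |f| <= int_0^oo t^(-a-1) P_t|U - U(x)|(x) dt]. Since
    [|U(x+z) - U(x)|] is the integral over [l] of [|1_{U>l}(x+z) - 1_{U>l}(x)|], it remains to
    estimate, for a single set [E], the integral of [g t^(-a-1) P_t|1_E - 1_E(x)|]: splitting
    the time axis at [|E|^(2/n)], Hoelder's inequality and the isoperimetric inequality
    [|E| <= C |E|^(1/n) Per(E)] bound it by [C Per(E)]. Here the perimeter is read off from
    the heat flow, as the supremum of [2^j A(4^-j)] with [A t = int P_t|1_E - 1_E(x)|(x) dx],
    which makes coarea a monotone convergence argument. *)

Require Import Defs.
From HB Require Import structures.
From mathcomp Require Import all_boot all_order all_algebra.
From mathcomp Require Import all_classical all_reals all_analysis.
From mathcomp Require Import measurable_realfun ess_sup_inf.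
From mathcomp Require Import ring lra.

Set Implicit Arguments.
Unset Strict Implicit.
Unset Printing Implicit Defensive.

Import Order.TTheory GRing.Theory Num.Theory.
Import numFieldNormedType.Exports.

Local Open Scope classical_set_scope.
Local Open Scope ring_scope.

(** * Integration on R^n *)

Section measurability.
Context d (T : measurableType d) (R : realType).

(** The fractional variation gives no access to the level sets of [f] itself. The potential [U] has
    an ordinary gradient, which is the fractional gradient of [f], so that its superlevel sets have
    integrable perimeters, and the proof moves to them. The price is the inversion of the potential.
    Done for functions, it is an endpoint estimate on [L^1] and would yield only a weak-type
    inequality; done set by set, it can use a volume bound and a perimeter bound at each time scale.
    The order [s] becomes [a = s/2] in time because the heat flow spreads over a distance [sqrt t].

    The heat kernel is preferred because it is a product of one-dimensional Gaussians and because
    the Riesz kernel and [|z|^(-n-alpha-1)] are superpositions of it in time. No Fourier transform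
    occurs, and of the constants that arise as time integrals only positivity and finiteness matter.
    Two regularisations coexist: a compactly supported bump, from which smooth test fields are
    built, and a heat flow of duration [d], which makes the Riesz kernel bounded. The final
    constants depend on neither. *)

Lemma measurable_rVD n (f g : T -> 'rV[R]_n) :
  measurable_fun setT f -> measurable_fun setT g ->
  measurable_fun setT (fun x => f x + g x).
Proof.
move=> /measurable_fun_rVP mf /measurable_fun_rVP mg.
apply/measurable_fun_rVP => i; under eq_fun do rewrite mxE.
exact: measurable_funD.
Qed.

Lemma measurable_rVZ n (k : R) (f : T -> 'rV[R]_n) :
  measurable_fun setT f -> measurable_fun setT (fun x => k *: f x).
Proof.
move=> /measurable_fun_rVP mf.
apply/measurable_fun_rVP => i; under eq_fun do rewrite mxE.
exact: measurable_funM.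
Qed.

Lemma measurable_rVN n (f : T -> 'rV[R]_n) :
  measurable_fun setT f -> measurable_fun setT (fun x => - f x).
Proof.
by move=> mf; under eq_fun do rewrite -scaleN1r; exact: measurable_rVZ.
Qed.

Lemma measurable_rVE n (f : T -> 'rV[R]_n) i :
  measurable_fun setT f -> measurable_fun setT (fun x => f x ord0 i).
Proof. by move=> mf; apply: (measurable_fun_rVP f).1. Qed.

(** The inverse is discontinuous at 0, but on each side of 0 it is a power of exponent [-1], and
    powers are measurable. *)
Lemma measurable_inv (f : T -> R) :
  measurable_fun setT f -> measurable_fun setT (fun x => (f x)^-1).
Proof.
move=> mf.
have -> : (fun x => (f x)^-1) = (fun x => if 0 <= f x then f x `^ (-1)
    else - ((- f x) `^ (-1))).
  apply/funext => x; case: ifPn => [fx|]; first by rewrite powR_inv1.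
  by rewrite -ltNge => fx; rewrite powR_inv1 ?invrN ?opprK// oppr_ge0 ltW.
apply: measurable_fun_ifT => //.
- by apply: measurable_fun_ler.
- exact: (measurableT_comp (measurable_powR _)).
- apply: measurableT_comp => //; apply: (measurableT_comp (measurable_powR _)).
  exact: measurableT_comp.
Qed.

Lemma measurable_dotv n (f g : T -> 'rV[R]_n) :
  measurable_fun setT f -> measurable_fun setT g ->
  measurable_fun setT (fun x => dotv (f x) (g x)).
Proof.
move=> mf mg; apply: measurable_sum => i.
by apply: measurable_funM; exact: measurable_rVE.
Qed.

End measurability.

Ltac mfun1 :=
  match goal with
  | H : measurable_fun _ ?f |- measurable_fun _ ?f => exact H
  | |- measurable_fun _ id => exact: measurable_id
  | |- measurable_fun _ ( *:%R _) => apply: measurable_rVZ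
  | |- measurable_fun _ ( *%R _) => exact: mulrl_measurable
  | |- measurable_fun _ (+%R _) =>
      first [apply: measurable_rVD | apply: measurable_funD]
  | |- measurable_fun _ -%R =>
      first [exact: oppr_measurable | apply: measurable_rVN | apply: measurable_funN]
  | |- measurable_fun _ (fun x => x) => exact: measurable_id
  | |- measurable_fun _ (fun x => ?c) => exact: measurable_cst
  | |- measurable_fun _ fst => exact: measurable_fst
  | |- measurable_fun _ snd => exact: measurable_snd
  | |- measurable_fun _ (fun x => (@?g x).1) => apply: (measurableT_comp measurable_fst)
  | |- measurable_fun _ (fun x => (@?g x).2) => apply: (measurableT_comp measurable_snd)
  | |- measurable_fun _ (fun x => (@?f x, @?g x)) => apply: measurable_fun_pair
  | |- measurable_fun _ (fun x => (@?f x)%:E) => apply/measurable_EFinP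
  | |- measurable_fun _ (EFin \o _) => apply/measurable_EFinP
  | |- measurable_fun _ (fun x => mule (@?f x) (@?g x)) => apply: emeasurable_funM
  | |- measurable_fun _ (mule _) => apply: emeasurable_funM
  | |- measurable_fun _ (fun x => (`|@?f x|)%E) =>
      apply: (@measurableT_comp _ _ _ _ _ _ abse); [exact: abse_measurable|]
  | |- measurable_fun _ (fun x => GRing.add (@?f x) (@?g x)) =>
      first [apply: measurable_rVD | apply: measurable_funD | apply: emeasurable_funD]
  | |- measurable_fun _ (fun x => @?f x * @?g x) => apply: measurable_funM
  | |- measurable_fun _ (fun x => - @?f x) =>
      first [exact: oppr_measurable | apply: measurable_rVN | apply: measurable_funN]
  | |- measurable_fun _ (fun x => _ *: @?f x) => apply: measurable_rVZ
  | |- measurable_fun _ (fun x => @Num.norm ?A ?B (@?f x)) =>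
      apply: (@measurableT_comp _ _ _ _ _ _ (@Num.norm A B));
      [exact: normr_measurable|]
  | |- measurable_fun _ (fun x => (@?f x)^-1) => apply: measurable_inv
  | |- measurable_fun _ (fun x => Num.sqrt (@?f x)) =>
      apply: (measurableT_comp (continuous_measurable_fun (@sqrt_continuous _)))
  | |- measurable_fun _ (fun x => (@?f x) ^+ _) => apply: measurable_funX
  | |- measurable_fun _ (fun x => dotv (@?f x) (@?g x)) => apply: measurable_dotv
  | |- measurable_fun _ (fun x => expR (@?f x)) =>
      apply: (@measurableT_comp _ _ _ _ _ _ (@expR _)); [exact: measurable_expR|]
  | |- measurable_fun _ (fun x => (@?f x) `^ _) => apply: (measurableT_comp (measurable_powR _))
  | |- measurable_fun _ (fun x => fun_of_matrix (@?f x) ord0 ?i) => apply: measurable_rVE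
  | |- measurable_fun _ (fun x => @Order.lt _ _ (@?f x) (@?g x)) =>
      apply: measurable_fun_ltr
  | |- measurable_fun _ (fun x => @Order.le _ _ (@?f x) (@?g x)) =>
      apply: measurable_fun_ler
  | |- measurable_fun _ (@Order.lt _ _ _) => apply: measurable_fun_ltr
  | |- measurable_fun _ (@Order.le _ _ _) => apply: measurable_fun_ler
  | H : measurable_fun _ ?f |- measurable_fun _ (fun x => ?f (@?g x)) =>
      apply: (measurableT_comp H)
  | H : forall _, measurable_fun _ _ |- measurable_fun _ _ => exact: H
  | H : forall _, measurable_fun _ _ |- measurable_fun _ _ =>
      apply: (measurableT_comp (H _))
  | |- forall _, measurable_fun _ _ => intro
  | |- measurable_fun _ _ => apply: measurable_fun_ifT
  | |- measurable_fun _ _ => apply: measurable_sum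
  end.
Ltac mfun := rewrite /=; repeat mfun1.

Ltac nneg1 :=
  match goal with
  | H : is_true (@Order.lt _ _ _ ?x) |- is_true (@Order.le _ _ _ ?x) => exact: (ltW H)
  | H : is_true (@Order.le _ _ _ ?x) |- is_true (@Order.le _ _ _ ?x) => exact: H
  | |- forall _, _ => intro
  | |- is_true (@Order.le _ _ _ (integral _ _ _)) => apply: integral_ge0
  | |- is_true (@Order.le _ _ _ (mule _ _)) => apply: mule_ge0
  | |- is_true (@Order.le _ _ _ (abse _)) => exact: abse_ge0
  | |- is_true (@Order.le _ _ _ (EFin _)) => rewrite lee_fin
  | |- is_true (@Order.le _ _ _ (GRing.mul _ _)) => apply: mulr_ge0
  | |- is_true (@Order.le _ _ _ (GRing.add _ _)) => first [apply: adde_ge0 | apply: addr_ge0]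
  | |- is_true (@Order.le _ _ _ (powR _ _)) => exact: powR_ge0
  | |- is_true (@Order.le _ _ _ (expR _)) => exact: expR_ge0
  | |- is_true (@Order.le _ _ _ (Num.norm _)) => exact: normr_ge0
  | |- is_true (@Order.le _ _ _ (GRing.natmul _ _)) => exact: ler0n
  | |- is_true (@Order.le _ _ _ (GRing.inv _)) => rewrite invr_ge0
  | |- is_true (@Order.le _ _ _ (Num.sqrt _)) => exact: sqrtr_ge0
  | |- is_true (@Order.le _ _ _ (GRing.exp _ _)) => apply: exprn_ge0
  | |- is_true (@Order.le _ _ _ (\prod_(_ <- _ | _) _)%R) => apply: prodr_ge0 => *
  | H : forall _, _ |- is_true (@Order.le _ _ _ _) => exact: H
  | |- is_true (@Order.le _ _ _ _) => done
  end.
(** A hook, rebound when new kernels arrive, which keeps the sign conditions of Tonelli's theorem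
    automatic. [mfun_ext] does the same for measurability. *)
Ltac nneg_ext := fail.
Ltac nneg := rewrite /=; repeat first [nneg_ext | nneg1].

Ltac pos1 :=
  match goal with
  | H : is_true (@Order.lt _ _ _ ?x) |- is_true (@Order.lt _ _ _ ?x) => exact: H
  | |- is_true (@Order.lt _ _ _ (GRing.mul _ _)) => apply: mulr_gt0
  | |- is_true (@Order.lt _ _ _ (GRing.add _ _)) => apply: addr_gt0
  | |- is_true (@Order.lt _ _ _ (GRing.inv _)) => rewrite invr_gt0
  | |- is_true (@Order.lt _ _ _ (powR _ _)) => apply: powR_gt0
  | |- is_true (@Order.lt _ _ _ (expR _)) => exact: expR_gt0
  | |- is_true (@Order.lt _ _ _ (Num.sqrt _)) => rewrite sqrtr_gt0
  | |- is_true (@Order.lt _ _ _ (GRing.exp _ _)) => apply: exprn_gt0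
  | |- is_true (@Order.lt _ _ _ pi) => exact: pi_gt0
  | |- is_true (@Order.lt _ _ _ _) => done
  end.
Ltac pos := rewrite /=; repeat pos1.

Ltac side :=
  match goal with
  | |- measurable_fun _ _ => solve [mfun]
  | |- measurable _ => exact: measurableT
  | |- is_true (@Order.le _ _ 0%R _) => solve [nneg]
  | |- is_true (@Order.le _ _ 0%E _) => solve [nneg]
  | |- forall _, _ => solve [nneg]
  end.

Section tonelli.
Local Open Scope ereal_scope.
Context d1 d2 (T1 : measurableType d1) (T2 : measurableType d2) (R : realType).
Variable m1 : {sigma_finite_measure set T1 -> \bar R}.
Variable m2 : {sigma_finite_measure set T2 -> \bar R}.
Variable f : T1 -> T2 -> \bar R.
Hypothesis f0 : forall x y, 0 <= f x y.

Lemma tonelli : measurable_fun setT (fun p => f p.1 p.2) ->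
  \int[m1]_x \int[m2]_y f x y = \int[m2]_y \int[m1]_x f x y.
Proof. by move=> mf; rewrite (fubini_tonelli (fun p => f p.1 p.2)). Qed.

Lemma measurable_integral2 : measurable_fun setT (fun p => f p.1 p.2) ->
  measurable_fun setT (fun x => \int[m2]_y f x y).
Proof.
by move=> mf; apply: (measurable_fun_fubini_tonelli_F (fun p => f p.1 p.2)).
Qed.

End tonelli.

Ltac mfun_ext := fail.
Ltac mfun ::= rewrite /=; repeat
  first [match goal with
         | H : measurable_fun _ ?f |- measurable_fun _ ?f => exact H
         end
        | match goal with |- measurable_fun _ (fun x => integral _ _ _) =>
            apply: measurable_integral2; [solve [nneg]|rewrite /=]
          end
        | mfun_ext | mfun1].

(** * Affine changes of variable *)

Section affine.
Context (R : realType).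
Local Open Scope ereal_scope.
Notation mu := (@lebesgue_measure R).
Variables (c d : R).
Hypothesis c0 : (c != 0)%R.

Let phi (x : measurableTypeR R) : measurableTypeR R := (c * x + d)%R.

Let mphi : measurable_fun setT phi.
Proof. by apply: measurable_funD => //; exact: measurable_funM. Qed.

Let push := measure_function_pushforward__canonical__measure_function_Measure mu mphi.

(** Uniqueness of Lebesgue measure: the rescaled image measure is compared with it on half-open
    intervals. For [c < 0] the preimage is closed at the other end, which leaves its length
    unchanged. *)
Lemma lebesgue_measure_affine (A : set R) : measurable A ->
  mu A = `|c|%:E * mu ((fun x => c * x + d)%R @^-1` A).
Proof.
move=> mA; suff -> : mu A = mscale (NngNum (normr_ge0 c)) push A by [].
apply: lebesgue_measure_unique => // _ [[a b]] _ <- /=.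
rewrite /mscale /= /pushforward.
have [cpos|cneg] : ((0 < c) \/ (c < 0))%R.
  by move: c0; case: (ltgtP c 0%R) => //; [right|left].
- rewrite [phi @^-1` _](_ : _ =
    [set` `]((a - d) / c)%R, ((b - d) / c)%R]]); last first.
    apply/seteqP; split => x /=; rewrite /phi !in_itv/= ltr_pdivrMr// ler_pdivlMr//;
    rewrite (mulrC x); lra.
  rewrite !lebesgue_measure_itv/= !lte_fin ltr_pM2r ?invr_gt0// ltrD2r.
  case: ifPn => ab; last by rewrite mule0.
  rewrite (gtr0_norm cpos) -!EFinB -EFinM; congr EFin.
  by field; rewrite gt_eqF.
- rewrite [phi @^-1` _](_ : _ =
    [set` `[((b - d) / c)%R, ((a - d) / c)%R[]); last first.
    apply/seteqP; split => x /=; rewrite /phi !in_itv/= ltr_ndivlMr// ler_ndivrMr//;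
    rewrite (mulrC x); lra.
  rewrite !lebesgue_measure_itv/= !lte_fin ltr_nM2r ?invr_lt0// ltrD2r.
  case: ifPn => ab; last by rewrite mule0.
  rewrite (ltr0_norm cneg) -!EFinB -EFinM; congr EFin.
  by field; rewrite lt_eqF.
Qed.

Lemma integral_affine (F : R -> \bar R) :
  measurable_fun setT F -> (forall x, 0 <= F x) ->
  \int[mu]_x F x = `|c|%:E * \int[mu]_x F (c * x + d)%R.
Proof.
move=> mF F0.
rewrite (@eq_measure_integral _ _ _ _ (mscale (NngNum (normr_ge0 c)) push)).
  by rewrite ge0_integral_mscale//= ge0_integral_pushforward.
by move=> A mA _; exact: lebesgue_measure_affine.
Qed.

End affine.

Section rV_integral.
Context (R : realType).
Local Open Scope ereal_scope.

Lemma integral_rV0 (F : 'rV[R]_0 -> \bar R) :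
  measurable_fun setT F -> \int[lebesgue_rV R 0]_x F x = F 0%R.
Proof. by move=> mF; rewrite integral_dirac// diracT mul1e. Qed.

Lemma integral_rVS n (F : 'rV[R]_n.+1 -> \bar R) :
  measurable_fun setT F -> (forall x, 0 <= F x) ->
  \int[lebesgue_rV R n.+1]_x F x =
  \int[lebesgue_measure]_r \int[lebesgue_rV R n]_v F (rV_cons (r, v)).
Proof.
move=> mF F0.
rewrite /= /cons_measure (ge0_integral_pushforward (@measurable_rV_cons R n))//.
rewrite (fubini_tonelli1 (F \o @rV_cons R n))//=.
exact: (measurableT_comp mF (@measurable_rV_cons R n)).
Qed.

Lemma rV_consD n r v s w :
  (@rV_cons R n (r, v) + rV_cons (s, w) = rV_cons (r + s, v + w))%R.
Proof.
apply/rowP => i; rewrite mxE; have [j ->|->] := unliftP ord0 i.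
  by rewrite !rV_consS mxE.
by rewrite !rV_cons0.
Qed.

Lemma rV_consZ n (k : R) r v :
  (k *: @rV_cons R n (r, v) = rV_cons (k * r, k *: v))%R.
Proof.
apply/rowP => i; rewrite mxE; have [j ->|->] := unliftP ord0 i.
  by rewrite !rV_consS mxE.
by rewrite !rV_cons0.
Qed.

Lemma rV_uncons_consE n (x : 'rV[R]_n.+1) : rV_cons (rV_uncons x) = x.
Proof.
apply/rowP => i; have [j ->|->] := unliftP ord0 i.
  by rewrite rV_consS mxE.
by rewrite rV_cons0.
Qed.

(** Induction on the dimension, peeling off the first coordinate. Translations, reflections and the
    dilation by 2 of the heat modulus are instances. *)
Lemma integral_rV_affine n (c : R) (w : 'rV[R]_n) (F : 'rV[R]_n -> \bar R) :
  c != 0%R -> measurable_fun setT F -> (forall x, 0 <= F x) ->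
  \int[lebesgue_rV R n]_x F x =
  (`|c| ^+ n)%:E * \int[lebesgue_rV R n]_x F (c *: x + w)%R.
Proof.
elim: n w F => [|n IHn] w F c0 mF F0.
  rewrite expr0 mul1e !integral_rV0//; last by mfun.
  by rewrite (_ : (_ + _)%R = 0%R)//; apply/rowP => -[].
rewrite !integral_rVS//; last by mfun.
have mG : measurable_fun setT (fun p : R * 'rV[R]_n => F (rV_cons p)).
  exact: (measurableT_comp mF (@measurable_rV_cons R n)).
have -> : w = rV_cons (rV_uncons w) by rewrite rV_uncons_consE.
move: (rV_uncons w) => [b v].
under [X in _ = _ * X]eq_integral do under eq_integral do rewrite rV_consZ rV_consD.
rewrite [LHS](@integral_affine R c b c0 (fun r => \int[lebesgue_rV R n]_u F (rV_cons (r, u)))); first last.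
- by move=> r; apply: integral_ge0.
- exact: (measurable_fun_fubini_tonelli_F (fun p => F (rV_cons p))).
rewrite exprS EFinM -muleA; congr (_ * _).
rewrite -ge0_integralZl//; first last.
- by move=> r _; apply: integral_ge0.
- apply: measurable_integral2 => //.
  by apply: (measurableT_comp mG); mfun.
apply: eq_integral => r _; rewrite (IHn v (fun x => F (rV_cons ((c * r + b)%R, x))))//.
by apply: (measurableT_comp mG); mfun.
Qed.

Lemma integral_rVD n (w : 'rV[R]_n) (F : 'rV[R]_n -> \bar R) :
  measurable_fun setT F -> (forall x, 0 <= F x) ->
  \int[lebesgue_rV R n]_x F (x + w)%R = \int[lebesgue_rV R n]_x F x.
Proof.
move=> mF F0; rewrite [RHS](integral_rV_affine w (oner_neq0 R))//.
rewrite normr1 expr1n mul1e.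
by under [RHS]eq_integral do rewrite scale1r.
Qed.

Lemma integral_rVBr n (w : 'rV[R]_n) (F : 'rV[R]_n -> \bar R) :
  measurable_fun setT F -> (forall x, 0 <= F x) ->
  \int[lebesgue_rV R n]_x F (w - x)%R = \int[lebesgue_rV R n]_x F x.
Proof.
move=> mF F0; have N10 : (-1 != 0 :> R)%R by rewrite oppr_eq0 oner_neq0.
rewrite [RHS](integral_rV_affine w N10)// normrN normr1 expr1n mul1e.
by under [RHS]eq_integral do rewrite scaleN1r addrC.
Qed.

(** Gaussians and bumps on R^n are products over the coordinates; this reduces their explicit
    integrals to the line. *)
Lemma integral_rV_prod n (a : 'I_n -> R -> R) :
  (forall i, measurable_fun setT (a i)) -> (forall i x, 0 <= a i x)%R ->
  \int[lebesgue_rV R n]_x (\prod_(i < n) a i (x ord0 i))%:E =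
  \prod_(i < n) \int[lebesgue_measure]_r (a i r)%:E.
Proof.
elim: n a => [|n IHn] a ma a0.
  rewrite big_ord0 integral_rV0; first by rewrite big_ord0.
  by apply/measurable_EFinP; under eq_fun do rewrite big_ord0; exact: measurable_cst.
have mprod m (b : 'I_m -> R -> R) : (forall i, measurable_fun setT (b i)) ->
    measurable_fun setT (fun x : 'rV[R]_m => (\prod_(i < m) b i (x ord0 i))%R).
  move=> mb; apply: measurable_prod => i _.
  by apply: (measurableT_comp (mb i)); mfun.
rewrite integral_rVS; first last.
- by move=> x; rewrite lee_fin prodr_ge0.
- by apply/measurable_EFinP; exact: mprod.
rewrite big_ord_recl -(IHn (fun j => a (lift ord0 j)))//.
rewrite -ge0_integralZr; [|by []|by apply/measurable_EFinP; exact: ma|by nneg|by nneg].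
apply: eq_integral => r _.
rewrite -ge0_integralZl; [|by []|by apply/measurable_EFinP; exact: (mprod _ (fun j => a (lift ord0 j)))
  |by nneg|by nneg].
apply: eq_integral => v _; rewrite big_ord_recl rV_cons0 EFinM.
by under eq_bigr do rewrite rV_consS.
Qed.

End rV_integral.

Section integral_bounds.
Local Open Scope ereal_scope.

Lemma le_integralT d (T : measurableType d) (R : realType)
    (mu : {measure set T -> \bar R}) (f g : T -> \bar R) :
  (forall x, 0 <= f x) -> measurable_fun setT f -> measurable_fun setT g ->
  (forall x, f x <= g x) -> \int[mu]_x f x <= \int[mu]_x g x.
Proof. by move=> f0 mf mg fg; apply: ge0_le_integral => // x _. Qed.

(** Domains of integration are mostly encoded by an [if] in the integrand, so that Tonelli's theorem
    and comparisons take place on the whole space. This converts between the two forms. *)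
Lemma integral_setT_ifE d (T : measurableType d) (R : realType)
    (mu : {measure set T -> \bar R}) (D : set T) (f g : T -> \bar R) :
  (forall x, D x -> g x = f x) -> (forall x, ~ D x -> g x = 0) ->
  \int[mu]_x g x = \int[mu]_(x in D) f x.
Proof.
move=> gf g0; rewrite [RHS]integral_mkcond; apply: eq_integral => x _.
rewrite patchE; case: ifPn => [|]; first by rewrite inE => /gf.
by rewrite notin_setE => /g0.
Qed.

Lemma integral_bigcup_le d (T : measurableType d) (R : realType)
    (mu : {measure set T -> \bar R}) (F : (set T)^nat) (f : T -> \bar R) M :
  nondecreasing_seq F -> (forall i, measurable (F i)) ->
  measurable_fun setT f -> (forall x, 0 <= f x) ->
  (forall i, \int[mu]_(x in F i) f x <= M) ->
  \int[mu]_(x in \bigcup_i F i) f x <= M.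
Proof.
move=> ndF mF mf f0 H.
have mf' i : measurable_fun (F i) f by exact: measurable_funTS.
have c := ge0_nondecreasing_set_cvg_integral (mu := mu) ndF mF mf' (fun i x _ => f0 x).
rewrite -(cvg_lim _ c)//; apply: lime_le.
  by apply/cvg_ex; exists (\int[mu]_(x in \bigcup_i F i) f x).
by apply: nearW.
Qed.

(** Serves to show that constants given by time integrals are nonzero. The interval [[1, 2]] avoids
    the two singular ends of the half-line. *)
Lemma integral_gt0 (R : realType) (f : R -> \bar R) (m : R) :
  (0 < m)%R -> measurable_fun setT f -> (forall x, 0 <= f x) ->
  (forall x, (1 <= x <= 2)%R -> m%:E <= f x) -> 0 < \int[lebesgue_measure]_x f x.
Proof.
move=> m0 mf f0 f12; apply: (@lt_le_trans _ _ (\int[lebesgue_measure]_(x in `[1%R, 2%R]) f x)).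
  apply: (@lt_le_trans _ _ (\int[lebesgue_measure]_(x in `[1%R, 2%R]) m%:E)).
    rewrite integral_cst// /= lebesgue_measure_itv/= lte_fin ltr1n.
    by rewrite -EFinB -EFinM lte_fin mulr_gt0// subr_gt0 ltr1n.
  apply: ge0_le_integral => //.
  - by move=> x _; rewrite lee_fin ltW.
  - exact: measurable_funTS.
apply: ge0_subset_integral;
  [exact: measurable_itv|exact: measurableT|exact: mf|by move=> x _; exact: f0|by []].
Qed.

End integral_bounds.

(** * Powers on the half-line and the heat kernel *)

Section power_weights.
Context (R : realType).
Implicit Types (a b c t x : R).

(* [pw c] is [t^c] on the half-line and 0 elsewhere ([powR] is 1 at negative
   bases), so that time integrals can be taken over all of R. *)
Definition pw c t : R := if 0 < t then t `^ c else 0.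

Lemma pw_ge0 c t : 0 <= pw c t.
Proof. by rewrite /pw; case: ifP => // _; exact: powR_ge0. Qed.

Lemma measurable_pw c : measurable_fun setT (pw c).
Proof. by rewrite /pw; mfun. Qed.

Lemma pwE c t : 0 < t -> pw c t = t `^ c.
Proof. by rewrite /pw => ->. Qed.

Lemma pwM c y t : 0 < y -> pw c (y * t) = y `^ c * pw c t.
Proof.
move=> y0; rewrite /pw pmulr_rgt0//; case: ifPn => t0; last by rewrite mulr0.
by rewrite powRM// ltW.
Qed.

Lemma continuous_powR c t : 0 < t -> {for t, continuous (@powR R ^~ c)}.
Proof.
move=> t0; apply: differentiable_continuous; apply/derivable1_diffP.
by apply: derivable_powR; rewrite in_itv/= t0.
Qed.

Local Open Scope ereal_scope.

Lemma integral_powR_itv c a b : c != 0%R -> (0 < a)%R -> (a < b)%R ->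
  \int[lebesgue_measure]_(t in `[a, b]) (t `^ (c - 1))%:E =
  ((b `^ c - a `^ c) / c)%:E.
Proof.
move=> c0 a0 ab.
rewrite (@continuous_FTC2 _ _ (fun t => c^-1 * t `^ c)%R)//.
- by rewrite -EFinB; congr EFin; field.
- apply: continuous_in_subspaceT => x; rewrite inE/= in_itv/= => /andP[ax _].
  by apply: continuous_powR; exact: lt_le_trans ax.
- have cF x : (0 < x)%R -> {for x, continuous (fun t => c^-1 * t `^ c)%R}.
    by move=> x0; apply: continuousM; [exact: cvg_cst|exact: continuous_powR].
  split.
  + move=> x; rewrite in_itv/= => /andP[ax _].
    apply: derivableM; first exact: derivable_cst.
    by apply: derivable_powR; rewrite in_itv/= (lt_trans a0 ax).
  + by apply: cvg_at_right_filter; exact: cF.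
  + by apply: cvg_at_left_filter; apply: cF; exact: lt_trans ab.
- move=> x; rewrite in_itv/= => /andP[ax _].
  have x0 : (0 < x)%R by exact: lt_trans ax.
  rewrite derive1E deriveM//=; last first.
    by apply: derivable_powR; rewrite in_itv/= x0.
  rewrite derive_cst scaler0 addr0 -derive1E powR_derive1 ?in_itv/= ?x0//.
  by rewrite /GRing.scale/= mulrA mulVf// mul1r.
Qed.

Lemma integral_pw_near0 c x : (0 < c)%R -> (0 < x)%R ->
  \int[lebesgue_measure]_t (if (t <= x)%R then pw (c - 1) t else 0%R)%:E <=
  (x `^ c / c)%:E.
Proof.
move=> c0 x0; have mp := measurable_pw (c - 1).
(* With [k.+2] the interval is nondegenerate already for [k = 0]. *)
pose F k := `[(x / k.+2%:R)%R, x]%classic.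
apply: (@le_trans _ _ (\int[lebesgue_measure]_(t in \bigcup_k F k) (pw (c - 1) t)%:E)).
rewrite le_eqVlt; apply/orP; left; apply/eqP; apply: integral_setT_ifE; last first.
- move=> t nt; case: ifPn => // tx; rewrite /pw; case: ifPn => // t0.
  exfalso; apply: nt.
  have [k _ hk] := near_infty_natSinv_lt (PosNum (divr_gt0 t0 x0)).
  exists k => //; rewrite /F/= in_itv/= tx andbT.
  have := hk k (leqnn k); rewrite /= ltr_pdivlMr// => /ltW; apply: le_trans.
  rewrite mulrC ler_wpM2r ?(ltW x0)// lef_pV2 ?posrE ?ltr0n// ler_nat.
  exact: leqnSn.
- by move=> t [k _]; rewrite /F/= in_itv/= => /andP[_ ->].
apply: integral_bigcup_le => //.
- apply/nondecreasing_seqP => k; apply/subsetPset => t; rewrite /F/= !in_itv/=.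
  move=> /andP[h ->]; rewrite andbT; apply: le_trans h.
  by rewrite ler_wpM2l ?(ltW x0)// lef_pV2 ?posrE ?ltr0n// ler_nat.
- by move=> k; exact: measurable_itv.
- by mfun.
- by move=> t; rewrite lee_fin pw_ge0.
move=> k; under eq_integral => t tF.
  have -> : (pw (c - 1) t = t `^ (c - 1))%R.
    move: tF; rewrite inE /F/= in_itv/= => /andP[h _]; rewrite pwE//.
    by apply: lt_le_trans h; rewrite divr_gt0.
  over.
rewrite /F.
rewrite integral_powR_itv ?gt_eqF ?divr_gt0//; last first.
  by rewrite ltr_pdivrMr// ltr_pMr// ltr1n.
by rewrite lee_fin ler_wpM2r ?invr_ge0 ?ltW// ltrBlDr ltrDl powR_gt0// divr_gt0.
Qed.

Lemma integral_pw_nearoo c x : (0 < c)%R -> (0 < x)%R ->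
  \int[lebesgue_measure]_t (if (x <= t)%R then pw (- c - 1) t else 0%R)%:E <=
  (x `^ (- c) / c)%:E.
Proof.
move=> c0 x0; have mp := measurable_pw (- c - 1).
pose F k := `[x, (x + k.+1%:R)%R]%classic.
apply: (@le_trans _ _ (\int[lebesgue_measure]_(t in \bigcup_k F k) (pw (- c - 1) t)%:E)).
rewrite le_eqVlt; apply/orP; left; apply/eqP; apply: integral_setT_ifE; last first.
- move=> t nt; case: ifPn => // tx; exfalso; apply: nt.
  exists (Num.truncn (t - x)) => //; rewrite /F/= in_itv/= tx/= -lerBlDl ltW//.
  exact: truncnS_gt.
- by move=> t [k _]; rewrite /F/= in_itv/= => /andP[-> _].
apply: integral_bigcup_le => //.
- apply/nondecreasing_seqP => k; apply/subsetPset => t; rewrite /F/= !in_itv/=.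
  by move=> /andP[-> h]; apply: (le_trans h); rewrite lerD2l ler_nat.
- by move=> k; exact: measurable_itv.
- by mfun.
- by move=> t; rewrite lee_fin pw_ge0.
move=> k; under eq_integral => t tF.
  have -> : (pw (- c - 1) t = t `^ (- c - 1))%R.
    move: tF; rewrite inE /F/= in_itv/= => /andP[h _]; rewrite pwE//.
    exact: lt_le_trans h.
  over.
rewrite /F.
rewrite integral_powR_itv ?oppr_eq0 ?gt_eqF ?ltrDl//.
rewrite lee_fin invrN mulrN -mulNr opprB ler_wpM2r ?invr_ge0 ?ltW//.
by rewrite ltrBlDr ltrDl powR_gt0// addr_gt0.
Qed.

(** The measure [pw c t dt] is homogeneous of degree [c + 1]. *)
Lemma integral_pw_scale c (h : R -> \bar R) y : (0 < y)%R ->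
  measurable_fun setT h -> (forall t, 0 <= h t) ->
  \int[lebesgue_measure]_t ((pw c t)%:E * h t) =
  (y `^ (c + 1))%:E * \int[lebesgue_measure]_t ((pw c t)%:E * h (y * t)%R).
Proof.
move=> y0 mh h0; have mp := measurable_pw c; have pw0 := pw_ge0 c.
have yN0 : (y != 0)%R by rewrite gt_eqF.
rewrite (integral_affine 0 yN0); try side.
rewrite (gtr0_norm y0) -[LHS]ge0_integralZl; try side.
rewrite -[RHS]ge0_integralZl; try side.
apply: eq_integral => t _; rewrite addr0 pwM// !muleA -!EFinM; congr (_%:E * _).
by rewrite powRD ?(gt_eqF y0) ?implybT// powRr1 ?(ltW y0)//; ring.
Qed.

End power_weights.

Section gamma.
Context (R : realType).
Local Open Scope ereal_scope.

(** A single Taylor term bounds [expR x] from below. *)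
Lemma expRN_le (k : nat) (x : R) : (0 < x)%R ->
  (expR (- x) <= k.+1`!%:R * x ^- k.+1)%R.
Proof.
move=> x0; rewrite expRN -invf_div lef_pV2 ?posrE ?expR_gt0//; last first.
  by rewrite divr_gt0 ?exprn_gt0// ltr0n fact_gt0.
by apply: le_trans (expR_ge1Dxn k (ltW x0)); rewrite lerDr.
Qed.

(** For arguments at least 1 the exponent [c] is rounded up to an integer; below 1 the negative
    power is at least 1 and the exponential at most 1. *)
Lemma expRN_le_powR (c x : R) : (0 <= c)%R -> exists2 C : R, (0 < C)%R &
  forall x, (0 < x)%R -> (expR (- x) <= C * x `^ (- c))%R.
Proof.
move=> c0; pose k := Num.truncn c.
have kc : (c <= k.+1%:R)%R by apply/ltW/truncnS_gt.
exists (k.+1`!%:R); first by rewrite ltr0n fact_gt0.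
move=> y y0; have [y1|y1] := leP 1%R y.
- apply: (le_trans (expRN_le k y0)); rewrite ler_wpM2l// -powR_invn ?(ltW y0)//.
  by rewrite ler_powR// lerN2.
- apply: (@le_trans _ _ 1%R); first by rewrite -expR0 ler_expR oppr_le0 ltW.
  rewrite -[leLHS]mul1r ler_pM//; first by rewrite ler1n fact_gt0.
  by rewrite -(powRr0 y) ger_powR// ?oppr_le0// y0 ltW.
Qed.

(** [frac_cst] divides by a value of [Gamma]. A divergent real integral would be read as 0, so
    finiteness is proved along with positivity; the integrand is dominated by [t^(s-1)] near 0 and
    by a multiple of [t^(-2)] at infinity. *)
Lemma Gamma_gt0 (s : R) : (0 < s)%R -> (0 < Gamma s)%R.
Proof.
move=> s0; rewrite /Gamma.
pose f (t : R) := (pw (s - 1) t * expR (- t))%R.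
have mpw c : measurable_fun setT (pw c) := @measurable_pw R c.
have mf : measurable_fun setT f by rewrite /f; mfun.
have f0 t : (0 <= f t)%R by rewrite mulr_ge0 ?pw_ge0 ?expR_ge0.
have fE : \int[lebesgue_measure]_(t in `]0%R, +oo[) (t `^ (s - 1) * expR (- t))%:E
    = \int[lebesgue_measure]_t (f t)%:E.
  apply/esym; apply: integral_setT_ifE => t /=; rewrite in_itv/= andbT => t0.
    by rewrite /f pwE.
  by rewrite /f /pw; move/negP: t0 => /negbTE ->; rewrite mul0r.
rewrite /Rintegral fE fine_gt0//; apply/andP; split.
  apply: (@integral_gt0 _ _ (Num.min (1 `^ (s - 1)) (2 `^ (s - 1)) * expR (- 2))%R).
  - by rewrite mulr_gt0 ?expR_gt0// lt_min !powR_gt0.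
  - by mfun.
  - by move=> x; rewrite lee_fin.
  - move=> x /andP[x1 x2]; rewrite lee_fin /f pwE; last exact: lt_le_trans x1.
    apply: ler_pM; rewrite ?expR_ge0 ?le_min ?powR_ge0//; last first.
      by rewrite ler_expR lerN2.
    rewrite ge_min; have [s1|s1] := leP 1%R s.
      by apply/orP; left; apply: ge0_ler_powR; rewrite ?nnegrE ?subr_ge0//; exact: le_trans x1.
    apply/orP; right; rewrite -[(s - 1)%R]opprK !(powRN _ (- (s - 1))%R) lef_pV2 ?posrE ?powR_gt0//; last exact: lt_le_trans x1.
    by apply: ge0_ler_powR; rewrite ?nnegrE ?oppr_ge0 ?subr_le0 ?(ltW s1)//; exact: le_trans x1.
have [C C0 hC] := @expRN_le_powR (s + 1) 0 (addr_ge0 (ltW s0) ler01).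
have h : forall t, (f t)%:E <=
    (if (t <= 1)%R then pw (s - 1) t else 0%R)%:E + C%:E * (if (1 <= t)%R then pw (- 1 - 1) t else 0%R)%:E.
  move=> t; rewrite -EFinM -EFinD lee_fin /f; have [t0|t0] := leP t 0%R.
    rewrite /pw ltNge t0/= mul0r; case: ifP => _; case: ifP => _; rewrite ?mulr0 ?addr0//.
  have [t1|t1] := leP t 1%R.
    apply: (@le_trans _ _ (pw (s - 1) t)).
      by rewrite ler_piMr ?pw_ge0// -expR0 ler_expR oppr_le0 ltW.
    by rewrite lerDl mulr_ge0 ?(ltW C0)//; case: ifP => // _; exact: pw_ge0.
  rewrite (ltW t1) !pwE// add0r.
  apply: le_trans (ler_wpM2l (powR_ge0 _ _) (hC t t0)) _.
  rewrite mulrCA ler_wpM2l ?(ltW C0)// -powRD ?(gt_eqF t0) ?implybT//.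
  by rewrite (_ : (s - 1 + - (s + 1) = -1 -1)%R)//; ring.
apply: (@le_lt_trans _ _ (\int[lebesgue_measure]_t
  ((if (t <= 1)%R then pw (s - 1) t else 0%R)%:E +
    C%:E * (if (1 <= t)%R then pw (- 1 - 1) t else 0%R)%:E))).
  apply: le_integralT => //; first by mfun.
  by mfun.
rewrite ge0_integralD//; last 4 first.
- by move=> t _; rewrite lee_fin; case: ifP => // _; exact: pw_ge0.
- by mfun.
- by move=> t _; rewrite mule_ge0// lee_fin ?(ltW C0)//; case: ifP => // _; exact: pw_ge0.
- by mfun.
rewrite ge0_integralZl//; last 3 first.
- by mfun.
- by move=> t _; rewrite lee_fin; case: ifP => // _; exact: pw_ge0.
- by rewrite lee_fin ltW.
rewrite lte_add_pinfty//; first by apply: le_lt_trans (integral_pw_near0 s0 ltr01) _; rewrite ltry.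
rewrite lte_mul_pinfty ?lee_fin ?ltW//.
by apply: le_lt_trans (integral_pw_nearoo ltr01 ltr01) _; rewrite ltry.
Qed.

End gamma.

(** * The heat kernel in one and in n dimensions *)

Section gauss1.
Context (R : realType).
Implicit Types t r x y z m : R.
Local Open Scope ring_scope.

(** The heat kernel whose generator is the Laplacian, hence a centred normal density of variance
    [2 t]. *)
Definition gauss1 t z : R := (Num.sqrt (4 * pi * t))^-1 * expR (- (z ^+ 2 / (4 * t))).

Lemma gauss1_ge0 t z : 0 <= gauss1 t z.
Proof. by rewrite /gauss1 mulr_ge0 ?expR_ge0// invr_ge0 sqrtr_ge0. Qed.

Lemma measurable_gauss1 t : measurable_fun setT (gauss1 t).
Proof. by rewrite /gauss1; mfun. Qed.

Lemma gauss1_integral t m : 0 < t ->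
  (\int[lebesgue_measure]_z (gauss1 t (z - m))%:E = 1)%E.
Proof.
move=> t0; rewrite -(@integral_normal_pdf R m (Num.sqrt (2 * t))).
apply: eq_integral => z _; congr EFin.
rewrite normal_pdfE; last by rewrite gt_eqF// sqrtr_gt0 mulr_gt0.
rewrite /normal_peak /normal_fun /gauss1.
rewrite sqr_sqrtr; last by rewrite mulr_ge0// ltW.
congr (_^-1 * expR _).
  by congr Num.sqrt; rewrite mulr2n; ring.
by rewrite mulNr; congr (- (_ / _)); rewrite mulr2n; ring.
Qed.

(** Completing the square in [y]. The second factor is a normalised Gaussian in [y], so the
    semigroup law follows without further computation. *)
Lemma gauss1M t r x y : 0 < t -> 0 < r ->
  gauss1 t (x - y) * gauss1 r y =
  gauss1 (t + r) x * gauss1 (t * r / (t + r)) (y - x * r / (t + r)).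
Proof.
move=> t0 r0; have tr0 : 0 < t + r by exact: addr_gt0.
have pi0 := pi_gt0 R.
rewrite /gauss1 !(mulrACA _ (expR _)) -!expRD -!invfM -!sqrtrM; last 2 first.
- by rewrite !mulr_ge0// ltW.
- by rewrite !mulr_ge0// ltW.
congr ((Num.sqrt _)^-1 * expR _).
  by field; rewrite gt_eqF.
by field; rewrite !gt_eqF.
Qed.

Lemma gauss1_conv t r x : 0 < t -> 0 < r ->
  (\int[lebesgue_measure]_y (gauss1 t (x - y) * gauss1 r y)%:E =
   (gauss1 (t + r) x)%:E)%E.
Proof.
move=> t0 r0; under eq_integral do rewrite gauss1M// EFinM.
have mg := measurable_gauss1 (t * r / (t + r)).
rewrite ge0_integralZl//; [|by mfun| |]; last 2 first.
- by move=> y _; rewrite lee_fin gauss1_ge0.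
- by rewrite lee_fin gauss1_ge0.
rewrite gauss1_integral ?mule1//.
by rewrite divr_gt0 ?mulr_gt0 ?addr_gt0.
Qed.

End gauss1.

Section gaussn.
Context (R : realType) (n : nat).
Implicit Types (t r : R) (x y z : 'rV[R]_n).
Local Open Scope ring_scope.

Definition gaussn t z : R :=
  (Num.sqrt (4 * pi * t))^-1 ^+ n * expR (- (dotv z z / (4 * t))).

Lemma dotv_ge0 z : 0 <= dotv z z.
Proof. by apply: sumr_ge0 => i _; rewrite -expr2 sqr_ge0. Qed.

Lemma gaussn_ge0 t z : 0 <= gaussn t z.
Proof. by rewrite /gaussn mulr_ge0 ?expR_ge0// exprn_ge0// invr_ge0 sqrtr_ge0. Qed.

Lemma measurable_gaussn d (T : measurableType d) (f : T -> R) (g : T -> 'rV[R]_n) :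
  measurable_fun setT f -> measurable_fun setT g ->
  measurable_fun setT (fun u : T => gaussn (f u) (g u)).
Proof. by move=> mf mg; rewrite /gaussn; mfun. Qed.

Lemma gaussn_prod t z : gaussn t z = \prod_(i < n) gauss1 t (z ord0 i).
Proof.
rewrite /gauss1 big_split/= prodr_const card_ord; congr (_ * _).
rewrite -(big_morph expR (@expRD R) (@expR0 R)); congr expR.
by rewrite sumrN mulr_suml.
Qed.

Lemma prod_EFin (I : Type) (s : seq I) (f : I -> R) :
  (\prod_(i <- s) (f i)%:E = (\prod_(i <- s) f i)%:E)%E.
Proof. by elim/big_rec2 : _ => // i y1 y2 _ ->; rewrite EFinM. Qed.

Lemma gaussnN t z : gaussn t (- z) = gaussn t z.
Proof.
rewrite /gaussn (_ : dotv (- z) (- z) = dotv z z)//.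
by apply: eq_bigr => i _; rewrite !mxE mulrNN.
Qed.

Lemma gaussn_integral t m : 0 < t ->
  (\int[lebesgue_rV R n]_z (gaussn t (z - m))%:E = 1)%E.
Proof.
move=> t0; under eq_integral => z _.
  rewrite gaussn_prod; under eq_bigr do rewrite !mxE.
  over.
rewrite (integral_rV_prod (a := fun i r => gauss1 t (r - m ord0 i)))//=.
- by rewrite big1// => i _; exact: gauss1_integral.
- move=> i; have mg := measurable_gauss1 t.
  by mfun.
- by move=> i x; exact: gauss1_ge0.
Qed.

Lemma gaussn_conv t r x : 0 < t -> 0 < r ->
  (\int[lebesgue_rV R n]_y (gaussn t (x - y) * gaussn r y)%:E =
   (gaussn (t + r) x)%:E)%E.
Proof.
move=> t0 r0; under eq_integral => y _.
  rewrite !gaussn_prod -big_split/=; under eq_bigr do rewrite !mxE.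
  over.
rewrite (integral_rV_prod (a := fun i u => gauss1 t (x ord0 i - u) * gauss1 r u))//=.
- by under eq_bigr do rewrite gauss1_conv//; rewrite prod_EFin gaussn_prod.
- move=> i; have mg := measurable_gauss1 t; have mr := measurable_gauss1 r.
  by mfun.
- by move=> i u; rewrite mulr_ge0// gauss1_ge0.
Qed.

Lemma gaussn_le t z : 0 < t -> gaussn t z <= (Num.sqrt (4 * pi * t))^-1 ^+ n.
Proof.
move=> t0; rewrite /gaussn ler_piMr ?exprn_ge0 ?invr_ge0 ?sqrtr_ge0//.
by rewrite -expR0 ler_expR oppr_le0 divr_ge0 ?dotv_ge0// mulr_ge0// ltW.
Qed.

Lemma gaussn_scale t z : 0 < t -> gaussn (4 * t) (2 *: z) = 2^-1 ^+ n * gaussn t z.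
Proof.
move=> t0; rewrite /gaussn.
have -> : Num.sqrt (4 * pi * (4 * t)) = 2 * Num.sqrt (4 * pi * t).
  have -> : 4 * pi * (4 * t) = 2 ^+ 2 * (4 * pi * t) by ring.
  by rewrite sqrtrM ?sqr_ge0// sqrtr_sqr ger0_norm.
rewrite invfM exprMn -[LHS]mulrA; congr (_ * (_ * expR (- _))).
have -> : dotv (2 *: z) (2 *: z) = 4 * dotv z z.
  by rewrite /dotv mulr_sumr; apply: eq_bigr => i _; rewrite !mxE; ring.
by field; rewrite gt_eqF.
Qed.

(** The exponential factor increases with time, while the peak drops by at most [2^n] when time is
    multiplied by at most 4. This compares a general time with the nearest power of 4. *)
Lemma gaussn_le4 t r z : 0 < t -> t <= r -> r <= 4 * t ->
  gaussn t z <= 2 ^+ n * gaussn r z.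
Proof.
move=> t0 tr r4t; have r0 : 0 < r by exact: lt_le_trans tr.
have pi0 := pi_gt0 R.
rewrite /gaussn mulrA -exprMn; apply: ler_pM; rewrite ?expR_ge0//.
- rewrite lerXn2r// ?nnegrE ?mulr_ge0 ?invr_ge0 ?sqrtr_ge0//.
  rewrite -[leRHS]invrK lef_pV2 ?posrE ?sqrtr_gt0 ?mulr_gt0// ?invr_gt0 ?mulr_gt0 ?invr_gt0 ?sqrtr_gt0 ?mulr_gt0//.
  rewrite invfM invrK ler_pdivrMl//.
  have -> : 2 = Num.sqrt 4 :> R by rewrite (_ : 4 = 2 ^+ 2) ?sqrtr_sqr ?ger0_norm//; ring.
  by rewrite -sqrtrM// ler_wsqrtr//; nra.
- rewrite ler_expR lerN2 ler_wpM2l ?dotv_ge0// lef_pV2 ?posrE ?mulr_gt0//.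
  by rewrite ler_pM2l.
Qed.

(** Half of the exponent is spent on the factor [|z_i|]: with [y = |z_i| / sqrt (8 t)] one has
    [y <= 1 + y^2 <= exp (y^2)]. The other half is a Gaussian at the doubled time. *)
Lemma gaussn_moment : exists2 C : R, 0 < C & forall t z i, 0 < t ->
  gaussn t z * `|z ord0 i| <= C * Num.sqrt t * gaussn (2 * t) z.
Proof.
exists (Num.sqrt 2 ^+ n * Num.sqrt 8).
  by rewrite mulr_gt0 ?exprn_gt0 ?sqrtr_gt0.
move=> t z i t0; have pi0 := pi_gt0 R.
have -> : gaussn t z = Num.sqrt 2 ^+ n * expR (- (dotv z z / (8 * t))) * gaussn (2 * t) z.
  rewrite /gaussn mulrACA -expRD -exprMn; congr (_ ^+ n * expR _).
    have -> : 4 * pi * (2 * t) = 2 * (4 * pi * t) by ring.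
    rewrite [in RHS]sqrtrM// invfM mulrA divff ?mul1r// gt_eqF// sqrtr_gt0//.
  by field; rewrite gt_eqF.
rewrite mulrAC ler_wpM2r ?gaussn_ge0// -!mulrA ler_wpM2l ?exprn_ge0 ?sqrtr_ge0//.
rewrite -sqrtrM//; set s := Num.sqrt _.
have s0 : 0 < s by rewrite sqrtr_gt0 mulr_gt0.
have sE : s ^+ 2 = 8 * t by rewrite sqr_sqrtr// mulr_ge0// ltW.
set y := `|z ord0 i| / s; have y0 : 0 <= y by rewrite divr_ge0// ltW.
have -> : `|z ord0 i| = s * y by rewrite mulrC divfK// gt_eqF.
rewrite mulrCA ler_piMr ?(ltW s0)//.
have yz : y ^+ 2 <= dotv z z / (8 * t).
  rewrite /y expr_div_n sE ler_wpM2r ?invr_ge0 ?mulr_ge0 ?(ltW t0)//.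
  rewrite real_normK ?num_real// /dotv (bigD1 i)//= expr2 lerDl sumr_ge0// => j _.
  by rewrite -expr2 sqr_ge0.
apply: (@le_trans _ _ (expR (- y ^+ 2) * expR (y ^+ 2))); last first.
  by rewrite -expRD addNr expR0.
apply: ler_pM; rewrite ?expR_ge0 ?ler_expR ?lerN2//.
apply: (@le_trans _ _ (1 + y ^+ 2)); last exact: expR_ge1Dx.
nra.
Qed.

End gaussn.

Lemma measurable_gaussn1 (R : realType) n t : measurable_fun setT (@gaussn R n t).
Proof. by apply: measurable_gaussn; mfun. Qed.

Ltac mfun_ext ::=
  match goal with
  | |- measurable_fun _ (fun x => gaussn (@?f x) (@?g x)) => apply: measurable_gaussn
  | |- measurable_fun _ (gaussn _) => exact: measurable_gaussn1
  | |- measurable_fun _ (gauss1 _) => exact: measurable_gauss1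
  | |- measurable_fun _ (fun x => gauss1 _ (@?f x)) =>
      apply: (measurableT_comp (measurable_gauss1 _))
  | |- measurable_fun _ (pw _) => exact: measurable_pw
  | |- measurable_fun _ (fun x => pw _ (@?f x)) =>
      apply: (measurableT_comp (@measurable_pw _ _))
  end.

Ltac nneg_ext ::=
  match goal with
  | |- is_true (@Order.le _ _ _ (gaussn _ _)) => exact: gaussn_ge0
  | |- is_true (@Order.le _ _ _ (pw _ _)) => exact: pw_ge0
  end.

(** * Heat variation of sets *)

Section heat_modulus.
Context (R : realType) (n : nat).
Implicit Types (e : 'rV[R]_n -> R) (t r : R).
Local Open Scope ereal_scope.
Notation mu := (lebesgue_rV R n).

Definition modulus e (z : 'rV[R]_n) : \bar R :=
  \int[mu]_x `|e (x + z)%R - e x|%:E.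

Definition heat_modulus e t : \bar R :=
  \int[mu]_z ((gaussn t z)%:E * modulus e z).

(** At [t = 4^-j] the weight [2^j] is [t^(-1/2)]. Along powers of 4 the quantity is nondecreasing in
    [j], so that the supremum is also a limit. *)
Definition heat_variation e : \bar R :=
  ereal_sup (range (fun j : nat => (2 ^+ j)%:E * heat_modulus e (4^-1 ^+ j))).

Lemma modulus_ge0 e z : 0 <= modulus e z.
Proof. by apply: integral_ge0 => x _; rewrite lee_fin. Qed.

Lemma heat_modulus_ge0 e t : 0 <= heat_modulus e t.
Proof.
apply: integral_ge0 => x _.
by apply: mule_ge0; [rewrite lee_fin gaussn_ge0|exact: modulus_ge0].
Qed.

Variable e : 'rV[R]_n -> R.
Hypothesis me : measurable_fun setT e.

Lemma measurable_modulus : measurable_fun setT (modulus e).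
Proof.
apply: (@measurable_integral2 _ _ _ _ _ mu (fun z x => `|e (x + z)%R - e x|%:E)) => //=.
by mfun.
Qed.
Let mmod := measurable_modulus.

Lemma modulusD z w : modulus e (z + w) <= modulus e z + modulus e w.
Proof.
rewrite {2}/modulus.
rewrite -(@integral_rVD _ _ w (fun x => `|e (x + z)%R - e x|%:E)); try side.
rewrite -ge0_integralD; try side.
apply: le_integralT => //; [by mfun|by mfun|].
move=> x; rewrite -EFinD lee_fin.
have -> : (e (x + (z + w)) - e x = (e (x + w + z) - e (x + w)) + (e (x + w) - e x))%R.
  by rewrite [RHS]addrA subrK (addrC z) addrA.
exact: ler_normD.
Qed.

Lemma modulus0 : modulus e 0 = 0.
Proof. by apply: integral0_eq => x _; rewrite addr0 subrr normr0. Qed.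

Lemma modulus_sum (I : Type) (s : seq I) (v : I -> 'rV[R]_n) :
  modulus e (\sum_(i <- s) v i)%R <= \sum_(i <- s) modulus e (v i).
Proof.
elim: s => [|i s IH]; first by rewrite !big_nil modulus0.
by rewrite !big_cons; apply: (le_trans (modulusD _ _)); exact: leeD2l.
Qed.

(** The substitution [z -> 2 z] turns time [4 t] into time [t], and subadditivity bounds the modulus
    at [2 z] by twice that at [z]. A factor 2 for a factor 4 in time is the scaling of [sqrt t]. *)
Lemma heat_modulus4 t : (0 < t)%R -> heat_modulus e (4 * t) <= 2%:E * heat_modulus e t.
Proof.
move=> t0; rewrite /heat_modulus.
have m0 := modulus_ge0 e.
have g0 := @gaussn_ge0 R n.
have two0 : (2 != 0 :> R)%R by [].
rewrite (integral_rV_affine 0%R two0); try side.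
rewrite -!ge0_integralZl; try side.
apply: le_integralT; [by nneg|by mfun|by mfun|].
move=> z; rewrite addr0 gaussn_scale// muleA -EFinM mulrA.
rewrite ger0_norm// -exprMn divff// expr1n mul1r muleCA.
apply: lee_wpmul2l; first by rewrite lee_fin.
rewrite scaler_nat mulr2n mule_natl mule2n.
exact: modulusD.
Qed.

Lemma heat_modulus_le4 t r : (0 < t)%R -> (t <= r)%R -> (r <= 4 * t)%R ->
  heat_modulus e t <= (2 ^+ n)%:E * heat_modulus e r.
Proof.
move=> t0 tr r4; rewrite /heat_modulus.
have m0 := modulus_ge0 e.
have g0 := @gaussn_ge0 R n.
rewrite -ge0_integralZl; try side.
apply: le_integralT; [by nneg|by mfun|by mfun|].
move=> z; rewrite muleA -EFinM; apply: lee_wpmul2r => //.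
by rewrite lee_fin gaussn_le4.
Qed.

Lemma heat_modulus_pow4 t k : (0 < t)%R ->
  heat_modulus e (4 ^+ k * t) <= (2 ^+ k)%:E * heat_modulus e t.
Proof.
move=> t0; elim: k => [|k IH]; first by rewrite !expr0 mul1r mul1e.
rewrite exprS -mulrA; apply: (le_trans (heat_modulus4 _)); first by rewrite mulr_gt0.
rewrite exprS EFinM -muleA; apply: lee_wpmul2l => //.
Qed.

Lemma heat_variation_nd :
  nondecreasing_seq (fun j : nat => (2 ^+ j)%:E * heat_modulus e (4^-1 ^+ j)).
Proof.
apply/nondecreasing_seqP => j.
rewrite [in leRHS]exprSr EFinM -muleA; apply: lee_wpmul2l => //.
have -> : (4^-1 ^+ j = 4 * 4^-1 ^+ j.+1 :> R)%R by rewrite exprS mulrA divff// mul1r.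
by apply: heat_modulus4.
Qed.

Lemma heat_variation_ge0 : 0 <= heat_variation e.
Proof.
apply: le_trans (ereal_sup_ubound _); last by exists 0%N.
by rewrite mule_ge0// heat_modulus_ge0.
Qed.

(** For [t <= 1] the bracketing [4^-(i+1) < t <= 4^-i] costs [2^n] in the kernel and 2 in the square
    root, whence [2^(n+1)]. A time above 1 is brought below 1 by divisions by 4, which
    [heat_modulus_pow4] pays for exactly. *)
Lemma heat_modulus_le_variation t : (0 < t)%R ->
  heat_modulus e t <= (2 ^+ n.+1 * Num.sqrt t)%:E * heat_variation e.
Proof.
have small u : (0 < u)%R -> (u <= 1)%R ->
    heat_modulus e u <= (2 ^+ n.+1 * Num.sqrt u)%:E * heat_variation e.
  move=> u0 u1.
  have ex : exists i, (4^-1 ^+ i.+1 < u)%R.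
    have /cvgrPdist_lt/(_ u u0)[k _ hk] : ((4^-1 : R) ^+ i)%R @[i --> \oo] --> (0 : R)%R.
      by apply: cvg_expr; rewrite ger0_norm// invf_lt1// ltr1n.
    exists k; have := hk k.+1 (leqnSn k); rewrite sub0r normrN ger0_norm//.
  case: (ex_minnP ex) => i iu imin.
  have ui : (u <= 4^-1 ^+ i)%R.
    case: i imin {iu} => [|i] imin; first by rewrite expr0.
    by rewrite leNgt; apply/negP => /imin; rewrite ltnn.
  apply: (le_trans (heat_modulus_le4 u0 ui _)).
    by move: iu; rewrite exprS => /ltW; rewrite -ler_pdivrMl.
  have h : heat_modulus e (4^-1 ^+ i) <= (2^-1 ^+ i)%:E * heat_variation e.
    apply: (@le_trans _ _ ((2^-1 ^+ i)%:E * ((2 ^+ i)%:E * heat_modulus e (4^-1 ^+ i)))).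
      by rewrite muleA -EFinM -exprMn mulVf// expr1n mul1e.
    by apply: lee_wpmul2l; [rewrite lee_fin exprn_ge0|apply: ereal_sup_ubound; exists i].
  apply: (@le_trans _ _ ((2 ^+ n)%:E * ((2^-1 ^+ i)%:E * heat_variation e))).
    by apply: lee_wpmul2l.
  rewrite muleA -EFinM; apply: lee_wpmul2r; first exact: heat_variation_ge0.
  rewrite lee_fin exprSr -mulrA ler_wpM2l//.
  have -> : (2^-1 ^+ i = 2 * 2^-1 ^+ i.+1 :> R)%R by rewrite exprS mulrA divff// mul1r.
  rewrite ler_wpM2l//.
  have -> : (2^-1 ^+ i.+1 = Num.sqrt (4^-1 ^+ i.+1) :> R)%R.
    have -> : (4^-1 ^+ i.+1 = (2^-1 ^+ i.+1) ^+ 2 :> R)%R.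
      by rewrite exprAC; congr (_ ^+ _)%R; rewrite expr2 -invfM -natrM.
    by rewrite sqrtr_sqr ger0_norm// exprn_ge0.
  by rewrite ler_wsqrtr// ltW.
move=> t0; have [k kt] : exists k, (4^-1 ^+ k * t <= 1)%R.
  have /cvgrPdist_lt/(_ t^-1%R) : ((4^-1 : R) ^+ i)%R @[i --> \oo] --> (0 : R)%R.
    by apply: cvg_expr; rewrite ger0_norm// invf_lt1// ltr1n.
  rewrite invr_gt0 => /(_ t0)[k _ hk]; exists k.
  have := hk k (leqnn k); rewrite sub0r normrN ger0_norm ?exprn_ge0//.
  by move=> /ltW; rewrite -[X in (_ <= X)%R]mul1r ler_pdivlMr.
have u0 : (0 < 4^-1 ^+ k * t)%R by rewrite mulr_gt0// exprn_gt0.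
have tE : t = (4 ^+ k * (4^-1 ^+ k * t))%R.
  by rewrite mulrA -exprMn divff// expr1n mul1r.
rewrite [in leLHS]tE.
apply: (le_trans (heat_modulus_pow4 _ u0)).
apply: (@le_trans _ _ ((2 ^+ k)%:E * ((2 ^+ n.+1 * Num.sqrt (4^-1 ^+ k * t))%:E * heat_variation e))).
  by apply: lee_wpmul2l => //; exact: small.
rewrite muleA -EFinM mulrCA.
suff -> : (2 ^+ k * Num.sqrt (4^-1 ^+ k * t) = Num.sqrt t)%R by [].
rewrite sqrtrM ?exprn_ge0// mulrA.
have -> : (4^-1 ^+ k = (2^-1 ^+ k) ^+ 2 :> R)%R.
  by rewrite exprAC; congr (_ ^+ _)%R; rewrite expr2 -invfM -natrM.
by rewrite sqrtr_sqr ger0_norm ?exprn_ge0// -exprMn divff// expr1n mul1r.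
Qed.

End heat_modulus.

(** * Interpolation in time between volume and perimeter *)

Section interpolation.
Context (R : realType) (n : nat) (alpha : R).
Hypotheses (alpha_gt0 : 0 < alpha) (alpha_lt1 : alpha < 1) (n_ge2 : (2 <= n)%N).
Local Open Scope ring_scope.

Let a : R := (1 - alpha) / 2.
Let r : R := (n%:R - alpha) / n%:R.
Let n0 : 0 < n%:R :> R. Proof. by rewrite ltr0n; case: n n_ge2. Qed.
Let n1 : 0 < n%:R - 1 :> R. Proof. by rewrite subr_gt0 ltr1n. Qed.
Let an : 0 < n%:R - alpha.
Proof. by have := n1; have := alpha_lt1; lra. Qed.
Let nn0 : (n%:R == 0 :> R) = false. Proof. by rewrite gt_eqF. Qed.

Let a_gt0 : 0 < a. Proof. by rewrite divr_gt0// subr_gt0. Qed.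
Let r_gt0 : 0 < r. Proof. exact: divr_gt0. Qed.
(** The integrand behaves like [t^(c1 - 1)] near 0. Since [c1 = alpha (n - 1) / (2 n)], convergence
    there is one of the uses of [n >= 2]. *)
Let c1 : R := r / 2 - a.
Let c1E : c1 = alpha * (n%:R - 1) / (2 * n%:R).
Proof. by rewrite /c1 /r /a; field; rewrite nn0. Qed.
Let c1_gt0 : 0 < c1.
Proof. by rewrite c1E divr_gt0// mulr_gt0. Qed.

(** Here [m] is the volume and [D] the perimeter. When [D] is of order [m^(1-1/n)], the bounds
    [sqrt t D] and [2 m] balance at [rho = m^(2/n)], so the first is used before [rho] and the
    second after it. Near 0 the result is a multiple of [D^r (m^(1-1/n))^(alpha/n)], which the
    isoperimetric hypothesis turns into a multiple of [D] because [r + alpha/n = 1]. At infinity it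
    is a multiple of [m^(1-1/n)] itself. *)
Lemma interpolation_bound (K K' : R) : 0 < K -> 0 < K' -> exists2 C : R, 0 < C &
  forall m D (A : R -> R), measurable_fun setT A -> 0 < m -> 0 <= D ->
    (forall t, 0 < t -> [/\ 0 <= A t, A t <= K * Num.sqrt t * D & A t <= 2 * m]) ->
    m `^ (1 - n%:R^-1) <= K' * D ->
  (\int[lebesgue_measure]_t (pw (- a - 1) t * A t `^ r)%:E <= (C * D)%:E)%E.
Proof.
move=> K0 K'0.
exists (K `^ r * K' `^ (alpha / n%:R) / c1 + 2 `^ r * K' / a).
  by pos.
move=> m D A mA m0 D0 hA mD.
set rho := m `^ (2 / n%:R).
have rho0 : 0 < rho by exact: powR_gt0.
have mpw c : measurable_fun setT (pw c) := @measurable_pw R c.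
have KD0 : 0 <= K * D by rewrite mulr_ge0// ltW.
have pw0 c t : 0 <= pw c t := @pw_ge0 R c t.
have if0 (b : bool) c t : 0 <= if b then pw c t else 0 :> R by case: b.
apply: (@le_trans _ _ (\int[lebesgue_measure]_t
   (((K * D) `^ r)%:E * (if t <= rho then pw (c1 - 1) t else 0)%:E +
    ((2 * m) `^ r)%:E * (if rho <= t then pw (- a - 1) t else 0)%:E))%E).
  apply: le_integralT; [by nneg|by mfun|by mfun|].
  move=> t; rewrite -!EFinM -EFinD lee_fin.
  have [t0|t0] := leP t 0.
    rewrite {1}/pw ltNge t0/= mul0r; apply: addr_ge0; apply: mulr_ge0 => //; exact: powR_ge0.
  have [A0 A1 A2] := hA t t0.
  have [tr|tr] := leP t rho.
    apply: ler_wpDr; first by rewrite mulr_ge0 ?powR_ge0.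
    apply: (@le_trans _ _ (pw (- a - 1) t * (K * Num.sqrt t * D) `^ r)).
      rewrite ler_wpM2l//; apply: ge0_ler_powR; rewrite ?(ltW r_gt0) ?nnegrE//.
      exact: le_trans A1.
    rewrite mulrAC (powRM _ KD0 (sqrtr_ge0 _)) -powR12_sqrt ?(ltW t0)// -powRrM.
    rewrite !pwE// mulrCA -powRD ?(gt_eqF t0) ?implybT//.
    rewrite (_ : - a - 1 + 2^-1 * r = c1 - 1)// /c1; ring.
  rewrite (ltW tr) mulr0 add0r mulrC ler_wpM2r//.
  by apply: ge0_ler_powR; rewrite ?(ltW r_gt0) ?nnegrE// mulr_ge0// ltW.
rewrite ge0_integralD; try side.
rewrite !ge0_integralZl; try side.
apply: (@le_trans _ _ (((K * D) `^ r)%:E * (rho `^ c1 / c1)%:E + ((2 * m) `^ r)%:E * (rho `^ (- a) / a)%:E)%E).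
  apply: leeD; apply: lee_wpmul2l; rewrite ?lee_fin ?powR_ge0//.
    exact: integral_pw_near0.
  exact: integral_pw_nearoo.
rewrite -!EFinM -EFinD lee_fin [leRHS]mulrDl; apply: lerD.
  rewrite [leLHS]mulrA [leRHS]mulrAC ler_wpM2r ?invr_ge0 ?(ltW c1_gt0)//.
  have -> : rho `^ c1 = (m `^ (1 - n%:R^-1)) `^ (alpha / n%:R).
    rewrite /rho -!powRrM; congr (_ `^ _); rewrite c1E.
    by field; rewrite nn0.
  apply: (@le_trans _ _ ((K * D) `^ r * (K' * D) `^ (alpha / n%:R))).
    rewrite ler_wpM2l ?powR_ge0//; apply: ge0_ler_powR => //; rewrite ?nnegrE ?powR_ge0 ?mulr_ge0 ?divr_ge0 ?(ltW K'0) ?(ltW alpha_gt0)//.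
  rewrite (powRM _ (ltW K0) D0) (powRM _ (ltW K'0) D0) mulrACA.
  have -> : D `^ r * D `^ (alpha / n%:R) = D.
    have e : r + alpha / n%:R = 1 by rewrite /r; field; rewrite nn0.
    rewrite -powRD e ?powRr1//.
    by rewrite oner_eq0.
  by [].
rewrite [leLHS]mulrA [leRHS]mulrAC ler_wpM2r ?invr_ge0 ?(ltW a_gt0)//.
rewrite (powRM _ _ (ltW m0))// -mulrA.
have -> : m `^ r * rho `^ (- a) = m `^ (1 - n%:R^-1).
  rewrite /rho -powRrM -powRD ?(gt_eqF m0) ?implybT//; congr (_ `^ _).
  by rewrite /r /a; field; rewrite nn0.
by rewrite -mulrA ler_wpM2l// powR_ge0.
Qed.

End interpolation.

Section hoelder_bound.
Local Open Scope ereal_scope.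

(** As [Q] takes values in [[0, 1]], [Q^p <= Q], so the [L^p] norm in Hoelder's inequality is
    controlled by the integral of [Q] alone. *)
Lemma hoelder_le1 d (T : measurableType d) (R : realType)
    (mu : {measure set T -> \bar R}) (g Q : T -> R) (p q : R) :
  measurable_fun setT g -> measurable_fun setT Q ->
  (forall x, 0 <= g x)%R -> (forall x, 0 <= Q x <= 1)%R ->
  (1 < p)%R -> (p^-1 + q^-1 = 1)%R ->
  \int[mu]_x (g x `^ q)%:E <= 1 ->
  \int[mu]_x (g x * Q x)%:E <= (\int[mu]_x (Q x)%:E) `^ p^-1.
Proof.
move=> mg mQ g0 Q01 p1 pq gq1.
have p0 : (0 < p)%R by exact: lt_trans p1.
have q0 : (0 < q)%R.
  have -> : (q = (1 - p^-1)^-1)%R by rewrite -pq addrC addKr invrK.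
  by rewrite invr_gt0 subr_gt0 invf_lt1.
have Q0 x : (0 <= Q x)%R by case/andP: (Q01 x).
have := hoelder mu mg mQ q0 p0; rewrite addrC => /(_ pq).
rewrite Lnorm1 unlock.
under eq_integral do rewrite /= ger0_norm ?mulr_ge0//.
move=> /le_trans; apply.
apply: (@le_trans _ _ (1 * (\int[mu]_x (Q x)%:E) `^ p^-1)); last by rewrite mul1e.
apply: lee_pmul; rewrite ?poweR_ge0//.
  rewrite -[leRHS](poweR1r q^-1); apply: gt0_ler_poweR; rewrite ?invr_ge0 ?(ltW q0)//.
  - by rewrite in_itv/= leey andbT; apply: integral_ge0 => x _; rewrite lee_fin powR_ge0.
  - by rewrite in_itv/= leey andbT lee_fin.
  - apply: le_trans gq1; rewrite le_eqVlt; apply/orP; left; apply/eqP.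
    by apply: eq_integral => x _; rewrite /= ger0_norm.
apply: gt0_ler_poweR; rewrite ?invr_ge0 ?(ltW p0)//.
- by rewrite in_itv/= leey andbT; apply: integral_ge0 => x _; rewrite lee_fin powR_ge0.
- by rewrite in_itv/= leey andbT; apply: integral_ge0 => x _; rewrite lee_fin.
apply: le_integralT.
- by move=> x; exact: poweR_ge0.
- have -> : (fun x => `|(EFin \o Q) x| `^ p) = (fun x => (Q x `^ p)%:E).
    by apply/funext => x; rewrite /= ger0_norm.
  by mfun.
- by mfun.
- move=> x; rewrite /= ger0_norm// lee_fin.
  have /andP[_ Q1] := Q01 x.
  have [->|Qx0] := eqVneq (Q x) 0%R; first by rewrite powR0// gt_eqF.
  by rewrite ge1r_powR ?(ltW p1)// Q1 andbT lt_neqAle eq_sym Qx0/=.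
Qed.

End hoelder_bound.

Section set_estimate.
Context (R : realType) (n : nat).
Local Open Scope ereal_scope.
Notation mu := (lebesgue_rV R n).
Variable b : 'rV[R]_n -> bool.
Hypothesis mb : measurable_fun setT b.

(** Sets are boolean predicates here: a superlevel set is then the comparison [l < U x], visibly
    measurable jointly in the level and the point. *)
Definition bindic (b : 'rV[R]_n -> bool) (x : 'rV[R]_n) : R := if b x then 1%R else 0%R.
Let e := bindic b.

Let me : measurable_fun setT e.
Proof. by rewrite /e /bindic; mfun. Qed.

Let e01 x : (0 <= e x <= 1)%R.
Proof. by rewrite /e /bindic; case: (b x); rewrite ?lexx ?ler01. Qed.
Let e0 x : (0 <= e x)%R. Proof. by case/andP: (e01 x). Qed.

Let dif_le1 x y : (`|e x - e y| <= 1)%R.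
Proof.
by rewrite /e /bindic; case: (b x); case: (b y); rewrite ?subrr ?subr0 ?sub0r ?normrN ?normr1 ?normr0.
Qed.

Let g0 t (z : 'rV[R]_n) : (0 <= gaussn t z)%R := gaussn_ge0 t z.

Let gauss1E t : (0 < t)%R -> \int[mu]_z (gaussn t z)%:E = 1.
Proof.
move=> t0; rewrite -(@gaussn_integral R n t 0 t0).
by apply: eq_integral => z _; rewrite subr0.
Qed.

Definition heat_dev (t : R) (x : 'rV[R]_n) : R :=
  \int[mu]_z (gaussn t z * `|e (x + z) - e x|)%R.

Lemma heat_devE t x : (0 < t)%R ->
  (heat_dev t x)%:E = \int[mu]_z (gaussn t z * `|e (x + z) - e x|)%:E.
Proof.
move=> t0; rewrite fineK// ge0_fin_numE; last by side.
apply: (@le_lt_trans _ _ 1); last by rewrite ltry.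
rewrite -(gauss1E t0); apply: le_integralT; [by nneg|by mfun|by mfun|].
by move=> z; rewrite lee_fin ler_piMr.
Qed.

Lemma heat_dev_ge0 t x : (0 <= heat_dev t x)%R.
Proof. by apply: Rintegral_ge0 => z _; rewrite mulr_ge0. Qed.

Lemma heat_dev_le1 t x : (0 < t)%R -> (heat_dev t x <= 1)%R.
Proof.
move=> t0; rewrite -lee_fin heat_devE// -(gauss1E t0).
apply: le_integralT; [by nneg|by mfun|by mfun|].
by move=> z; rewrite lee_fin ler_piMr.
Qed.

Lemma measurable_heat_dev t : measurable_fun setT (heat_dev t).
Proof.
apply: (@measurableT_comp _ _ _ _ _ _ fine) => //.
apply: (@measurable_integral2 _ _ _ _ _ mu (fun x z : 'rV[R]_n => (gaussn t z * `|e (x + z)%R - e x|)%:E)); first by nneg.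
by mfun.
Qed.

Lemma integral_heat_dev t : (0 < t)%R ->
  \int[mu]_x (heat_dev t x)%:E = heat_modulus e t.
Proof.
move=> t0; under eq_integral do rewrite heat_devE//.
rewrite (@tonelli _ _ _ _ _ mu mu (fun x z => (gaussn t z * `|e (x + z)%R - e x|)%:E)); try side.
  rewrite /heat_modulus /modulus; apply: eq_integral => z _.
  under eq_integral do rewrite EFinM.
  by rewrite ge0_integralZl; try side.
Qed.

Variable m : R.
Hypothesis mE : \int[mu]_x (e x)%:E = m%:E.

Lemma modulus_le_mass z : modulus e z <= (2 * m)%:E.
Proof.
rewrite /modulus; apply: (@le_trans _ _ (\int[mu]_x ((e (x + z))%:E + (e x)%:E))).
  apply: le_integralT; [by nneg|by mfun|by mfun|].
  move=> x; rewrite -EFinD lee_fin; apply: (le_trans (ler_normB _ _)).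
  by rewrite !ger0_norm.
rewrite ge0_integralD; try side.
rewrite (@integral_rVD _ _ z (fun x => (e x)%:E)); try side.
by rewrite mE -EFinD mulr2n mulrDl mul1r.
Qed.

Lemma heat_modulus_le_mass t : (0 < t)%R -> heat_modulus e t <= (2 * m)%:E.
Proof.
move=> t0; rewrite /heat_modulus.
have mm := measurable_modulus me.
have m0 := modulus_ge0 e.
have m2 : 0 <= (2 * m)%:E := le_trans (m0 0%R) (modulus_le_mass 0%R).
apply: (@le_trans _ _ (\int[mu]_z ((gaussn t z)%:E * (2 * m)%:E))).
  apply: le_integralT; [by nneg|by mfun|by mfun|].
  by move=> z; apply: lee_wpmul2l; rewrite ?lee_fin// modulus_le_mass.
by rewrite ge0_integralZr; try side; rewrite gauss1E// mul1e.
Qed.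

(* If the heat kernel has spread so much that [P_t 1_E <= 1/2], then the heat
   deviation is at least 1/2 on all of E. *)
Lemma mass_le_heat_modulus t : (0 < t)%R ->
  ((Num.sqrt (4 * pi * t))^-1 ^+ n * m <= 2^-1)%R ->
  m%:E <= 2%:E * heat_modulus e t.
Proof.
move=> t0 hm.
have hdev x : (e x <= 2 * heat_dev t x)%R.
  rewrite /e /bindic; case: ifPn => bx; last by rewrite mulr_ge0// heat_dev_ge0.
  rewrite -ler_pdivrMl// mulr1 -lee_fin heat_devE//.
  have h : 1 <= \int[mu]_z (gaussn t z * `|e (x + z) - e x|)%:E + (2^-1)%:E.
    rewrite -[leLHS](gauss1E t0).
    apply: (@le_trans _ _ (\int[mu]_z ((gaussn t z * `|e (x + z) - e x|)%:E + (gaussn t z * e (x + z)%R)%:E))).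
      apply: le_integralT; [by nneg|by mfun|by mfun|].
      move=> z; rewrite -EFinD lee_fin -mulrDr ler_peMr//.
      rewrite /e /bindic bx; case: (b _).
        by rewrite subrr normr0 add0r.
      by rewrite sub0r normrN normr1 addr0.
    rewrite ge0_integralD; try side.
    apply: leeD2l; apply: le_trans (_ : ((Num.sqrt (4 * pi * t))^-1 ^+ n * m)%:E <= _); last first.
      by rewrite lee_fin.
    rewrite EFinM -mE.
    rewrite -(@integral_rVD _ _ x (fun x => (e x)%:E)); try side.
    rewrite -ge0_integralZl; try side.
    apply: le_integralT; [by nneg|by mfun|by mfun|].
    move=> z; rewrite -EFinM lee_fin (addrC x) ler_wpM2r//.
    exact: gaussn_le.
  move: h; case: (\int[mu]_z _) => [r| |//]; last by move=> _; rewrite leey.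
  by rewrite -EFinD !lee_fin => h; lra.
rewrite -mE -integral_heat_dev//.
have mh := measurable_heat_dev t.
have h0 := heat_dev_ge0 t.
rewrite -ge0_integralZl; try side.
by apply: le_integralT; [by nneg|by mfun|by mfun|by move=> x; rewrite -EFinM lee_fin].
Qed.

End set_estimate.

(** * The isoperimetric inequality and level sets *)

Section set_estimate_main.
Context (R : realType) (n : nat) (alpha : R).
Hypotheses (alpha_gt0 : 0 < alpha) (alpha_lt1 : alpha < 1) (n_ge2 : (2 <= n)%N).
Local Open Scope ereal_scope.
Notation mu := (lebesgue_rV R n).
Let a : R := ((1 - alpha) / 2)%R.
Let r : R := ((n%:R - alpha) / n%:R)%R.
Let q : R := (n%:R / alpha)%R.

Let n0 : (0 < n%:R :> R)%R. Proof. by rewrite ltr0n; case: n n_ge2. Qed.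
Let n1 : (0 < n%:R - 1 :> R)%R. Proof. by rewrite subr_gt0 ltr1n. Qed.
Let an : (0 < n%:R - alpha)%R.
Proof. by have := n1; have := alpha_lt1; lra. Qed.
Let nn0 : (n%:R == 0 :> R)%R = false. Proof. by rewrite gt_eqF. Qed.
Let r_gt0 : (0 < r)%R. Proof. exact: divr_gt0. Qed.
Let r_lt1 : (r < 1)%R.
Proof. by rewrite /r ltr_pdivrMr// mul1r ltrBlDr ltrDl. Qed.

(** The time is chosen with [4 pi t = (2 m)^(2/n)], so that the peak of the heat kernel times the
    volume is exactly 1/2. Then [m <= 2 A(t)] for the heat modulus [A], while
    [A(t) <= 2^(n+1) sqrt t D] and [sqrt t <= (2 m)^(1/n)]. *)
Lemma isoperimetric (b : 'rV[R]_n -> bool) (m D : R) :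
  measurable_fun setT b -> \int[mu]_x (bindic b x)%:E = m%:E -> (0 < m)%R ->
  heat_variation (bindic b) = D%:E ->
  (m `^ (1 - n%:R^-1) <= 2 ^+ n.+2 * 2 `^ n%:R^-1 * D)%R.
Proof.
move=> mb mE m0 DE.
have me : measurable_fun setT (bindic b) by rewrite /bindic; mfun.
have D0 : (0 <= D)%R by rewrite -lee_fin -DE heat_variation_ge0.
have pi0 := pi_gt0 R.
set w := ((2 * m) `^ n%:R^-1)%R.
have w0 : (0 < w)%R by rewrite powR_gt0// mulr_gt0.
pose t := (w ^+ 2 / (4 * pi))%R.
have t0 : (0 < t)%R by rewrite divr_gt0 ?exprn_gt0// mulr_gt0.
have st : Num.sqrt (4 * pi * t) = w.
  rewrite /t mulrC divfK ?gt_eqF ?mulr_gt0// sqrtr_sqr ger0_norm//; exact: ltW.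
have h : ((Num.sqrt (4 * pi * t))^-1 ^+ n * m <= 2^-1)%R.
  rewrite st exprVn /w -powR_mulrn ?powR_ge0// -powRrM mulVf ?nn0// powRr1; last by rewrite mulr_ge0// ltW.
  by rewrite invfM -mulrA mulVf ?gt_eqF// mulr1.
have h1 := mass_le_heat_modulus mb mE t0 h.
have h2 := heat_modulus_le_variation me t0.
have {h1 h2} : (m <= 2 * (2 ^+ n.+1 * Num.sqrt t * D))%R.
  rewrite -lee_fin EFinM (EFinM _ D) -DE; apply: (le_trans h1).
  exact: lee_wpmul2l.
have tw : (Num.sqrt t <= w)%R.
  rewrite -st ler_wsqrtr// ler_peMl ?(ltW t0)//.
  by have := pi_ge2 R; lra.
move=> {}h.
have {}h : (m <= 2 ^+ n.+2 * w * D)%R.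
  apply: (le_trans h); rewrite (exprS 2 n.+1) -!mulrA; apply: ler_wpM2l => //.
  by apply: ler_wpM2l; rewrite ?exprn_ge0//; apply: ler_wpM2r.
rewrite powRB ?(gt_eqF m0) ?implybT// powRr1 ?(ltW m0)// ler_pdivrMr ?powR_gt0//.
apply: (le_trans h); rewrite /w powRM ?(ltW m0)//.
by rewrite le_eqVlt; apply/orP; left; apply/eqP; ring.
Qed.

Lemma measurable_heat_modulus (e : 'rV[R]_n -> R) :
  measurable_fun setT e -> measurable_fun setT (heat_modulus e).
Proof.
move=> me; have mm := measurable_modulus me.
have m0 := modulus_ge0 e.
have g0 := @gaussn_ge0 R n.
have mg : measurable_fun setT (fun p : R * 'rV[R]_n => gaussn p.1 p.2).
  by apply: measurable_gaussn; mfun.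
rewrite /heat_modulus; apply: measurable_integral2; first by nneg.
by rewrite /=; mfun.
Qed.

(** At each time Hoelder's inequality with exponent [1/r] replaces the weighted heat deviation by
    the power [r] of the heat modulus. The weight [g] disappears, and [interpolation_bound] takes
    over. *)
Let finite_mass_estimate : exists2 C : R, (0 < C)%R &
  forall (b : 'rV[R]_n -> bool) (g : 'rV[R]_n -> R), measurable_fun setT b -> \int[mu]_x (bindic b x)%:E < +oo ->
    measurable_fun setT g -> (forall x, 0 <= g x)%R ->
    \int[mu]_x (g x `^ q)%:E <= 1 ->
  \int[lebesgue_measure]_t ((pw (- a - 1) t)%:E * \int[mu]_x ((g x)%:E *
     \int[mu]_z (gaussn t z * `|bindic b (x + z) - bindic b x|)%:E))
  <= C%:E * heat_variation (bindic b).
Proof.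
have [C C0 hC] := interpolation_bound alpha_gt0 alpha_lt1 n_ge2
  (K := (2 ^+ n.+1)%R) (K' := (2 ^+ n.+2 * 2 `^ n%:R^-1)%R)
  (exprn_gt0 n.+1 (ltr0Sn _ 1)) (mulr_gt0 (exprn_gt0 n.+2 (ltr0Sn _ 1)) (powR_gt0 _ (ltr0Sn _ 1))).
exists C => // b g mb foo mg g0 gq1.
have me : measurable_fun setT (bindic b) by rewrite /bindic; mfun.
have e0 x : (0 <= bindic b x :> R)%R by rewrite /bindic; case: ifP.
have mm := measurable_heat_modulus me.
have h0 := heat_modulus_ge0 (bindic b).
have mpw := @measurable_pw R.
have pw0 := @pw_ge0 R.
have gs0 := @gaussn_ge0 R n.
have mgs : measurable_fun setT (fun p : R * 'rV[R]_n => gaussn p.1 p.2).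
  by apply: measurable_gaussn; mfun.
have mG : measurable_fun setT (fun t => \int[mu]_x ((g x)%:E *
     \int[mu]_z (gaussn t z * `|bindic b (x + z)%R - bindic b x|)%:E)).
  apply: measurable_integral2; first by nneg.
  rewrite /=; mfun.
have [[D DE]|DE] : (exists D, heat_variation (bindic b) = D%:E) \/ heat_variation (bindic b) = +oo.
  have := heat_variation_ge0 (bindic b).
  by case: (heat_variation _) => [D| |] // _; [left; exists D|right].
2: by rewrite DE gt0_muley ?leey// lte_fin.
rewrite DE -EFinM.
have D0 : (0 <= D)%R by rewrite -lee_fin -DE heat_variation_ge0.
have [m mE] : exists m, \int[mu]_x (bindic b x)%:E = m%:E.
  exists (fine (\int[mu]_x (bindic b x)%:E)); rewrite fineK// ge0_fin_numE//.
  by side.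
have m0 : (0 <= m)%R by rewrite -lee_fin -mE; nneg.
pose A t := fine (heat_modulus (bindic b) t).
have AE t : (0 < t)%R -> heat_modulus (bindic b) t = (A t)%:E.
  move=> t0; rewrite fineK// ge0_fin_numE//.
  by apply: le_lt_trans (heat_modulus_le_mass mb mE t0) _; rewrite ltry.
have A0 t : (0 <= A t)%R by rewrite fine_ge0.
have hbound t : (0 < t)%R -> \int[mu]_x ((g x)%:E *
     \int[mu]_z (gaussn t z * `|bindic b (x + z) - bindic b x|)%:E) <= (A t `^ r)%:E.
  move=> t0; under eq_integral do rewrite -heat_devE// -EFinM.
  have rV : (1 < r^-1)%R by rewrite invf_gt1.
  have rq : (r^-1^-1 + q^-1 = 1)%R.
    by rewrite invrK /r /q invf_div -mulrDl subrK divff// nn0.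
  have := hoelder_le1 mg (measurable_heat_dev mb t) g0 _ rV rq gq1.
  rewrite integral_heat_dev// invrK AE// poweR_EFin; apply.
  by move=> x; rewrite heat_dev_ge0 heat_dev_le1.
have mA : measurable_fun setT A by apply: (@measurableT_comp _ _ _ _ _ _ fine); [exact: fine_measurable|exact: mm].
apply: (@le_trans _ _ (\int[lebesgue_measure]_t (pw (- a - 1) t * A t `^ r)%:E)).
  apply: le_integralT; [by nneg|by mfun|by mfun|].
  move=> t; have [t0|t0] := leP t 0%R; first by rewrite /pw ltNge t0/= mul0e mul0r.
  by rewrite EFinM; apply: lee_wpmul2l; [rewrite lee_fin|exact: hbound].
(* A null set has no splitting time [m^(2/n)]; for it the volume bound [2 m] makes the integrand
   vanish. *)
have [m0'|m_gt0] := eqVneq m 0%R.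
  rewrite (_ : \int[_]_t _ = 0) ?lee_fin ?mulr_ge0 ?(ltW C0)//.
  apply: integral0_eq => t _; have [t0|t0] := leP t 0%R.
    by rewrite /pw ltNge t0/= mul0r.
  suff -> : A t = 0%R by rewrite powR0 ?mulr0// gt_eqF.
  apply/le_anti/andP; split => //; rewrite -lee_fin -AE//.
  apply: (le_trans (heat_modulus_le_mass mb mE t0)).
  by rewrite m0' mulr0.
have {}m_gt0 : (0 < m)%R by rewrite lt_neqAle eq_sym m_gt0.
apply: (hC m); [exact: mA|exact: m_gt0|exact: D0| |].
  move=> t t0; split; first exact: A0.
  - rewrite -lee_fin -AE// EFinM -DE; exact: heat_modulus_le_variation.
  - by rewrite -lee_fin -AE//; exact: heat_modulus_le_mass.
exact: (isoperimetric mb mE m_gt0 DE).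
Qed.

(** Both sides involve only differences of indicators, in absolute value, so a set may be replaced
    by its complement. This is needed for superlevel sets at negative levels. *)
Lemma set_estimate : exists2 C : R, (0 < C)%R &
  forall (b : 'rV[R]_n -> bool) (g : 'rV[R]_n -> R), measurable_fun setT b ->
    \int[mu]_x (bindic b x)%:E < +oo \/ \int[mu]_x (bindic (negb \o b) x)%:E < +oo ->
    measurable_fun setT g -> (forall x, 0 <= g x)%R ->
    \int[mu]_x (g x `^ q)%:E <= 1 ->
  \int[lebesgue_measure]_t ((pw (- a - 1) t)%:E * \int[mu]_x ((g x)%:E *
     \int[mu]_z (gaussn t z * `|bindic b (x + z) - bindic b x|)%:E))
  <= C%:E * heat_variation (bindic b).
Proof.
have [C C0 hC] := finite_mass_estimate; exists C => // b g mb [foo|foo] mg g0 gq1.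
  exact: hC.
have difN x y : (`|bindic b x - bindic b y| =
    `|bindic (negb \o b) x - bindic (negb \o b) y| :> R)%R.
  by rewrite /bindic/=; case: (b x); case: (b y); rewrite /= ?subrr// sub0r subr0 normrN.
have E : heat_modulus (bindic b) = heat_modulus (bindic (negb \o b)) :> (R -> \bar R).
  apply/funext => t; rewrite /heat_modulus /modulus; apply: eq_integral => z _.
  by congr (_ * _); apply: eq_integral => x _; rewrite difN.
rewrite /heat_variation E -/(heat_variation _).
under eq_integral => t _.
  under eq_integral => x _.
    under eq_integral => z _ do rewrite difN.
    over.
  over.
by apply: hC => //; exact: measurable_neg.
Qed.

End set_estimate_main.

(** * Coarea for superlevel sets *)

Section layer_cake.
Context (R : realType).
Local Open Scope ereal_scope.

Lemma integral_layer (u v : R) :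
  \int[lebesgue_measure]_l
    (`|(if (l < u)%R then 1 else 0) - (if (l < v)%R then 1 else 0)|%R)%:E =
  (`|u - v|%R)%:E.
Proof.
wlog vu : u v / (v <= u)%R.
  move=> H; have [vu|uv] := leP v u; first exact: H.
  rewrite distrC -H ?(ltW uv)//; apply: eq_integral => l _.
  by rewrite distrC.
transitivity (\int[lebesgue_measure]_(l in `[v, u[) (cst 1%:E l)); last first.
  rewrite integral_cst//= lebesgue_measure_itv/= lte_fin mul1e.
  rewrite ger0_norm ?subr_ge0//; case: ifPn => // uv.
  by rewrite (@le_anti _ _ u v) ?subrr// vu leNgt uv.
apply: integral_setT_ifE => /=.
- by move=> l; rewrite in_itv/= => /andP[vl ->]; rewrite ltNge vl/= subr0 normr1.
- move=> l /negP; rewrite in_itv/= negb_and -leNgt -ltNge => /orP[lv|ul].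
    by rewrite lv (lt_le_trans lv vu) subrr normr0.
  by rewrite !ltNge ul (le_trans vu ul)/= subrr normr0.
Qed.

End layer_cake.

Section level_sets.
Context (R : realType) (n : nat) (alpha : R).
Hypotheses (alpha_gt0 : 0 < alpha) (alpha_lt1 : alpha < 1) (n_ge2 : (2 <= n)%N).
Local Open Scope ereal_scope.
Notation mu := (lebesgue_rV R n).
Notation leb := (@lebesgue_measure R).
Let a : R := ((1 - alpha) / 2)%R.
Let q : R := (n%:R / alpha)%R.

Definition superlevel (U : 'rV[R]_n -> R) (l : R) (x : 'rV[R]_n) : bool := (l < U x)%R.

Lemma measurable_bindic_superlevel d (T : measurableType d) U (f : T -> R)
    (g : T -> 'rV[R]_n) : measurable_fun setT U ->
  measurable_fun setT f -> measurable_fun setT g ->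
  measurable_fun setT (fun u : T => bindic (superlevel U (f u)) (g u)).
Proof. by move=> mU mf mg; rewrite /bindic /superlevel; mfun. Qed.

Variable U : 'rV[R]_n -> R.
Hypothesis mU : measurable_fun setT U.
Let e l := @bindic R n (superlevel U l).
Let me d (T : measurableType d) (f : T -> R) (g : T -> 'rV[R]_n) :
  measurable_fun setT f -> measurable_fun setT g ->
  measurable_fun setT (fun u : T => e (f u) (g u)).
Proof. by move=> mf mg; exact: measurable_bindic_superlevel. Qed.

Let mdif d (T : measurableType d) (f : T -> R) (g h : T -> 'rV[R]_n) :
  measurable_fun setT f -> measurable_fun setT g -> measurable_fun setT h ->
  measurable_fun setT (fun u : T => `|e (f u) (g u + h u)%R - e (f u) (g u)|)%R.
Proof.
move=> mf mg mh.
apply: (@measurableT_comp _ _ _ _ _ _ (@Num.norm R R)); first exact: normr_measurable.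
apply: measurable_funD; last apply: measurable_funN; apply: me => //.
exact: measurable_rVD.
Qed.

Let UE x z : `|U (x + z) - U x|%:E =
  \int[leb]_l (`|e l (x + z) - e l x|)%:E.
Proof. by rewrite -integral_layer. Qed.

Let mg2 d (T : measurableType d) (f : T -> R) (g : T -> 'rV[R]_n) :
  measurable_fun setT f -> measurable_fun setT g ->
  measurable_fun setT (fun u : T => gaussn (f u) (g u)).
Proof. by move=> *; apply: measurable_gaussn. Qed.

Let g0 := @gaussn_ge0 R n.

(** At a fixed time coarea is Tonelli's theorem applied to the layer formula, with equality. Only
    the supremum over times needs a limit argument. *)
Lemma heat_modulus_layer t :
  heat_modulus U t = \int[leb]_l heat_modulus (e l) t.
Proof.
rewrite /heat_modulus /modulus.
rewrite (@tonelli _ _ _ _ _ leb mu (fun l z => (gaussn t z)%:E * \int[mu]_x (`|e l (x + z)%R - e l x|)%:E)); last 2 first.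
- by nneg.
- rewrite /=; apply: emeasurable_funM.
    by apply/measurable_EFinP; apply: mg2; mfun.
  apply: measurable_integral2; first by nneg.
  by rewrite /=; apply/measurable_EFinP; apply: mdif; mfun.
apply: eq_integral => z _; rewrite ge0_integralZl; try side.
  congr (_ * _); rewrite (@tonelli _ _ _ _ _ leb mu (fun l x => (`|e l (x + z)%R - e l x|)%:E)); first last.
  - by rewrite /=; apply/measurable_EFinP; apply: mdif; mfun.
  - by nneg.
  by apply: eq_integral => x _; exact: UE.
apply: measurable_integral2; first by nneg.
by rewrite /=; apply/measurable_EFinP; apply: mdif; mfun.
Qed.

Let mel l : measurable_fun setT (e l).
Proof. by rewrite -[e l]/(fun x => e (cst l x) x); apply: me; mfun. Qed.

Let g_ (j : nat) l := (2 ^+ j)%:E * heat_modulus (e l) (4^-1 ^+ j).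

Let mg_ j : measurable_fun setT (g_ j).
Proof.
rewrite /g_; apply: emeasurable_funM; first exact: measurable_cst.
rewrite /heat_modulus /modulus; apply: measurable_integral2; first by nneg.
rewrite /=; apply: emeasurable_funM; first by mfun.
apply: measurable_integral2; first by nneg.
by rewrite /=; apply/measurable_EFinP; apply: mdif; mfun.
Qed.

Let gE l : g_ ^~ l @ \oo --> heat_variation (e l).
Proof. by apply: ereal_nondecreasing_cvgn; apply: heat_variation_nd. Qed.

Lemma measurable_heat_variation_superlevel :
  measurable_fun setT (fun l => heat_variation (bindic (superlevel U l))).
Proof. by apply: (emeasurable_fun_cvg g_ _ mg_) => l _; exact: gE. Qed.

(** Every term of the monotone limit is bounded by [M], because [2^j sqrt (4^-j) = 1]. *)
Lemma integral_heat_variation_le (M : R) :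
  (forall t, (0 < t)%R -> heat_modulus U t <= (M * Num.sqrt t)%:E) ->
  \int[leb]_l heat_variation (e l) <= M%:E.
Proof.
move=> hM.
have gE' l : heat_variation (e l) = limn (g_ ^~ l).
  by apply/esym/cvg_lim => //; exact: gE.
under eq_integral do rewrite gE'.
have h0 l t : 0 <= heat_modulus (e l) t by exact: heat_modulus_ge0.
have mh t : measurable_fun setT (fun l => heat_modulus (e l) t).
  rewrite /heat_modulus /modulus; apply: measurable_integral2; first by nneg.
  rewrite /=; apply: emeasurable_funM; first by mfun.
  apply: measurable_integral2; first by nneg.
  by rewrite /=; apply/measurable_EFinP; apply: mdif; mfun.
rewrite (monotone_convergence leb measurableT mg_); last 2 first.
- by move=> j l _; rewrite /g_ mule_ge0.
- by move=> l _; exact: heat_variation_nd.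
apply: lime_le.
  apply: ereal_nondecreasing_is_cvgn => i j ij.
  apply: le_integralT; [by move=> l; rewrite /g_ mule_ge0|exact: mg_|exact: mg_|].
  by move=> l; exact: heat_variation_nd.
apply: nearW => j; rewrite /g_ ge0_integralZl; try side.
rewrite -heat_modulus_layer.
apply: (@le_trans _ _ ((2 ^+ j)%:E * (M * Num.sqrt (4^-1 ^+ j))%:E)).
  by apply: lee_wpmul2l => //; apply: hM; rewrite exprn_gt0.
rewrite -EFinM lee_fin mulrCA.
have -> : (4^-1 ^+ j = (2^-1 ^+ j) ^+ 2 :> R)%R.
  by rewrite exprAC; congr (_ ^+ _)%R; rewrite expr2 -invfM -natrM.
by rewrite sqrtr_sqr ger0_norm ?exprn_ge0// -exprMn divff// expr1n mulr1.
Qed.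

Variable g : 'rV[R]_n -> R.
Hypothesis mg : measurable_fun setT g.
Hypothesis gg0 : forall x, (0 <= g x)%R.
Let mpw := @measurable_pw R.
Let pw0 := @pw_ge0 R.

Let mz d (T : measurableType d) (l t : T -> R) (x : T -> 'rV[R]_n) :
  measurable_fun setT l -> measurable_fun setT t -> measurable_fun setT x ->
  measurable_fun setT (fun u => \int[mu]_z (gaussn (t u) z * `|e (l u) (x u + z)%R - e (l u) (x u)|)%:E).
Proof.
move=> ml mt mx; apply: measurable_integral2; first by nneg.
rewrite /=; apply/measurable_EFinP; apply: measurable_funM.
  by apply: mg2; mfun; apply: (measurableT_comp mt); mfun.
by apply: mdif; mfun.
Qed.

Let mx d (T : measurableType d) (l t : T -> R) :
  measurable_fun setT l -> measurable_fun setT t ->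
  measurable_fun setT (fun u => \int[mu]_x ((g x)%:E *
    \int[mu]_z (gaussn (t u) z * `|e (l u) (x + z)%R - e (l u) x|)%:E)).
Proof.
move=> ml mt; apply: measurable_integral2; first by nneg.
rewrite /=; apply: emeasurable_funM; first by mfun.
by apply: mz; mfun.
Qed.

Lemma measurable_heat_dev_superlevel :
  measurable_fun setT (fun l => \int[leb]_t ((pw (- a - 1) t)%:E * \int[mu]_x ((g x)%:E *
     \int[mu]_z (gaussn t z * `|bindic (superlevel U l) (x + z)%R - bindic (superlevel U l) x|)%:E))).
Proof.
apply: measurable_integral2; first by nneg.
by rewrite /=; apply: emeasurable_funM; [mfun|apply: mx; mfun].
Qed.

Lemma heat_dev_layer :
  \int[leb]_t ((pw (- a - 1) t)%:E * \int[mu]_x ((g x)%:E *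
     \int[mu]_z (gaussn t z * `|U (x + z) - U x|)%:E)) =
  \int[leb]_l \int[leb]_t ((pw (- a - 1) t)%:E * \int[mu]_x ((g x)%:E *
     \int[mu]_z (gaussn t z * `|e l (x + z) - e l x|)%:E)).
Proof.
rewrite [RHS](@tonelli _ _ _ _ _ leb leb (fun l t => (pw (- a - 1) t)%:E * \int[mu]_x ((g x)%:E *
     \int[mu]_z (gaussn t z * `|e l (x + z)%R - e l x|)%:E))); last 2 first.
- by nneg.
- rewrite /=; apply: emeasurable_funM; first by mfun.
  by apply: mx; mfun.
apply: eq_integral => t _; rewrite ge0_integralZl; try side; last by apply: mx; mfun.
congr (_ * _).
rewrite [RHS](@tonelli _ _ _ _ _ leb mu (fun l x => (g x)%:E *
     \int[mu]_z (gaussn t z * `|e l (x + z)%R - e l x|)%:E)); last 2 first.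
- by nneg.
- rewrite /=; apply: emeasurable_funM; first by mfun.
  by apply: mz; mfun.
apply: eq_integral => x _; rewrite ge0_integralZl; try side; last by apply: mz; mfun.
congr (_ * _).
rewrite [RHS](@tonelli _ _ _ _ _ leb mu (fun l z => (gaussn t z * `|e l (x + z)%R - e l x|)%:E)); last 2 first.
- by nneg.
- rewrite /=; apply/measurable_EFinP; apply: measurable_funM.
    by apply: mg2; mfun.
  by apply: mdif; mfun.
apply: eq_integral => z _; rewrite EFinM UE; under [RHS]eq_integral do rewrite EFinM.
rewrite ge0_integralZl; try side; first by [].
by apply/measurable_EFinP; apply: mdif; mfun.
Qed.

End level_sets.

Section level_set_estimate.
Context (R : realType) (n : nat) (alpha : R).
Hypotheses (alpha_gt0 : 0 < alpha) (alpha_lt1 : alpha < 1) (n_ge2 : (2 <= n)%N).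
Local Open Scope ereal_scope.
Notation mu := (lebesgue_rV R n).
Notation leb := (@lebesgue_measure R).
Let a : R := ((1 - alpha) / 2)%R.
Let q : R := (n%:R / alpha)%R.

Lemma level_set_estimate : exists2 C : R, (0 < C)%R &
  forall (U g : 'rV[R]_n -> R) (M : R), measurable_fun setT U ->
    (forall l, l != 0%R -> \int[mu]_x (bindic (superlevel U l) x)%:E < +oo \/
      \int[mu]_x (bindic (negb \o superlevel U l) x)%:E < +oo) ->
    (forall t, (0 < t)%R -> heat_modulus U t <= (M * Num.sqrt t)%:E) ->
    measurable_fun setT g -> (forall x, 0 <= g x)%R ->
    \int[mu]_x (g x `^ q)%:E <= 1 ->
  \int[leb]_t ((pw (- a - 1) t)%:E * \int[mu]_x ((g x)%:E *
     \int[mu]_z (gaussn t z * `|U (x + z) - U x|)%:E)) <= (C * M)%:E.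
Proof.
have [C C0 hC] := @set_estimate R n alpha alpha_gt0 alpha_lt1 n_ge2.
exists C => // U g M mU fin hM mg g0 gq1.
rewrite heat_dev_layer//.
have hv0 l : 0 <= heat_variation (bindic (superlevel U l)) :> \bar R.
  exact: heat_variation_ge0.
have mhv := measurable_heat_variation_superlevel mU.
apply: (@le_trans _ _ (\int[leb]_l (C%:E * heat_variation (bindic (superlevel U l))))); last first.
  rewrite ge0_integralZl; try side.
  by rewrite EFinM; apply: lee_wpmul2l; [rewrite lee_fin ltW|exact: (integral_heat_variation_le mU hM)].
have pw0 := @pw_ge0 R; have gs0 := @gaussn_ge0 R n.
(* At level 0 the superlevel set and its complement may both have infinite measure. A single level
   is negligible. *)
apply: ae_ge0_le_integral; [exact: measurableT|by nneg|exact: measurable_heat_dev_superlevel|by nneg|by mfun|].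
exists [set 0%R]; split; [exact: measurable_set1|exact: lebesgue_measure_set1|].
move=> l /= /not_implyP[_ hl]; apply: contrapT => /eqP l0; apply: hl.
apply: hC => //; last exact: fin.
by rewrite /superlevel; mfun.
Qed.

End level_set_estimate.

(** * Marchaud's integral *)

Section marchaud.
Context (R : realType) (a : R).
Hypotheses (a_gt0 : 0 < a) (a_lt1 : a < 1).
Local Open Scope ereal_scope.
Notation leb := (@lebesgue_measure R).

(** For [t >= 0] this is [v tau - v (tau + t)], where [v] is the indicator of the times at most [s].
    Accordingly [marchaud_cst s] is Marchaud's double integral of that indicator. *)
Definition between (s tau t : R) : R := if (tau <= s)%R then if (s < tau + t)%R then 1%R else 0%R else 0%R.

Definition marchaud_cst (s : R) : \bar R :=
  \int[leb]_t ((pw (- a - 1) t)%:E * \int[leb]_tau ((pw (a - 1) tau)%:E * (between s tau t)%:E)).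

Let mpw := @measurable_pw R.
Let pw0 := @pw_ge0 R.
Let b0 s tau t : (0 <= between s tau t)%R.
Proof. by rewrite /between; case: ifP => // _; case: ifP. Qed.

(** The two weights have opposite degrees of homogeneity, [-a] and [a]. Hence every level of a
    decreasing function contributes the same constant, whatever the time at which it is crossed. *)
Lemma marchaud_cst_scale s : (0 < s)%R -> marchaud_cst s = marchaud_cst 1.
Proof.
move=> s0; rewrite /marchaud_cst.
rewrite (@integral_pw_scale _ _ (fun t => \int[leb]_tau ((pw (a - 1) tau)%:E * (between s tau t)%:E)) s)//; last 2 first.
- apply: measurable_integral2; first by nneg.
  by rewrite /= /between; mfun.
- by nneg.
under eq_integral => t _.
  rewrite (@integral_pw_scale _ _ (fun tau => (between s tau (s * t))%:E) s)//; last 2 first.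
  - by rewrite /between; mfun.
  - by nneg.
  rewrite muleCA; under [X in _ * (_ * X)]eq_integral => tau _.
    have -> : (between s (s * tau) (s * t) = between 1 tau t)%R.
      rewrite /between -mulrDr ger_pMr// [X in _ = if _ then if X then _ else _ else _](_ : _ = (s < s * (tau + t))%R)//.
      by rewrite ltr_pMr.
    over.
  over.
rewrite ge0_integralZl; try side.
rewrite muleA -EFinM -powRD ?(gt_eqF s0) ?implybT//.
have -> : (- a - 1 + 1 + (a - 1 + 1) = 0)%R by ring.
by rewrite powRr0 mul1e.
Qed.

Let mbetween d (T : measurableType d) (f g h : T -> R) :
  measurable_fun setT f -> measurable_fun setT g -> measurable_fun setT h ->
  measurable_fun setT (fun u => between (f u) (g u) (h u)).
Proof. by move=> mf mg mh; rewrite /between; mfun. Qed.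

Let minner s : measurable_fun setT
  (fun t => \int[leb]_tau ((pw (a - 1) tau)%:E * (between s tau t)%:E)).
Proof.
apply: measurable_integral2; first by nneg.
by rewrite /=; mfun; apply: mbetween; mfun.
Qed.

Let integral_between t : (0 < t)%R -> \int[leb]_tau (between 1 tau t)%:E = t%:E.
Proof.
move=> t0; transitivity (\int[leb]_(tau in `](1 - t)%R, 1%R]) (cst 1%:E tau)).
  apply: integral_setT_ifE => tau /=; rewrite in_itv/= /between ltrBlDr.
    by move=> /andP[-> ->].
  by move/negP; rewrite negb_and => /orP[] /negbTE ->//; case: ifP.
rewrite integral_cst//= lebesgue_measure_itv/= lte_fin mul1e ltrBlDr ltrDl t0.
by rewrite -EFinB opprB addrCA subrr addr0.
Qed.

(** For [t <= 1/2] the window of [tau] has length [t] and stays above 1/2, so the inner integral is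
    at most [2 t] and [a < 1] gives convergence at 0. It is always at most [1/a], and [a > 0] gives
    convergence at infinity. *)
Lemma marchaud_cst_fin : marchaud_cst 1 < +oo.
Proof.
have a1 : (0 < 1 - a)%R by rewrite subr_gt0.
have h2 : (0 < 2^-1 :> R)%R by rewrite invr_gt0.
have ifpw0 (b : bool) c t : (0 <= if b then pw c t else 0 :> R)%R by case: b => //; exact: pw0.
have inner_small t : (0 < t)%R -> (t <= 2^-1)%R ->
    \int[leb]_tau ((pw (a - 1) tau)%:E * (between 1 tau t)%:E) <= (2 * t)%:E.
  move=> t0 t2; rewrite EFinM -(integral_between t0).
  have mb : measurable_fun setT (fun tau => between 1 tau t) by apply: mbetween; mfun.
  rewrite -ge0_integralZl; try side.
  apply: le_integralT; [by nneg|by mfun|by mfun|].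
  move=> tau; rewrite -!EFinM lee_fin /between.
  case: ifPn => [tau1|_]; last by rewrite !mulr0.
  case: ifPn => [h|_]; last by rewrite !mulr0.
  have tau2 : (2^-1 <= tau)%R by lra.
  have tau0 : (0 < tau)%R by exact: lt_le_trans tau2.
  rewrite !mulr1 pwE// (_ : (a - 1 = -1 * (1 - a))%R); last by ring.
  rewrite powRrM powR_inv1 ?(ltW tau0)//.
  apply: (@le_trans _ _ tau^-1%R).
    by apply: ler1_powR; rewrite ?invf_ge1// gerBl ltW.
  by rewrite -[leRHS]invrK lef_pV2 ?posrE.
have inner_large t : \int[leb]_tau ((pw (a - 1) tau)%:E * (between 1 tau t)%:E) <= (a^-1)%:E.
  have := integral_pw_near0 a_gt0 (@ltr01 R); rewrite powR1 mul1r; apply: le_trans.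
  have mb : measurable_fun setT (fun tau => between 1 tau t) by apply: mbetween; mfun.
  apply: le_integralT; [by nneg|by mfun|by mfun|].
  move=> tau; rewrite -EFinM lee_fin /between; case: ifPn => _; last by rewrite mulr0.
  by case: ifPn => _; rewrite ?mulr0 ?mulr1.
apply: (@le_lt_trans _ _ (\int[leb]_t
  (2%:E * (if (t <= 2^-1)%R then pw (1 - a - 1) t else 0%R)%:E +
   (a^-1)%:E * (if (2^-1 <= t)%R then pw (- a - 1) t else 0%R)%:E))).
  have mi := minner 1.
  apply: le_integralT; [by nneg|by mfun|by mfun|].
  have ai : (0 <= a^-1)%R by rewrite invr_ge0 ltW.
  move=> t; have [t0|t0] := leP t 0%R.
    by rewrite {1}/pw ltNge t0/= mul0e; nneg.
  have [t2|t2] := leP t 2^-1%R.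
    apply: (@le_trans _ _ ((pw (- a - 1) t)%:E * (2 * t)%:E)).
      by apply: lee_wpmul2l; [rewrite lee_fin|exact: inner_small].
    apply: lee_paddr; first by nneg.
    rewrite -!EFinM lee_fin !pwE// mulrCA ler_wpM2l//.
    rewrite -[X in (_ * X <= _)%R]powRr1 ?(ltW t0)// -powRD ?(gt_eqF t0) ?implybT//.
    by rewrite (_ : (- a - 1 + 1 = 1 - a - 1)%R)//; ring.
  rewrite (ltW t2) mule0 add0e muleC; apply: lee_wpmul2r; first by rewrite lee_fin.
  exact: inner_large.
rewrite ge0_integralD; try side.
have ai : (0 <= a^-1)%R by rewrite invr_ge0 ltW.
rewrite !ge0_integralZl; try side.
rewrite lte_add_pinfty// lte_mul_pinfty ?lee_fin//.
  by apply: le_lt_trans (integral_pw_near0 a1 h2) _; rewrite ltry.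
by apply: le_lt_trans (integral_pw_nearoo a_gt0 h2) _; rewrite ltry.
Qed.

(** For [t] between 1 and 2 the window contains the positive part of [[1/2, 1]] seen at [t = 1/2],
    where the weight [tau^(a-1)] is at least 1. Positivity allows division in the inversion
    formula. *)
Lemma marchaud_cst_gt0 : 0 < marchaud_cst 1.
Proof.
have mi := minner 1.
apply: (@integral_gt0 _ _ (2 `^ (- a - 1) * 2^-1)%R); [by pos|by mfun|by nneg|].
move=> t /andP[t1 t2]; rewrite EFinM; apply: lee_pmul; rewrite ?lee_fin ?powR_ge0 ?invr_ge0//.
  rewrite pwE; last exact: lt_le_trans t1.
  rewrite -[(- a - 1)%R]opprK !(powRN _ (- (- a - 1))%R) lef_pV2 ?posrE ?powR_gt0//; last exact: lt_le_trans t1.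
  have t0 : (0 <= t)%R by exact: le_trans t1.
  by apply: ge0_ler_powR; rewrite ?nnegrE// opprB opprK addr_ge0// ltW.
have mb s : measurable_fun setT (fun tau => between 1 tau s) by apply: mbetween; mfun.
apply: (@le_trans _ _ (\int[leb]_tau (between 1 tau 2^-1)%:E)).
  by rewrite integral_between// invr_gt0.
have bb := mb t; have bb2 := mb 2^-1%R.
apply: le_integralT; [by nneg|by mfun|by mfun|].
move=> tau; rewrite -EFinM lee_fin /between.
case: ifPn => [tau1|_]; last by rewrite mulr0.
case: ifPn => [h|_]; last by case: ifP; rewrite ?mulr0// mulr1.
have tau0 : (0 < tau)%R by lra.
rewrite ifT; last by lra.
rewrite mulr1 pwE// -opprB powRN -[leLHS]invr1 lef_pV2 ?posrE ?powR_gt0//.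
have e1 : (1 `^ (1 - a) = 1 :> R)%R by rewrite powR1.
by rewrite -[leRHS]e1; apply: ge0_ler_powR; rewrite ?nnegrE ?subr_ge0 ?(ltW a_lt1) ?(ltW tau0).
Qed.

(* Layer-cake proof: for [0 < l < v 0], continuity and monotonicity of [v] show
   that [v (tau + t) < l <= v tau] iff [tau <= s < tau + t], [s] being the last
   time at which [v] is at least [l]. *)
Lemma marchaud_nonincreasing (v : R -> R) : measurable_fun setT v ->
  (forall x y, 0 <= x -> x <= y -> v y <= v x)%R ->
  (forall x, 0 <= x -> 0 <= v x)%R ->
  (forall x, 0 <= x -> {for x, continuous v})%R ->
  (forall l, 0 < l -> exists2 x, 0 <= x & v x < l)%R ->
  \int[leb]_t \int[leb]_tau (pw (- a - 1) t * pw (a - 1) tau * (v tau - v (tau + t)))%:E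
  = marchaud_cst 1 * (v 0%R)%:E.
Proof.
move=> mv ndv v0 cv voo.
pose chi l tau t : R := if (v (tau + t) < l)%R then if (l <= v tau)%R then 1%R else 0%R else 0%R.
have chi0 l tau t : (0 <= chi l tau t)%R by rewrite /chi; do 2 case: ifP => //.
have mchi d (T : measurableType d) (f g h : T -> R) :
    measurable_fun setT f -> measurable_fun setT g -> measurable_fun setT h ->
    measurable_fun setT (fun u => chi (f u) (g u) (h u)).
  move=> mf mg mh; rewrite /chi.
  by apply: measurable_fun_ifT; [apply: measurable_fun_ltr| |]; mfun.
have layer t tau : (pw (- a - 1) t * pw (a - 1) tau * (v tau - v (tau + t)))%:E =
    \int[leb]_l ((pw (- a - 1) t)%:E * ((pw (a - 1) tau)%:E * (chi l tau t)%:E)).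
  have mc : measurable_fun setT (fun l => chi l tau t) by apply: mchi; mfun.
  rewrite ge0_integralZl; try side.
  rewrite ge0_integralZl; try side.
  rewrite muleA -EFinM.
  have [t0|t0] := leP t 0%R; first by rewrite {1 3}/pw ltNge t0/= !mul0r mul0e.
  have [tau0|tau0] := leP tau 0%R; first by rewrite /pw (ltNge 0%R tau) tau0/= mulr0 mul0r mul0e.
  rewrite [LHS]EFinM; congr (_ * _).
  transitivity (\int[leb]_(l in `]v (tau + t)%R, v tau]) (cst 1%:E l)); last first.
    apply/esym; apply: integral_setT_ifE => l /=; rewrite in_itv/= /chi.
      by move=> /andP[-> ->].
    by move/negP; rewrite negb_and => /orP[] /negbTE ->//; case: ifP.
  rewrite integral_cst//= lebesgue_measure_itv/= lte_fin mul1e -EFinB.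
  have le : (v (tau + t) <= v tau)%R by apply: ndv; rewrite ?lerDl ?(ltW t0) ?(ltW tau0).
  case: ifPn => // h; suff -> : (v (tau + t) = v tau)%R by rewrite subrr.
  by apply: le_anti; rewrite le leNgt.
under eq_integral do under eq_integral do rewrite layer.
have mW1 t : measurable_fun setT (fun p : R * R => (pw (- a - 1) t)%:E * ((pw (a - 1) p.2)%:E * (chi p.1 p.2 t)%:E)).
  by mfun; apply: mchi; mfun.
transitivity (\int[leb]_t \int[leb]_l \int[leb]_tau
    ((pw (- a - 1) t)%:E * ((pw (a - 1) tau)%:E * (chi l tau t)%:E))).
  apply: eq_integral => t _; apply/esym.
  by rewrite (@tonelli _ _ _ _ _ leb leb (fun l tau => (pw (- a - 1) t)%:E * ((pw (a - 1) tau)%:E * (chi l tau t)%:E))); try side.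
have mW2 : measurable_fun setT (fun p : R * R => \int[leb]_tau
    ((pw (- a - 1) p.2)%:E * ((pw (a - 1) tau)%:E * (chi p.1 tau p.2)%:E))).
  apply: measurable_integral2; first by nneg.
  by rewrite /=; mfun; apply: mchi; mfun.
rewrite -(@tonelli _ _ _ _ _ leb leb (fun l t => \int[leb]_tau
    ((pw (- a - 1) t)%:E * ((pw (a - 1) tau)%:E * (chi l tau t)%:E)))); try side.
pose I l := \int[leb]_t \int[leb]_tau ((pw (- a - 1) t)%:E * ((pw (a - 1) tau)%:E * (chi l tau t)%:E)).
have mI : measurable_fun setT I by apply: measurable_integral2; [by nneg|exact: mW2].
have I_out l : (l <= 0)%R \/ (v 0 < l)%R -> I l = 0.
  move=> hl; apply: integral0_eq => t _; apply: integral0_eq => tau _.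
  have [t0|t0] := leP t 0%R; first by rewrite /pw ltNge t0/= mul0e.
  have [tau0|tau0] := leP tau 0%R; first by rewrite {2}/pw ltNge tau0/= mul0e mule0.
  suff -> : chi l tau t = 0%R by rewrite !mule0.
  rewrite /chi; case: hl => hl.
    rewrite ifF//; apply/negbTE; rewrite -leNgt; apply: (le_trans hl).
    by apply: v0; rewrite addr_ge0// ltW.
  case: ifP => // _; rewrite ifF//; apply/negbTE; rewrite -ltNge.
  by apply: le_lt_trans hl; apply: ndv => //; exact: ltW.
have I_in l : (0 < l)%R -> (l < v 0)%R -> I l = marchaud_cst 1.
  move=> l0 lv.
  pose S := [set x | (0 <= x)%R /\ (l <= v x)%R].
  have [M M0 vM] := voo l l0.
  have S0 : S 0%R by split => //; exact: ltW.
  have ubS : ubound S M.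
    move=> x [x0 lx]; rewrite leNgt; apply/negP => Mx.
    by have := le_trans lx (ndv _ _ M0 (ltW Mx)); rewrite leNgt vM.
  have supS : has_sup S by split; [exists 0%R|exists M].
  set s := sup S.
  have sup_ge x : S x -> (x <= s)%R by move=> Sx; apply: ub_le_sup => //; exists M.
  have s_ge0 : (0 <= s)%R by exact: sup_ge.
  have below x : (0 <= x)%R -> (x < s)%R -> (l <= v x)%R.
    move=> x0 xs; have [y Sy xy] := sup_adherent (ltac:(rewrite subr_gt0; exact: xs) : (0 < s - x)%R) supS.
    by apply: (le_trans Sy.2); apply: ndv => //; rewrite ltW// -(subKr s x).
  have s_gt0 : (0 < s)%R.
    have /cvgrPdist_lt/(_ (v 0 - l)%R) := cv 0%R (lexx 0%R).
    rewrite subr_gt0 => /(_ lv) [e /= e0 he].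
    have e2 : (0 < e / 2)%R by rewrite divr_gt0.
    apply: (lt_le_trans e2); apply: sup_ge; split; first by rewrite (ltW e2).
    have := he (e / 2)%R; rewrite /ball_ /= sub0r normrN gtr0_norm// => /(_ _)/ltW.
    rewrite ltr_pdivrMr// ltr_pMr// ltr1n => /(_ isT).
    by move/ler_normlP => [_]; lra.
  have vs : (l <= v s)%R.
    rewrite leNgt; apply/negP => vsl.
    have /cvgrPdist_lt/(_ (l - v s)%R) := cv s s_ge0.
    rewrite subr_gt0 => /(_ vsl) [e /= e0 he].
    pose x := Num.max 0%R (s - e / 2)%R.
    have e2 : (0 < e / 2)%R by rewrite divr_gt0.
    have xs : (x < s)%R by rewrite /x gt_max s_gt0/= ltrBlDr ltrDl.
    have x0 : (0 <= x)%R by rewrite /x le_max lexx.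
    have sx : (s - e / 2 <= x)%R by rewrite /x le_max lexx orbT.
    have := he x; rewrite /ball_ /= ger0_norm; last by rewrite subr_ge0 ltW.
    have -> : (s - x < e)%R by lra.
    by move=> /(_ isT); have := below _ x0 xs; rewrite ltr_norml => ? /andP[]; lra.
  have above x : (s < x)%R -> (v x < l)%R.
    move=> sx; rewrite ltNge; apply/negP => lx.
    have : S x by split => //; exact: le_trans (ltW sx).
    by move=> /sup_ge; rewrite leNgt sx.
  rewrite -(marchaud_cst_scale s_gt0); apply: eq_integral => t _.
  have mb : measurable_fun setT (fun tau => between s tau t) by apply: mbetween; mfun.
  rewrite -ge0_integralZl; try side.
  apply: eq_integral => tau _.
  have [t0|t0] := leP t 0%R; first by rewrite /pw (ltNge 0%R t) t0/= !mul0e.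
  have [tau0|tau0] := leP tau 0%R; first by rewrite {2 4}/pw ltNge tau0/= !mul0e.
  congr (_ * (_ * _%:E)); rewrite /chi /between.
  have [taus|staU] := leP tau s.
    have -> : (l <= v tau)%R by apply: (le_trans vs); apply: ndv => //; exact: ltW.
    have [h|h] := ltP s (tau + t)%R; first by rewrite above.
    rewrite ifF//; apply/negbTE; rewrite -leNgt.
    by apply: (le_trans vs); apply: ndv => //; rewrite addr_ge0// ltW.
  have -> : (l <= v tau)%R = false by apply/negbTE; rewrite -ltNge above.
  by case: ifP.
have v00 : (0 <= v 0)%R by exact: v0.
have c0 : 0 <= marchaud_cst 1 by exact/ltW/marchaud_cst_gt0.
pose w (l : R) : R := if (0 < l)%R then if (l < v 0)%R then 1%R else 0%R else 0%R.
have mw : measurable_fun setT w by rewrite /w; mfun.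
have w0 l : (0 <= w l)%R by rewrite /w; do 2 case: ifP => //.
transitivity (\int[leb]_l (marchaud_cst 1 * (w l)%:E)).
  apply: ge0_ae_eq_integral => //; first by mfun.
  - by move=> l _; apply: integral_ge0 => t _; nneg.
  - by nneg.
  (* At the level [v 0] the last time [s] may be 0, where the scaling of [marchaud_cst] breaks down;
     this level is negligible. *)
  exists [set (v 0)%R]; split; [exact: measurable_set1|exact: lebesgue_measure_set1|].
  apply: subsetCl => l /= lv _; rewrite -/(I l) /w.
  have [l0|l0] := ltP 0%R l; last by rewrite I_out ?mule0//; left.
  have [h|h] := ltP l (v 0)%R; first by rewrite I_in ?mule1.
  rewrite I_out ?mule0//; right; rewrite lt_neqAle h andbT.
  by apply/eqP => e; apply: lv.
rewrite ge0_integralZl; try side.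
congr (_ * _); transitivity (\int[leb]_(l in `]0%R, (v 0%R)[) (cst 1%:E l)).
  apply: integral_setT_ifE => l /=; rewrite in_itv/= /w.
    by move=> /andP[-> ->].
  by move/negP; rewrite negb_and => /orP[] /negbTE ->//; case: ifP.
rewrite integral_cst//= lebesgue_measure_itv/= lte_fin mul1e.
case: ifPn => [_|]; first by rewrite oppr0 adde0.
by rewrite -leNgt => h; congr EFin; apply: le_anti; rewrite h v00.
Qed.

End marchaud.

(** * Domination and Fubini for real-valued integrals *)

Section Rintegral.
Context d1 (T1 : measurableType d1) (R : realType).
Variable m1 : {measure set T1 -> \bar R}.

Lemma integrable_lt_pinfty (f : T1 -> R) : measurable_fun setT f ->
  (\int[m1]_x `|f x|%:E < +oo)%E -> m1.-integrable setT (EFin \o f).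
Proof. by move=> mf foo; apply/integrableP; split=> //; exact/measurable_EFinP. Qed.

Lemma EFin_Rintegral (f : T1 -> R) : m1.-integrable setT (EFin \o f) ->
  (\int[m1]_x f x)%:E = (\int[m1]_x (f x)%:E)%E.
Proof. by move=> intf; rewrite fineK//; exact: integrable_fin_num. Qed.

Lemma EFin_Rintegral_ge0 (f : T1 -> R) : (forall x, 0 <= f x) ->
  (\int[m1]_x (f x)%:E < +oo)%E ->
  (\int[m1]_x f x)%:E = (\int[m1]_x (f x)%:E)%E.
Proof.
move=> f0 foo; rewrite fineK// ge0_fin_numE//.
by apply: integral_ge0 => x _; rewrite lee_fin.
Qed.

Lemma normr_Rintegral_le (f : T1 -> R) : measurable_fun setT f ->
  (`|\int[m1]_x f x|%:E <= \int[m1]_x `|f x|%:E)%E.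
Proof.
move=> mf; have mf' : measurable_fun setT (EFin \o f) by exact/measurable_EFinP.
apply: le_trans (le_abse_integral m1 measurableT mf').
by rewrite /Rintegral; case: (integral _ _ _) => [r| |]//=; rewrite ?normr0 ?leey.
Qed.

Lemma integrableR_B (f g : T1 -> R) : m1.-integrable setT (EFin \o f) ->
  m1.-integrable setT (EFin \o g) ->
  m1.-integrable setT (EFin \o (fun x => f x - g x)).
Proof. by move=> fi gi; have := integrableB measurableT fi gi. Qed.

Lemma integrableR_Zl k (f : T1 -> R) : m1.-integrable setT (EFin \o f) ->
  m1.-integrable setT (EFin \o (fun x => k * f x)).
Proof. by move=> fi; have := integrableZl measurableT k fi. Qed.

Lemma integrableR_le (f g : T1 -> R) : measurable_fun setT f ->
  m1.-integrable setT (EFin \o g) -> (forall x, `|f x| <= `|g x|) ->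
  m1.-integrable setT (EFin \o f).
Proof.
move=> mf gi fg; apply: (le_integrable measurableT _ _ gi).
  exact/measurable_EFinP.
by move=> x _; rewrite lee_fin.
Qed.

Lemma integrableR_fin (f : T1 -> R) : m1.-integrable setT (EFin \o f) ->
  (\int[m1]_x `|f x|%:E < +oo)%E.
Proof. by move=> /integrableP[]. Qed.

End Rintegral.

Section Rintegral_fubini.
Context d1 d2 (T1 : measurableType d1) (T2 : measurableType d2) (R : realType).
Variable m1 : {sigma_finite_measure set T1 -> \bar R}.
Variable m2 : {sigma_finite_measure set T2 -> \bar R}.

Lemma measurable_Rintegral2 (F : T1 -> T2 -> R) :
  measurable_fun setT (fun p => F p.1 p.2) ->
  measurable_fun setT (fun x => \int[m2]_y F x y).
Proof.
move=> mF; apply: (@measurableT_comp _ _ _ _ _ _ (@fine R)) => //.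
have mF' : measurable_fun setT (fun p : T1 * T2 => (F p.1 p.2)%:E) by exact/measurable_EFinP.
rewrite (_ : (fun x => _) = (fun x =>
    (\int[m2]_y (fun p : T1 * T2 => (F p.1 p.2)%:E)^\+ (x, y)) -
    (\int[m2]_y (fun p : T1 * T2 => (F p.1 p.2)%:E)^\- (x, y)))%E).
  apply: emeasurable_funB; apply: measurable_fun_fubini_tonelli_F => //.
  - exact: measurable_funepos.
  - exact: measurable_funeneg.
apply/funext => x; rewrite [LHS]integralE.
by congr (_ - _)%E; apply: eq_integral => y _; rewrite ?funeposE ?funenegE.
Qed.

(** Integrability of the sections is required at every point, not almost everywhere, so that the
    real inner integrals coincide everywhere with the extended ones of Fubini's theorem. *)
Lemma Rintegral_swap (F : T1 -> T2 -> R) :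
  measurable_fun setT (fun p => F p.1 p.2) ->
  (\int[m1]_x \int[m2]_y `|F x y|%:E < +oo)%E ->
  (forall x, \int[m2]_y `|F x y|%:E < +oo)%E ->
  (forall y, \int[m1]_x `|F x y|%:E < +oo)%E ->
  \int[m1]_x \int[m2]_y F x y = \int[m2]_y \int[m1]_x F x y.
Proof.
move=> mF Foo F1 F2.
have mF' : measurable_fun setT (fun p : T1 * T2 => (F p.1 p.2)%:E) by exact/measurable_EFinP.
have iF : (m1 \x m2)%E.-integrable setT (fun p : T1 * T2 => (F p.1 p.2)%:E).
  by apply/(integrable12ltyP m1 m2 mF').2.
have := Fubini iF; rewrite /= /Rintegral => FE; congr fine.
transitivity (\int[m1]_x \int[m2]_y (F x y)%:E)%E.
  apply: eq_integral => x _; rewrite EFin_Rintegral//.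
  apply: integrable_lt_pinfty => //.
  have mx : measurable_fun setT (fun y : T2 => (x, y)) by mfun.
  exact: (measurableT_comp mF mx).
rewrite [LHS]FE; apply: eq_integral => y _; rewrite EFin_Rintegral//.
apply: integrable_lt_pinfty => //.
have my : measurable_fun setT (fun x : T1 => (x, y)) by mfun.
exact: (measurableT_comp mF my).
Qed.

End Rintegral_fubini.

Lemma Rintegral_swap_le d1 d2 (T1 : measurableType d1) (T2 : measurableType d2) (R : realType)
    (m1 : {sigma_finite_measure set T1 -> \bar R}) (m2 : {sigma_finite_measure set T2 -> \bar R})
    (F : T1 -> T2 -> R) (f : T1 -> R) :
  measurable_fun setT (fun p => F p.1 p.2) -> m1.-integrable setT (EFin \o f) ->
  (forall x, \int[m2]_y `|F x y|%:E <= (f x)%:E)%E ->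
  (forall y, \int[m1]_x `|F x y|%:E < +oo)%E ->
  \int[m1]_x \int[m2]_y F x y = \int[m2]_y \int[m1]_x F x y.
Proof.
move=> mF iF Ff F2; have f0 x : 0 <= f x.
  by rewrite -lee_fin; apply: le_trans (Ff x); apply: integral_ge0 => y _; rewrite lee_fin.
apply: Rintegral_swap => // [|x].
  have [mf _] := integrableP _ _ _ iF.
  apply: le_lt_trans (integrableR_fin iF).
  have mf' : measurable_fun setT f by exact/measurable_EFinP.
  apply: le_integralT; [by nneg|by mfun; apply: (measurableT_comp mF); mfun|by mfun|].
  by move=> x; rewrite ger0_norm.
by apply: le_lt_trans (Ff x) _; rewrite ltry.
Qed.

Ltac mfun_ext ::=
  match goal with
  | |- measurable_fun _ (fun x => Rintegral _ _ _) => apply: measurable_Rintegral2; rewrite /=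
  | |- measurable_fun _ (fun x => gaussn (@?f x) (@?g x)) => apply: measurable_gaussn
  | |- measurable_fun _ (gaussn _) => exact: measurable_gaussn1
  | |- measurable_fun _ (gauss1 _) => exact: measurable_gauss1
  | |- measurable_fun _ (fun x => gauss1 _ (@?f x)) =>
      apply: (measurableT_comp (measurable_gauss1 _))
  | |- measurable_fun _ (pw _) => exact: measurable_pw
  | |- measurable_fun _ (fun x => pw _ (@?f x)) =>
      apply: (measurableT_comp (@measurable_pw _ _))
  end.

(** * Riesz potentials and their inversion *)

Section marchaud_difference.
Context (R : realType) (a : R).
Hypotheses (a_gt0 : 0 < a) (a_lt1 : a < 1).
Notation leb := (@lebesgue_measure R).
Variable v : R -> R.
Hypotheses (mv : measurable_fun setT v)
  (ndv : forall x y, 0 <= x -> x <= y -> v y <= v x)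
  (v0 : forall x, 0 <= x -> 0 <= v x)
  (cv : forall x, 0 <= x -> {for x, continuous v})
  (voo : forall l, 0 < l -> exists2 x, 0 <= x & v x < l)
  (vfin : (\int[leb]_tau (pw (a - 1) tau * v tau)%:E < +oo)%E).

(** Weyl's fractional integral of order [a] of [v], without the factor [1/Gamma(a)]. *)
Definition time_average t : R := \int[leb]_tau (pw (a - 1) tau * v (tau + t)).

Let pw0 := @pw_ge0 R.

Let pwv0 t tau : 0 <= t -> 0 <= pw (a - 1) tau * v (tau + t).
Proof.
move=> t0; have [tau0|tau0] := leP tau 0.
  by rewrite /pw ltNge tau0/= mul0r.
by rewrite mulr_ge0// v0// addr_ge0// ltW.
Qed.

Let pwv_le t tau : 0 <= t -> pw (a - 1) tau * v (tau + t) <= pw (a - 1) tau * v tau.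
Proof.
move=> t0; have [tau0|tau0] := leP tau 0.
  by rewrite /pw ltNge tau0/= !mul0r.
by apply: ler_wpM2l => //; apply: ndv; rewrite ?lerDl// ltW.
Qed.

Lemma integrable_time_average t : 0 <= t ->
  leb.-integrable setT (EFin \o (fun tau => pw (a - 1) tau * v (tau + t))).
Proof.
move=> t0; apply: integrable_lt_pinfty; first by mfun.
apply: le_lt_trans vfin; apply: le_integralT; [by nneg|by mfun|by mfun|].
by move=> tau; rewrite lee_fin ger0_norm ?pwv0// pwv_le.
Qed.

Lemma marchaud_difference_ge0 t : 0 <= pw (- a - 1) t * (time_average 0 - time_average t).
Proof.
have [t0|t0] := leP t 0; first by rewrite /pw ltNge t0/= mul0r.
rewrite mulr_ge0// subr_ge0 /time_average; apply: le_Rintegral => //.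
- exact/integrable_time_average/ltW.
- exact: integrable_time_average.
by move=> tau _; rewrite addr0; apply/pwv_le/ltW.
Qed.

(** Marchaud's derivative inverts the fractional integral at time 0. The finiteness of [vfin]
    permits writing the difference of two integrals as the integral of a difference, to which the
    layer argument applies. *)
Lemma integral_marchaud_difference :
  (\int[leb]_t (pw (- a - 1) t * (time_average 0 - time_average t))%:E =
   marchaud_cst a 1 * (v 0)%:E)%E.
Proof.
rewrite -marchaud_nonincreasing//; apply: eq_integral => t _.
have [t0|t0] := leP t 0.
  rewrite /pw ltNge t0/= mul0r integral0_eq// => tau _.
  by rewrite !mul0r.
have t0' := ltW t0; have i0 := integrable_time_average (lexx 0); have it := integrable_time_average t0'.
rewrite -RintegralB//.
have ipw : leb.-integrable setT (EFin \o (fun tau => pw (a - 1) tau * v (tau + 0) - pw (a - 1) tau * v (tau + t))).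
  exact: integrableR_B.
rewrite -RintegralZl// EFin_Rintegral; last first.
  exact: integrableR_Zl.
by apply: eq_integral => tau _; congr EFin; rewrite addr0; ring.
Qed.

End marchaud_difference.

(** * The Riesz kernel regularised by the heat flow *)

Section riesz.
Context (R : realType) (n : nat) (a : R).
Hypotheses (n_ge2 : (2 <= n)%N) (a_gt0 : 0 < a) (a_lt1 : a < 1).
Notation leb := (@lebesgue_measure R).
Notation mu := (lebesgue_rV R n).
Implicit Types (s t d tau : R) (w x y z : 'rV[R]_n).

Let pw0 := @pw_ge0 R.
Let g0 := @gaussn_ge0 R n.

Definition gpeak s : R := (Num.sqrt (4 * pi * s))^-1 ^+ n.

Lemma gpeak_ge0 s : 0 <= gpeak s.
Proof. by rewrite exprn_ge0// invr_ge0 sqrtr_ge0. Qed.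

Lemma gpeak_le s t : 0 < s -> s <= t -> gpeak t <= gpeak s.
Proof.
move=> s0 st; have pi0 := pi_gt0 R.
have t0 : 0 < t by exact: lt_le_trans st.
rewrite /gpeak lerXn2r// ?nnegrE ?invr_ge0 ?sqrtr_ge0//.
by rewrite lef_pV2 ?posrE ?sqrtr_gt0 ?mulr_gt0// ler_wsqrtr// ler_wpM2l// mulr_ge0// ltW.
Qed.

(** For [n >= 2] the peak [(4 pi s)^(-n/2)] is at most [1/(4 pi s)]. Against the weight [tau^(a-1)]
    with [a < 1] this makes the Riesz time integral converge at infinity. *)
Lemma gpeak_tail s : 1 <= s -> gpeak s <= s^-1.
Proof.
move=> s1; have s0 : 0 < s by exact: lt_le_trans s1.
have pi2 := pi_ge2 R.
have h : 1 <= 4 * pi * s.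
  by rewrite -[leLHS]mulr1 ler_pM//; lra.
have q1 : 1 <= Num.sqrt (4 * pi * s) by rewrite -[leLHS]sqrtr1 ler_wsqrtr.
apply: (@le_trans _ _ ((Num.sqrt (4 * pi * s))^-1 ^+ 2)).
  by apply: ler_wiXn2l => //; rewrite ?invr_ge0 ?sqrtr_ge0// invf_le1// (lt_le_trans _ q1).
rewrite exprVn sqr_sqrtr ?(le_trans ler01 h)// lef_pV2 ?posrE ?(lt_le_trans ltr01 h)//.
by rewrite ler_peMl ?(ltW s0)//; lra.
Qed.

Lemma measurable_gpeak : measurable_fun setT gpeak.
Proof. by rewrite /gpeak; mfun. Qed.
Let mgpeak := measurable_gpeak.
Let gp0 := gpeak_ge0.

Lemma gpeak_time_fin d : 0 < d ->
  (\int[leb]_tau (pw (a - 1) tau * gpeak (tau + d))%:E < +oo)%E.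
Proof.
move=> d0; have a1 : 0 < 1 - a by rewrite subr_gt0.
have if0 (b : bool) c t : 0 <= (if b then pw c t else 0 : R) by case: b => //; exact: pw0.
apply: (@le_lt_trans _ _ (\int[leb]_tau
  ((gpeak d)%:E * (if tau <= 1 then pw (a - 1) tau else 0)%:E +
   (if 1 <= tau then pw (- (1 - a) - 1) tau else 0)%:E))%E).
  apply: le_integralT; [by nneg|by mfun|by mfun|].
  move=> tau; rewrite -EFinM -EFinD lee_fin.
  have [t0|t0] := leP tau 0.
    by rewrite {1}/pw ltNge t0/= mul0r addr_ge0 ?mulr_ge0 ?if0.
  have [t1|t1] := leP tau 1.
    rewrite mulrC -[leLHS]addr0 lerD ?if0//.
    by rewrite ler_wpM2r// gpeak_le// lerDr ltW.
  rewrite (ltW t1) mulr0 add0r !pwE//.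
  apply: (@le_trans _ _ (tau `^ (a - 1) * tau^-1)).
    rewrite ler_wpM2l ?powR_ge0//; apply: (@le_trans _ _ (gpeak tau)).
      by apply: gpeak_le; rewrite // lerDl ltW.
    by apply: gpeak_tail; exact: ltW.
  rewrite -[X in _ * X]powR_inv1 ?(ltW t0)// -powRD ?(gt_eqF t0) ?implybT//.
  by rewrite (_ : a - 1 + -1 = - (1 - a) - 1)//; ring.
rewrite ge0_integralD; try side.
rewrite ge0_integralZl; try side.
rewrite lte_add_pinfty// ?lte_mul_pinfty ?lee_fin//.
  by apply: le_lt_trans (integral_pw_near0 a_gt0 ltr01) _; rewrite ltry.
by apply: le_lt_trans (integral_pw_nearoo a1 ltr01) _; rewrite ltry.
Qed.

(** The Riesz kernel of order [2 a], up to the factor [Gamma(a)], run through the heat flow for a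
    time [d]. The singularity at the origin disappears for [d > 0]. *)
Definition riesz d w : R := \int[leb]_tau (pw (a - 1) tau * gaussn (tau + d) w).

Lemma measurable_riesz e (T : measurableType e) (f : T -> R) (g : T -> 'rV[R]_n) :
  measurable_fun setT f -> measurable_fun setT g ->
  measurable_fun setT (fun u => riesz (f u) (g u)).
Proof. by move=> mf mg; rewrite /riesz; mfun. Qed.

Lemma riesz_ge0 d w : 0 <= riesz d w.
Proof. by apply: Rintegral_ge0 => tau _; rewrite mulr_ge0. Qed.

Lemma pw_gaussn_le c d tau w : 0 < d ->
  pw c tau * gaussn (tau + d) w <= pw c tau * gpeak (tau + d).
Proof.
move=> d0; have [t0|t0] := leP tau 0; first by rewrite /pw ltNge t0/= !mul0r.
by rewrite ler_wpM2l// gaussn_le// addr_gt0.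
Qed.

Lemma EFin_riesz d w : 0 < d ->
  (riesz d w)%:E = (\int[leb]_tau (pw (a - 1) tau * gaussn (tau + d) w)%:E)%E.
Proof.
move=> d0; apply: EFin_Rintegral_ge0; first by move=> tau; rewrite mulr_ge0.
apply: le_lt_trans (gpeak_time_fin d0); apply: le_integralT; [by nneg|by mfun|by mfun|].
by move=> tau; rewrite lee_fin pw_gaussn_le.
Qed.

Definition riesz_bound d : R := \int[leb]_tau (pw (a - 1) tau * gpeak (tau + d)).

Lemma riesz_le d w : 0 < d -> riesz d w <= riesz_bound d.
Proof.
move=> d0; rewrite -lee_fin EFin_riesz// EFin_Rintegral_ge0; last 2 first.
- by move=> tau; rewrite mulr_ge0.
- exact: gpeak_time_fin.
apply: le_integralT; [by nneg|by mfun|by mfun|].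
by move=> tau; rewrite lee_fin pw_gaussn_le.
Qed.

(** The semigroup law inside the time integral: the heat flow merely advances the parameter [d]. *)
Lemma riesz_heat d t w : 0 < d -> 0 < t ->
  (\int[mu]_z (gaussn t z * riesz d (w + z))%:E = (riesz (d + t) w)%:E)%E.
Proof.
move=> d0 t0; rewrite EFin_riesz ?addr_gt0//.
transitivity (\int[mu]_z \int[leb]_tau (gaussn t z * (pw (a - 1) tau * gaussn (tau + d) (w + z)))%:E)%E.
  apply: eq_integral => z _; rewrite EFinM EFin_riesz// -ge0_integralZl; try side.
  by [].
rewrite (@tonelli _ _ _ _ _ mu leb (fun z tau => (gaussn t z * (pw (a - 1) tau * gaussn (tau + d) (w + z)))%:E)%E); try side.
apply: eq_integral => tau _.
have [tau0|tau0] := leP tau 0.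
  rewrite /pw ltNge tau0/= mul0r integral0_eq// => z _.
  by rewrite mul0r mulr0.
have td0 : 0 < tau + d by rewrite addr_gt0.
rewrite EFinM addrA addrC -gaussn_conv// -ge0_integralZl; try side.
rewrite -[RHS](integral_rVD w); try side.
apply: eq_integral => z _; rewrite -EFinM; congr EFin.
by rewrite mulrCA opprD addrCA subrr addr0 gaussnN (addrC w).
Qed.

Let mgpeak1 d : measurable_fun setT (fun tau => gpeak (tau + d)).
Proof. by mfun. Qed.

Let gpeak_shift_nd d (x y : R) : 0 < d -> 0 <= x -> x <= y -> gpeak (y + d) <= gpeak (x + d).
Proof.
by move=> d0 x0 xy; apply: gpeak_le; [rewrite ltr_wpDl|rewrite lerD2r].
Qed.

Let gpeak_shift_cts d (x : R) : 0 < d -> 0 <= x -> {for x, continuous (fun tau => gpeak (tau + d))}.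
Proof.
move=> d0 x0; have pi0 := pi_gt0 R.
have xd : 0 < x + d by rewrite ltr_wpDl.
apply: (@continuous_comp _ _ _ (fun tau => (Num.sqrt (4 * pi * (tau + d)))^-1) (fun u => u ^+ n)); last exact: exprn_continuous.
apply: continuousV; first by rewrite gt_eqF// sqrtr_gt0 mulr_gt0// mulr_gt0.
apply: continuous_comp; last exact: sqrt_continuous.
apply: continuousM; first exact: cvg_cst.
by apply: continuousD; [exact: cvg_id|exact: cvg_cst].
Qed.

Let gpeak_shift_oo d l : 0 < d -> 0 < l -> exists2 x, 0 <= x & gpeak (x + d) < l.
Proof.
move=> d0 l0; have l1 : 0 < l^-1 by rewrite invr_gt0.
exists (1 + l^-1); first by rewrite addr_ge0// ltW.
have h : 1 <= 1 + l^-1 + d by rewrite -addrA lerDl addr_ge0// ltW.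
apply: (le_lt_trans (gpeak_tail h)).
rewrite invf_plt ?posrE//; last by rewrite !addr_gt0.
by rewrite -addrA addrCA ltrDl addr_gt0.
Qed.

(* [gaussn (tau + d) w] is not monotone in [tau], but it is the difference of
   [gpeak (tau + d)] and [gdefect d w tau], which are. *)
Let gdefect d w tau : R := gpeak (tau + d) - gaussn (tau + d) w.

Let gdefectE d w tau :
  gdefect d w tau = gpeak (tau + d) * (1 - expR (- (dotv w w / (4 * (tau + d))))).
Proof. by rewrite /gdefect /gaussn mulrBr mulr1. Qed.

Let gdefect_ge0 d w (x : R) : 0 < d -> 0 <= x -> 0 <= gdefect d w x.
Proof. by move=> d0 x0; rewrite subr_ge0 gaussn_le// ltr_wpDl. Qed.

Let gdefect_nd d w (x y : R) : 0 < d -> 0 <= x -> x <= y -> gdefect d w y <= gdefect d w x.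
Proof.
move=> d0 x0 xy; have xd : 0 < x + d by rewrite ltr_wpDl.
have yd : 0 < y + d by rewrite ltr_wpDl// (le_trans x0).
rewrite !gdefectE ler_pM//.
- rewrite subr_ge0 -expR0 ler_expR oppr_le0 divr_ge0 ?dotv_ge0// mulr_ge0//.
  exact: ltW.
- exact: gpeak_shift_nd.
- rewrite lerD2l lerN2 ler_expR lerN2 ler_wpM2l ?dotv_ge0//.
  by rewrite lef_pV2 ?posrE ?mulr_gt0// ler_pM2l// lerD2r.
Qed.

Let gdefect_cts d w (x : R) : 0 < d -> 0 <= x -> {for x, continuous (gdefect d w)}.
Proof.
move=> d0 x0; have xd : 0 < x + d by rewrite ltr_wpDl.
rewrite (_ : gdefect d w = fun tau => gpeak (tau + d) * (1 - expR (- (dotv w w / (4 * (tau + d)))))).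
  apply: continuousM; first exact: gpeak_shift_cts.
  apply: continuousB; first exact: cvg_cst.
  apply: continuous_comp; last exact: continuous_expR.
  apply: continuousN; apply: continuousM; first exact: cvg_cst.
  apply: continuousV; first by rewrite gt_eqF// mulr_gt0.
  apply: continuousM; first exact: cvg_cst.
  by apply: continuousD; [exact: cvg_id|exact: cvg_cst].
by apply/funext => tau; exact: gdefectE.
Qed.

Let gdefect_oo d w l : 0 < d -> 0 < l -> exists2 x, 0 <= x & gdefect d w x < l.
Proof.
move=> d0 l0; have [x x0 xl] := gpeak_shift_oo d0 l0; exists x => //.
by apply: le_lt_trans xl; rewrite gerBl.
Qed.

Let mgdefect d w : measurable_fun setT (gdefect d w).
Proof. by rewrite /gdefect; mfun. Qed.

Let gdefect_fin d w : 0 < d ->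
  (\int[leb]_tau (pw (a - 1) tau * gdefect d w tau)%:E < +oo)%E.
Proof.
move=> d0; have mgd := mgdefect d w.
have h tau : 0 <= pw (a - 1) tau * gdefect d w tau.
  have [t0|t0] := leP tau 0; first by rewrite /pw ltNge t0/= mul0r.
  by rewrite mulr_ge0// gdefect_ge0// ltW.
apply: le_lt_trans (gpeak_time_fin d0); apply: le_integralT; [by move=> tau; rewrite lee_fin h|by mfun|by mfun|].
by move=> tau; rewrite lee_fin ler_wpM2l// gerBl.
Qed.

(** The integrand in [t] of Marchaud's inversion, at the level of kernels. It is signed, and is the
    difference of the two nonnegative quantities [D1] and [D2] coming from the monotone profiles. *)
Definition marchaud_kernel d w t : R := pw (- a - 1) t * (riesz d w - riesz (d + t) w).

Let D1 d t := pw (- a - 1) t *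
  (time_average a (fun tau => gpeak (tau + d)) 0 - time_average a (fun tau => gpeak (tau + d)) t).
Let D2 d w t := pw (- a - 1) t *
  (time_average a (gdefect d w) 0 - time_average a (gdefect d w) t).

Let marchaud_kernelE d w t : 0 < d -> marchaud_kernel d w t = D1 d t - D2 d w t.
Proof.
move=> d0; rewrite /marchaud_kernel /D1 /D2.
have [t0|t0] := leP t 0; first by rewrite /pw ltNge t0/= !mul0r subrr.
rewrite -mulrBr; congr (_ * _).
have rE s : 0 <= s -> riesz (d + s) w = time_average a (fun tau => gpeak (tau + d)) s -
    time_average a (gdefect d w) s.
  move=> s0; rewrite /time_average -RintegralB//.
  - rewrite /riesz; apply: eq_Rintegral => tau _.
    by rewrite /gdefect (_ : tau + (d + s) = tau + s + d); ring.
  - have := @integrable_time_average R a (fun tau => gpeak (tau + d)); apply => //; last exact: gpeak_time_fin.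
    + by move=> x y; exact: gpeak_shift_nd.
  - have := @integrable_time_average R a (gdefect d w); apply => //; last exact: gdefect_fin.
    + by move=> x y; exact: gdefect_nd.
    + by move=> x; exact: gdefect_ge0.
have := rE 0 (lexx 0); rewrite addr0 => ->; rewrite (rE t (ltW t0)).
move: (time_average _ _ 0) (time_average _ _ t) => A B.
by move: (time_average _ _ 0) (time_average _ _ t) => C D; ring.
Qed.

Let D1_ge0 d t : 0 < d -> 0 <= D1 d t.
Proof.
move=> d0; apply: marchaud_difference_ge0 => //; last exact: gpeak_time_fin.
by move=> x y; exact: gpeak_shift_nd.
Qed.

Let D2_ge0 d w t : 0 < d -> 0 <= D2 d w t.
Proof.
move=> d0; apply: marchaud_difference_ge0 => //; last exact: gdefect_fin.
- by move=> x y; exact: gdefect_nd.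
- by move=> x; exact: gdefect_ge0.
Qed.

Let D1_integral d : 0 < d ->
  (\int[leb]_t (D1 d t)%:E = marchaud_cst a 1 * (gpeak d)%:E)%E.
Proof.
move=> d0; rewrite [LHS]integral_marchaud_difference ?add0r//.
- by move=> x y; exact: gpeak_shift_nd.
- by move=> x; exact: gpeak_shift_cts.
- by move=> l; exact: gpeak_shift_oo.
- exact: gpeak_time_fin.
Qed.

Let D2_integral d w : 0 < d ->
  (\int[leb]_t (D2 d w t)%:E = marchaud_cst a 1 * (gpeak d - gaussn d w)%:E)%E.
Proof.
move=> d0; rewrite [LHS]integral_marchaud_difference//; first by rewrite /gdefect add0r.
- by move=> x y; exact: gdefect_nd.
- by move=> x; exact: gdefect_ge0.
- by move=> x; exact: gdefect_cts.
- by move=> l; exact: gdefect_oo.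
- exact: gdefect_fin.
Qed.

Lemma measurable_marchaud_kernel e (T : measurableType e) (f : T -> 'rV[R]_n) (g : T -> R) d :
  measurable_fun setT f -> measurable_fun setT g ->
  measurable_fun setT (fun u => marchaud_kernel d (f u) (g u)).
Proof. by move=> mf mg; rewrite /marchaud_kernel /riesz; mfun. Qed.

Let mD1 d : measurable_fun setT (D1 d).
Proof. by rewrite /D1 /time_average; mfun. Qed.
Let mD2 d w : measurable_fun setT (D2 d w).
Proof. by rewrite /D2 /time_average /gdefect; mfun. Qed.

(** Uniform in [w]: the nonnegative parts [D1] and [D2] have explicit time integrals, each at most
    [marchaud_cst a 1] times the peak. This gives the domination required to integrate against a
    function of [L^1]. *)
Lemma marchaud_kernel_norm d w : 0 < d ->
  (\int[leb]_t `|marchaud_kernel d w t|%:E <= marchaud_cst a 1 * (2 * gpeak d)%:E)%E.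
Proof.
move=> d0.
have h1 t := D1_ge0 t d0; have h2 t := D2_ge0 w t d0.
apply: (@le_trans _ _ (\int[leb]_t ((D1 d t)%:E + (D2 d w t)%:E))%E).
  have mk : measurable_fun setT (marchaud_kernel d w) by apply: measurable_marchaud_kernel; mfun.
  apply: le_integralT.
  - by move=> t; rewrite lee_fin normr_ge0.
  - exact/measurable_EFinP/measurableT_comp.
  - by apply: emeasurable_funD; apply/measurable_EFinP; [exact: mD1|exact: mD2].
  move=> t; rewrite -EFinD lee_fin marchaud_kernelE//.
  by apply: (le_trans (ler_normB _ _)); rewrite !ger0_norm.
rewrite ge0_integralD; [|exact: measurableT|by move=> t _; rewrite lee_fin h1|
  by apply/measurable_EFinP; exact: mD1|by move=> t _; rewrite lee_fin h2|
  by apply/measurable_EFinP; exact: mD2].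
rewrite D1_integral// D2_integral//.
have c0 : (0 <= marchaud_cst a 1)%E by exact/ltW/marchaud_cst_gt0.
rewrite -ge0_muleDr ?lee_fin ?gpeak_ge0//; last by rewrite subr_ge0 gaussn_le.
apply: lee_wpmul2l => //; rewrite -EFinD lee_fin mulr2n mulrDl mul1r.
by rewrite lerD2l gerBl.
Qed.

Lemma marchaud_kernel_integral d w : 0 < d ->
  \int[leb]_t marchaud_kernel d w t = fine (marchaud_cst a 1) * gaussn d w.
Proof.
move=> d0.
have h1 t := D1_ge0 t d0; have h2 t := D2_ge0 w t d0.
have cfin : marchaud_cst a 1 \is a fin_num.
  by rewrite ge0_fin_numE ?marchaud_cst_fin// ltW// marchaud_cst_gt0.
have cfoo := marchaud_cst_fin a_gt0 a_lt1.
transitivity (\int[leb]_t (D1 d t - D2 d w t)).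
  by apply: eq_Rintegral => t _; rewrite marchaud_kernelE.
rewrite RintegralB//.
- rewrite /Rintegral D1_integral// D2_integral// -(fineK cfin) -!EFinM /=; ring.
- apply: integrable_lt_pinfty; first exact: mD1.
  under eq_integral do rewrite ger0_norm//.
  by rewrite D1_integral// lte_mul_pinfty ?ltry// ltW// marchaud_cst_gt0.
- apply: integrable_lt_pinfty; first exact: mD2.
  under eq_integral do rewrite ger0_norm//.
  by rewrite D2_integral// lte_mul_pinfty ?ltry// ltW// marchaud_cst_gt0.
Qed.

End riesz.

Ltac mfun_ext2 := fail.
Ltac mfun_ext ::=
  match goal with
  | |- measurable_fun _ (fun x => Rintegral _ _ _) => apply: measurable_Rintegral2; rewrite /=
  | |- measurable_fun _ (fun x => gaussn (@?f x) (@?g x)) => apply: measurable_gaussn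
  | |- measurable_fun _ (fun x => riesz _ (@?f x) (@?g x)) => apply: measurable_riesz
  | |- measurable_fun _ (fun x => marchaud_kernel _ _ (@?f x) (@?g x)) => apply: measurable_marchaud_kernel
  | |- measurable_fun _ (gaussn _) => exact: measurable_gaussn1
  | |- measurable_fun _ (gauss1 _) => exact: measurable_gauss1
  | |- measurable_fun _ (fun x => gauss1 _ (@?f x)) =>
      apply: (measurableT_comp (measurable_gauss1 _))
  | |- measurable_fun _ (pw _) => exact: measurable_pw
  | |- measurable_fun _ (fun x => pw _ (@?f x)) =>
      apply: (measurableT_comp (@measurable_pw _ _))
  | |- _ => mfun_ext2
  end.

Ltac nneg_ext ::=
  match goal with
  | |- is_true (@Order.le _ _ _ (gaussn _ _)) => exact: gaussn_ge0
  | |- is_true (@Order.le _ _ _ (pw _ _)) => exact: pw_ge0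
  | |- is_true (@Order.le _ _ _ (gpeak _ _)) => exact: gpeak_ge0
  | |- is_true (@Order.le _ _ _ (riesz _ _ _)) => exact: riesz_ge0
  end.

Lemma gaussn_integral1 (R : realType) n (t : R) : 0 < t ->
  (\int[lebesgue_rV R n]_z (gaussn t z)%:E = 1)%E.
Proof.
move=> t0; rewrite -[RHS](@gaussn_integral R n t 0 t0).
by apply: eq_integral => z _; rewrite subr0.
Qed.

Lemma integrable_gaussn (R : realType) n (t : R) : 0 < t ->
  (lebesgue_rV R n).-integrable setT (EFin \o @gaussn R n t).
Proof.
move=> t0; apply: integrable_lt_pinfty; first by mfun.
under eq_integral do rewrite ger0_norm ?gaussn_ge0//.
by rewrite gaussn_integral1// ltry.
Qed.

Section convolution.
Context (R : realType) (n : nat).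
Notation mu := (lebesgue_rV R n).
Implicit Types (k G : 'rV[R]_n -> R) (x y z w : 'rV[R]_n).

Definition convol k G y : R := \int[mu]_x (k (y - x) * G x).

Variables (k G : 'rV[R]_n -> R) (K : R).
Hypotheses (mk : measurable_fun setT k) (k0 : forall w, 0 <= k w) (kK : forall w, k w <= K)
  (mG : measurable_fun setT G) (iG : mu.-integrable setT (EFin \o G)).

Lemma convol_integrable y : mu.-integrable setT (EFin \o (fun x => k (y - x) * G x)).
Proof.
apply: (@integrableR_le _ _ _ _ _ (fun x => K * G x)); first by mfun.
  exact: integrableR_Zl.
by move=> x; rewrite !normrM ler_wpM2r// !ger0_norm// (le_trans (k0 0)).
Qed.

Lemma measurable_convol : measurable_fun setT (convol k G).
Proof. by rewrite /convol; mfun. Qed.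

Lemma heat_convol k' t y : 0 < t -> measurable_fun setT k' ->
  (forall w, (\int[mu]_z (gaussn t z * k (w + z))%:E = (k' w)%:E)%E) ->
  \int[mu]_z (gaussn t z * convol k G (y + z)) = convol k' G y.
Proof.
move=> t0 mk' kk'; have g0 := @gaussn_ge0 R n t.
have K0 : 0 <= K by apply: le_trans (kK 0).
have gE := @gaussn_integral1 R n t t0; have ig := integrable_gaussn n t0.
have GG := integrableR_fin iG.
have nG : (\int[mu]_x `|G x|%:E)%E = (\int[mu]_x `|G x|)%:E.
  by rewrite EFin_Rintegral_ge0.
transitivity (\int[mu]_z \int[mu]_x (gaussn t z * (k (y + z - x) * G x))).
  apply: eq_Rintegral => z _; rewrite -RintegralZl//.
  exact: convol_integrable.
rewrite (@Rintegral_swap_le _ _ _ _ _ mu mu _ (fun z => K * \int[mu]_x `|G x| * gaussn t z)).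
- apply: eq_Rintegral => x _.
  under eq_Rintegral do rewrite mulrA.
  rewrite RintegralZr//.
    congr (_ * _); rewrite -[k' _]/(fine (k' _)%:E) -kk'; congr fine.
    by apply: eq_integral => z _; rewrite addrAC.
  apply: (@integrableR_le _ _ _ _ _ (fun z => K * gaussn t z)); first by mfun.
    exact: integrableR_Zl.
  by move=> z; rewrite !ger0_norm ?mulr_ge0// mulrC ler_wpM2r.
- by mfun.
- exact: integrableR_Zl.
- move=> z; rewrite mulrAC EFinM -nG.
  have c0 : 0 <= K * gaussn t z by rewrite mulr_ge0.
  rewrite -ge0_integralZl; try side.
  apply: le_integralT; [by nneg|by mfun|by mfun|].
  move=> x; rewrite -EFinM lee_fin (normrM (gaussn t z)) (normrM (k _)) (ger0_norm (g0 z)) (ger0_norm (k0 _)).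
  by rewrite mulrA ler_wpM2r// mulrC ler_wpM2r.
- move=> x; apply: (@le_lt_trans _ _ (\int[mu]_z ((K * `|G x|)%:E * (gaussn t z)%:E))%E).
    apply: le_integralT; [by nneg|by mfun|by mfun|].
    move=> z; rewrite -EFinM lee_fin (normrM (gaussn t z)) (normrM (k _)) (ger0_norm (g0 z)) (ger0_norm (k0 _)).
    by rewrite mulrC ler_wpM2r// ler_wpM2r.
  have c0 : 0 <= K * `|G x| by rewrite mulr_ge0.
  by rewrite ge0_integralZl ?gE ?mule1 ?ltry; try side.
Qed.

End convolution.

Section heat_difference.
Context (R : realType) (n : nat).
Notation mu := (lebesgue_rV R n).
Variables (V : 'rV[R]_n -> R) (K : R).
Hypotheses (mV : measurable_fun setT V) (VK : forall x, `|V x| <= K).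

Lemma measurable_heat_difference y :
  measurable_fun setT (fun t => \int[mu]_z (gaussn t z * `|V (y + z) - V y|)%:E)%E.
Proof. by mfun. Qed.

Lemma heat_difference_le t y : 0 < t ->
  (`|V y - \int[mu]_z (gaussn t z * V (y + z))|%:E <=
   \int[mu]_z (gaussn t z * `|V (y + z) - V y|)%:E)%E.
Proof.
move=> t0; have g0 := @gaussn_ge0 R n; have ig := integrable_gaussn n t0.
have gE : \int[mu]_z gaussn t z = 1.
  by rewrite /Rintegral gaussn_integral1.
have igV : mu.-integrable setT (EFin \o (fun z => gaussn t z * V (y + z))).
  apply: (@integrableR_le _ _ _ _ _ (fun z => K * gaussn t z)).
  - by mfun.
  - exact: integrableR_Zl.
  move=> z; rewrite [K * _]mulrC !(normrM (gaussn t z)) (ger0_norm (g0 _ _)) ler_wpM2l//.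
  by apply: le_trans (VK _) _; exact: ler_norm.
have igVy : mu.-integrable setT (EFin \o (fun z => gaussn t z * V y)).
  by under eq_fun do rewrite mulrC; exact: integrableR_Zl.
have {1}-> : V y = \int[mu]_z (gaussn t z * V y) by rewrite RintegralZr// gE mul1r.
rewrite -RintegralB//; apply: le_trans (normr_Rintegral_le _ _) _; first by mfun.
apply: le_integralT; [by nneg|by mfun|by mfun|].
by move=> z; rewrite lee_fin -mulrBr (normrM (gaussn t z)) (ger0_norm (g0 _ _)) distrC.
Qed.

End heat_difference.

Section riesz_potential.
Context (R : realType) (n : nat) (a d : R).
Hypotheses (n_ge2 : (2 <= n)%N) (a_gt0 : 0 < a) (a_lt1 : a < 1) (d_gt0 : 0 < d).
Notation leb := (@lebesgue_measure R).
Notation mu := (lebesgue_rV R n).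
Implicit Types (x y z w : 'rV[R]_n).
Variable G : 'rV[R]_n -> R.
Hypotheses (mG : measurable_fun setT G) (iG : mu.-integrable setT (EFin \o G)).
Let U := convol (riesz a d) G.
Let g0 := @gaussn_ge0 R n.
Let pw0 := @pw_ge0 R.
Let r0 := @riesz_ge0 R n a.

Let mriesz e : measurable_fun setT (@riesz R n a e).
Proof. by apply: measurable_riesz; mfun. Qed.

Let rK e w : 0 < e -> riesz a e w <= riesz_bound n a e.
Proof. by move=> e0; exact: riesz_le. Qed.

Let mU : measurable_fun setT U.
Proof. by apply: measurable_convol. Qed.

Let GG := integrableR_fin iG.
Let nG : (\int[mu]_x `|G x|%:E)%E = (\int[mu]_x `|G x|)%:E.
Proof. by rewrite EFin_Rintegral_ge0. Qed.
Let nG0 : 0 <= \int[mu]_x `|G x|.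
Proof. exact: Rintegral_ge0. Qed.

Let U_heat t y : 0 < t -> \int[mu]_z (gaussn t z * U (y + z)) = convol (riesz a (d + t)) G y.
Proof.
move=> t0; apply: (@heat_convol _ _ _ _ (riesz_bound n a d)) => //.
- by move=> w; exact: rK.
- by move=> w; exact: riesz_heat.
Qed.

Let U_bound y : `|U y| <= riesz_bound n a d * \int[mu]_x `|G x|.
Proof.
rewrite -lee_fin EFinM -nG.
have K0 : 0 <= riesz_bound n a d by apply: le_trans (rK 0 d_gt0).
have mr := mriesz d.
apply: le_trans (normr_Rintegral_le _ _) _; first by mfun.
rewrite -ge0_integralZl; try side.
apply: le_integralT; [by nneg|by mfun|by mfun|].
by move=> x; rewrite -EFinM lee_fin normrM ger0_norm// ler_wpM2r ?rK.
Qed.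

(** Integrating the kernel identity against [G] writes [c] times the heat-smoothed [G] as the
    integral of [t^(-a-1) (U - P_t U)], because [P_t U] is the convolution with [riesz a (d + t)].
    Jensen's inequality then replaces [|U - P_t U|] by [P_t |U - U(y)|] at [y]. *)
Lemma marchaud_inversion y :
  (marchaud_cst a 1 * `|convol (gaussn d) G y|%:E <=
   \int[leb]_t ((pw (- a - 1) t)%:E *
     \int[mu]_z (gaussn t z * `|U (y + z) - U y|)%:E))%E.
Proof.
have c0 := marchaud_cst_gt0 a_gt0 a_lt1; have cfoo := marchaud_cst_fin a_gt0 a_lt1.
have cE : (fine (marchaud_cst a 1))%:E = marchaud_cst a 1.
  by rewrite fineK// ge0_fin_numE// ltW.
have c0' : 0 <= fine (marchaud_cst a 1) by rewrite fine_ge0// ltW.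
set c := fine _ in cE c0'.
have mK : measurable_fun setT (fun p : 'rV[R]_n * R => marchaud_kernel a d p.1 p.2).
  by apply: measurable_marchaud_kernel; mfun.
have mKG : measurable_fun setT (fun p : 'rV[R]_n * R => marchaud_kernel a d (y - p.1) p.2 * G p.1).
  by apply: measurable_funM; [apply: measurable_marchaud_kernel|]; mfun.
have iconv e : 0 < e -> mu.-integrable setT (EFin \o (fun x => riesz a e (y - x) * G x)).
  by move=> e0; apply: (@convol_integrable _ _ _ _ (riesz_bound n a e)) => // w; exact: rK.
have kE t x : marchaud_kernel a d (y - x) t * G x =
    pw (- a - 1) t * (riesz a d (y - x) * G x - riesz a (d + t) (y - x) * G x).
  by rewrite /marchaud_kernel -mulrBl mulrA.
have iK t : mu.-integrable setT (EFin \o (fun x => marchaud_kernel a d (y - x) t * G x)).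
  under eq_fun do rewrite kE.
  have [t0|t0] := leP t 0.
    rewrite /pw ltNge t0/=; under eq_fun do rewrite mul0r.
    by apply: integrable_lt_pinfty => //; under eq_integral do rewrite normr0; rewrite integral0 ltry.
  by apply: integrableR_Zl; apply: integrableR_B; apply: iconv; rewrite ?addr_gt0.
have cF : c * convol (gaussn d) G y = \int[leb]_t \int[mu]_x (marchaud_kernel a d (y - x) t * G x).
  rewrite -(@Rintegral_swap_le _ _ _ _ _ mu leb (fun x t => marchaud_kernel a d (y - x) t * G x)
    (fun x => c * (2 * gpeak n d) * `|G x|)); last 4 first.
  - exact: mKG.
  - apply: integrableR_Zl; apply: integrable_lt_pinfty; first by mfun.
    by under eq_integral do rewrite normr_id.
  - move=> x; under eq_integral do rewrite normrM EFinM.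
    have mKx : measurable_fun setT (marchaud_kernel a d (y - x)) by apply: measurable_marchaud_kernel; mfun.
    rewrite ge0_integralZr; try side.
    rewrite [leRHS]EFinM; apply: lee_wpmul2r; first by rewrite lee_fin.
    by rewrite EFinM cE; exact: marchaud_kernel_norm.
  - move=> t.
    exact: integrableR_fin.
  rewrite /convol -RintegralZl//; last first.
    apply: (@convol_integrable _ _ _ _ (gpeak n d)) => //; first by mfun.
    by move=> w; exact: gaussn_le.
  apply: eq_Rintegral => x _; rewrite mulrA -marchaud_kernel_integral//.
  rewrite RintegralZr//; apply: integrable_lt_pinfty.
    by apply: measurable_marchaud_kernel; mfun.
  apply: le_lt_trans (marchaud_kernel_norm _ _ _ _ _) _ => //.
  by rewrite -cE -EFinM ltry.
rewrite -cE -EFinM -[X in (X * _)%:E]ger0_norm// -normrM cF.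
apply: le_trans (normr_Rintegral_le _ _) _; first by mfun.
have mH := measurable_heat_difference mU y.
apply: le_integralT; [by nneg|by mfun|by mfun|].
move=> t; under eq_Rintegral do rewrite kE.
have [t0|t0] := leP t 0.
  rewrite /pw ltNge t0/= mul0e; under eq_Rintegral do rewrite mul0r.
  by rewrite /Rintegral integral0 normr0.
have idt : 0 < d + t by rewrite addr_gt0.
rewrite RintegralZl//; last by apply: integrableR_B; exact: iconv.
rewrite RintegralB//; [|exact: iconv|exact: iconv].
rewrite -/(convol _ _ _) -/(convol _ _ _) -/U -(U_heat y t0).
rewrite normrM (ger0_norm (pw0 _ _)) EFinM.
apply: lee_wpmul2l; first by rewrite lee_fin.
by apply: heat_difference_le t0 => //; exact: U_bound.
Qed.

Let near T w : \bar R :=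
  (\int[leb]_tau ((if tau <= T then pw (a - 1) tau else 0) * gaussn (tau + d) w)%:E)%E.

Let riesz_split T w : 1 <= T ->
  ((riesz a d w)%:E <= near T w + (T `^ (- (1 - a)) / (1 - a))%:E)%E.
Proof.
move=> T1; have T0 : 0 < T by exact: lt_le_trans T1.
have a1 : 0 < 1 - a by rewrite subr_gt0.
have if0 (b : bool) c t : 0 <= (if b then pw c t else 0 : R) by case: b => //; exact: pw0.
rewrite EFin_riesz//; apply: (@le_trans _ _ (near T w +
    \int[leb]_tau (if T <= tau then pw (- (1 - a) - 1) tau else 0)%:E)%E); last first.
  by rewrite leeD2l// integral_pw_nearoo.
rewrite /near -ge0_integralD; try side.
apply: le_integralT; [by nneg|by mfun|by mfun|].
move=> tau; rewrite -EFinD lee_fin; case: ifPn => [h|]; first by rewrite lerDl.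
rewrite -ltNge => h; rewrite (ltW h) mul0r add0r.
have t0 : 0 < tau by exact: lt_trans h.
rewrite !pwE//.
apply: (@le_trans _ _ (tau `^ (a - 1) * tau^-1)).
  rewrite ler_wpM2l ?powR_ge0//; apply: (le_trans (gaussn_le _ _)); first by rewrite addr_gt0.
  rewrite -/(gpeak n _); apply: (@le_trans _ _ (gpeak n tau)).
    by apply: gpeak_le; rewrite // lerDl ltW.
  by apply: gpeak_tail => //; exact: (le_trans T1 (ltW h)).
rewrite -[X in _ * X]powR_inv1 ?(ltW t0)// -powRD ?(gt_eqF t0) ?implybT//.
by rewrite (_ : a - 1 + -1 = - (1 - a) - 1)//; ring.
Qed.

Let near_fin T : 0 < T -> (\int[mu]_w near T w < +oo)%E.
Proof.
move=> T0; have if0 (b : bool) c t : 0 <= (if b then pw c t else 0 : R) by case: b => //; exact: pw0.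
rewrite /near (@tonelli _ _ _ _ _ mu leb (fun w tau => ((if tau <= T then pw (a - 1) tau else 0) * gaussn (tau + d) w)%:E)%E); try side.
apply: le_lt_trans (ltry (T `^ a / a)); apply: le_trans (integral_pw_near0 a_gt0 T0).
apply: le_integralT; [by nneg|by mfun|by mfun|].
move=> tau; under eq_integral do rewrite EFinM.
rewrite ge0_integralZl; try side.
have [t0|t0] := leP tau 0.
  by rewrite /pw ltNge t0/= if_same mul0e.
have td : 0 < tau + d by rewrite addr_gt0.
by rewrite gaussn_integral1// mule1.
Qed.

(** [U] need not be integrable. Its kernel is cut at time [T]: the part before [T] is integrable,
    the part after [T] is uniformly small. Where [|U| >= l], the early part contributes at least
    [l/2], and Chebyshev's inequality applies to it. *)
Lemma riesz_superlevel_fin l : 0 < l ->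
  (\int[mu]_x (if l <= `|U x| then 1 else 0)%:E < +oo)%E.
Proof.
move=> l0; have a1 : 0 < 1 - a by rewrite subr_gt0.
pose N := \int[mu]_x `|G x|.
(* The late part is at most [T^(a-1) N / (1-a)], which is at most [l/2] as soon as [T^(1-a) >= c].
   The summand 1 in [T] ensures [T >= 1], as required by [riesz_split]. *)
pose c := N * 2 / ((1 - a) * l).
have c0 : 0 <= c by rewrite divr_ge0 ?(mulr_ge0 nG0)// mulr_ge0// ltW.
pose T := 1 + c `^ (1 - a)^-1.
have T1 : 1 <= T by rewrite lerDl powR_ge0.
have T0 : 0 < T by exact: lt_le_trans T1.
have tail : T `^ (- (1 - a)) / (1 - a) * N <= l / 2.
  have cT : c <= T `^ (1 - a).
    have {1}-> : c = (c `^ (1 - a)^-1) `^ (1 - a).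
      by rewrite -powRrM mulVf ?powRr1// gt_eqF.
    by apply: ge0_ler_powR; rewrite ?nnegrE ?powR_ge0 ?(ltW a1) ?(ltW T0)// lerDr.
  rewrite powRN mulrAC ler_pdivrMr// mulrC ler_pdivrMr ?powR_gt0//.
  apply: (@le_trans _ _ (l / 2 * (1 - a) * c)); last by rewrite ler_wpM2l// mulr_ge0 ?ltW// divr_gt0.
  by rewrite /c le_eqVlt; apply/orP; left; apply/eqP; field; rewrite !gt_eqF.
have if0 (b : bool) c' t : 0 <= (if b then pw c' t else 0 : R) by case: b => //; exact: pw0.
have if1 (b : bool) : 0 <= (if b then 1 else 0 : R) by case: b.
have mnear : measurable_fun setT (near T) by rewrite /near; mfun.
have near0 w : (0 <= near T w)%E by rewrite /near; nneg.
move: (near T) mnear near0 (fun w => @riesz_split T w T1) (near_fin T0) => nr mnr nr0 r_split nr_fin.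
pose A y : \bar R := (\int[mu]_x (nr (y - x)%R * `|G x|%:E))%E.
have UA y : (`|U y|%:E <= A y + (l / 2)%:E)%E.
  have mr := mriesz d.
  apply: le_trans (normr_Rintegral_le _ _) _; first by mfun.
  apply: (@le_trans _ _ (A y + (T `^ (- (1 - a)) / (1 - a) * N)%:E)%E); last by rewrite leeD2l// lee_fin.
  have ct0 : 0 <= T `^ (- (1 - a)) / (1 - a) by rewrite divr_ge0 ?powR_ge0// ltW.
  rewrite EFinM -nG -ge0_integralZl; try side.
  rewrite -ge0_integralD; try side.
  apply: le_integralT; [by nneg|by mfun|by mfun|].
  move=> x; rewrite normrM (ger0_norm (r0 _ _)) EFinM -ge0_muleDl ?lee_fin//.
  by apply: lee_wpmul2r; [rewrite lee_fin|exact: r_split].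
have mA : measurable_fun setT A by rewrite /A; mfun.
have A0 y : (0 <= A y)%E by rewrite /A; nneg.
have l2 : 0 <= 2 / l by rewrite divr_ge0// ltW.
apply: (@le_lt_trans _ _ (\int[mu]_y ((2 / l)%:E * A y))%E).
  apply: le_integralT; [by nneg|by mfun|by mfun|].
  move=> y; case: ifPn => [h|_]; last by rewrite mule_ge0.
  have lA : ((l / 2)%:E <= A y)%E.
    have := UA y; case: (A y) => [r| |] //=; rewrite ?leey// -?EFinD ?lee_fin.
    by move=> h'; have := le_trans h h'; lra.
  apply: (@le_trans _ _ ((2 / l)%:E * (l / 2)%:E)%E); last by apply: lee_wpmul2l.
  by rewrite -EFinM lee_fin le_eqVlt; apply/orP; left; apply/eqP; field; rewrite gt_eqF.
rewrite ge0_integralZl; try side.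
rewrite lte_mul_pinfty//.
rewrite /A (@tonelli _ _ _ _ _ mu mu (fun y x => nr (y - x)%R * `|G x|%:E)%E); try side.
apply: (@le_lt_trans _ _ (\int[mu]_x ((\int[mu]_w nr w) * `|G x|%:E))%E).
  have nI : (0 <= \int[mu]_w nr w)%E by nneg.
  apply: le_integralT; [by nneg|by mfun|by mfun|].
  move=> x; rewrite ge0_integralZr; try side.
  by rewrite (integral_rVD (- x)); try side.
have nI : (0 <= \int[mu]_w nr w)%E by nneg.
rewrite ge0_integralZl; try side.
by rewrite lte_mul_pinfty// ge0_fin_numE// nr_fin.
Qed.

End riesz_potential.

(** * Smooth compactly supported fields *)

Section quadratic_derivative.
Context (R : realType) (V W : normedModType R).

(** A quadratic remainder passes through an integral as a plain inequality, so convolutions are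
    differentiated without a theorem on derivatives under the integral sign. With [C = 0] it covers
    affine functions. *)
Lemma is_derive_quadratic (f : V -> W) (x v : V) (df : W) (C : R) :
  (forall h : R, `|f (h *: v + x) - f x - h *: df| <= C * h ^+ 2) ->
  is_derive x v f df.
Proof.
move=> fC.
have C0 : 0 <= C.
  have := fC 1; rewrite expr1n mulr1; exact: le_trans (normr_ge0 _).
have c : h^-1 *: ((f \o shift x) (h *: v) - f x) @[h --> 0^'] --> df.
  have C1 : 0 < C + 1 by rewrite ltr_wpDl.
  apply/cvgrPdist_le => e e0; near=> h.
  have h0 : h != 0 by near: h; exact: nbhs_dnbhs_neq.
  have -> : df - h^-1 *: ((f \o shift x) (h *: v) - f x) = - (h^-1 *: (f (h *: v + x) - f x - h *: df)).
    by rewrite /= [in RHS]scalerBr scalerA mulVf// scale1r [RHS]opprB.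
  rewrite normrN normrZ normfV ler_pdivrMl ?normr_gt0//.
  apply: (le_trans (fC h)); rewrite -real_normK ?num_real// expr2 mulrCA ler_wpM2l//.
  have hC : `|h| <= e / (C + 1).
    near: h; apply: dnbhs0_le; exact: divr_gt0.
  apply: (@le_trans _ _ (C * (e / (C + 1)))); first by rewrite ler_wpM2l.
  rewrite mulrA ler_pdivrMr// mulrC ler_wpM2l ?(ltW e0)// lerDl//.
by split; [apply/cvg_ex; exists df|exact/cvg_lim].
Unshelve. all: by end_near. Qed.

End quadratic_derivative.

Lemma is_derive1_chain (R : realType) (f g : R -> R) (x df dg : R) :
  is_derive (g x) (1 : R) f df -> is_derive x (1 : R) g dg ->
  is_derive x (1 : R) (fun y => f (g y)) (df * dg).
Proof.
move=> [fx fE] [gx gE]; split.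
  by apply/derivable1_diffP; apply: (@differentiable_comp _ _ _ _ g f); exact/derivable1_diffP.
rewrite -derive1E; have -> : (fun y => f (g y)) = f \o g by [].
by rewrite (derive1_comp gx fx) !derive1E gE fE.
Qed.

(** * Smooth functions of one variable *)

Section smooth1.
Context (R : realType).
Implicit Types f g : R -> R.

(** The derivative is an existential witness, so closure under sums, products and inverses is an
    induction on [k] with explicit derivatives. Iterated [derive1] is recovered afterwards. *)
Fixpoint smooth_upto (k : nat) f : Prop :=
  if k is k'.+1 then
    exists2 f', (forall x, is_derive (x : R) (1 : R) f (f' x)) & smooth_upto k' f'
  else True.

Lemma smooth_uptoS k f : smooth_upto k.+1 f -> smooth_upto k f.
Proof.
by elim: k f => // k IH f [f' ff' /IH f'k]; exists f'.
Qed.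

Lemma smooth_upto_cst k c : smooth_upto k (fun=> c).
Proof.
elim: k c => // k IH c; exists (fun=> 0); last exact: IH.
by move=> x; exact: is_derive_cst.
Qed.

Lemma smooth_uptoD k f g : smooth_upto k f -> smooth_upto k g ->
  smooth_upto k (fun x => f x + g x).
Proof.
elim: k f g => // k IH f g [f' ff' kf'] [g' gg' kg'].
exists (fun x => f' x + g' x); last exact: IH.
by move=> x; apply: is_deriveD.
Qed.

Lemma smooth_uptoM k f g : smooth_upto k f -> smooth_upto k g ->
  smooth_upto k (fun x => f x * g x).
Proof.
elim: k f g => // k IH f g kf kg.
have kf1 := smooth_uptoS kf; have kg1 := smooth_uptoS kg.
have [f' ff' kf'] := kf; have [g' gg' kg'] := kg.
exists (fun x => f x * g' x + g x * f' x); last first.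
  by apply: smooth_uptoD; exact: IH.
by move=> x; apply: is_deriveM.
Qed.

Lemma smooth_uptoV k f : (forall x, f x != 0) -> smooth_upto k f ->
  smooth_upto k (fun x => (f x)^-1).
Proof.
move=> f0; elim: k => // k IH kf.
have kf1 := smooth_uptoS kf.
have [f' ff' kf'] := kf.
exists (fun x => - 1 * (f' x * ((f x)^-1 * (f x)^-1))); last first.
  apply: smooth_uptoM; first exact: smooth_upto_cst.
  by apply: smooth_uptoM => //; apply: smooth_uptoM; exact: IH.
move=> x; have [dx ex] := ff' x; split; first exact: derivableV.
by rewrite deriveV// ex /GRing.scale/=; field.
Qed.

Lemma smooth_upto_affine k f s c : smooth_upto k f ->
  smooth_upto k (fun x => f (s * x + c)).
Proof.
elim: k f => // k IH f [f' ff' kf'].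
exists (fun x => s * f' (s * x + c)); last first.
  by apply: smooth_uptoM; [exact: smooth_upto_cst|exact: IH].
move=> x; have lx : is_derive (x : R) (1 : R) (fun x : R => s * x + c) s.
  apply: (@is_derive_quadratic R R R _ _ _ _ 0) => h; rewrite mul0r.
  by rewrite (_ : _ - _ - _ = 0) ?normr0// /GRing.scale/=; ring.
by apply: (is_derive_eq (@is_derive1_chain R f (fun x => s * x + c) x _ _ (ff' (s * x + c)) lx)); rewrite mulrC.
Qed.

Definition smooth1 f := forall k, smooth_upto k f.

Lemma smooth1_derive f : smooth1 f ->
  (forall x, is_derive (x : R) (1 : R) f ((derive1 f) x)) /\ smooth1 (derive1 f).
Proof.
move=> sf; split=> [x|k].
  have [f' ff' _] := sf 1%N; have fx := ff' x.
  by rewrite derive1E; apply: DeriveDef.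
have [f' ff' kf'] := sf k.+1.
suff -> : (derive1 f) = f' by [].
by apply/funext => x; rewrite derive1E; have := ff' x => -[].
Qed.

Lemma smooth1_derive1n f k : smooth1 f -> smooth1 (derive1n k f).
Proof.
by move=> sf; elim: k => // k IH; rewrite derive1nS; exact: (smooth1_derive IH).2.
Qed.

Lemma is_derive_derive1n f k x : smooth1 f -> is_derive (x : R) (1 : R) (derive1n k f) ((derive1n k.+1 f) x).
Proof. by move=> sf; rewrite derive1nS; exact: (smooth1_derive (smooth1_derive1n k sf)).1. Qed.

Lemma smooth1_continuous f : smooth1 f -> continuous f.
Proof.
move=> sf x; apply/differentiable_continuous/derivable1_diffP.
by have [? _] := (smooth1_derive sf).1 x.
Qed.

Lemma smooth1_derive1n_out f M k : smooth1 f -> (forall x, M < `|x| -> f x = 0) ->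
  forall x, M < `|x| -> (derive1n k f) x = 0.
Proof.
move=> sf f0; elim: k => // k IH x Mx; rewrite derive1nS derive1E.
have : is_derive (x : R) (1 : R) (fun=> 0 : R) 0 by exact: is_derive_cst.
move=> -[_ <-]; apply: near_eq_derive; near=> y.
apply: IH; near: y.
have : `|y| @[y --> x] --> `|x| by exact: norm_continuous.
move/cvgr_gt; apply; exact: Mx.
Unshelve. all: by end_near. Qed.

Lemma smooth1_bounded f M k : smooth1 f -> (forall x, M < `|x| -> f x = 0) ->
  exists2 K : R, 0 <= K & forall x, `|(derive1n k f) x| <= K.
Proof.
move=> sf f0.
have ck := smooth1_continuous (smooth1_derive1n k sf).
have out := smooth1_derive1n_out k sf f0.
pose N := Num.max 0 M.
have N0 : - N <= N by rewrite ge0_cp// le_max lexx.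
have ca : {within `[- N, N], continuous (fun x => `|(derive1n k f) x|)}.
  apply: continuous_subspaceT => x; apply: continuous_comp; first exact: ck.
  exact: norm_continuous.
have [c cN hc] := EVT_max N0 ca.
exists `|(derive1n k f) c| => // x; have [xN|xN] := leP `|x| N.
  by apply: hc; rewrite in_itv/= -ler_norml.
by rewrite out ?normr0//; move: xN; rewrite gt_max => /andP[].
Qed.

(** The mean value theorem is applied to the derivative of order [k], then to [y -> f y - y f'(x)]
    at the same order. The remainder bounds are global because derivatives vanish outside a bounded
    interval. *)
Lemma smooth1_taylor f M : smooth1 f -> (forall x, M < `|x| -> f x = 0) ->
  forall k, exists2 K : R, 0 <= K & forall x s,
    `|(derive1n k f) (x + s) - (derive1n k f) x| <= K * `|s| /\
    `|(derive1n k f) (x + s) - (derive1n k f) x - s * (derive1n k.+1 f) x| <= K * s ^+ 2.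
Proof.
move=> sf f0 k; have [K1 K10 hK1] := smooth1_bounded k.+1 sf f0.
have [K2 K20 hK2] := smooth1_bounded k.+2 sf f0.
have mvt j K : (forall x, `|(derive1n j.+1 f) x| <= K) -> forall x y, `|(derive1n j f) x - (derive1n j f) y| <= K * `|x - y|.
  move=> hK; have w x y : x <= y -> `|(derive1n j f) x - (derive1n j f) y| <= K * `|x - y|.
    move=> xy.
    have [c _ e] := @MVT_segment R (derive1n j f) (derive1n j.+1 f) x y xy (fun z _ => is_derive_derive1n j z sf)
      (continuous_subspaceT (smooth1_continuous (smooth1_derive1n j sf))).
    by rewrite distrC e normrM (distrC y) ler_wpM2r.
  by move=> x y; have [/w//|/ltW/w] := leP x y; rewrite distrC (distrC y).
exists (K1 + K2); first exact: addr_ge0.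
move=> x s; split.
  apply: (le_trans (mvt _ _ hK1 _ _)).
  by rewrite addrAC subrr add0r ler_wpM2r// lerDl.
pose g y := (derive1n k f) y - y * (derive1n k.+1 f) x.
have gd y : is_derive (y : R) (1 : R) g ((derive1n k.+1 f) y - (derive1n k.+1 f) x).
  apply: is_deriveB; first exact: is_derive_derive1n.
  apply: (@is_derive_quadratic R R R _ _ _ _ 0) => h; rewrite mul0r.
  by rewrite (_ : _ - _ - _ = 0) ?normr0// /GRing.scale/=; ring.
have gc : continuous g.
  move=> y; apply/differentiable_continuous/derivable1_diffP.
  by have [] := gd y.
have gE : (derive1n k f) (x + s) - (derive1n k f) x - s * (derive1n k.+1 f) x = g (x + s) - g x.
  by rewrite /g; ring.
have kk : K2 * s ^+ 2 <= (K1 + K2) * s ^+ 2 by rewrite ler_wpM2r ?sqr_ge0// lerDr.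
apply: le_trans kk; rewrite gE.
have w y z u : y <= z -> `|y - x| <= `|s| -> `|z - x| <= `|s| -> u = z - y ->
    `|u| = `|s| -> `|g z - g y| <= K2 * s ^+ 2.
  move=> yz ys zs uE us.
  have [c cyz ->] := @MVT_segment R g _ y z yz (fun w _ => gd w) (continuous_subspaceT gc).
  rewrite -uE normrM us -real_normK ?num_real// expr2 mulrA ler_wpM2r//.
  apply: (le_trans (mvt _ _ hK2 _ _)); rewrite ler_wpM2l//.
  move: cyz; rewrite in_itv/= => /andP[yc cz].
  by move: ys zs; rewrite !ler_norml => /andP[? ?] /andP[? ?]; apply/andP; split; lra.
have [s0|s0] := leP 0 s.
  by apply: (w _ _ s) => //; rewrite ?lerDl// ?subrr ?normr0// addrAC subrr add0r.
rewrite distrC; apply: (w _ _ (- s)) => //.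
- by rewrite gerDl ltW.
- by rewrite addrAC subrr add0r.
- by rewrite subrr normr0.
- by rewrite opprD addrA subrr add0r.
- by rewrite normrN.
Qed.

End smooth1.

(** * A bump function with an explicit primitive *)

Section bump.
Context (R : realType).
Implicit Types (x y h : R).

(** The powers of [1/x] make the family closed under differentiation, the derivative of [flat q]
    being [- q flat (q+1) + flat (q+2)]. Smoothness, including at 0, is then one induction for all
    [q] at once. *)
Definition flat (q : nat) x : R := if 0 < x then x^-1 ^+ q * expR (- x^-1) else 0.

Lemma flat_ge0 q x : 0 <= flat q x.
Proof.
rewrite /flat; case: ifPn => // x0.
by rewrite mulr_ge0 ?expR_ge0// exprn_ge0// invr_ge0 ltW.
Qed.

Lemma flat_gt0 q x : 0 < x -> 0 < flat q x.
Proof. by move=> x0; rewrite /flat x0 mulr_gt0 ?expR_gt0// exprn_gt0// invr_gt0. Qed.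

Lemma flat0 q x : x <= 0 -> flat q x = 0.
Proof. by rewrite /flat ltNge => ->. Qed.

(** The Taylor term of order [q + 2] of the exponential absorbs [x^(-q)] and leaves [x^2]: this is
    the quadratic remainder that gives the derivative 0 at the origin. *)
Lemma flat_le q x : flat q x <= q.+2`!%:R * x ^+ 2.
Proof.
have [x0|x0] := leP x 0; first by rewrite flat0// mulr_ge0// sqr_ge0.
rewrite /flat x0.
have y0 : 0 < x^-1 by rewrite invr_gt0.
apply: (le_trans (ler_wpM2l (exprn_ge0 _ (ltW y0)) (expRN_le q.+1 y0))).
rewrite mulrCA ler_wpM2l// -exprVn invrK -[q.+2]addn2 exprD mulrA -exprMn mulVf ?gt_eqF//.
by rewrite expr1n mul1r.
Qed.

Lemma is_derive_flat q x :
  is_derive x (1 : R) (flat q) (- q%:R * flat q.+1 x + flat q.+2 x).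
Proof.
have [x0|x0|->] := ltgtP x 0.
- rewrite !flat0 ?(ltW x0)// mulr0 addr0.
  have dc : is_derive x (1 : R) (cst (0 : R) : R -> R) 0 by exact: is_derive_cst.
  apply: (near_eq_is_derive _ dc).
  near=> y; rewrite flat0//= ltW//; near: y; exact: lt_nbhsl.
- have xN0 : x != 0 by rewrite gt_eqF.
  have dV : is_derive x (1 : R) (fun y => y^-1) (- x ^- 2).
    have [di ei] := is_derive_id x (1 : R).
    split; first exact: derivableV.
    by rewrite (@deriveV _ _ id)// ei /GRing.scale/= mulr1.
  have dX : is_derive x (1 : R) (fun y => y^-1 ^+ q) (- q%:R * x^-1 ^+ q.+1).
    rewrite (_ : (fun y => _) = (fun y : R => y^-1) ^+ q); last by rewrite exprfctE.
    apply: (is_derive_eq (is_deriveX q dV)).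
    rewrite /GRing.scale/=; case: (q) => [|k]; first by rewrite !mul0r oppr0 mul0r.
    by rewrite /= mulrN mulNr -mulrA -exprVn -exprD addn2.
  have dE : is_derive x (1 : R) (fun y => expR (- y^-1)) (x ^- 2 * expR (- x^-1)).
    apply: (is_derive_eq (@is_derive1_chain R expR (fun y => - y^-1) x _ _ (is_derive_expR (- x^-1)) (is_deriveN dV))).
    by rewrite opprK mulrC.
  apply: (@near_eq_is_derive _ _ _ (fun y => y^-1 ^+ q * expR (- y^-1))).
    by near=> y; rewrite /flat ifT//; near: y; exact: lt_nbhsr.
  apply: (is_derive_eq (is_deriveM dX dE)).
  rewrite /GRing.scale/= /flat x0 -exprVn; move: (x^-1) (expR _) => u E.
  by rewrite [u ^+ q.+2]exprS [u ^+ q.+1]exprS; ring.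
- rewrite !flat0// mulr0 addr0.
  apply: (@is_derive_quadratic R R R _ _ _ _ q.+2`!%:R) => h.
  rewrite /GRing.scale/= mulr1 addr0 (flat0 q (lexx 0)) mulr0 !subr0.
  by rewrite ger0_norm ?flat_ge0// flat_le.
Unshelve. all: by end_near. Qed.

Lemma smooth1_flat q : smooth1 (flat q).
Proof.
move=> k; elim: k q => // k IH q.
exists (fun x => - q%:R * flat q.+1 x + flat q.+2 x); first exact: is_derive_flat.
apply: smooth_uptoD; last exact: IH.
by apply: smooth_uptoM; [exact: smooth_upto_cst|exact: IH].
Qed.

Variable e : R.
Hypothesis e0 : 0 < e.

Let den x := flat 0 (x + e) + flat 0 (e - x).

Let den_gt0 x : 0 < den x.
Proof.
rewrite /den; have [h|h] := ltP (- e) x.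
  by rewrite ltr_pwDl ?flat_ge0// flat_gt0// -ltrBlDr sub0r.
by apply: ltr_wpDl; [exact: flat_ge0|apply: flat_gt0; have e1 := e0; lra].
Qed.

Definition step x : R := flat 0 (x + e) / (flat 0 (x + e) + flat 0 (e - x)).

(** The derivative of [step], by the quotient rule. As [step] rises from 0 at [-e] to 1 at [e], the
    bump has integral 1 with no normalising constant. *)
Definition bump x : R :=
  (flat 2 (x + e) * flat 0 (e - x) + flat 0 (x + e) * flat 2 (e - x)) /
  (flat 0 (x + e) + flat 0 (e - x)) ^+ 2.

Let smooth_affine k q s c : smooth_upto k (fun x => flat q (s * x + c)).
Proof. by apply: smooth_upto_affine; exact: smooth1_flat. Qed.

Let smoothp k q : smooth_upto k (fun x => flat q (x + e)).
Proof. by have := smooth_affine k q 1 e; under eq_fun do rewrite mul1r. Qed.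

Let smoothm k q : smooth_upto k (fun x => flat q (e - x)).
Proof. by have := smooth_affine k q (-1) e; under eq_fun do rewrite mulN1r addrC. Qed.

Lemma is_derive_step x : is_derive x (1 : R) step (bump x).
Proof.
have dp : is_derive x (1 : R) (fun x => flat 0 (x + e)) (flat 2 (x + e)).
  have l : is_derive x (1 : R) (fun x => x + e) 1.
    apply: (@is_derive_quadratic R R R _ _ _ _ 0) => h; rewrite mul0r.
    by rewrite (_ : _ - _ - _ = 0) ?normr0// /GRing.scale/=; ring.
  apply: (is_derive_eq (@is_derive1_chain R (flat 0) (fun x => x + e) x _ _ (is_derive_flat 0 (x + e)) l)).
  by rewrite oppr0 mul0r add0r mulr1.
have dm : is_derive x (1 : R) (fun x => flat 0 (e - x)) (- flat 2 (e - x)).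
  have l : is_derive x (1 : R) (fun x => e - x) (-1).
    apply: (@is_derive_quadratic R R R _ _ _ _ 0) => h; rewrite mul0r.
    by rewrite (_ : _ - _ - _ = 0) ?normr0// /GRing.scale/=; ring.
  apply: (is_derive_eq (@is_derive1_chain R (flat 0) (fun x => e - x) x _ _ (is_derive_flat 0 (e - x)) l)).
  by rewrite oppr0 mul0r add0r mulrN1.
have dd : is_derive x (1 : R) den (flat 2 (x + e) - flat 2 (e - x)) by exact: is_deriveD.
have dN0 : den x != 0 by rewrite gt_eqF// den_gt0.
have dV : is_derive x (1 : R) (fun x => (den x)^-1) (- (den x) ^- 2 * (flat 2 (x + e) - flat 2 (e - x))).
  have [di ei] := dd; split; first exact: derivableV.
  by rewrite deriveV// ei.
apply: (is_derive_eq (is_deriveM dp dV)).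
rewrite /GRing.scale/= /bump -/(den x); move: dN0; rewrite /den => dN0.
by field.
Qed.

Lemma smooth1_step : smooth1 step.
Proof.
move=> k; apply: smooth_uptoM; first exact: smoothp.
apply: smooth_uptoV; last by apply: smooth_uptoD; [exact: smoothp|exact: smoothm].
by move=> x; rewrite gt_eqF// den_gt0.
Qed.

Lemma smooth1_bump : smooth1 bump.
Proof.
move=> k; apply: smooth_uptoM.
  by apply: smooth_uptoD; apply: smooth_uptoM.
apply: smooth_uptoV; first by move=> x; rewrite expf_neq0// gt_eqF// den_gt0.
by apply: smooth_uptoM; apply: smooth_uptoD.
Qed.

Lemma bump_ge0 x : 0 <= bump x.
Proof.
rewrite /bump divr_ge0 ?sqr_ge0// addr_ge0// mulr_ge0// flat_ge0//.
Qed.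

Lemma bump_out x : e <= `|x| -> bump x = 0.
Proof.
rewrite /bump ler_normr => /orP[ex|ex].
  by rewrite (@flat0 _ (e - x)) ?(@flat0 _ (e - x)) ?subr_le0// !mulr0 addr0 mul0r.
by rewrite !(@flat0 _ (x + e)) ?mul0r ?addr0 ?mul0r//; lra.
Qed.

Lemma step_left x : x <= - e -> step x = 0.
Proof. by move=> xe; rewrite /step (@flat0 _ (x + e)) ?mul0r//; lra. Qed.

Lemma step_right x : e <= x -> step x = 1.
Proof.
move=> ex; rewrite /step (@flat0 _ (e - x)) ?subr_le0// addr0 divff// gt_eqF//.
by apply: flat_gt0; rewrite ltr_wpDl// (le_trans (ltW e0)).
Qed.

Let mbump : measurable_fun setT bump.
Proof. by apply: continuous_measurable_fun; apply: smooth1_continuous smooth1_bump. Qed.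

Lemma integral_bump_itv x y : x < y ->
  (\int[lebesgue_measure]_(u in `[x, y]) (bump u)%:E = (step y - step x)%:E)%E.
Proof.
move=> xy; have cs := smooth1_continuous smooth1_step.
rewrite (@continuous_FTC2 _ _ step)//.
- exact: continuous_subspaceT (smooth1_continuous smooth1_bump).
- split.
  + by move=> u _; have [] := is_derive_step u.
  + by apply: cvg_at_right_filter; exact: cs.
  + by apply: cvg_at_left_filter; exact: cs.
- by move=> u _; rewrite derive1E; have [_ ->] := is_derive_step u.
Qed.

Lemma integral_bump : (\int[lebesgue_measure]_u (bump u)%:E = 1)%E.
Proof.
transitivity (\int[lebesgue_measure]_(u in `[(- e)%R, e]) (bump u)%:E)%E.
  apply: integral_setT_ifE => // u /=; rewrite in_itv/= => h; rewrite bump_out//.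
  by move/negP: h; rewrite -ler_norml -ltNge => /ltW.
have e1 := e0; rewrite integral_bump_itv; last by lra.
by rewrite step_right// step_left// subr0.
Qed.

Variable h : R.
Hypothesis h0 : 0 < h.

(** The integral of [bump] over [[x - h, x]]. Its derivative is a difference of two bumps, so an
    integration by parts produces a finite difference of step [h]; its total mass is [h]. *)
Definition step_diff x : R := step x - step (x - h).

Lemma smooth1_step_diff : smooth1 step_diff.
Proof.
move=> k; rewrite (_ : step_diff = fun x => step x + (-1) * step (1 * x + (- h))).
  apply: smooth_uptoD; first exact: smooth1_step.
  apply: smooth_uptoM; first exact: smooth_upto_cst.
  by apply: smooth_upto_affine; exact: smooth1_step.
by apply/funext => x; rewrite mul1r mulN1r.
Qed.

Lemma is_derive_step_diff x : is_derive x (1 : R) step_diff (bump x - bump (x - h)).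
Proof.
apply: is_deriveB; first exact: is_derive_step.
have l : is_derive x (1 : R) (fun x => x - h) 1.
  apply: (@is_derive_quadratic R R R _ _ _ _ 0) => y; rewrite mul0r.
  by rewrite (_ : _ - _ - _ = 0) ?normr0// /GRing.scale/=; ring.
by apply: (is_derive_eq (@is_derive1_chain R step (fun x => x - h) x _ _ (is_derive_step (x - h)) l)); rewrite mulr1.
Qed.

Let step_diffE x : ((step_diff x)%:E =
  \int[lebesgue_measure]_u (if (x - h <= u)%R then if (u <= x)%R then bump u else 0%R else 0%R)%:E)%E.
Proof.
rewrite /step_diff -integral_bump_itv; last by rewrite gtrBl.
apply/esym; apply: integral_setT_ifE => u /=; rewrite in_itv/=.
  by move=> /andP[-> ->].
by move/negP; rewrite negb_and => /orP[] /negbTE ->//; case: ifP.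
Qed.

Lemma step_diff_ge0 x : 0 <= step_diff x.
Proof.
rewrite -lee_fin step_diffE; apply: integral_ge0 => u _; rewrite lee_fin.
by case: ifP => // _; case: ifP => // _; exact: bump_ge0.
Qed.

Lemma step_diff_out x : e + h <= `|x| -> step_diff x = 0.
Proof.
have e1 := e0; have h1 := h0; rewrite /step_diff ler_normr => /orP[ex|ex].
  by rewrite (@step_right x) ?(@step_right (x - h)) ?subrr//; lra.
by rewrite (@step_left x) ?(@step_left (x - h)) ?subrr//; lra.
Qed.

Lemma integral_step_diff : (\int[lebesgue_measure]_x (step_diff x)%:E = h%:E)%E.
Proof.
have b0 := bump_ge0.
under eq_integral do rewrite step_diffE.
rewrite (@tonelli _ _ _ _ _ lebesgue_measure lebesgue_measure (fun x u => (if (x - h <= u)%R then if (u <= x)%R then bump u else 0%R else 0%R)%:E)); last 2 first.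
- by move=> x u; rewrite lee_fin; case: ifP => // _; case: ifP.
- by mfun.
transitivity (\int[lebesgue_measure]_u (h%:E * (bump u)%:E))%E; last first.
  by rewrite ge0_integralZl ?integral_bump ?mule1; try side.
apply: eq_integral => u _.
transitivity (\int[lebesgue_measure]_(x in `[u, (u + h)%R]) (cst (bump u)%:E x))%E.
  apply: integral_setT_ifE => x /=; rewrite in_itv/= lerBlDr.
    by move=> /andP[-> ->].
  by move/negP; rewrite negb_and => /orP[] /negbTE ->//; case: ifP.
rewrite integral_cst//= lebesgue_measure_itv/= lte_fin ltrDl h0 -EFinB -EFinM.
by congr EFin; ring.
Qed.

End bump.

(** Telescoping: the factors are changed one at a time. *)
Lemma prod_sub_le (R : realType) (I : Type) (s : seq I) (a b : I -> R) (K : R) :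
  1 <= K -> (forall i, `|a i| <= K) -> (forall i, `|b i| <= K) ->
  `|\prod_(i <- s) a i - \prod_(i <- s) b i| <= K ^+ size s * \sum_(i <- s) `|a i - b i|.
Proof.
move=> K1 aK bK; have K0 : 0 <= K by exact: le_trans K1.
elim: s => [|i s IH]; first by rewrite !big_nil subrr normr0 mulr0.
rewrite !big_cons /= exprS.
have -> : a i * \prod_(j <- s) a j - b i * \prod_(j <- s) b j =
    (a i - b i) * \prod_(j <- s) a j + b i * (\prod_(j <- s) a j - \prod_(j <- s) b j) by ring.
apply: (le_trans (ler_normD _ _)); rewrite !normrM mulrDr lerD//.
  rewrite mulrC ler_wpM2r// normr_prod.
  apply: (@le_trans _ _ (\prod_(j <- s) K)).
    by apply: ler_prod => j _; rewrite normr_ge0/= aK.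
  by rewrite big_const_seq count_predT iter_mulr_1 ler_peMl// exprn_ge0.
by rewrite -mulrA; apply: ler_pM.
Qed.

Lemma lipschitz_continuous (R : realType) (V W : normedModType R) (f : V -> W) (L : R) :
  (forall x y, `|f x - f y| <= L * `|x - y|) -> continuous f.
Proof.
move=> lip x; apply/cvgrPdist_le => e e0.
pose L' := `|L| + 1; have L0 : 0 < L' by rewrite ltr_wpDl.
near=> y; apply: (le_trans (lip _ _)).
have h2 : `|x - y| <= e / L'.
  near: y; apply: cvgr_dist_le => //; exact: divr_gt0.
apply: (@le_trans _ _ (L' * `|x - y|)); first by rewrite ler_wpM2r// ler_wpDr ?ler_norm.
by rewrite mulrC -ler_pdivlMr.
Unshelve. all: by end_near. Qed.

Lemma coord_le_norm (R : realType) n (v : 'rV[R]_n) j : `|v ord0 j| <= `|v|.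
Proof.
rewrite -[leRHS]/(mx_norm v) mx_normrE.
by apply: (le_bigmax _ (fun ij : 'I_1 * 'I_n => `|v ij.1 ij.2|) (ord0, j)).
Qed.

(** * Product kernels and the test fields built from them *)

Section product_kernel.
Context (R : realType) (n : nat).
Notation mu := (lebesgue_rV R n).
Implicit Types (x y z : 'rV[R]_n) (b : 'I_n -> nat).
Variables (c : 'I_n -> R -> R) (M : R).
Hypotheses (sc : forall j, smooth1 (c j)) (cM : forall j (x : R), M < `|x| -> c j x = 0).

(** [b] is a multi-index of derivatives. Treating all partial derivatives together makes the
    smoothness proof a single induction. *)
Definition prodk b z : R := \prod_(j < n) derive1n (b j) (c j) (z ord0 j).

Lemma prodk_out b z j : M < `|z ord0 j| -> prodk b z = 0.
Proof.
move=> h; rewrite /prodk (bigD1 j)//= (@smooth1_derive1n_out _ _ M) ?mul0r//.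
exact: cM.
Qed.

Let cderiv_cont j k : continuous (derive1n k (c j)).
Proof. by apply: smooth1_continuous; exact: smooth1_derive1n. Qed.

Lemma measurable_prodk b : measurable_fun setT (prodk b).
Proof.
apply: measurable_prod => j _.
have mc := continuous_measurable_fun (@cderiv_cont j (b j)).
by apply: (measurableT_comp mc); mfun.
Qed.

Let taylor b : exists2 K : R, 1 <= K & forall j u s,
  [/\ `|derive1n (b j) (c j) u| <= K,
    `|derive1n (b j) (c j) (u + s) - derive1n (b j) (c j) u| <= K * `|s| &
    `|derive1n (b j) (c j) (u + s) - derive1n (b j) (c j) u - s * derive1n (b j).+1 (c j) u| <= K * s ^+ 2].
Proof.
have /fin_all_exists2[K1 K10 h1] : forall j, exists2 K : R, 0 <= K & forall u, `|derive1n (b j) (c j) u| <= K.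
  by move=> j; apply: (@smooth1_bounded _ _ M) => //; exact: cM.
have /fin_all_exists2[K2 K20 h2] := fun j => @smooth1_taylor _ _ M (sc j) (cM j) (b j).
pose K := 1 + \sum_j (K1 j + K2 j).
have KE j : K1 j + K2 j <= K.
  rewrite /K (bigD1 j)//= addrCA lerDl addr_ge0// sumr_ge0// => i _.
  by rewrite addr_ge0.
exists K; first by rewrite lerDl sumr_ge0// => i _; rewrite addr_ge0.
move=> j u s; have [h3 h4] := h2 j u s; have := KE j => kk; split.
- by apply: (le_trans (h1 _ _)); apply: le_trans kk; rewrite lerDl.
- by apply: (le_trans h3); rewrite ler_wpM2r//; apply: le_trans kk; rewrite lerDr.
- by apply: (le_trans h4); rewrite ler_wpM2r ?sqr_ge0//; apply: le_trans kk; rewrite lerDr.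
Qed.

Lemma prodk_bounded b : exists2 K : R, 0 <= K & forall z, `|prodk b z| <= K.
Proof.
have [K K1 h] := taylor b; have K0 : 0 <= K by exact: le_trans K1.
exists (K ^+ n); first exact: exprn_ge0.
move=> z; rewrite /prodk normr_prod.
apply: (@le_trans _ _ (\prod_(j < n) K)); last by rewrite prodr_const card_ord.
by apply: ler_prod => j _; rewrite normr_ge0/=; have [] := h j (z ord0 j) 0.
Qed.

Lemma prodk_lipschitz b : exists2 K : R, 0 <= K & forall z v,
  `|prodk b (z + v) - prodk b z| <= K * \sum_(j < n) `|v ord0 j|.
Proof.
have [K K1 h] := taylor b; have K0 : 0 <= K by exact: le_trans K1.
exists (K ^+ size (index_enum 'I_n) * K); first by rewrite mulr_ge0 ?exprn_ge0.
move=> z v; apply: (le_trans (prod_sub_le _ K1 _ _)).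
- by move=> j; have [] := h j ((z + v) ord0 j) 0.
- by move=> j; have [] := h j (z ord0 j) 0.
rewrite -mulrA ler_wpM2l ?exprn_ge0// mulr_sumr; apply: ler_sum => j _.
by rewrite mxE; have [] := h j (z ord0 j) (v ord0 j).
Qed.

Definition bump_index b i : 'I_n -> nat := fun j => if j == i then (b j).+1 else b j.

(** Along direction [i] only one factor varies; the others form a bounded constant, and the
    one-variable expansion applies. *)
Lemma prodk_taylor b i : exists2 K : R, 0 <= K & forall z s,
  `|prodk b (z + s *: delta_mx ord0 i) - prodk b z - s * prodk (bump_index b i) z| <= K * s ^+ 2.
Proof.
have [K K1 h] := taylor b; have K0 : 0 <= K by exact: le_trans K1.
pose L := \prod_(j < n | j != i) K.
have L0 : 0 <= L by exact: prodr_ge0.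
exists (L * K); first by rewrite mulr_ge0.
move=> z s; rewrite /prodk !(bigD1 i (P := xpredT))//=.
set P := \prod_(j < n | j != i) derive1n (b j) (c j) (z ord0 j).
have -> : \prod_(j < n | j != i) derive1n (b j) (c j) ((z + s *: delta_mx ord0 i) ord0 j) = P.
  by apply: eq_bigr => j ji; rewrite !mxE (negbTE ji) andbF mulr0 addr0.
have -> : \prod_(j < n | j != i) derive1n (bump_index b i j) (c j) (z ord0 j) = P.
  by apply: eq_bigr => j ji; rewrite /bump_index (negbTE ji).
rewrite /bump_index eqxx !mxE !eqxx mulr1.
have PL : `|P| <= L.
  rewrite normr_prod; apply: ler_prod => j _; rewrite normr_ge0/=.
  by have [] := h j (z ord0 j) 0.
rewrite mulrA -!mulrBl normrM mulrC -mulrA; apply: ler_pM => //.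
by have [] := h i (z ord0 i) s.
Qed.

Variables (g : 'rV[R]_n -> R) (N : R).
Hypotheses (mg : measurable_fun setT g) (ig : mu.-integrable setT (EFin \o g))
  (gN : forall y j, N < `|y ord0 j| -> g y = 0).

Definition prodk_conv b x : R := \int[mu]_y (prodk b (y - x) * g y).

Lemma integrable_prodk_conv b x : mu.-integrable setT (EFin \o (fun y => prodk b (y - x) * g y)).
Proof.
have [K K0 h] := prodk_bounded b; have mp := measurable_prodk b.
apply: (@integrableR_le _ _ _ _ _ (fun y => K * g y)); first by mfun.
  exact: integrableR_Zl.
by move=> y; rewrite !normrM ler_wpM2r// (le_trans (h _))// ler_norm.
Qed.

Let G := \int[mu]_y `|g y|.
Let GE : (\int[mu]_y `|g y|%:E)%E = G%:E.
Proof. by rewrite EFin_Rintegral_ge0//; exact: integrableR_fin. Qed.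

(* Every estimate on [prodk_conv] comes from a pointwise one on [prodk]. *)
Let conv_le (F : 'rV[R]_n -> R) (L : R) : 0 <= L -> measurable_fun setT F ->
  (forall y, `|F y| <= L) -> `|\int[mu]_y (F y * g y)| <= L * G.
Proof.
move=> L0 mF FL; rewrite -lee_fin; apply: (le_trans (normr_Rintegral_le _ _)); first by mfun.
rewrite EFinM -GE -ge0_integralZl; try side.
apply: le_integralT; [by nneg|by mfun|by mfun|].
by move=> y; rewrite -EFinM lee_fin normrM ler_wpM2r.
Qed.

(** The point [x] enters the kernel as [y - x], hence the plus sign in front of the first-order
    term. *)
Lemma prodk_conv_taylor b i : exists K, forall x s,
  `|prodk_conv b (s *: delta_mx ord0 i + x) - prodk_conv b x
    + s * prodk_conv (bump_index b i) x| <= K * s ^+ 2.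
Proof.
have [K K0 h] := prodk_taylor b i.
have mb := measurable_prodk b; have mbi := measurable_prodk (bump_index b i).
exists (K * G) => x s; rewrite /prodk_conv
  -RintegralB//; [|exact: integrable_prodk_conv|exact: integrable_prodk_conv].
rewrite -RintegralZl//; last exact: integrable_prodk_conv.
rewrite -RintegralD//; last 2 first.
- by apply: integrableR_B; exact: integrable_prodk_conv.
- by apply: integrableR_Zl; exact: integrable_prodk_conv.
rewrite mulrAC; under eq_Rintegral => y _.
  have -> : prodk b (y - (s *: delta_mx ord0 i + x)) * g y - prodk b (y - x) * g y
      + s * (prodk (bump_index b i) (y - x) * g y) =
      (prodk b (y - x + (- s) *: delta_mx ord0 i) - prodk b (y - x)
       - (- s) * prodk (bump_index b i) (y - x)) * g y.
    have -> : y - x + (- s) *: delta_mx ord0 i = y - (s *: delta_mx ord0 i + x).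
      by rewrite scaleNr opprD addrAC addrA.
    by ring.
  over.
apply: conv_le; first by rewrite mulr_ge0 ?sqr_ge0.
  by mfun.
by move=> y; apply: (le_trans (h _ _)); rewrite sqrrN.
Qed.

Lemma prodk_conv_lipschitz b : exists2 L : R, 0 <= L & forall x v,
  `|prodk_conv b (x + v) - prodk_conv b x| <= L * \sum_(j < n) `|v ord0 j|.
Proof.
have [K K0 h] := prodk_lipschitz b; have mb := measurable_prodk b.
exists (K * G); first by rewrite mulr_ge0// Rintegral_ge0.
move=> x v.
rewrite /prodk_conv -RintegralB//; [|exact: integrable_prodk_conv|exact: integrable_prodk_conv].
under eq_Rintegral => z _ do rewrite -mulrBl.
rewrite mulrAC; apply: conv_le; first by rewrite mulr_ge0// sumr_ge0.
  by mfun.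
move=> z; have := h (z - x) (- v); rewrite -addrA -opprD => /le_trans; apply.
by under eq_bigr do rewrite mxE normrN.
Qed.

Lemma prodk_conv_bounded b : exists2 K : R, 0 <= K & forall x, `|prodk_conv b x| <= K.
Proof.
have [K K0 h] := prodk_bounded b; have mb := measurable_prodk b.
exists (K * G); first by rewrite mulr_ge0// Rintegral_ge0.
by move=> x; apply: conv_le => //; mfun.
Qed.

Lemma measurable_prodk_conv b : measurable_fun setT (prodk_conv b).
Proof. by have mb := measurable_prodk b; rewrite /prodk_conv; mfun. Qed.

Variable i : 'I_n.

(** The scalar [s] records the sign that each derivative flips, so that the family over all [s] and
    [b] is closed under partial derivatives. *)
Definition test_kernel_field (s : R) b x : 'rV[R]_n := (s * prodk_conv b x) *: delta_mx ord0 i.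

Let is_derive_field s b j x : is_derive x (delta_mx ord0 j) (test_kernel_field s b)
  (test_kernel_field (- s) (bump_index b j) x).
Proof.
have [K h] := prodk_conv_taylor b j.
apply: (@is_derive_quadratic _ _ _ _ _ _ _ (K * `|s| * `|delta_mx ord0 i : 'rV[R]_n|)) => t.
rewrite /test_kernel_field scalerA -!scalerBl normrZ mulrAC ler_wpM2r//.
have -> : s * prodk_conv b (t *: delta_mx ord0 j + x) - s * prodk_conv b x
    - t * (- s * prodk_conv (bump_index b j) x) =
    s * (prodk_conv b (t *: delta_mx ord0 j + x) - prodk_conv b x + t * prodk_conv (bump_index b j) x).
  by ring.
by rewrite normrM mulrAC mulrC ler_wpM2r.
Qed.

Let continuous_field s b : continuous (test_kernel_field s b).
Proof.
have [L L0 h] := prodk_conv_lipschitz b.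
apply: (@lipschitz_continuous _ _ _ _ (L * n%:R * `|s| * `|delta_mx ord0 i : 'rV[R]_n|)) => x y.
rewrite /test_kernel_field -scalerBl normrZ mulrAC ler_wpM2r// -mulrBr normrM.
rewrite mulrAC mulrC ler_wpM2r//; have := h y (x - y); rewrite (addrC y) subrK => /le_trans; apply.
rewrite -mulrA ler_wpM2l//; apply: (@le_trans _ _ (\sum_(j < n) `|x - y|)).
  by apply: ler_sum => j _; exact: coord_le_norm.
by rewrite sumr_const card_ord mulr_natl.
Qed.

Lemma class_C_test_kernel_field k s b : class_C k (test_kernel_field s b).
Proof.
elim: k s b => [|k IH] s b /=.
  by split=> //; exact: continuous_field.
split; first exact: continuous_field.
move=> j; split; first by move=> x; have [] := is_derive_field s b j x.
rewrite (_ : 'D_(delta_mx ord0 j) _ = test_kernel_field (- s) (bump_index b j)); first exact: IH.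
by apply/funext => x; have [_ ->] := is_derive_field s b j x.
Qed.

Lemma test_field_test_kernel_field : test_field (test_kernel_field 1 (fun=> 0%N)).
Proof.
split; first by move=> k; exact: class_C_test_kernel_field.
(* The weight vanishes off the cube of half-side [N] and the kernel off that of half-side [M]; their
   supports add up. *)
pose B := [set x : 'rV[R]_n | forall j, `[- (M + N), M + N]%classic (x ord0 j)].
have cB : compact B by apply: (@rV_compact R n (fun=> `[- (M + N), M + N]%classic)) => j; exact: segment_compact.
apply: (@subclosed_compact _ _ B) => //; first exact: closed_closure.
have clB : closed B by apply: compact_closed => //; exact: (@norm_hausdorff _ 'rV[R]_n).
rewrite (closure_id B).1//; apply: closure_subset => x /= fx j.
apply: contrapT => xj; move/eqP: fx; apply.
rewrite /test_kernel_field /prodk_conv (_ : \int[mu]_y _ = 0) ?mulr0 ?scale0r//.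
rewrite /Rintegral integral0_eq// => y _; congr EFin.
have [yN|yN] := leP `|y ord0 j| N; last by rewrite (gN yN) mulr0.
rewrite (@prodk_out _ _ j) ?mul0r// !mxE ltNge; apply/negP => h; apply: xj => /=.
rewrite in_itv/= -ler_norml -(subKr (y ord0 j) (x ord0 j)).
by apply: (le_trans (ler_normB _ _)); rewrite addrC lerD.
Qed.

Lemma enorm_test_kernel_field s b x : enorm (test_kernel_field s b x) = `|s * prodk_conv b x|.
Proof.
rewrite /enorm /dotv (bigD1 i)//= big1 => [|j ji].
  by rewrite !mxE !eqxx mulr1 addr0 -expr2 sqrtr_sqr.
by rewrite !mxE (negbTE ji) andbF mulr0 mul0r.
Qed.

End product_kernel.

(** * The fractional divergence of a test field *)

Lemma prod_EFin_cond (R : realType) (I : Type) (s : seq I) (P : pred I) (f : I -> R) :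
  ((\prod_(i <- s | P i) f i)%:E = \prod_(i <- s | P i) (f i)%:E)%E.
Proof. by elim/big_rec2 : _ => // i y1 y2 _ <-; rewrite EFinM. Qed.

Section Rintegral_rV.
Context (R : realType) (n : nat).
Notation mu := (lebesgue_rV R n).
Implicit Types (x w z : 'rV[R]_n).

Lemma Rintegral_rVBr w (F : 'rV[R]_n -> R) : measurable_fun setT F ->
  \int[mu]_x F (w - x) = \int[mu]_x F x.
Proof.
move=> mF; rewrite /Rintegral; congr fine.
have mF' : measurable_fun setT (EFin \o F) by exact/measurable_EFinP.
rewrite [LHS]integralE [RHS]integralE; congr (_ - _)%E.
- rewrite -(integral_rVBr w (measurable_funepos mF')); last by move=> x; exact: funepos_ge0.
  by apply: eq_integral => x _; rewrite !funeposE.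
- rewrite -(integral_rVBr w (measurable_funeneg mF')); last by move=> x; exact: funeneg_ge0.
  by apply: eq_integral => x _; rewrite !funenegE.
Qed.

Lemma Rintegral_rVD w (F : 'rV[R]_n -> R) : measurable_fun setT F ->
  \int[mu]_x F (x + w) = \int[mu]_x F x.
Proof.
move=> mF; have mG : measurable_fun setT (fun x => F (w - x)) by mfun.
rewrite -(Rintegral_rVBr w mF) -(Rintegral_rVBr 0 mG).
by apply: eq_Rintegral => x _; rewrite sub0r opprK addrC.
Qed.

(* One factor is allowed to change sign. *)
Lemma Rintegral_rV_prod1 (i : 'I_n) (a : 'I_n -> R -> R) (p q : R -> R) :
  (forall j, measurable_fun setT (a j)) -> (forall j (r : R), 0 <= a j r) ->
  (forall j, (\int[lebesgue_measure]_r (a j r)%:E < +oo)%E) ->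
  measurable_fun setT p -> (forall r : R, 0 <= p r) -> (\int[lebesgue_measure]_r (p r)%:E < +oo)%E ->
  measurable_fun setT q -> (forall r : R, 0 <= q r) -> (\int[lebesgue_measure]_r (q r)%:E < +oo)%E ->
  \int[mu]_x ((p (x ord0 i) - q (x ord0 i)) * \prod_(j < n | j != i) a j (x ord0 j)) =
  (\int[lebesgue_measure]_r p r - \int[lebesgue_measure]_r q r) *
  \prod_(j < n | j != i) \int[lebesgue_measure]_r a j r.
Proof.
move=> ma a0 afin mp p0 pfin mq q0 qfin.
pose P := \prod_(j < n | j != i) \int[lebesgue_measure]_r a j r.
have one (s : R -> R) : measurable_fun setT s -> (forall r : R, 0 <= s r) ->
    (\int[lebesgue_measure]_r (s r)%:E < +oo)%E ->
    (\int[mu]_x (s (x ord0 i) * \prod_(j < n | j != i) a j (x ord0 j))%:E =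
    (\int[lebesgue_measure]_r s r * P)%:E)%E.
  move=> ms s0 sfin; pose a' j := if j == i then s else a j.
  transitivity (\int[mu]_x (\prod_(j < n) a' j (x ord0 j))%:E)%E.
    apply: eq_integral => x _; congr EFin; rewrite [RHS](bigD1 i)//= /a' eqxx.
    by congr (_ * _); apply: eq_bigr => j /negbTE ->.
  rewrite integral_rV_prod; last 2 first.
  - by move=> j; rewrite /a'; case: ifP.
  - by move=> j x; rewrite /a'; case: ifP.
  rewrite (bigD1 i)//= /a' eqxx EFinM EFin_Rintegral_ge0//; congr (_ * _)%E.
  rewrite /P prod_EFin_cond; apply: eq_bigr => j ji.
  by rewrite (negbTE ji) EFin_Rintegral_ge0.
have int (s : R -> R) : measurable_fun setT s -> (forall r : R, 0 <= s r) ->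
    (\int[lebesgue_measure]_r (s r)%:E < +oo)%E ->
    mu.-integrable setT (EFin \o (fun x => s (x ord0 i) * \prod_(j < n | j != i) a j (x ord0 j))).
  move=> ms s0 sfin.
  apply: integrable_lt_pinfty.
    apply: measurable_funM; first by mfun.
    under eq_fun do rewrite big_mkcond/=.
    by apply: measurable_prod => j; case: (j != i); have maj := ma j; mfun.
  under eq_integral => x _.
    rewrite ger0_norm; last by rewrite mulr_ge0// prodr_ge0.
    over.
  by rewrite one// ltry.
under eq_Rintegral do rewrite mulrBl.
by rewrite RintegralB//; [rewrite /Rintegral !one//= mulrBl|exact: int|exact: int].
Qed.

End Rintegral_rV.

(** * Gaussian integration by parts *)

Section gauss1_by_parts.
Context (R : realType).
Notation leb := (@lebesgue_measure R).
Variables (t w e h : R).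
Hypotheses (t0 : 0 < t) (e0 : 0 < e) (h0 : 0 < h).
Let b := bump e.
Let B := step_diff e h.

Let cb : continuous b. Proof. exact/smooth1_continuous/smooth1_bump. Qed.
Let cB : continuous B. Proof. exact/smooth1_continuous/smooth1_step_diff. Qed.

Lemma is_derive_gauss1 z : is_derive z (1 : R) (gauss1 t) (- (z / (2 * t)) * gauss1 t z).
Proof.
have d1 : is_derive z (1 : R) (fun z => - (z ^+ 2 / (4 * t))) (- (z / (2 * t))).
  apply: (@is_derive_quadratic R R R _ _ _ _ (4 * t)^-1) => u.
  rewrite (_ : _ - _ - _ = - (u ^+ 2 / (4 * t))) ?normrN ?ger0_norm//.
  - by rewrite mulrC.
  - by rewrite divr_ge0 ?sqr_ge0// mulr_ge0// ltW.
  - by rewrite /GRing.scale/=; field; rewrite gt_eqF.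
have d2 := @is_derive1_chain R expR (fun z => - (z ^+ 2 / (4 * t))) z _ _ (is_derive_expR _) d1.
have := @is_deriveZ _ _ _ _ (Num.sqrt (4 * pi * t))^-1 _ _ _ d2.
rewrite /gauss1 /GRing.scale/= => d3; apply: (is_derive_eq d3).
by rewrite /GRing.scale/=; ring.
Qed.

Let cg : continuous (gauss1 t).
Proof.
move=> z; apply/differentiable_continuous/derivable1_diffP.
by have [] := is_derive_gauss1 z.
Qed.

Let wd z : is_derive z (1 : R) (fun z => w - z) (-1).
Proof.
apply: (@is_derive_quadratic R R R _ _ _ _ 0) => y; rewrite mul0r.
by rewrite (_ : _ - _ - _ = 0) ?normr0// /GRing.scale/=; ring.
Qed.

Let F (z : R) : R := gauss1 t z * B (w - z).
Let F' (z : R) : R := - (z / (2 * t)) * gauss1 t z * B (w - z) - gauss1 t z * (b (w - z) - b (w - z - h)).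

Let FF' z : is_derive z (1 : R) F (F' z).
Proof.
have dB := @is_derive1_chain R B (fun z => w - z) z _ _ (is_derive_step_diff e0 h (w - z)) (wd z).
by apply: (is_derive_eq (is_deriveM (is_derive_gauss1 z) dB)); rewrite /GRing.scale/= /F' /b; ring.
Qed.

Let cF' : continuous F'.
Proof.
have cw : continuous (fun z : R => w - z) by move=> z; apply: continuousB; [exact: cvg_cst|exact: cvg_id].
have cbw : continuous (fun z : R => b (w - z)).
  by move=> z; apply: (@continuous_comp _ _ _ (fun z => w - z) b); [exact: cw|exact: cb].
have cbwh : continuous (fun z : R => b (w - z - h)).
  move=> z; apply: (@continuous_comp _ _ _ (fun z => w - z - h) b); last exact: cb.
  by apply: continuousB; [exact: cw|exact: cvg_cst].
have cBw : continuous (fun z : R => B (w - z)).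
  by move=> z; apply: (@continuous_comp _ _ _ (fun z => w - z) B); [exact: cw|exact: cB].
have c0 : continuous (fun z : R => - (z / (2 * t))).
  apply: (@lipschitz_continuous R R R _ (2 * t)^-1) => x y.
  rewrite -opprD normrN -mulrBl normrM mulrC (@ger0_norm _ (2 * t)^-1)//.
  by rewrite invr_ge0 mulr_ge0// ltW.
have c1 z : {for z, continuous (fun z : R => - (z / (2 * t)) * gauss1 t z * B (w - z))}.
  by apply: continuousM; [apply: continuousM; [exact: c0|exact: cg]|exact: cBw].
have c2 z : {for z, continuous (fun z : R => gauss1 t z * (b (w - z) - b (w - z - h)))}.
  by apply: continuousM; [exact: cg|apply: continuousB; [exact: cbw|exact: cbwh]].
have c3 z : {for z, continuous F'} by apply: continuousB; [exact: c1|exact: c2].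
exact: c3.
Qed.

(** Beyond this distance every shifted profile vanishes, so the boundary terms at [-L] and [L] are
    0. *)
Let L : R := `|w| + e + h + 1.
Let L0 : 0 < L. Proof. by rewrite /L ltr_wpDl// !addr_ge0// ltW. Qed.

Let outL z : L <= `|z| -> [/\ B (w - z) = 0, b (w - z) = 0 & b (w - z - h) = 0].
Proof.
move=> Lz; have wz : e + h + 1 <= `|w - z|.
  have := lerB_dist z w; rewrite (distrC z) => h1.
  by move: Lz; rewrite /L; lra.
have e1 := e0; have h1 := h0; split.
- by apply: step_diff_out => //; lra.
- by apply: bump_out => //; lra.
- apply: bump_out => //; have := lerB_dist (w - z) h; rewrite (gtr0_norm h0).
  by lra.
Qed.

Let mb : measurable_fun setT b. Proof. exact: continuous_measurable_fun. Qed.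
Let mB : measurable_fun setT B. Proof. exact: continuous_measurable_fun. Qed.
Let g0 := @gauss1_ge0 R.

Let gE : (\int[leb]_z (gauss1 t z)%:E = 1)%E.
Proof.
rewrite -[RHS](gauss1_integral 0 t0); apply: eq_integral => z _.
by rewrite subr0.
Qed.

Let ig : leb.-integrable setT (EFin \o gauss1 t).
Proof.
apply: integrable_lt_pinfty; first by mfun.
by under eq_integral do rewrite ger0_norm//; rewrite gE ltry.
Qed.

Let igm (f : R -> R) (K : R) : measurable_fun setT f -> (forall z, `|f z| <= K) ->
  leb.-integrable setT (EFin \o (fun z => gauss1 t z * f z)).
Proof.
move=> mf fK; apply: (@integrableR_le _ _ _ leb _ (fun z => K * gauss1 t z)).
- by mfun.
- exact: integrableR_Zl.
move=> z; rewrite [K * _]mulrC !(normrM (gauss1 t z)) (ger0_norm (g0 _ _)) ler_wpM2l//.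
by apply: (le_trans (fK _)); exact: ler_norm.
Qed.

Lemma gauss1_bump_integrable u : leb.-integrable setT (EFin \o (fun z => gauss1 t z * b (u - z))).
Proof.
have [K _ hK] := @smooth1_bounded R b e 0 (smooth1_bump e0) (fun x ex => bump_out (ltW ex)).
by apply: (igm (K := K)); [mfun|move=> z; exact: hK].
Qed.

Lemma gauss1_moment_integrable : leb.-integrable setT (EFin \o (fun z => gauss1 t z * (z * B (w - z)))).
Proof.
have e1 := e0; have h1 := h0.
have out x : e + h < `|x| -> B x = 0 by move=> ex; apply: step_diff_out => //; exact: ltW.
have [K K0 hK] := @smooth1_bounded R B (e + h) 0 (smooth1_step_diff e0 h) out.
apply: (igm (K := L * K)); first by mfun.
move=> z; rewrite normrM; have [zL|Lz] := leP `|z| L.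
  by rewrite ler_pM//; exact: hK.
have [-> _ _] := outL (ltW Lz).
by rewrite normr0 mulr0 mulr_ge0// ltW.
Qed.

(** Since [z gauss1 t z] is [- 2 t] times the derivative of the Gaussian, the derivative moves onto
    [step_diff] and becomes a difference of bumps. *)
Lemma gauss1_by_parts :
  \int[leb]_z (gauss1 t z * (z * B (w - z))) =
  - (2 * t) * (\int[leb]_z (gauss1 t z * b (w - z)) - \int[leb]_z (gauss1 t z * b (w - h - z))).
Proof.
have I1 := gauss1_bump_integrable w; have I2 := gauss1_bump_integrable (w - h).
have I3 := gauss1_moment_integrable.
have F'0 : (\int[leb]_z (F' z)%:E = 0)%E.
  transitivity (\int[leb]_(z in `[(- L)%R, L]) (F' z)%:E)%E.
    apply: integral_setT_ifE => // z /=; rewrite in_itv/= => /negP.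
    rewrite -ler_norml -ltNge => Lz; have [e1 e2 e3] := outL (ltW Lz).
    by rewrite /F' e1 e2 e3 mulr0 subrr mulr0 subrr.
  have cF z : {for z, continuous F}.
    apply/differentiable_continuous/derivable1_diffP.
    by have [] := FF' z.
  rewrite (@continuous_FTC2 _ _ F).
  - have FL z : `|z| = L -> F z = 0.
      by move=> zL; rewrite /F; have [-> _ _] := @outL z (ltac:(rewrite zL; exact: lexx)); rewrite mulr0.
    by rewrite !FL ?subee// ?normrN gtr0_norm.
  - by have l0 := L0; lra.
  - by apply: continuous_subspaceT; exact: cF'.
  - split.
    + by move=> z _; have [] := FF' z.
    + by apply: cvg_at_right_filter; exact: cF.
    + by apply: cvg_at_left_filter; exact: cF.
  - by move=> z _; rewrite derive1E; have [_ ->] := FF' z.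
have t2 : 2 * t != 0 by rewrite mulf_neq0// gt_eqF.
have : \int[leb]_z (- (2 * t)^-1 * (gauss1 t z * (z * B (w - z))) -
     (gauss1 t z * b (w - z) - gauss1 t z * b (w - h - z))) = 0.
  rewrite /Rintegral -[RHS]/(fine 0%E) -F'0; congr fine; apply: eq_integral => z _.
  by rewrite /F' (addrAC w) ; congr EFin; ring.
rewrite RintegralB//; last 2 first.
- exact: integrableR_Zl.
- exact: integrableR_B.
rewrite RintegralZl// RintegralB//.
set X := Rintegral _ _ _; set Y := Rintegral _ _ _; set Z := Rintegral _ _ _.
move=> h1; rewrite (_ : Y - Z = - (2 * t)^-1 * X); last by lra.
by rewrite mulrA mulrNN divff// mul1r.
Qed.

End gauss1_by_parts.

(** * Subordination to the heat kernel *)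

Section subordination.
Context (R : realType) (n : nat) (alpha : R).
Hypotheses (alpha_gt0 : 0 < alpha) (alpha_lt1 : alpha < 1).
Notation leb := (@lebesgue_measure R).
Let s : R := (n%:R + alpha + 1) / 2.
Let S : \bar R := (\int[leb]_t ((pw (- s - 1) t)%:E * (expR (- (4 * t)^-1))%:E))%E.
Let pw0 := @pw_ge0 R.

Let s_gt0 : 0 < s.
Proof. by rewrite divr_gt0// addr_gt0// ltr_wpDl. Qed.

Let S_gt0 : (0 < S)%E.
Proof.
apply: (@integral_gt0 _ _ (2 `^ (- s - 1) * expR (- 4^-1))).
- by rewrite mulr_gt0 ?powR_gt0 ?expR_gt0.
- by mfun.
- by nneg.
move=> t /andP[t1 t2]; have t0 : 0 < t by exact: lt_le_trans t1.
rewrite -EFinM lee_fin pwE//; apply: ler_pM; rewrite ?powR_ge0 ?expR_ge0//.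
  rewrite -[- s - 1]opprK !(powRN _ (- (- s - 1))) lef_pV2 ?posrE ?powR_gt0//.
  apply: ge0_ler_powR; rewrite ?nnegrE//; last exact: ltW.
  by rewrite opprB opprK addr_ge0// ltW.
by rewrite ler_expR lerN2 lef_pV2 ?posrE ?mulr_gt0// ler_peMr.
Qed.

Let S_fin : (S < +oo)%E.
Proof.
have s1 : 0 <= s + 1 by rewrite addr_ge0// ltW.
have [C C0 hC] := @expRN_le_powR R (s + 1) 0 s1.
have ifpw0 (b : bool) c t : 0 <= (if b then pw c t else 0 : R) by case: b.
have C4 : 0 <= C * 4 `^ (s + 1) by rewrite mulr_ge0 ?powR_ge0// ltW.
apply: (@le_lt_trans _ _ (\int[leb]_t
  ((C * 4 `^ (s + 1))%:E * (if t <= 1 then pw (1 - 1) t else 0)%:E +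
    (if 1 <= t then pw (- s - 1) t else 0)%:E))%E).
  apply: le_integralT; [by nneg|by mfun|by mfun|].
  move=> t; rewrite -!EFinM -EFinD lee_fin; have [t0|t0] := leP t 0.
    by rewrite {1}/pw ltNge t0/= mul0r addr_ge0// mulr_ge0.
  have [t1|t1] := leP t 1.
    rewrite -[leLHS]addr0 lerD//.
    apply: (@le_trans _ _ (pw (- s - 1) t * (C * (4 * t)^-1 `^ (- (s + 1))))).
      by rewrite ler_wpM2l// hC// invr_gt0 mulr_gt0.
    rewrite !pwE// mulrCA -!mulrA ler_wpM2l ?(ltW C0)//.
    rewrite -powR_inv1 ?mulr_ge0 ?(ltW t0)// -powRrM mulN1r opprK powRM ?(ltW t0)//.
    rewrite mulrCA ler_wpM2l ?powR_ge0// -powRD ?(gt_eqF t0) ?implybT//.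
    by rewrite subrr powRr0 (_ : - s - 1 + (s + 1) = 0) ?powRr0//; ring.
  rewrite (ltW t1) mulr0 add0r ler_piMr//.
  by rewrite -expR0 ler_expR oppr_le0 invr_ge0 mulr_ge0// ltW.
rewrite ge0_integralD; try side.
rewrite ge0_integralZl; try side.
rewrite lte_add_pinfty// ?lte_mul_pinfty ?lee_fin//.
  by apply: le_lt_trans (integral_pw_near0 ltr01 ltr01) _; rewrite ltry.
by apply: le_lt_trans (integral_pw_nearoo s_gt0 ltr01) _; rewrite ltry.
Qed.

(** Scaling time by [|z|^2] extracts [|z|^(-2 s)] with [2 s = n + alpha + 1]; the exponent
    [-(alpha+3)/2] is what remains of [-s - 1] once the Gaussian has supplied [t^(-n/2)]. The
    constant is [E = (4 pi)^(-n/2) S]. *)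
Lemma gaussn_subordination : exists2 E : R, 0 < E & forall z : 'rV[R]_n, z != 0 ->
  (\int[leb]_t (pw (- (alpha + 3) / 2) t * gaussn t z)%:E =
   (E / enorm z `^ (n%:R + alpha + 1))%:E)%E.
Proof.
have Sfin : S \is a fin_num by rewrite ge0_fin_numE// ltW.
have pi0 := pi_gt0 R.
pose k : R := (Num.sqrt (4 * pi))^-1 ^+ n.
have k0 : 0 < k by rewrite exprn_gt0// invr_gt0 sqrtr_gt0 mulr_gt0.
exists (k * fine S); first by rewrite mulr_gt0// fine_gt0// S_gt0.
move=> z z0; pose r := dotv z z.
have r0 : 0 < r.
  rewrite lt_neqAle dotv_ge0 andbT; apply: contra z0 => /eqP rz.
  apply/eqP/rowP => j; rewrite mxE; apply/eqP; rewrite -sqrf_eq0 expr2.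
  have zz (i : 'I_n) : true -> 0 <= z ord0 i * z ord0 i by rewrite -expr2 sqr_ge0.
  by rewrite (psumr_eq0P zz (esym rz)).
transitivity (\int[leb]_t (k%:E * ((pw (- s - 1) t)%:E * (expR (- (r / (4 * t))))%:E)))%E.
  apply: eq_integral => t _; rewrite -!EFinM; congr EFin.
  have [t0|t0] := leP t 0; first by rewrite /pw ltNge t0/= !mul0r mulr0.
  rewrite !pwE// /gaussn -/r sqrtrM ?mulr_ge0 ?(ltW pi0)// invfM exprMn -/k.
  rewrite -[k * _ * _]mulrA mulrCA; congr (k * _); rewrite mulrA; congr (_ * _).
  have -> : (Num.sqrt t)^-1 = t `^ (- 2^-1) by rewrite -powR12_sqrt ?(ltW t0)// powRN.
  rewrite -powR_mulrn ?powR_ge0// -powRrM -powRD ?(gt_eqF t0) ?implybT//; congr (_ `^ _).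
  by rewrite /s; field.
rewrite ge0_integralZl; try side.
rewrite (@integral_pw_scale _ (- s - 1) (fun t => (expR (- (r / (4 * t))))%:E) r r0); last 2 first.
- by mfun.
- by nneg.
have -> : (\int[leb]_t ((pw (- s - 1) t)%:E * (expR (- (r / (4 * (r * t)))))%:E) = S)%E.
  apply: eq_integral => t _; congr (_ * (expR (- _))%:E)%E.
  rewrite mulrCA invfM mulrA divff ?mul1r// gt_eqF//.
rewrite -(fineK Sfin) -!EFinM /=; congr EFin; rewrite -mulrA; congr (_ * _).
rewrite mulrC; congr (_ * _); rewrite -powRN (_ : - s - 1 + 1 = - s); last by ring.
have er : r = enorm z `^ 2%:R by rewrite powR_mulrn ?sqrtr_ge0// sqr_sqrtr ?dotv_ge0.
by rewrite er -powRrM; congr (_ `^ _); rewrite /s; field.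
Qed.

End subordination.

Section mollifier.
Context (R : realType) (n : nat) (e : R).
Hypothesis e0 : 0 < e.
Notation mu := (lebesgue_rV R n).
Implicit Types (w z : 'rV[R]_n).

Definition mollifier z : R := \prod_(j < n) bump e (z ord0 j).

Definition heat_mollifier t w : R := \int[mu]_z (gaussn t z * mollifier (w - z)).

Let mbump : measurable_fun setT (bump e).
Proof. by apply: continuous_measurable_fun; apply: smooth1_continuous; exact: smooth1_bump. Qed.

Lemma measurable_mollifier : measurable_fun setT mollifier.
Proof. by apply: measurable_prod => j; mfun. Qed.

Lemma mollifier_ge0 z : 0 <= mollifier z.
Proof. by apply: prodr_ge0 => j _; exact: bump_ge0. Qed.

Lemma integral_mollifier : (\int[mu]_z (mollifier z)%:E = 1)%E.
Proof.
rewrite (integral_rV_prod (a := fun=> bump e))//; last by move=> _ x; exact: bump_ge0.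
by rewrite big1// => j _; exact: integral_bump.
Qed.

Let bump_bounded : exists2 K : R, 0 <= K & forall x, `|bump e x| <= K.
Proof.
have := @smooth1_bounded R (bump e) e 0 (smooth1_bump e0) (fun x ex => bump_out (ltW ex)).
by [].
Qed.

Lemma mollifier_bounded : exists2 K : R, 0 <= K & forall z, mollifier z <= K.
Proof.
have [K K0 hK] := bump_bounded; exists (K ^+ n); first exact: exprn_ge0.
move=> z; rewrite -[n in leRHS]card_ord -prodr_const; apply: ler_prod => j _.
by rewrite bump_ge0/= (le_trans (ler_norm _)).
Qed.

Lemma measurable_heat_mollifier d (T : measurableType d) (f : T -> R) (g : T -> 'rV[R]_n) :
  measurable_fun setT f -> measurable_fun setT g ->
  measurable_fun setT (fun u => heat_mollifier (f u) (g u)).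
Proof.
by move=> mf mg; have mm := measurable_mollifier; rewrite /heat_mollifier; mfun.
Qed.

Lemma heat_mollifier_ge0 t w : 0 <= heat_mollifier t w.
Proof. by apply: Rintegral_ge0 => z _; rewrite mulr_ge0 ?gaussn_ge0// mollifier_ge0. Qed.

Lemma heat_mollifierE t w : 0 < t ->
  (heat_mollifier t w)%:E = (\int[mu]_z (gaussn t z * mollifier (w - z))%:E)%E.
Proof.
move=> t0; have [K K0 hK] := mollifier_bounded.
have m0 := mollifier_ge0; have mm := measurable_mollifier.
apply: EFin_Rintegral_ge0; first by move=> z; rewrite mulr_ge0 ?gaussn_ge0.
apply: (@le_lt_trans _ _ (\int[mu]_z (K%:E * (gaussn t z)%:E))%E).
  apply: le_integralT; [by nneg|by mfun|by mfun|].
  by move=> z; rewrite -EFinM lee_fin mulrC ler_wpM2r ?gaussn_ge0.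
by rewrite ge0_integralZl ?gaussn_integral1 ?mule1 ?ltry; try side.
Qed.

Lemma heat_mollifier_le_gpeak t w : 0 < t -> heat_mollifier t w <= gpeak n t.
Proof.
move=> t0; have m0 := mollifier_ge0; have mm := measurable_mollifier.
rewrite -lee_fin heat_mollifierE//.
apply: (@le_trans _ _ (\int[mu]_z ((gpeak n t)%:E * (mollifier (w - z))%:E))%E).
  apply: le_integralT; [by nneg|by mfun|by mfun|].
  by move=> z; rewrite -EFinM lee_fin ler_wpM2r// gaussn_le.
rewrite ge0_integralZl; try side.
by rewrite (integral_rVBr w (F := fun z => (mollifier z)%:E)) ?integral_mollifier ?mule1; try side.
Qed.

Lemma heat_mollifier_bounded : exists2 K : R, 0 <= K & forall t w, 0 < t -> heat_mollifier t w <= K.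
Proof.
have [K K0 hK] := mollifier_bounded; exists K => // t w t0.
have m0 := mollifier_ge0; have mm := measurable_mollifier.
rewrite -lee_fin heat_mollifierE//.
apply: (@le_trans _ _ (\int[mu]_z (K%:E * (gaussn t z)%:E))%E).
  apply: le_integralT; [by nneg|by mfun|by mfun|].
  by move=> z; rewrite -EFinM lee_fin mulrC ler_wpM2r ?gaussn_ge0.
by rewrite ge0_integralZl ?gaussn_integral1 ?mule1; try side.
Qed.

Section riesz_mollifier.
Variable a : R.
Hypotheses (n_ge2 : (2 <= n)%N) (a_gt0 : 0 < a) (a_lt1 : a < 1).
Notation leb := (@lebesgue_measure R).

(** The Riesz potential of order [2 a] of the mollifier, up to the factor [Gamma(a)]. *)
Definition riesz_mollifier w : R := \int[leb]_t (pw (a - 1) t * heat_mollifier t w).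

(** Up to time 1 the heat flow is bounded by the supremum of the mollifier; afterwards it is bounded
    by the peak of the heat kernel, which decays like [1/t]. *)
Lemma riesz_mollifier_bounded : exists2 K : R, 0 <= K &
  forall w, (\int[leb]_t (pw (a - 1) t * heat_mollifier t w)%:E <= K%:E)%E.
Proof.
have [K K0 hK] := heat_mollifier_bounded; have a1 : 0 < 1 - a by rewrite subr_gt0.
have if0 (b : bool) c t : 0 <= (if b then pw c t else 0 : R) by case: b => //; exact: pw_ge0.
exists (K * (1 `^ a / a) + 1 `^ (- (1 - a)) / (1 - a)).
  by rewrite addr_ge0 ?(mulr_ge0 K0)// divr_ge0 ?powR_ge0 ?(ltW a_gt0) ?(ltW a1).
move=> w; apply: (@le_trans _ _ (\int[leb]_tau
  (K%:E * (if tau <= 1 then pw (a - 1) tau else 0)%:E +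
   (if 1 <= tau then pw (- (1 - a) - 1) tau else 0)%:E))%E).
  have mh : measurable_fun setT (fun t => heat_mollifier t w) by apply: measurable_heat_mollifier; mfun.
  have h0 := heat_mollifier_ge0.
  apply: le_integralT; [by nneg|by mfun|by mfun|].
  move=> tau; rewrite -EFinM -EFinD lee_fin.
  have [t0|t0] := leP tau 0.
    by rewrite {1}/pw ltNge t0/= mul0r addr_ge0 ?mulr_ge0 ?if0.
  have [t1|t1] := leP tau 1.
    by rewrite mulrC -[leLHS]addr0 lerD ?if0// ler_wpM2r ?pw_ge0// hK.
  rewrite (ltW t1) mulr0 add0r !pwE//.
  apply: (@le_trans _ _ (tau `^ (a - 1) * tau^-1)).
    rewrite ler_wpM2l ?powR_ge0//; apply: (@le_trans _ _ (gpeak n tau)).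
      exact: heat_mollifier_le_gpeak.
    by apply: gpeak_tail => //; exact: ltW.
  rewrite -[X in _ * X]powR_inv1 ?(ltW t0)// -powRD ?(gt_eqF t0) ?implybT//.
  by rewrite (_ : a - 1 + -1 = - (1 - a) - 1)//; ring.
rewrite ge0_integralD; try side.
rewrite ge0_integralZl; try side.
rewrite EFinD leeD//; last by exact: (integral_pw_nearoo a1 ltr01).
by rewrite EFinM lee_wpmul2l ?lee_fin//; exact: (integral_pw_near0 a_gt0 ltr01).
Qed.

End riesz_mollifier.
End mollifier.

(** * The fractional divergence as a finite difference of a potential *)

Section representation.
Context (R : realType) (n : nat) (alpha : R).
Hypotheses (n_ge2 : (2 <= n)%N) (alpha_gt0 : 0 < alpha) (alpha_lt1 : alpha < 1).
Notation leb := (@lebesgue_measure R).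
Notation mu := (lebesgue_rV R n).
Implicit Types (x y z w : 'rV[R]_n) (t : R).
Variables (i : 'I_n) (e h : R).
Hypotheses (e0 : 0 < e) (h0 : 0 < h).
Let a : R := (1 - alpha) / 2.
Let ei : 'rV[R]_n := delta_mx ord0 i.
Let g0 := @gaussn_ge0 R n.

Let a_gt0 : 0 < a. Proof. by rewrite divr_gt0// subr_gt0. Qed.
Let a_lt1 : a < 1. Proof. by have := alpha_gt0; rewrite /a; lra. Qed.

(** The corresponding product is the mollifier integrated over a segment of length [h] in direction
    [i]. Its derivative in that direction is a difference of two translated mollifiers. *)
Definition shift_profile (j : 'I_n) : R -> R := if j == i then step_diff e h else bump e.

Lemma smooth1_shift_profile j : smooth1 (shift_profile j).
Proof.
by rewrite /shift_profile; case: ifP => _; [exact: smooth1_step_diff|exact: smooth1_bump].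
Qed.

Lemma shift_profile_out j (r : R) : e + h < `|r| -> shift_profile j r = 0.
Proof.
move=> ehr; rewrite /shift_profile; case: ifP => _.
  by apply: step_diff_out => //; exact: ltW.
apply: bump_out => //; apply: ltW; apply: le_lt_trans ehr.
by rewrite lerDl ltW.
Qed.

Lemma shift_profile_ge0 j r : 0 <= shift_profile j r.
Proof. by rewrite /shift_profile; case: ifP => _; [exact: step_diff_ge0|exact: bump_ge0]. Qed.

Let m := prodk shift_profile (fun=> 0%N).

Lemma integral_prodk_shift : (\int[mu]_z (m z)%:E = h%:E)%E.
Proof.
rewrite (integral_rV_prod (a := shift_profile)); last 2 first.
- by move=> j; apply: continuous_measurable_fun; apply: smooth1_continuous; exact: smooth1_shift_profile.
- by move=> j r; exact: shift_profile_ge0.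
rewrite (bigD1 i)//= big1 ?mule1; first by rewrite /shift_profile eqxx integral_step_diff.
by move=> j /negbTE ji; rewrite /shift_profile ji integral_bump.
Qed.

Lemma prodk_shift_ge0 z : 0 <= m z.
Proof. by apply: prodr_ge0 => j _; exact: shift_profile_ge0. Qed.

Let mm : measurable_fun setT m.
Proof. by apply: measurable_prodk => j; exact: smooth1_shift_profile. Qed.

Let m_bounded : exists2 K : R, 0 <= K & forall z, `|m z| <= K.
Proof.
by apply: (@prodk_bounded _ _ _ (e + h)); [exact: smooth1_shift_profile|exact: shift_profile_out].
Qed.

Let moment_integrable t (F : 'rV[R]_n -> R) (K : R) : 0 < t -> measurable_fun setT F ->
  (forall z, `|F z| <= K) ->
  mu.-integrable setT (EFin \o (fun z => gaussn t z * (z ord0 i * F z))).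
Proof.
move=> t0 mF FK; have [C C0 hC] := gaussn_moment R n.
have t20 : 0 < 2 * t by rewrite mulr_gt0.
apply: (@integrableR_le _ _ _ mu _ (fun z => C * Num.sqrt t * K * gaussn (2 * t) z)).
- by mfun.
- by apply: integrableR_Zl; exact: integrable_gaussn.
move=> z; have K0 : 0 <= K by apply: le_trans (FK 0).
rewrite [leRHS]ger0_norm; last by rewrite !mulr_ge0 ?sqrtr_ge0// ltW.
rewrite (normrM (gaussn t z)) (normrM (z ord0 i)) (ger0_norm (g0 t z)) mulrA (mulrAC _ K).
by rewrite ler_pM ?mulr_ge0//; exact: hC.
Qed.

Let mb : measurable_fun setT (bump e).
Proof. by apply: continuous_measurable_fun; apply: smooth1_continuous; exact: smooth1_bump. Qed.
Let mB : measurable_fun setT (step_diff e h).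
Proof. by apply: continuous_measurable_fun; apply: smooth1_continuous; exact: smooth1_step_diff. Qed.

Let gb t w (j : 'I_n) r : R := gauss1 t r * bump e (w ord0 j - r).

Let gb_ge0 t w j r : 0 <= gb t w j r.
Proof. by rewrite mulr_ge0 ?gauss1_ge0// bump_ge0. Qed.

Let mgb t w j : measurable_fun setT (gb t w j).
Proof. by rewrite /gb; mfun. Qed.

Let gb_fin t w j : 0 < t -> (\int[leb]_r (gb t w j r)%:E < +oo)%E.
Proof.
move=> t0; have := integrableR_fin (gauss1_bump_integrable t0 e0 (w ord0 j)).
by under eq_integral do rewrite (ger0_norm (gb_ge0 _ _ _ _)).
Qed.

Let heat_mollifier_split t w r : 0 < t ->
  heat_mollifier e t (w - r *: ei) =
  (\int[leb]_u (gauss1 t u * bump e (w ord0 i - r - u))) *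
  \prod_(j < n | j != i) \int[leb]_u gb t w j u.
Proof.
move=> t0; pose p u : R := gauss1 t u * bump e (w ord0 i - r - u).
have mp : measurable_fun setT p by rewrite /p; mfun.
have p0 u : 0 <= p u by rewrite mulr_ge0 ?gauss1_ge0// bump_ge0.
have pfin : (\int[leb]_u (p u)%:E < +oo)%E.
  have := integrableR_fin (gauss1_bump_integrable t0 e0 (w ord0 i - r)).
  by under eq_integral do rewrite (ger0_norm (p0 _)).
have z0fin : (\int[leb]_u (0 : R)%:E < +oo)%E by rewrite integral0 ltry.
have := @Rintegral_rV_prod1 R n i (gb t w) p (fun=> 0) (mgb t w) (gb_ge0 t w)
  (fun j => gb_fin w j t0) mp p0 pfin (@measurable_cst _ _ _ _ _ _) (fun=> lexx 0) z0fin.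
have -> : \int[leb]_u (0 : R) = 0 by rewrite /Rintegral integral0.
rewrite subr0 => <-; apply: eq_Rintegral => z _.
rewrite gaussn_prod -big_split/= (bigD1 i)//= subr0; congr (_ * _).
  by rewrite !mxE !eqxx mulr1.
by apply: eq_bigr => j ji; rewrite !mxE (negbTE ji) andbF mulr0 subr0.
Qed.

(** Only the factor of index [i] sees [z_i], so the integral factors and the one-dimensional
    integration by parts applies. The result is a finite difference of the heat flow of the
    mollifier. *)
Lemma heat_moment t w : 0 < t ->
  \int[mu]_z (gaussn t z * (z ord0 i * (m (w - z) - m w))) =
  - (2 * t) * (heat_mollifier e t w - heat_mollifier e t (w - h *: ei)).
Proof.
move=> t0; have [K K0 hK] := m_bounded.
under eq_Rintegral do rewrite mulrBr mulrBr.
rewrite RintegralB//; last 2 first.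
- by apply: (moment_integrable (K := K)) => //; mfun.
- by apply: (moment_integrable (K := K)) => //; mfun.
(* The integrand is odd, so reflection shows the integral equal to its opposite. *)
have -> : \int[mu]_z (gaussn t z * (z ord0 i * m w)) = 0.
  have mF : measurable_fun setT (fun z => gaussn t z * (z ord0 i * m w)) by mfun.
  have := Rintegral_rVBr 0 mF.
  under eq_Rintegral => z _.
    rewrite sub0r gaussnN mxE mulNr mulrN -mulN1r.
    over.
  rewrite RintegralZl//; last by apply: (moment_integrable (K := K)) => //; mfun.
  by rewrite mulN1r => /eqP; rewrite eq_sym -addr_eq0 -mulr2n mulrn_eq0/= => /eqP.
rewrite subr0.
pose F r : R := gauss1 t r * (r * step_diff e h (w ord0 i - r)).
(* Positive and negative parts, because [Rintegral_rV_prod1] takes the signed factor as a difference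
   of nonnegative functions. *)
pose p r : R := Num.max (F r) 0; pose q r : R := Num.max (- F r) 0.
have pq r : p r - q r = F r.
  rewrite /p /q; have [F0|F0] := leP (F r) 0.
    by rewrite max_l ?oppr_ge0// sub0r opprK.
  by rewrite max_r ?subr0// oppr_le0 ltW.
have mF : measurable_fun setT F by rewrite /F; mfun.
have iF := gauss1_moment_integrable (w ord0 i) t0 e0 h0.
have mp : measurable_fun setT p by apply: measurable_maxr => //; exact: measurable_cst.
have mq : measurable_fun setT q by apply: measurable_maxr; [exact: measurableT_comp|exact: measurable_cst].
have p0 r : 0 <= p r by rewrite le_max lexx orbT.
have q0 r : 0 <= q r by rewrite le_max lexx orbT.
have pfin : (\int[leb]_r (p r)%:E < +oo)%E.
  apply: le_lt_trans (integrableR_fin iF); apply: le_integralT; [by nneg|by mfun|by mfun|].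
  by move=> r; rewrite lee_fin ge_max normr_ge0 ler_norm.
have qfin : (\int[leb]_r (q r)%:E < +oo)%E.
  apply: le_lt_trans (integrableR_fin iF); apply: le_integralT; [by nneg|by mfun|by mfun|].
  by move=> r; rewrite lee_fin ge_max normr_ge0 -normrN ler_norm.
have ip : leb.-integrable setT (EFin \o p).
  by apply: integrable_lt_pinfty => //; under eq_integral do rewrite ger0_norm//.
have iq : leb.-integrable setT (EFin \o q).
  by apply: integrable_lt_pinfty => //; under eq_integral do rewrite ger0_norm//.
have := @Rintegral_rV_prod1 R n i (gb t w) p q (mgb t w) (gb_ge0 t w)
  (fun j => gb_fin w j t0) mp p0 pfin mq q0 qfin.
rewrite -RintegralB//; under [X in _ = X * _]eq_Rintegral do rewrite pq.
rewrite /F gauss1_by_parts// => E1.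
transitivity (\int[mu]_x ((p (x ord0 i) - q (x ord0 i)) * \prod_(j < n | j != i) gb t w j (x ord0 j))).
  apply: eq_Rintegral => z _; rewrite pq gaussn_prod /m /prodk mulrCA -big_split/=.
  rewrite (bigD1 i)//= [in RHS]/F mulrA; congr (_ * _).
    by rewrite mulrCA /shift_profile eqxx !mxE.
  by apply: eq_bigr => j ji; rewrite /shift_profile (negbTE ji) !mxE.
rewrite E1 -mulrA; congr (_ * _); rewrite mulrBl heat_mollifier_split//; congr (_ - _).
have := heat_mollifier_split w 0 t0; rewrite scale0r !subr0 => ->.
by [].
Qed.

Variables (g : 'rV[R]_n -> R) (N : R).
Hypotheses (mg : measurable_fun setT g) (ig : mu.-integrable setT (EFin \o g))
  (gN : forall y j, N < `|y ord0 j| -> g y = 0).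

Let psi := prodk_conv shift_profile g (fun=> 0%N).
Let q x z : R := z ord0 i * (psi (x + z) - psi x).

Let mpsi : measurable_fun setT psi.
Proof. by apply: measurable_prodk_conv => // j; exact: smooth1_shift_profile. Qed.

(** The bound [t] comes from the Lipschitz estimate on [psi] and the bound [sqrt t] from its
    boundedness. Against the weight [t^(-(alpha+3)/2)] the first converges at 0 since [alpha < 1],
    the second at infinity since [alpha > 0]. *)
Let q_moment : exists2 C : R, 0 <= C & forall x t, 0 < t ->
  (\int[mu]_z `|gaussn t z * q x z|%:E <= (C * Num.min t (Num.sqrt t))%:E)%E.
Proof.
have [C C0 hC] := gaussn_moment R n.
have [L L0 hL] := @prodk_conv_lipschitz R n shift_profile (e + h) smooth1_shift_profile
  shift_profile_out g mg ig (fun=> 0%N).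
have [K K0 hK] := @prodk_conv_bounded R n shift_profile (e + h) smooth1_shift_profile
  shift_profile_out g mg ig (fun=> 0%N).
rewrite -/psi in hL hK.
pose D := L * (C * C * Num.sqrt 2 * n%:R) + C * (2 * K).
have D0 : 0 <= D by rewrite addr_ge0// !mulr_ge0 ?sqrtr_ge0// ltW.
exists D => // x t t0.
have g1 (u : R) : 0 < u -> (\int[mu]_z (gaussn u z)%:E = 1)%E by exact: gaussn_integral1.
have t20 : 0 < 2 * t by rewrite mulr_gt0.
have t40 : 0 < 2 * (2 * t) by rewrite mulr_gt0.
have bound (c u : R) : 0 <= c -> 0 < u ->
    (forall z, `|gaussn t z * q x z| <= c * gaussn u z) ->
    (\int[mu]_z `|gaussn t z * q x z|%:E <= c%:E)%E.
  move=> c0 u0 hq; rewrite -[leRHS]mule1 -(g1 _ u0) -ge0_integralZl; try side.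
  rewrite /q; apply: le_integralT; [by nneg|by mfun|by mfun|].
  by move=> z; rewrite -EFinM lee_fin; exact: hq.
have st0 : 0 <= Num.sqrt t by exact: sqrtr_ge0.
have tt : Num.sqrt t * Num.sqrt t = t by rewrite -expr2 sqr_sqrtr// ltW.
rewrite minEle; case: ifP => _.
- apply: (@le_trans _ _ (L * (C * C * Num.sqrt 2 * n%:R) * t)%:E); last first.
    by rewrite lee_fin ler_wpM2r ?(ltW t0)// lerDl !mulr_ge0// ltW.
  apply: (bound _ (2 * (2 * t))) => //; first by rewrite !mulr_ge0 ?sqrtr_ge0// ltW.
  move=> z; rewrite /q (normrM (gaussn t z)) (normrM (z ord0 i)) (ger0_norm (g0 _ _)).
  apply: (@le_trans _ _ (gaussn t z * `|z ord0 i| * (L * \sum_j `|z ord0 j|))).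
    by rewrite mulrA ler_wpM2l ?mulr_ge0.
  apply: (@le_trans _ _ (C * Num.sqrt t * gaussn (2 * t) z * (L * \sum_j `|z ord0 j|))).
    by rewrite ler_wpM2r ?hC// mulr_ge0// sumr_ge0.
  have : gaussn (2 * t) z * (\sum_j `|z ord0 j|) <= n%:R * (C * Num.sqrt (2 * t) * gaussn (2 * (2 * t)) z).
    rewrite mulr_sumr; apply: (@le_trans _ _ (\sum_(j < n) (C * Num.sqrt (2 * t) * gaussn (2 * (2 * t)) z))).
      by apply: ler_sum => j _; exact: hC.
    by rewrite sumr_const card_ord -[leLHS]mulr_natl.
  rewrite (sqrtrM t (ler0n R 2)).
  move: (gaussn (2 * t) z) (gaussn (2 * (2 * t)) z) (\sum_j `|z ord0 j|) => G1 G2 s hs.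
  have hc : 0 <= C * Num.sqrt t * L by rewrite !mulr_ge0// ltW.
  rewrite (_ : _ * (L * s) = C * Num.sqrt t * L * (G1 * s)); last by ring.
  apply: (le_trans (ler_wpM2l hc hs)); rewrite -[X in _ <= _ * X * G2]tt.
  by rewrite le_eqVlt; apply/orP; left; apply/eqP; ring.
- apply: (@le_trans _ _ (C * (2 * K) * Num.sqrt t)%:E); last first.
    by rewrite lee_fin ler_wpM2r// lerDr !mulr_ge0 ?sqrtr_ge0// ltW.
  apply: (bound _ (2 * t)) => //; first by rewrite !mulr_ge0// ltW.
  move=> z; rewrite /q (normrM (gaussn t z)) (normrM (z ord0 i)) (ger0_norm (g0 _ _)).
  apply: (@le_trans _ _ (gaussn t z * `|z ord0 i| * (2 * K))).
    rewrite mulrA ler_wpM2l ?mulr_ge0// (le_trans (ler_normB _ _))// mulr2n mulrDl mul1r.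
    by rewrite lerD.
  apply: (@le_trans _ _ (C * Num.sqrt t * gaussn (2 * t) z * (2 * K))).
    by rewrite ler_wpM2r ?hC// mulr_ge0.
  by move: (gaussn (2 * t) z) => G1; rewrite le_eqVlt; apply/orP; left; apply/eqP; ring.
Qed.

Let heat_q t x : 0 < t ->
  \int[mu]_z (gaussn t z * q x z) =
  - (2 * t) * \int[mu]_y ((heat_mollifier e t (y - x) - heat_mollifier e t (y - x - h *: ei)) * g y).
Proof.
move=> t0; have [K K0 hK] := m_bounded.
have [C C0 hC] := gaussn_moment R n.
have t20 : 0 < 2 * t by rewrite mulr_gt0.
have imc y : mu.-integrable setT (EFin \o (fun x => m (x - y) * g x)).
  by apply: (@integrable_prodk_conv _ _ _ (e + h)); [exact: smooth1_shift_profile|exact: shift_profile_out| |].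
pose G := \int[mu]_y `|g y|.
have GE : (\int[mu]_y `|g y|%:E)%E = G%:E.
  by rewrite EFin_Rintegral_ge0//; exact: integrableR_fin.
transitivity (\int[mu]_z \int[mu]_y (gaussn t z * (z ord0 i * (m (y - x - z) - m (y - x))) * g y)).
  apply: eq_Rintegral => z _; rewrite /q /psi /prodk_conv.
  rewrite -RintegralB//.
  rewrite mulrA -RintegralZl//; last by apply: integrableR_B; exact: imc.
  apply: eq_Rintegral => y _; rewrite opprD addrA -/m; ring.
rewrite (@Rintegral_swap_le _ _ _ _ _ mu mu _ (fun z => 2 * K * G * C * Num.sqrt t * gaussn (2 * t) z)).
- transitivity (\int[mu]_y (- (2 * t) * ((heat_mollifier e t (y - x) - heat_mollifier e t (y - x - h *: ei)) * g y))).
    apply: eq_Rintegral => y _; rewrite RintegralZr ?heat_moment ?mulrA//.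
    apply: (moment_integrable (K := 2 * K)) => //; first by mfun.
    by move=> z; rewrite (le_trans (ler_normB _ _))// mulr2n mulrDl mul1r lerD.
  rewrite RintegralZl//.
  have [KK KK0 hKK] := @heat_mollifier_bounded R n e e0.
  have mh1 : measurable_fun setT (fun y => heat_mollifier e t (y - x)).
    by apply: measurable_heat_mollifier => //; mfun.
  have mh2 : measurable_fun setT (fun y => heat_mollifier e t (y - x - h *: ei)).
    by apply: measurable_heat_mollifier => //; mfun.
  apply: (@integrableR_le _ _ _ mu _ (fun y => 2 * KK * g y)).
  + exact: (measurable_funM (measurable_funB mh1 mh2) mg).
  + exact: integrableR_Zl.
  have hm := @heat_mollifier_ge0 R n e t.
  have dist2 (A B : R) : 0 <= A -> 0 <= B -> A <= KK -> B <= KK -> `|A - B| <= `|2 * KK|.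
    move=> A0 B0 AK BK; rewrite [leRHS]ger0_norm ?mulr_ge0//.
    by rewrite ler_norml; apply/andP; split; lra.
  move=> y; rewrite (normrM _ (g y)) (normrM (2 * KK)); apply: ler_wpM2r => //.
  exact: (dist2 _ _ (hm _) (hm _) (hKK _ _ t0) (hKK _ _ t0)).
- by mfun.
- by apply: integrableR_Zl; exact: integrable_gaussn.
- move=> z; apply: (@le_trans _ _ ((gaussn t z * `|z ord0 i| * (2 * K))%:E * G%:E)%E); last first.
    rewrite -EFinM lee_fin; have := hC t z i t0 => hz.
    have G0 : 0 <= G by exact: Rintegral_ge0.
    have hKG : 0 <= 2 * K * G by rewrite !mulr_ge0.
    have := ler_wpM2r hKG hz; congr (_ <= _); ring.
  have c0 : 0 <= gaussn t z * `|z ord0 i| * (2 * K) by rewrite !mulr_ge0.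
  rewrite -GE -ge0_integralZl; try side.
  apply: le_integralT; [by nneg|by mfun|by mfun|].
  move=> y; rewrite -EFinM lee_fin (normrM _ (g y)) (normrM (gaussn t z)) (normrM (z ord0 i)) (ger0_norm (g0 t z)) ler_wpM2r// mulrA.
  rewrite ler_wpM2l ?mulr_ge0// (le_trans (ler_normB _ _))// mulr2n mulrDl mul1r.
  by rewrite lerD.
- move=> y; have mh : mu.-integrable setT (EFin \o (fun z => gaussn t z * (z ord0 i * (m (y - x - z) - m (y - x))))).
    apply: (moment_integrable (K := 2 * K)) => //; first by mfun.
    by move=> z; rewrite (le_trans (ler_normB _ _))// mulr2n mulrDl mul1r lerD.
  apply: integrableR_fin; under eq_fun do rewrite mulrC.
  exact: integrableR_Zl.
Qed.

Let kap := @riesz_mollifier R n e a.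
Let W t : R := pw (- (alpha + 3) / 2) t.
Let pw0 := @pw_ge0 R.

Let mheat (w : 'rV[R]_n) : measurable_fun setT (fun p : 'rV[R]_n * R => heat_mollifier e p.2 (p.1 - w)).
Proof. by apply: measurable_heat_mollifier => //; mfun. Qed.

Let mheat1 w : measurable_fun setT (fun t => heat_mollifier e t w).
Proof. by apply: measurable_heat_mollifier => //; mfun. Qed.

Let hm0 := @heat_mollifier_ge0 R n e.

Let heat_time_integrable w : leb.-integrable setT (EFin \o (fun t => pw (a - 1) t * heat_mollifier e t w)).
Proof.
have [K K0 hK] := riesz_mollifier_bounded e0 n_ge2 a_gt0 a_lt1.
have mh := mheat1 w.
apply: integrable_lt_pinfty; first by mfun.
under eq_integral => t _ do rewrite (ger0_norm (mulr_ge0 (pw0 _ _) (hm0 _ _))).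
by apply: le_lt_trans (hK w) _; rewrite ltry.
Qed.

Let mpwheat w : measurable_fun setT (fun t => (pw (a - 1) t * heat_mollifier e t w)%:E).
Proof.
apply/measurable_EFinP; apply: measurable_funM; last exact: mheat1.
exact: measurable_pw.
Qed.

Let kapE w : (kap w)%:E = (\int[leb]_t (pw (a - 1) t * heat_mollifier e t w)%:E)%E.
Proof. by rewrite -(EFin_Rintegral (heat_time_integrable w)). Qed.

Let kap_sub w w' : \int[leb]_t (pw (a - 1) t * (heat_mollifier e t w - heat_mollifier e t w')) = kap w - kap w'.
Proof.
under eq_Rintegral do rewrite mulrBr.
by rewrite RintegralB//; exact: heat_time_integrable.
Qed.

Let time_swap x :
  \int[leb]_t (pw (a - 1) t *
    \int[mu]_y ((heat_mollifier e t (y - x) - heat_mollifier e t (y - x - h *: ei)) * g y)) =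
  \int[mu]_y ((kap (y - x) - kap (y - x - h *: ei)) * g y).
Proof.
have [K K0 hK] := riesz_mollifier_bounded e0 n_ge2 a_gt0 a_lt1.
have [KK KK0 hKK] := heat_mollifier_bounded n e0.
have m1 := mheat x.
have m2 : measurable_fun setT (fun p : 'rV[R]_n * R => heat_mollifier e p.2 (p.1 - x - h *: ei)).
  by apply: measurable_heat_mollifier => //; mfun.
pose D y t : R := heat_mollifier e t (y - x) - heat_mollifier e t (y - x - h *: ei).
have mD : measurable_fun setT (fun p : 'rV[R]_n * R => D p.1 p.2) by exact: (measurable_funB m1 m2).
have mDt t : measurable_fun setT (fun y => D y t).
  exact: (measurableT_comp mD (measurable_fun_pair (@measurable_id _ _ setT) (@measurable_cst _ _ _ _ setT t))).
have mDy y : measurable_fun setT (D y) by exact: (measurable_funB (mheat1 _) (mheat1 _)).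
have DK y t : 0 < t -> `|D y t| <= 2 * KK.
  move=> t0; have := hm0 t (y - x); have := hm0 t (y - x - h *: ei).
  have := hKK t (y - x) t0; have := hKK t (y - x - h *: ei) t0; rewrite /D.
  move: (heat_mollifier _ _ _) (heat_mollifier _ _ _) => A B *.
  by rewrite ler_norml; apply/andP; split; lra.
have igD t : 0 < t -> mu.-integrable setT (EFin \o (fun y => D y t * g y)).
  move=> t0; apply: (@integrableR_le _ _ _ mu _ (fun y => 2 * KK * g y)).
  - exact: (measurable_funM (mDt t) mg).
  - exact: integrableR_Zl.
  move=> y; rewrite (normrM _ (g y)) (normrM (2 * KK)); apply: ler_wpM2r => //.
  by apply: (le_trans (DK _ _ t0)); exact: ler_norm.
transitivity (\int[leb]_t \int[mu]_y (pw (a - 1) t * D y t * g y)).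
  apply: eq_Rintegral => t _; have [t0|t0] := leP t 0.
    by rewrite /pw ltNge t0/= mul0r /Rintegral integral0_eq// => y _; rewrite !mul0r.
  by rewrite -RintegralZl ?igD//; apply: eq_Rintegral => y _; rewrite mulrA.
have mF : measurable_fun setT (fun p : 'rV[R]_n * R => pw (a - 1) p.2 * D p.1 p.2 * g p.1).
  apply: measurable_funM; last by mfun.
  by apply: measurable_funM; [mfun|exact: mD].
clear m1 m2.
rewrite -(@Rintegral_swap_le _ _ _ _ _ mu leb (fun y t => pw (a - 1) t * D y t * g y)
  (fun y => 2 * K * `|g y|)) //.
- apply: eq_Rintegral => y _; rewrite RintegralZr ?kap_sub//.
  apply: (@integrableR_le _ _ _ leb _ (fun t => pw (a - 1) t * heat_mollifier e t (y - x) + pw (a - 1) t * heat_mollifier e t (y - x - h *: ei))).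
  + by apply: measurable_funM; [mfun|exact: mDy].
  + have i1 := heat_time_integrable (y - x); have i2 := heat_time_integrable (y - x - h *: ei).
    by have := integrableD measurableT i1 i2.
  move=> t; have := hm0 t (y - x); have := hm0 t (y - x - h *: ei); rewrite /D.
  move: (heat_mollifier _ _ _) (heat_mollifier _ _ _) => A B A0 B0.
  rewrite -mulrDr !normrM ler_wpM2l// (le_trans (ler_normB _ _))// [leRHS]ger0_norm ?addr_ge0//.
  by rewrite (ger0_norm A0) (ger0_norm B0).
- apply: integrableR_Zl; apply: integrable_lt_pinfty; first by mfun.
  by under eq_integral do rewrite normr_id; exact: integrableR_fin.
- move=> y; apply: (@le_trans _ _ ((2 * K)%:E * `|g y|%:E)%E); last by rewrite -EFinM.
  under eq_integral => t _ do rewrite normrM EFinM.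
  have mpD : measurable_fun setT (fun t => pw (a - 1) t * D y t).
    by apply: measurable_funM; [mfun|exact: mDy].
  rewrite ge0_integralZr; try side.
  apply: lee_wpmul2r; first by rewrite lee_fin.
  apply: (@le_trans _ _ (\int[leb]_t ((pw (a - 1) t * heat_mollifier e t (y - x))%:E +
      (pw (a - 1) t * heat_mollifier e t (y - x - h *: ei))%:E))%E).
    apply: le_integralT.
    + by move=> t; rewrite lee_fin.
    + by apply/measurable_EFinP; apply: measurableT_comp.
    + by apply: emeasurable_funD; exact: mpwheat.
    move=> t; rewrite -EFinD lee_fin; have := hm0 t (y - x); have := hm0 t (y - x - h *: ei); rewrite /D.
    move: (heat_mollifier _ _ _) (heat_mollifier _ _ _) => A B A0 B0.
    rewrite -mulrDr normrM (ger0_norm (pw0 _ _)) ler_wpM2l// (le_trans (ler_normB _ _))//.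
    by rewrite (ger0_norm A0) (ger0_norm B0).
  rewrite ge0_integralD//.
  + by rewrite mulr2n mulrDl mul1r EFinD leeD.
  + by move=> t _; rewrite lee_fin mulr_ge0.
  + exact: mpwheat.
  + by move=> t _; rewrite lee_fin mulr_ge0.
  + exact: mpwheat.
- move=> t; have [t0|t0] := leP t 0.
    rewrite integral0_eq ?ltry// => y _.
    by rewrite /pw ltNge t0/= !mul0r normr0.
  under eq_integral => y _ do rewrite -mulrA.
  by apply: integrableR_fin; apply: integrableR_Zl; exact: igD.
Qed.

Let phi := test_kernel_field shift_profile g i 1 (fun=> 0%N).

(** Behind this is the identity of the fractional divergence with the ordinary divergence of a Riesz
    potential. Subordination replaces the singular kernel by Gaussians, for which the divergence is
    a finite difference times [- 2 t]; the extra [t] changes the weight [t^(-(alpha+3)/2)] into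
    [t^(a-1)], that of the Riesz potential. *)
Lemma frac_representation (E : R) : 0 < E ->
  (forall z : 'rV[R]_n, z != 0 -> (\int[leb]_t (pw (- (alpha + 3) / 2) t * gaussn t z)%:E =
   (E / enorm z `^ (n%:R + alpha + 1))%:E)%E) -> forall x,
  E * \int[mu]_y (dotv (y - x) (phi y - phi x) / enorm (y - x) `^ (n%:R + alpha + 1)) =
  - 2 * \int[mu]_y ((kap (y - x) - kap (y - x - h *: ei)) * g y).
Proof.
move=> E0 hE x; have [C C0 hC] := q_moment.
pose P z : R := enorm z `^ (n%:R + alpha + 1).
have mP : measurable_fun setT P by rewrite /P /enorm; mfun.
have mq : measurable_fun setT (q x) by rewrite /q; mfun.
have -> : \int[mu]_y (dotv (y - x) (phi y - phi x) / enorm (y - x) `^ (n%:R + alpha + 1)) =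
    \int[mu]_z (q x z / P z).
  rewrite -(Rintegral_rVD (- x) (F := fun z => q x z / P z)); last by mfun.
  apply: eq_Rintegral => y _; congr (_ / _).
  rewrite /dotv (bigD1 i)//= big1 => [|j ji].
    by rewrite addr0 /q !mxE !eqxx !mulr1 !mul1r (addrC x) subrK.
  by rewrite !mxE (negbTE ji) andbF !mulr0 subrr mulr0.
have W0 t : 0 <= W t by exact: pw_ge0.
have mW : measurable_fun setT W by exact: measurable_pw.
have if0 (b : bool) c t : 0 <= (if b then pw c t else 0 : R) by case: b => //; exact: pw0.
pose f t : R := C * ((if t <= 1 then pw (a - 1) t else 0) + (if 1 <= t then pw (- (alpha / 2) - 1) t else 0)).
have f0 t : 0 <= f t by rewrite mulr_ge0 ?addr_ge0.
have mf : measurable_fun setT f by rewrite /f; mfun.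
have Wmin t : 0 < t -> W t * Num.min t (Num.sqrt t) <=
    (if t <= 1 then pw (a - 1) t else 0) + (if 1 <= t then pw (- (alpha / 2) - 1) t else 0).
  move=> t0; have [t1|t1] := leP t 1.
    apply: (@le_trans _ _ (W t * t)); first by rewrite ler_wpM2l// ge_min lexx.
    rewrite -[leLHS]addr0 lerD// /W !pwE// -[X in _ * X](powRr1 (ltW t0)) -powRD ?(gt_eqF t0) ?implybT//.
    by rewrite (_ : - (alpha + 3) / 2 + 1 = a - 1)// /a; field.
  rewrite (ltW t1) add0r; apply: (@le_trans _ _ (W t * Num.sqrt t)).
    by rewrite ler_wpM2l// ge_min lexx orbT.
  rewrite /W !pwE// -powR12_sqrt ?(ltW t0)// -powRD ?(gt_eqF t0) ?implybT//.
  by rewrite (_ : - (alpha + 3) / 2 + 2^-1 = - (alpha / 2) - 1)//; field.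
have al2 : 0 < alpha / 2 by rewrite divr_gt0.
have intf : leb.-integrable setT (EFin \o f).
  apply: integrable_lt_pinfty => //; under eq_integral do rewrite ger0_norm//.
  under eq_integral do rewrite EFinM EFinD.
  rewrite ge0_integralZl; try side.
  rewrite ge0_integralD; try side.
  rewrite lte_mul_pinfty ?lee_fin//; apply: lte_add_pinfty.
    by apply: le_lt_trans (integral_pw_near0 a_gt0 ltr01) _; rewrite ltry.
  by apply: le_lt_trans (integral_pw_nearoo al2 ltr01) _; rewrite ltry.
pose F t z : R := W t * (gaussn t z * q x z).
have mF : measurable_fun setT (fun p : R * 'rV[R]_n => F p.1 p.2).
  apply: measurable_funM; first exact: (measurableT_comp mW measurable_fst).
  by apply: measurable_funM; [mfun|exact: (measurableT_comp mq measurable_snd)].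
have Ff t : (\int[mu]_z `|F t z|%:E <= (f t)%:E)%E.
  have [t0|t0] := leP t 0.
    rewrite integral0_eq ?lee_fin// => z _.
    by rewrite /F /W /pw ltNge t0/= mul0r normr0.
  under eq_integral => z _ do rewrite /F (normrM (W t)) (ger0_norm (W0 t)) EFinM.
  rewrite ge0_integralZl; try side.
  apply: (@le_trans _ _ ((W t)%:E * (C * Num.min t (Num.sqrt t))%:E)%E).
    by apply: lee_wpmul2l; [rewrite lee_fin|exact: hC].
  by rewrite -EFinM lee_fin mulrCA ler_wpM2l// Wmin.
(* Subordination excludes the origin, but there the numerator vanishes and both sides are 0. *)
have q0 z : z = 0 -> q x z = 0 by move=> ->; rewrite /q mxE mul0r.
have iWg z : z != 0 -> leb.-integrable setT (EFin \o (fun t => W t * gaussn t z)).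
  move=> z0; apply: integrable_lt_pinfty; first by mfun.
  under eq_integral do rewrite (ger0_norm (mulr_ge0 (W0 _) (g0 _ _))).
  by rewrite hE// ltry.
have Fz z : leb.-integrable setT (EFin \o (F ^~ z)).
  have [->|z0] := eqVneq z 0.
    rewrite (_ : F ^~ 0 = fun=> 0); last by apply/funext => t; rewrite /F q0// mulr0 mulr0.
    by apply: integrable_lt_pinfty => //; under eq_integral do rewrite normr0; rewrite integral0 ltry.
  rewrite (_ : F ^~ z = fun t => q x z * (W t * gaussn t z)).
    by apply: integrableR_Zl; exact: iWg.
  by apply/funext => t; rewrite /F mulrA mulrC.
have FzE z : \int[leb]_t F t z = E * (q x z / P z).
  have [->|z0] := eqVneq z 0.
    rewrite q0// mul0r mulr0 /Rintegral integral0_eq// => t _.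
    by rewrite /F q0// !mulr0.
  under eq_Rintegral do rewrite /F mulrA.
  rewrite RintegralZr//; last exact: iWg.
  by rewrite /Rintegral hE//= mulrAC -mulrA.
have swap : \int[leb]_t \int[mu]_z F t z = \int[mu]_z \int[leb]_t F t z.
  by apply: (@Rintegral_swap_le _ _ _ _ _ leb mu F f) => // z; exact: integrableR_fin.
have iqP : mu.-integrable setT (EFin \o (fun z => q x z / P z)).
  have mqP : measurable_fun setT (fun z => q x z / P z) by mfun.
  apply: integrable_lt_pinfty => //.
  apply: (@le_lt_trans _ _ (\int[mu]_z ((E^-1)%:E * \int[leb]_t `|F t z|%:E))%E).
    have Ei : 0 <= E^-1 by rewrite invr_ge0 ltW.
    have mI : measurable_fun setT (fun z => \int[leb]_t `|F t z|%:E)%E.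
      apply: measurable_integral2; first by nneg.
      have msw : measurable_fun setT (fun p : 'rV[R]_n * R => (p.2, p.1)) by mfun.
      by apply/measurable_EFinP; apply: measurableT_comp => //; exact: (measurableT_comp mF msw).
    apply: le_integralT; [by nneg|by mfun|by mfun|].
    move=> z; have := @normr_Rintegral_le _ _ R leb (F ^~ z).
    have mFz : measurable_fun setT (F ^~ z) by exact: (measurableT_comp mF (pair2_measurable z)).
    move=> /(_ mFz); rewrite FzE normrM (gtr0_norm E0) => h1.
    have := lee_wpmul2l (ltac:(rewrite lee_fin; exact: Ei) : (0 <= (E^-1)%:E)%E) h1.
    by rewrite -EFinM mulrA mulVf ?mul1r// gt_eqF.
  rewrite ge0_integralZl//; last 3 first.
  - apply: measurable_integral2; first by nneg.
    have msw : measurable_fun setT (fun p : 'rV[R]_n * R => (p.2, p.1)) by mfun.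
    by apply/measurable_EFinP; apply: measurableT_comp => //; exact: (measurableT_comp mF msw).
  - by move=> z _; nneg.
  - by rewrite lee_fin invr_ge0 ltW.
  rewrite lte_mul_pinfty ?lee_fin ?invr_ge0 ?(ltW E0)//.
  rewrite -(@tonelli _ _ _ _ _ leb mu (fun t z => `|F t z|%:E)); last 2 first.
  - by nneg.
  - by apply/measurable_EFinP; apply: measurableT_comp.
  apply: le_lt_trans (integrableR_fin intf); apply: le_integralT.
  - by nneg.
  - apply: measurable_integral2; first by nneg.
    by apply/measurable_EFinP; apply: measurableT_comp.
  - by mfun.
  by move=> t; rewrite (ger0_norm (f0 t)).
rewrite -RintegralZl//; under eq_Rintegral do rewrite -FzE.
pose X t := pw (a - 1) t *
  \int[mu]_y ((heat_mollifier e t (y - x) - heat_mollifier e t (y - x - h *: ei)) * g y).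
have XE t : \int[mu]_z F t z = - 2 * X t.
  rewrite /X; have [t0|t0] := leP t 0.
    rewrite /pw ltNge t0/= mul0r mulr0 /Rintegral integral0_eq// => z _.
    by rewrite /F /W /pw ltNge t0/= mul0r.
  rewrite /F RintegralZl//; last first.
    apply: integrable_lt_pinfty; first by mfun.
    by apply: le_lt_trans (hC x t t0) _; rewrite ltry.
  rewrite heat_q// mulrA [RHS]mulrA; congr (_ * _).
  rewrite mulrN mulNr; congr (- _); rewrite mulrCA; congr (_ * _).
  rewrite /W !pwE// -[X in _ * X](powRr1 (ltW t0)) -powRD ?(gt_eqF t0) ?implybT//.
  by congr (_ `^ _); rewrite /a; field.
have iX : leb.-integrable setT (EFin \o X).
  rewrite (_ : X = fun t => (- 2)^-1 * \int[mu]_z F t z); last first.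
    by apply/funext => t; rewrite XE mulrA mulVf ?mul1r// oppr_eq0.
  apply: integrableR_Zl; apply: (@integrableR_le _ _ _ leb _ f) => //.
    exact: measurable_Rintegral2.
  move=> t; rewrite (ger0_norm (f0 t)) -lee_fin; apply: le_trans (Ff t).
  by apply: normr_Rintegral_le; exact: (measurableT_comp mF (pair1_measurable t)).
rewrite -swap -time_swap -RintegralZl//.
by apply: eq_Rintegral => t _; exact: XE.
Qed.

End representation.

(** * The variation of the Riesz potential *)

Section riesz_variation.
Context (R : realType) (n : nat) (alpha : R).
Hypotheses (n_ge2 : (2 <= n)%N) (alpha_gt0 : 0 < alpha) (alpha_lt1 : alpha < 1).
Notation leb := (@lebesgue_measure R).
Notation mu := (lebesgue_rV R n).
Implicit Types (x y z w : 'rV[R]_n).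
Let a : R := (1 - alpha) / 2.
Let a_gt0 : 0 < a. Proof. by rewrite divr_gt0// subr_gt0. Qed.
Let a_lt1 : a < 1. Proof. by have := alpha_gt0; rewrite /a; lra. Qed.

Lemma frac_cst_gt0 : 0 < frac_cst n alpha.
Proof.
rewrite /frac_cst divr_gt0 ?Gamma_gt0//.
by rewrite !mulr_gt0 ?powR_gt0 ?pi_gt0// Gamma_gt0// divr_gt0// addr_gt0// ltr_wpDl.
Qed.

Variables (E : R) (e : R).
Hypotheses (E0 : 0 < E) (e0 : 0 < e)
  (hE : forall z : 'rV[R]_n, z != 0 -> (\int[leb]_t (pw (- (alpha + 3) / 2) t * gaussn t z)%:E =
   (E / enorm z `^ (n%:R + alpha + 1))%:E)%E).
Variables (f : 'rV[R]_n -> R) (V : R).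
Hypotheses (mf : measurable_fun setT f) (if_ : mu.-integrable setT (EFin \o f))
  (fV : (frac_variation alpha f <= V%:E)%E).

Let kap := @riesz_mollifier R n e a.
Let u := convol kap f.

Lemma measurable_riesz_mollifier : measurable_fun setT kap.
Proof.
apply: measurable_Rintegral2; rewrite /=; apply: measurable_funM; first by mfun.
by apply: measurable_heat_mollifier => //; mfun.
Qed.
Let mkap := measurable_riesz_mollifier.

Lemma riesz_mollifier_ge0 w : 0 <= kap w.
Proof.
apply: Rintegral_ge0 => t _.
by apply: mulr_ge0; [exact: pw_ge0|exact: heat_mollifier_ge0].
Qed.
Let kap0 := riesz_mollifier_ge0.

Lemma riesz_mollifierE w :
  (kap w)%:E = (\int[leb]_t (pw (a - 1) t * heat_mollifier e t w)%:E)%E.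
Proof.
have [K K0 hK] := riesz_mollifier_bounded e0 n_ge2 a_gt0 a_lt1.
apply: EFin_Rintegral_ge0.
  by move=> t; apply: mulr_ge0; [exact: pw_ge0|exact: heat_mollifier_ge0].
by apply: le_lt_trans (hK w) _; rewrite ltry.
Qed.

Let kap_bounded : exists2 K : R, 0 <= K & forall w, kap w <= K.
Proof.
have [K K0 hK] := riesz_mollifier_bounded e0 n_ge2 a_gt0 a_lt1.
by exists K => // w; rewrite -lee_fin riesz_mollifierE.
Qed.

Let mu_ : measurable_fun setT u.
Proof. exact: measurable_convol. Qed.

Section box.
Variables (i : 'I_n) (h : R) (N : R).
Hypothesis (h0 : 0 < h) (N0 : 0 <= N).
Let ei : 'rV[R]_n := delta_mx ord0 i.

(** Localises the sign weight: it becomes integrable, and the test field compactly supported. The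
    bound obtained does not depend on [N]. *)
Definition box_indic x : R := if [forall j, `|x ord0 j| <= N] then 1 else 0.

Let mbox : measurable_fun setT box_indic.
Proof.
rewrite (_ : box_indic = fun x => \prod_(j < n) (if `|x ord0 j| <= N then 1 else 0)).
  by apply: measurable_prod => j; mfun.
apply/funext => x; rewrite /box_indic; case: ifPn => [/forallP h1|].
  by rewrite big1// => j _; rewrite h1.
rewrite negb_forall => /existsP[j jN].
by rewrite (bigD1 j)//= (negbTE jN) mul0r.
Qed.

Let box01 x : 0 <= box_indic x <= 1.
Proof. by rewrite /box_indic; case: ifP; rewrite lexx ler01. Qed.

Let box_fin : (\int[mu]_x (box_indic x)%:E < +oo)%E.
Proof.
have -> : (\int[mu]_x (box_indic x)%:E = mu [set x | forall j, `[(- N)%R, N]%classic (x ord0 j)])%E.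
  rewrite -[RHS]mul1e -integral_cst//; last by apply: (@measurable_rV_box R n (fun=> `[(- N)%R, N]%classic)) => j; exact: measurable_itv.
  apply: integral_setT_ifE => x /= xN; rewrite /box_indic.
    by rewrite ifT//; apply/forallP => j; have := xN j; rewrite in_itv/= ler_norml.
  rewrite ifF//; apply/negP => /forallP h1; apply: xN => j.
  by rewrite in_itv/= -ler_norml.
rewrite (@lebesgue_rV_box R n (fun=> `[(- N)%R, N]%classic)) => [|j]; last exact: measurable_itv.
rewrite (eq_bigr (fun=> (N + N)%:E)).
  by rewrite prod_EFin ltry.
move=> j _; rewrite /= lebesgue_measure_itv/= lte_fin.
case: ifPn => [_|]; first by rewrite -EFinD opprK.
rewrite -leNgt => NN; have -> : N = 0 by apply: le_anti; rewrite N0 andbT; lra.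
by rewrite addr0.
Qed.

Let D y := u y - u (y - h *: ei).
(* The weight for which the test field detects the whole L^1 norm of [D] on the box. *)
Let g y : R := - (Num.sg (D y) * box_indic y / h).

Let mD : measurable_fun setT D.
Proof. by apply: (measurable_funB mu_); apply: (measurableT_comp mu_); mfun. Qed.

Let mg : measurable_fun setT g.
Proof.
have -> : g = fun y => - ((if D y <= 0 then if 0 <= D y then 0 else - 1 else 1) * box_indic y / h).
  apply/funext => y; rewrite /g; congr (- (_ * _ * _)).
  by case: sgrP.
clearbody D; by mfun.
Qed.

Let g_norm y : `|g y| <= h^-1 * box_indic y.
Proof.
have hi : 0 <= h^-1 by rewrite invr_ge0 ltW.
rewrite /g normrN 2!normrM (ger0_norm hi).
have /andP[b0 _] := box01 y; rewrite (ger0_norm b0) mulrC ler_wpM2l//.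
by rewrite ler_piMl// normr_sg; case: (_ != _); rewrite ?ler01.
Qed.

Let ig : mu.-integrable setT (EFin \o g).
Proof.
apply: (@integrableR_le _ _ _ mu _ (fun y => h^-1 * box_indic y)) => //.
  apply: integrableR_Zl; apply: integrable_lt_pinfty => //.
  under eq_integral => y _ do rewrite ger0_norm ?(andP (box01 y)).1//.
  exact: box_fin.
by move=> y; apply: (le_trans (g_norm y)); exact: ler_norm.
Qed.

Let gN y j : N < `|y ord0 j| -> g y = 0.
Proof.
move=> yN; rewrite /g /box_indic ifF ?mulr0 ?mul0r ?oppr0//.
by apply/negP => /forallP/(_ j); rewrite leNgt yN.
Qed.

Let c := @shift_profile R n i e h.
Let phi := test_kernel_field c g i 1 (fun=> 0%N).
Let sc j : smooth1 (c j). Proof. exact: smooth1_shift_profile. Qed.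
Let cM j (r : R) : e + h < `|r| -> c j r = 0. Proof. exact: shift_profile_out. Qed.

Let phi_test : test_field phi.
Proof. by apply: (@test_field_test_kernel_field _ _ _ (e + h) sc cM _ N mg ig gN). Qed.

(** The kernel has mass [h] and the weight is at most [1/h]. *)
Let phi_le1 : ('N[mu]_+oo[EFin \o (fun x => enorm (phi x))] <= 1)%E.
Proof.
have mm : measurable_fun setT (prodk c (fun=> 0%N)) by exact: measurable_prodk.
have m0 z : 0 <= prodk c (fun=> 0%N) z by exact: prodk_shift_ge0.
have hi : 0 <= h^-1 by rewrite invr_ge0 ltW.
have pt x : enorm (phi x) <= 1.
  rewrite /phi enorm_test_kernel_field mul1r -lee_fin.
  apply: le_trans (normr_Rintegral_le _ _) _; first by mfun.
  apply: (@le_trans _ _ (\int[mu]_y ((h^-1)%:E * (prodk c (fun=> 0%N) (y - x))%:E))%E).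
    apply: le_integralT; [by nneg|by mfun|by mfun|].
    move=> y; rewrite -EFinM lee_fin normrM (ger0_norm (m0 _)) mulrC ler_wpM2r//.
    apply: (le_trans (g_norm y)); rewrite ler_piMr//.
    by have /andP[] := box01 y.
  rewrite ge0_integralZl; try side.
  rewrite (integral_rVD (- x) (F := fun y => (prodk c (fun=> 0%N) y)%:E)); try side.
  by rewrite integral_prodk_shift// -EFinM mulVf// gt_eqF.
rewrite unlock; case: ifPn => // _; apply/ess_supP; apply/nearW => x /=.
by rewrite lee_fin ger0_norm ?sqrtr_ge0.
Qed.

Let kap_conv x : E * (frac_div alpha phi x) =
  - (2 * frac_cst n alpha) * \int[mu]_y ((kap (y - x) - kap (y - x - h *: ei)) * g y).
Proof.
rewrite /frac_div mulrCA (@frac_representation R n alpha n_ge2 alpha_gt0 alpha_lt1 i e h e0 h0 g mg ig E E0 hE x).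
by rewrite -/kap; move: (Rintegral _ _ _) (frac_cst _ _) => J C; ring.
Qed.

(** Fubini transposes the representation of the divergence: pairing it with [f] amounts to pairing
    the difference [D] of [u] with [g], up to [- 2 frac_cst / E]. By the choice of the sign in [g],
    [D g] is [- |D| / h] on the box. *)
Lemma box_shift_bound : (\int[mu]_y (box_indic y * `|u y - u (y - h *: ei)|)%:E <=
  (h * (V * (E / (2 * frac_cst n alpha))))%:E)%E.
Proof.
have fc := frac_cst_gt0; have [K K0 hK] := kap_bounded.
have mabs (k : 'rV[R]_n -> R) : measurable_fun setT k -> measurable_fun setT (fun x => `|k x|%:E) by move=> mk; mfun.
have mM (r : R) (k : 'rV[R]_n -> R) : measurable_fun setT k -> measurable_fun setT (fun x => (r%:E * `|k x|%:E)%E) by move=> mk; mfun.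
have dK w w' : `|kap w - kap w'| <= 2 * K.
  move: (kap0 w) (kap0 w') (hK w) (hK w'); move: (kap w) (kap w') => A B *.
  by rewrite ler_norml; apply/andP; split; lra.
have icv y : mu.-integrable setT (EFin \o (fun x => kap (y - x) * f x)).
  exact: (convol_integrable mkap kap0 hK mf if_).
have mdk : measurable_fun setT (fun p : 'rV[R]_n * 'rV[R]_n => kap (p.2 - p.1) - kap (p.2 - p.1 - h *: ei)).
  apply: measurable_funB; first by apply: (measurableT_comp mkap); mfun.
  by apply: (measurableT_comp mkap); mfun.
have mdg : measurable_fun setT (fun p : 'rV[R]_n * 'rV[R]_n => (kap (p.2 - p.1) - kap (p.2 - p.1 - h *: ei)) * g p.2).
  by apply: (measurable_funM mdk); exact: (measurableT_comp mg measurable_snd).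
pose F x y := (kap (y - x) - kap (y - x - h *: ei)) * g y * f x.
have mF : measurable_fun setT (fun p : 'rV[R]_n * 'rV[R]_n => F p.1 p.2).
  by apply: (measurable_funM mdg); exact: (measurableT_comp mf measurable_fst).
pose Nf := \int[mu]_x `|f x|; pose Ng := \int[mu]_y `|g y|.
have NfE : (\int[mu]_x `|f x|%:E)%E = Nf%:E.
  by rewrite EFin_Rintegral_ge0//; exact: (integrableR_fin if_).
have NgE : (\int[mu]_x `|g x|%:E)%E = Ng%:E.
  by rewrite EFin_Rintegral_ge0//; exact: (integrableR_fin ig).
have K2 : 0 <= 2 * K by rewrite mulr_ge0.
have dgK x y : `|(kap (y - x) - kap (y - x - h *: ei)) * g y| <= 2 * K * `|g y|.
  by rewrite normrM; apply: ler_wpM2r => //; exact: dK.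
have FK x y : `|F x y| <= 2 * K * `|g y| * `|f x|.
  by rewrite /F normrM; apply: ler_wpM2r => //; exact: dgK.
have mdgx x : measurable_fun setT (fun y => (kap (y - x) - kap (y - x - h *: ei)) * g y).
  by have := measurableT_comp mdg (pair1_measurable x).
have idg x : mu.-integrable setT (EFin \o (fun y => (kap (y - x) - kap (y - x - h *: ei)) * g y)).
  apply: (@integrableR_le _ _ _ mu _ (fun y => 2 * K * g y)).
  - exact: mdgx.
  - exact: integrableR_Zl.
  - by move=> y; rewrite (normrM (2 * K)) (ger0_norm K2); exact: dgK.
pose J x := \int[mu]_y ((kap (y - x) - kap (y - x - h *: ei)) * g y).
have inner x : \int[mu]_y F x y = J x * f x by rewrite -RintegralZr.
have mJ : measurable_fun setT J by apply: measurable_Rintegral2.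
have JK x : `|J x| <= 2 * K * Ng.
  rewrite -lee_fin; apply: (le_trans (normr_Rintegral_le _ (mdgx x))).
  rewrite EFinM -NgE -ge0_integralZl; try side.
  by apply: le_integralT; [move=> y; rewrite lee_fin|exact: (mabs _ (mdgx x))|first [exact: mM mg|exact: mM mf]|move=> y; rewrite -EFinM lee_fin].
have outer y : \int[mu]_x F x y = D y * g y.
  rewrite /D /u /convol -RintegralB//.
  rewrite -RintegralZr//; last exact: integrableR_B.
  by apply: eq_Rintegral => x _; rewrite /F (addrAC y (- x)); move: (kap _) (kap _) (g _) (f _) => A B C1 C2; ring.
have mFy y : measurable_fun setT (F ^~ y).
  by have := measurableT_comp mF (pair2_measurable y).
have Fy y : (\int[mu]_x `|F x y|%:E <= (2 * K * Nf * `|g y|)%:E)%E.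
  rewrite (_ : 2 * K * Nf * `|g y| = 2 * K * `|g y| * Nf); last by ring.
  have C0 : 0 <= 2 * K * `|g y| by rewrite mulr_ge0.
  rewrite EFinM -NfE -ge0_integralZl; try side.
  by apply: le_integralT; [move=> x; rewrite lee_fin|exact: (mabs _ (mFy y))|first [exact: mM mg|exact: mM mf]|move=> x; rewrite -EFinM lee_fin].
have Fx x : (\int[mu]_y `|F x y|%:E <= (2 * K * Ng * `|f x|)%:E)%E.
  rewrite (_ : 2 * K * Ng * `|f x| = 2 * K * `|f x| * Ng); last by ring.
  have C0 : 0 <= 2 * K * `|f x| by rewrite mulr_ge0.
  have mFx : measurable_fun setT (F x) by have := measurableT_comp mF (pair1_measurable x).
  rewrite EFinM -NgE -ge0_integralZl; try side.
  by apply: le_integralT; [move=> y; rewrite lee_fin|exact: (mabs _ mFx)|first [exact: mM mg|exact: mM mf]|move=> y; rewrite -EFinM lee_fin mulrAC].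
have swap : \int[mu]_x (J x * f x) = \int[mu]_y (D y * g y).
  under eq_Rintegral => x _ do rewrite -inner.
  rewrite (@Rintegral_swap_le _ _ _ _ _ mu mu F (fun x => 2 * K * Ng * `|f x|))//.
  - by apply: eq_Rintegral => y _; rewrite outer.
  - by apply: integrableR_Zl; have := integrable_norm if_.
  - by move=> y; apply: le_lt_trans (Fy y) _; rewrite ltry.
have DgE y : box_indic y * `|D y| = (- h) * (D y * g y).
  rewrite /g; have -> : Num.sg (D y) * box_indic y / h = h^-1 * (Num.sg (D y) * box_indic y) by ring.
  rewrite normrEsg; field; exact: lt0r_neq0.
have iDg : mu.-integrable setT (EFin \o (fun y => D y * g y)).
  apply: (@integrableR_le _ _ _ mu _ (fun y => 2 * K * Nf * `|g y|)).
  - exact: measurable_funM.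
  - by apply: integrableR_Zl; have := integrable_norm ig.
  - move=> y; apply: le_trans (ler_norm _); rewrite -outer -lee_fin.
    exact: (le_trans (normr_Rintegral_le _ (mFy y))).
have iDb : mu.-integrable setT (EFin \o (fun y => box_indic y * `|D y|)).
  by rewrite (funext DgE); exact: integrableR_Zl.
have divE x : f x * frac_div alpha phi x = (- (2 * frac_cst n alpha) / E) * (J x * f x).
  have := kap_conv x; rewrite -/(J x) => kx.
  have -> : frac_div alpha phi x = (E * frac_div alpha phi x) / E by field; exact: lt0r_neq0.
  by rewrite kx; field; exact: lt0r_neq0.
have iJf : mu.-integrable setT (EFin \o (fun x => J x * f x)).
  apply: (@integrableR_le _ _ _ mu _ (fun x => 2 * K * Ng * f x)).
  - exact: measurable_funM.
  - exact: integrableR_Zl.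
  - move=> x; rewrite (normrM (J x)) (normrM (2 * K * Ng)); apply: ler_wpM2r => //.
    by apply: (le_trans (JK x)); exact: ler_norm.
have /(le_trans _) : (\int[mu]_x (f x * frac_div alpha phi x)%:E <= V%:E)%E.
  by apply: le_trans fV; apply: ereal_sup_ubound; exists phi.
under eq_integral => x _ do rewrite divE.
rewrite -(EFin_Rintegral (integrableR_Zl _ iJf)).
rewrite RintegralZl// swap => /(_ _ (lexx _)).
rewrite -(EFin_Rintegral iDb); under [X in _ -> (X%:E <= _)%E]eq_Rintegral => y _ do rewrite DgE.
rewrite RintegralZl// !lee_fin.
set S := Rintegral _ _ _ => SV.
have -> : - h * S = h * ((- (2 * frac_cst n alpha) / E * S) * (E / (2 * frac_cst n alpha))).
  by field; rewrite !lt0r_neq0.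
apply: ler_wpM2l; first exact: ltW.
by apply: ler_wpM2r => //; rewrite divr_ge0 ?(ltW E0)// mulr_ge0// (ltW fc).
Qed.

End box.
End riesz_variation.

Lemma convol_bounded (R : realType) (n : nat) (k G : 'rV[R]_n -> R) (K : R) :
  measurable_fun setT k -> (forall w, 0 <= k w) -> (forall w, k w <= K) ->
  measurable_fun setT G -> (lebesgue_rV R n).-integrable setT (EFin \o G) ->
  forall y, `|convol k G y| <= K * \int[lebesgue_rV R n]_x `|G x|.
Proof.
move=> mk k0 kK mG iG y; have K0 : 0 <= K := le_trans (k0 0) (kK 0).
rewrite -lee_fin EFinM [X in (_ * X)%E]EFin_Rintegral_ge0//; last exact: (integrableR_fin iG).
apply: le_trans (normr_Rintegral_le _ _) _; first by mfun.
rewrite -ge0_integralZl; try side.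
apply: le_integralT; [by nneg|by mfun|by mfun|].
by move=> x; rewrite -EFinM lee_fin normrM (ger0_norm (k0 _)) ler_wpM2r.
Qed.

(** * Convolution with a probability density *)

Section convolution_theory.
Context (R : realType) (n : nat).
Notation mu := (lebesgue_rV R n).
Implicit Types (x y z w : 'rV[R]_n).
Variables (k : 'rV[R]_n -> R) (K : R).
Hypotheses (mk : measurable_fun setT k) (k0 : forall w, 0 <= k w) (kK : forall w, k w <= K)
  (k1 : (\int[mu]_z (k z)%:E = 1)%E).

Lemma norm_convol_le (G : 'rV[R]_n -> R) y : measurable_fun setT G ->
  (`|convol k G y|%:E <= \int[mu]_x (k (y - x) * `|G x|)%:E)%E.
Proof.
move=> mG; apply: le_trans (normr_Rintegral_le _ _) _; first by mfun.
apply: le_integralT; [by nneg|by mfun|by mfun|].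
by move=> x; rewrite lee_fin normrM (ger0_norm (k0 _)).
Qed.

Lemma integral_convol_le (G : 'rV[R]_n -> R) : measurable_fun setT G ->
  (\int[mu]_y `|convol k G y|%:E <= \int[mu]_x `|G x|%:E)%E.
Proof.
move=> mG; have mc : measurable_fun setT (convol k G) by exact: measurable_convol.
apply: (@le_trans _ _ (\int[mu]_y \int[mu]_x (k (y - x) * `|G x|)%:E)%E).
  apply: le_integralT; [by nneg|by mfun|by mfun|].
  by move=> y; exact: norm_convol_le.
rewrite (@tonelli _ _ _ _ _ mu mu (fun y x => (k (y - x) * `|G x|)%:E)%E); try side.
apply: le_integralT; [by nneg|by mfun|by mfun|].
move=> x; under eq_integral => y _ do rewrite mulrC EFinM.
rewrite ge0_integralZl; try side.
by rewrite (integral_rVD (- x) (F := fun y => (k y)%:E)) ?k1 ?mule1//; mfun.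
Qed.

Lemma integrable_convol (G : 'rV[R]_n -> R) : measurable_fun setT G ->
  mu.-integrable setT (EFin \o G) -> mu.-integrable setT (EFin \o convol k G).
Proof.
move=> mG iG; apply: integrable_lt_pinfty; first exact: measurable_convol.
by apply: le_lt_trans (integral_convol_le mG) (integrableR_fin iG).
Qed.

Let ik : mu.-integrable setT (EFin \o k).
Proof.
apply: integrable_lt_pinfty => //.
by under eq_integral => x _ do rewrite (ger0_norm (k0 x)); rewrite k1 ltry.
Qed.

Lemma convol_assoc (h G : 'rV[R]_n -> R) (L : R) y : measurable_fun setT h -> (forall w, 0 <= h w) ->
  (forall w, h w <= L) -> measurable_fun setT G -> mu.-integrable setT (EFin \o G) ->
  convol h (convol k G) y = convol (convol h k) G y.
Proof.
move=> mh h0 hL mG iG.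
have L0 : 0 <= L := le_trans (h0 0) (hL 0).
have K0 : 0 <= K := le_trans (k0 0) (kK 0).
pose F v x := h (y - x) * (k (x - v) * G v).
have FE v x : `|F v x| <= L * `|G v| * k (x - v).
  rewrite /F (normrM (h _)) (normrM (k _)) (ger0_norm (h0 _)) (ger0_norm (k0 _)).
  by rewrite -mulrA (mulrC `|G v|); apply: ler_wpM2r; rewrite ?mulr_ge0.
have mF : measurable_fun setT (fun p => F p.1 p.2) by rewrite /F; mfun.
transitivity (\int[mu]_x \int[mu]_v F v x).
  apply: eq_Rintegral => x _; rewrite -RintegralZl//.
  exact: (convol_integrable mk k0 kK mG iG).
rewrite -(@Rintegral_swap_le _ _ _ _ _ mu mu F (fun v => L * `|G v|))//.
- apply: eq_Rintegral => v _; rewrite /F.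
  under eq_Rintegral do rewrite mulrA.
  rewrite RintegralZr//; last first.
    apply: (@integrableR_le _ _ _ mu _ (fun x => L * k (x - v))); first by mfun.
      apply: integrableR_Zl; apply: integrable_lt_pinfty; first by mfun.
      under eq_integral => x _ do rewrite (ger0_norm (k0 _)).
      by rewrite (integral_rVD (- v) (F := fun y => (k y)%:E)) ?k1 ?ltry//; mfun.
    move=> x; rewrite !normrM (ger0_norm (k0 _)); apply: ler_wpM2r => //.
    by rewrite !ger0_norm.
  congr (_ * _); rewrite -[LHS](Rintegral_rVD v); last by mfun.
  by apply: eq_Rintegral => x _; rewrite addrK opprD addrA addrAC.
- by apply: integrableR_Zl; have := integrable_norm iG.
- move=> v; have C0 : 0 <= L * `|G v| by rewrite mulr_ge0.
  apply: (@le_trans _ _ (\int[mu]_x ((L * `|G v|)%:E * (k (x - v))%:E))%E).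
    by apply: le_integralT; [by nneg|by rewrite /F; mfun|by mfun|move=> x; rewrite -EFinM lee_fin].
  rewrite ge0_integralZl; try side.
  by rewrite (integral_rVD (- v) (F := fun y => (k y)%:E)) ?k1 ?mule1//; mfun.
- move=> x; have C0 : 0 <= L * K by rewrite mulr_ge0.
  apply: (@le_lt_trans _ _ (\int[mu]_v ((L * K)%:E * `|G v|%:E))%E).
    apply: le_integralT; [by nneg|by rewrite /F; mfun|by mfun|move=> v; rewrite -EFinM lee_fin].
    by apply: (le_trans (FE _ _)); rewrite mulrAC; apply: ler_wpM2r; rewrite ?ler_wpM2l.
  rewrite ge0_integralZl; try side.
  by rewrite lte_mul_pinfty//; exact: integrableR_fin.
Qed.

(** As [k] has mass 1, the difference is an average of [G (x - z) - G x]; it remains to integrate in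
    [x] first. *)
Lemma convol_diff_le (G : 'rV[R]_n -> R) : measurable_fun setT G ->
  mu.-integrable setT (EFin \o G) ->
  (\int[mu]_x `|convol k G x - G x|%:E <= \int[mu]_z ((k z)%:E * modulus G (- z)))%E.
Proof.
move=> mG iG.
have mc : measurable_fun setT (convol k G) by exact: measurable_convol.
have k1' : \int[mu]_z k z = 1 by rewrite /Rintegral k1.
have iz x : mu.-integrable setT (EFin \o (fun z => k z * G (x - z))).
  have := convol_integrable mk k0 kK mG iG x.
  move=> /integrableR_fin; rewrite -(integral_rVBr x); last 2 first.
  - by mfun.
  - by move=> z; rewrite lee_fin.
  move=> h; apply: integrable_lt_pinfty; first by mfun.
  by under eq_integral => z _ do rewrite -{1}(subKr x z).
have dE x : convol k G x - G x = \int[mu]_z (k z * (G (x - z) - G x)).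
  have {1}-> : G x = \int[mu]_z (G x * k z) by rewrite RintegralZl// k1' mulr1.
  rewrite /convol -(Rintegral_rVBr x); last by mfun.
  under eq_Rintegral => z _ do rewrite subKr.
  rewrite -RintegralB//; last exact: integrableR_Zl.
  by apply: eq_Rintegral => z _; ring.
apply: (@le_trans _ _ (\int[mu]_x \int[mu]_z (k z * `|G (x - z) - G x|)%:E)%E).
  apply: le_integralT; [by nneg|by mfun|by mfun|].
  move=> x; rewrite dE; apply: (le_trans (normr_Rintegral_le _ _)); first by mfun.
  apply: le_integralT; [by nneg|by mfun|by mfun|].
  by move=> z; rewrite lee_fin normrM (ger0_norm (k0 _)).
rewrite (@tonelli _ _ _ _ _ mu mu (fun x z => (k z * `|G (x - z) - G x|)%:E)%E); try side.
rewrite le_eqVlt; apply/orP; left; apply/eqP; apply: eq_integral => z _.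
rewrite /modulus -ge0_integralZl; try side.
by [].
Qed.
End convolution_theory.

Section modulus_bounds.
Context (R : realType) (n : nat).
Notation mu := (lebesgue_rV R n).
Implicit Types (x y z w : 'rV[R]_n).
Variables (u : 'rV[R]_n -> R) (A : R).
Hypothesis mu_ : measurable_fun setT u.

(** A displacement is decomposed along the axes and the modulus is subadditive. This loses a
    dimensional constant only. *)
Lemma modulus_le_coord z :
  (forall i (h : R), 0 < h ->
    (\int[mu]_y `|u y - u (y - h *: delta_mx ord0 i)|%:E <= (h * A)%:E)%E) ->
  (modulus u z <= (A * \sum_(i < n) `|z ord0 i|)%:E)%E.
Proof.
move=> shift_bound.
have coord i (h : R) : (modulus u (h *: delta_mx ord0 i) <= (`|h| * A)%:E)%E.
  have [h0|h0|->] := ltgtP h 0; last by rewrite scale0r modulus0// normr0 mul0r.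
  - have := @shift_bound i (- h); rewrite oppr_gt0 => /(_ h0).
    rewrite scaleNr opprK (ltr0_norm h0); apply: le_trans.
    rewrite le_eqVlt; apply/orP; left; apply/eqP; apply: eq_integral => x _.
    by rewrite distrC.
  - have := @shift_bound i h h0; rewrite (gtr0_norm h0); apply: le_trans.
    rewrite le_eqVlt; apply/orP; left; apply/eqP.
    rewrite /modulus -(integral_rVD (- (h *: delta_mx ord0 i))); try side.
    by apply: eq_integral => x _; rewrite subrK.
have {1}-> : z = \sum_(i < n) (z ord0 i *: delta_mx ord0 i) by exact: row_sum_delta.
apply: (le_trans (modulus_sum mu_ _ _)).
rewrite mulr_sumr -sumEFin; apply: lee_sum => i _.
by rewrite mulrC; exact: coord.
Qed.

Lemma modulus_heat (d : R) (K : R) z : 0 < d -> (forall x, `|u x| <= K) ->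
  (modulus (fun y => \int[mu]_v (gaussn d v * u (y + v)))%R z <= modulus u z)%E.
Proof.
move=> d0 uK; have g0 := @gaussn_ge0 R n.
have iu y : mu.-integrable setT (EFin \o (fun v => gaussn d v * u (y + v))).
  apply: (@integrableR_le _ _ _ mu _ (fun v => K * gaussn d v)); first by mfun.
    by apply: integrableR_Zl; exact: integrable_gaussn.
  move=> v; rewrite mulrC (normrM (u _)) (normrM K); apply: ler_wpM2r => //.
  by apply: (le_trans (uK _)); exact: ler_norm.
rewrite /modulus.
apply: (@le_trans _ _ (\int[mu]_x \int[mu]_v (gaussn d v * `|u (x + z + v) - u (x + v)|)%:E)%E).
  apply: le_integralT; [by nneg|by mfun|by mfun|].
  move=> x; rewrite -RintegralB//; apply: (le_trans (normr_Rintegral_le _ _)); first by mfun.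
  apply: le_integralT; [by nneg|by mfun|by mfun|].
  by move=> v; rewrite lee_fin -mulrBr (normrM (gaussn _ _)) (ger0_norm (g0 _ _)).
rewrite (@tonelli _ _ _ _ _ mu mu (fun x v => (gaussn d v * `|u (x + z + v) - u (x + v)|)%:E)%E); try side.
apply: (@le_trans _ _ (\int[mu]_v ((gaussn d v)%:E * modulus u z))%E); last first.
  have m0 := modulus_ge0 u z.
  by rewrite ge0_integralZr ?gaussn_integral1 ?mul1e//; try side.
have m0 := modulus_ge0 u z.
rewrite le_eqVlt; apply/orP; left; apply/eqP; apply: eq_integral => v _.
rewrite /modulus -(integral_rVD v (F := fun x => `|u (x + z) - u x|%:E)); try side.
rewrite -ge0_integralZl; try side.
by apply: eq_integral => x _; rewrite addrAC.
Qed.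

Lemma gaussn_first_moment : exists2 C : R, 0 < C & forall d : R, 0 < d ->
  (\int[mu]_z (gaussn d z * \sum_(i < n) `|z ord0 i|)%:E <= (C * Num.sqrt d)%:E)%E.
Proof.
have [C C0 hC] := @gaussn_moment R n.
(* The summand 1 keeps the constant positive when [n = 0]. *)
exists (C *+ n + 1) => [|d d0]; first by rewrite ltr_wpDl// mulrn_wge0// ltW.
have g0 := @gaussn_ge0 R n; have d20 : 0 < 2 * d by rewrite mulr_gt0.
have s0 z : 0 <= \sum_(i < n) `|z ord0 i| by apply: sumr_ge0.
have ms : measurable_fun setT (fun z : 'rV[R]_n => \sum_(i < n) `|z ord0 i|).
  by apply: measurable_sum => i; mfun.
have K0 : 0 <= C *+ n * Num.sqrt d by rewrite mulr_ge0 ?sqrtr_ge0// mulrn_wge0// ltW.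
apply: (@le_trans _ _ (\int[mu]_z ((C *+ n * Num.sqrt d)%:E * (gaussn (2 * d) z)%:E))%E).
  apply: le_integralT; [by nneg|by mfun|by mfun|].
  move=> z; rewrite -EFinM lee_fin mulr_sumr.
  apply: (@le_trans _ _ (\sum_(i < n) (C * Num.sqrt d * gaussn (2 * d) z))).
    by apply: ler_sum => i _; exact: hC.
  rewrite sumr_const card_ord; move: (gaussn _ _) (Num.sqrt _) => v1 v2.
  by rewrite -[leLHS]mulr_natl -[C *+ n]mulr_natl !mulrA.
rewrite ge0_integralZl ?gaussn_integral1 ?mule1//; try side.
by rewrite lee_fin; apply: ler_wpM2r; rewrite ?sqrtr_ge0// lerDl.
Qed.

Lemma heat_modulus_le_linear : exists2 C : R, 0 < C & forall (u : 'rV[R]_n -> R) (A : R),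
  0 <= A -> (forall z, (modulus u z <= (A * \sum_(i < n) `|z ord0 i|)%:E)%E) ->
  measurable_fun setT u ->
  forall t : R, 0 < t -> (heat_modulus u t <= (C * A * Num.sqrt t)%:E)%E.
Proof.
have [C C0 hC] := gaussn_first_moment; exists C => // v B B0 hB mv t t0.
have g0 := @gaussn_ge0 R n.
have mm := measurable_modulus mv; have m0 z := modulus_ge0 v z.
have s0 z : 0 <= \sum_(i < n) `|z ord0 i| by apply: sumr_ge0.
have ms : measurable_fun setT (fun z : 'rV[R]_n => \sum_(i < n) `|z ord0 i|).
  by apply: measurable_sum => i; mfun.
rewrite /heat_modulus (mulrC C) -mulrA.
apply: (@le_trans _ _ (B%:E * \int[mu]_z (gaussn t z * \sum_(i < n) `|z ord0 i|)%:E)%E).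
  rewrite -ge0_integralZl; try side.
  apply: le_integralT; [by nneg|by mfun|by mfun|].
  move=> z; apply: (le_trans (lee_wpmul2l _ (hB z))); first by rewrite lee_fin.
  by rewrite -!EFinM lee_fin mulrCA.
by rewrite EFinM; apply: lee_wpmul2l; [rewrite lee_fin|exact: hC].
Qed.

Lemma gaussn_heat (d t : R) w : 0 < d -> 0 < t ->
  (\int[mu]_z (gaussn d z * gaussn t (w + z))%:E = (gaussn (t + d) w)%:E)%E.
Proof.
move=> d0 t0; have g0 := @gaussn_ge0 R n.
rewrite -(gaussn_conv w t0 d0).
have mF : measurable_fun setT (fun z => (gaussn d z * gaussn t (w + z))%:E) by mfun.
have F0 z : (0 <= (gaussn d z * gaussn t (w + z))%:E)%E by rewrite lee_fin mulr_ge0.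
rewrite -(integral_rVBr 0 mF F0).
by apply: eq_integral => z _; rewrite sub0r gaussnN mulrC.
Qed.

End modulus_bounds.

Section riesz_modulus.
Context (R : realType) (n : nat) (alpha : R).
Hypotheses (n_ge2 : (2 <= n)%N) (alpha_gt0 : 0 < alpha) (alpha_lt1 : alpha < 1).
Notation leb := (@lebesgue_measure R).
Notation mu := (lebesgue_rV R n).
Implicit Types (x y z w : 'rV[R]_n).
Let a : R := (1 - alpha) / 2.
Let a_gt0 : 0 < a. Proof. by rewrite divr_gt0// subr_gt0. Qed.
Let a_lt1 : a < 1. Proof. by have := alpha_gt0; rewrite /a; lra. Qed.

Variables (E : R) (e : R).
Hypotheses (E0 : 0 < E) (e0 : 0 < e)
  (hE : forall z : 'rV[R]_n, z != 0 -> (\int[leb]_t (pw (- (alpha + 3) / 2) t * gaussn t z)%:E =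
   (E / enorm z `^ (n%:R + alpha + 1))%:E)%E).
Variables (f : 'rV[R]_n -> R) (V : R).
Hypotheses (mf : measurable_fun setT f) (if_ : mu.-integrable setT (EFin \o f))
  (fV : (frac_variation alpha f <= V%:E)%E).

Let kap := @riesz_mollifier R n e a.
Let u := convol kap f.
Let A : R := V * (E / (2 * frac_cst n alpha)).

Let mkap : measurable_fun setT kap.
Proof. exact: measurable_riesz_mollifier. Qed.
Let kap0 w : 0 <= kap w.
Proof. exact: riesz_mollifier_ge0. Qed.
Let mu_ : measurable_fun setT u.
Proof. exact: measurable_convol. Qed.
(** The cubes exhaust the space and the bound on each is the same. *)
Lemma riesz_shift_bound i (h : R) : 0 < h ->
  (\int[mu]_y `|u y - u (y - h *: delta_mx ord0 i)|%:E <= (h * A)%:E)%E.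
Proof.
move=> h0.
pose B (N : nat) := [set x : 'rV[R]_n | forall j, `[(- N%:R)%R, N%:R]%classic (x ord0 j)].
have -> : setT = \bigcup_N B N.
  apply/esym; rewrite -subTset => x _.
  exists (\sum_(j < n) (Num.truncn `|x ord0 j|).+1)%N => // j.
  rewrite /= in_itv/= -ler_norml; apply: (le_trans (ltW (truncnS_gt _))).
  by rewrite ler_nat (bigD1 j)//= leq_addr.
apply: integral_bigcup_le.
- apply/nondecreasing_seqP => N; apply/subsetPset => x Bx j; have := Bx j.
  rewrite /= !in_itv/= -!ler_norml => /le_trans; apply.
  by rewrite ler_nat.
- by move=> N; apply: (@measurable_rV_box R n (fun=> `[(- N%:R)%R, N%:R]%classic)) => j; exact: measurable_itv.
- have := mu_; move: u => u' m'; clear - m'; mfun.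
- by move=> x; rewrite lee_fin.
move=> N; have hb := @box_shift_bound R n alpha n_ge2 alpha_gt0 alpha_lt1 E e E0 e0 hE f V mf if_ fV i h N%:R h0 (ler0n _ _).
refine (le_trans _ hb); rewrite le_eqVlt; apply/orP; left; apply/eqP/esym.
apply: integral_setT_ifE => x Bx; rewrite /box_indic.
  rewrite ifT ?mul1r//; apply/forallP => j; have := Bx j.
  by rewrite /= in_itv/= -ler_norml.
rewrite ifF ?mul0r//; apply/negP => /forallP xN; apply: Bx => j.
by rewrite /= in_itv/= -ler_norml.
Qed.

Variable d : R.
Hypothesis d0 : 0 < d.
Let G := convol (mollifier e) f.
Let U := convol (riesz a d) G.

Lemma heat_mollifier_subst t w : 0 < t ->
  ((heat_mollifier e t w)%:E = \int[mu]_v (gaussn t (w - v) * mollifier e v)%:E)%E.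
Proof.
move=> t0; rewrite (heat_mollifierE e0 w t0).
have F0 z : (0 <= (gaussn t z * mollifier e (w - z))%:E)%E.
  by rewrite lee_fin mulr_ge0 ?gaussn_ge0// mollifier_ge0.
have mF : measurable_fun setT (fun z => (gaussn t z * mollifier e (w - z))%:E).
  by have := @measurable_mollifier R n e e0; move: (mollifier e) => m mm; clear - mm; mfun.
rewrite -(integral_rVBr w mF F0).
by apply: eq_integral => v _; rewrite subKr.
Qed.

Let m := @mollifier R n e.
Let mm : measurable_fun setT m. Proof. exact: measurable_mollifier. Qed.
Let m0 w : 0 <= m w. Proof. exact: mollifier_ge0. Qed.
Let g0 := @gaussn_ge0 R n.
Let pw0 := @pw_ge0 R.

(** Heat flow and Riesz potential commute: flowing the potential of the mollifier for a time [d] is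
    the same as convolving the mollifier with the regularised kernel. *)
Lemma heat_riesz_mollifier w :
  (\int[mu]_z (gaussn d z * kap (w + z))%:E = (convol (riesz a d) m w)%:E)%E.
Proof.
have mh z : measurable_fun setT (fun t => (pw (a - 1) t * heat_mollifier e t (w + z))%:E).
  apply/measurable_EFinP; apply: measurable_funM; first by mfun.
  by apply: measurable_heat_mollifier => //; mfun.
have h0 z t : (0 <= (pw (a - 1) t * heat_mollifier e t (w + z))%:E)%E.
  by rewrite lee_fin; apply: mulr_ge0; [exact: pw0|exact: heat_mollifier_ge0].
transitivity (\int[mu]_z \int[leb]_t \int[mu]_v
    (gaussn d z * (pw (a - 1) t * (gaussn t (w + z - v) * m v)))%:E)%E.
  apply: eq_integral => z _; rewrite EFinM.
  have -> : (kap (w + z))%:E = (\int[leb]_t (pw (a - 1) t * heat_mollifier e t (w + z))%:E)%E.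
    exact: riesz_mollifierE.
  rewrite -ge0_integralZl; [|exact: measurableT|exact: mh|by move=> t _; exact: h0|by rewrite lee_fin; exact: g0].
  apply: eq_integral => t _; have [t0|t0] := leP t 0.
    rewrite /pw ltNge t0/= mul0r mule0 integral0_eq// => v _.
    by rewrite mul0r mulr0.
  rewrite (EFinM (pw _ _)) (heat_mollifier_subst _ t0) -/m muleA -EFinM.
  rewrite -ge0_integralZl; try side.
  by apply: eq_integral => v _; rewrite -EFinM -mulrA.
rewrite (@tonelli _ _ _ _ _ mu leb (fun z t => \int[mu]_v
    (gaussn d z * (pw (a - 1) t * (gaussn t (w + z - v) * m v)))%:E)%E); try side.
transitivity (\int[leb]_t \int[mu]_v (pw (a - 1) t * (gaussn (t + d) (w - v) * m v))%:E)%E.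
  apply: eq_integral => t _; have [t0|t0] := leP t 0.
    rewrite /pw ltNge t0/= [RHS]integral0_eq => [|v _]; last by rewrite mul0r.
    by apply: integral0_eq => z _; apply: integral0_eq => v _; rewrite mul0r mulr0.
  rewrite (@tonelli _ _ _ _ _ mu mu (fun z v =>
    (gaussn d z * (pw (a - 1) t * (gaussn t (w + z - v) * m v)))%:E)%E); try side.
  apply: eq_integral => v _.
  rewrite mulrCA [X in X%:E]mulrC EFinM -(gaussn_heat _ d0 t0) -ge0_integralZl; try side.
  apply: eq_integral => z _; rewrite -EFinM addrAC; congr EFin.
  by move: (gaussn d z) (gaussn t _) (pw _ _) (m v) => *; ring.
rewrite (@tonelli _ _ _ _ _ leb mu (fun t v => (pw (a - 1) t * (gaussn (t + d) (w - v) * m v))%:E)%E); try side.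
have mr : measurable_fun setT (@riesz R n a d) by apply: measurable_riesz; mfun.
have r0 := @riesz_ge0 R n a.
have [K K0 hK] := @mollifier_bounded R n e e0.
have bd := @riesz_le R n a n_ge2 a_gt0 a_lt1 d.
rewrite /convol EFin_Rintegral_ge0; last 2 first.
- by move=> v; rewrite mulr_ge0.
- apply: (@le_lt_trans _ _ (\int[mu]_v ((riesz_bound n a d)%:E * (m v)%:E))%E).
    apply: le_integralT; [by nneg|by mfun|by mfun|].
    by move=> v; rewrite -EFinM lee_fin; apply: ler_wpM2r => //; exact: bd.
  have b0 : 0 <= riesz_bound n a d by apply: le_trans (bd 0 d0); exact: r0.
  by rewrite ge0_integralZl ?integral_mollifier ?mule1 ?ltry//; try side.
apply: eq_integral => v _; rewrite EFinM (EFin_riesz n_ge2 a_gt0 a_lt1 _ d0) -ge0_integralZr; try side.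
by apply: eq_integral => t _; rewrite -EFinM mulrA.
Qed.

Lemma riesz_mollifier_le : exists2 K : R, 0 <= K & forall w, kap w <= K.
Proof.
have [K K0 hK] := riesz_mollifier_bounded e0 n_ge2 a_gt0 a_lt1.
exists K => // w; rewrite -lee_fin.
have -> : (kap w)%:E = (\int[leb]_t (pw (a - 1) t * heat_mollifier e t w)%:E)%E.
  exact: riesz_mollifierE.
exact: hK.
Qed.

(** Joins the two halves of the proof. The test fields bound the variation of [u], whereas
    Marchaud's inversion is available for [U]; as [U] is the heat flow of [u], it inherits the
    bound. *)
Lemma heat_convol_riesz y : \int[mu]_z (gaussn d z * u (y + z)) = U y.
Proof.
have [K K0 hK] := riesz_mollifier_le; have [M M0 hM] := @mollifier_bounded R n e e0.
have mr : measurable_fun setT (@riesz R n a d) by apply: measurable_riesz; mfun.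
have rd w : riesz a d w <= riesz_bound n a d by exact: (@riesz_le R n a n_ge2 a_gt0 a_lt1).
have r0 := @riesz_ge0 R n a d.
have mc : measurable_fun setT (convol (riesz a d) m) by exact: measurable_convol.
rewrite /u (heat_convol mkap kap0 hK mf if_ y d0 mc heat_riesz_mollifier).
rewrite /U /G (convol_assoc mm m0 hM _ y mr r0 rd mf if_)//.
exact: integral_mollifier.
Qed.

(** [A] bounds a nonnegative integral, the shift by 1 along the first axis. *)
Lemma variation_cst_ge0 : 0 <= A.
Proof.
have i : 'I_n by apply: (@Ordinal n 0); exact: leq_trans n_ge2.
have := riesz_shift_bound i ltr01; rewrite mul1r -lee_fin; apply: le_trans.
by apply: integral_ge0 => x _; rewrite lee_fin.
Qed.

Lemma measurable_riesz_convol : measurable_fun setT U.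
Proof.
have mr : measurable_fun setT (@riesz R n a d) by apply: measurable_riesz; mfun.
by apply: measurable_convol => //; exact: measurable_convol.
Qed.

Lemma modulus_riesz z : (modulus U z <= (A * \sum_(i < n) `|z ord0 i|)%:E)%E.
Proof.
have [K K0 hK] := riesz_mollifier_le.
have -> : U = fun y => \int[mu]_v (gaussn d v * u (y + v)).
  by apply/funext => y; rewrite heat_convol_riesz.
refine (le_trans (modulus_heat mu_ z d0 (convol_bounded mkap kap0 hK mf if_)) _).
by apply: modulus_le_coord => // i h; exact: riesz_shift_bound.
Qed.

End riesz_modulus.

Section weighted_estimate.
Context (R : realType) (n : nat) (alpha : R).
Hypotheses (n_ge2 : (2 <= n)%N) (alpha_gt0 : 0 < alpha) (alpha_lt1 : alpha < 1).
Notation leb := (@lebesgue_measure R).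
Notation mu := (lebesgue_rV R n).
Implicit Types (x y z w : 'rV[R]_n).
Let a : R := (1 - alpha) / 2.
Let a_gt0 : 0 < a. Proof. by rewrite divr_gt0// subr_gt0. Qed.
Let a_lt1 : a < 1. Proof. by have := alpha_gt0; rewrite /a; lra. Qed.

(** For [l > 0] the set itself lies in [|U| >= l]; for [l < 0] its complement lies in
    [|U| >= - l]. *)
Lemma superlevel_fin (U : 'rV[R]_n -> R) : measurable_fun setT U ->
  (forall l, 0 < l -> (\int[mu]_x (if l <= `|U x| then 1 else 0)%:E < +oo)%E) ->
  forall l, l != 0 -> (\int[mu]_x (bindic (superlevel U l) x)%:E < +oo)%E \/
    (\int[mu]_x (bindic (negb \o superlevel U l) x)%:E < +oo)%E.
Proof.
move=> mU hU l l0; rewrite /bindic /superlevel /=.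
have b01 (b : bool) : 0 <= (if b then 1 else 0 : R) by case: b.
have bb (b c : bool) : (b -> c) -> (if b then 1 else 0 : R) <= if c then 1 else 0.
  by case: b c => [] [] // /(_ isT).
have [l1|l1|l1] := ltgtP l 0; last by move: l0; rewrite l1 eqxx.
- right; apply: le_lt_trans (hU (- l) _); last by rewrite oppr_gt0.
  apply: le_integralT; [by nneg|by mfun|by mfun|].
  move=> x; rewrite lee_fin; apply: bb; rewrite -leNgt => h.
  by rewrite (ler0_norm (le_trans h (ltW l1))) lerN2.
- left; apply: le_lt_trans (hU l l1).
  apply: le_integralT; [by nneg|by mfun|by mfun|].
  by move=> x; rewrite lee_fin; apply: bb => /ltW h; apply: (le_trans h); exact: ler_norm.
Qed.

(** The constant involves neither [e] nor [d]: bounds that depend on them serve only to justify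
    exchanges of integrals and the finiteness of superlevel sets. This makes it possible to remove
    both regularisations afterwards. *)
Lemma weighted_estimate : exists2 C : R, 0 < C &
  forall (f g : 'rV[R]_n -> R) (V e d : R), measurable_fun setT f ->
    mu.-integrable setT (EFin \o f) -> (frac_variation alpha f <= V%:E)%E ->
    0 < e -> 0 < d -> measurable_fun setT g -> (forall x, 0 <= g x) ->
    (\int[mu]_x (g x `^ (n%:R / alpha))%:E <= 1)%E ->
  (\int[mu]_x (g x * `|convol (gaussn d) (convol (mollifier e) f) x|)%:E <= (C * V)%:E)%E.
Proof.
have [E E0 hE] := @gaussn_subordination R n alpha alpha_gt0.
have [C1 C10 h1] := @level_set_estimate R n alpha alpha_gt0 alpha_lt1 n_ge2.
have [C2 C20 h2] := @heat_modulus_le_linear R n.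
have c0 := @marchaud_cst_gt0 R a a_gt0 a_lt1.
have cfoo := @marchaud_cst_fin R a a_gt0 a_lt1.
pose c := fine (marchaud_cst a 1).
have cE : c%:E = marchaud_cst a 1 by rewrite fineK// ge0_fin_numE// ltW.
have c0' : 0 < c by rewrite -lte_fin cE.
have fc := @frac_cst_gt0 R n alpha alpha_gt0 alpha_lt1.
exists (c^-1 * (C1 * C2 * (E / (2 * frac_cst n alpha)))) => [|f g V e d mf if_ fV e0 d0 mg g0 gq].
  by rewrite !mulr_gt0 ?invr_gt0// mulr_gt0.
pose A := V * (E / (2 * frac_cst n alpha)).
have A0 : 0 <= A by exact: (@variation_cst_ge0 R n alpha n_ge2 alpha_gt0 alpha_lt1 E e E0 e0 hE f V mf if_ fV).
pose G := convol (mollifier e) f; pose U := convol (riesz a d) G.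
have [K K0 hK] := @mollifier_bounded R n e e0.
have mm := @measurable_mollifier R n e e0.
have m0 := @mollifier_ge0 R n e.
have mG : measurable_fun setT G by exact: measurable_convol.
have iG : mu.-integrable setT (EFin \o G).
  by apply: (integrable_convol mm m0 _ mf if_); exact: integral_mollifier.
have mU : measurable_fun setT U by exact: (measurable_riesz_convol alpha e0 mf).
have mod := @modulus_riesz R n alpha n_ge2 alpha_gt0 alpha_lt1 E e E0 e0 hE f V mf if_ fV d d0.
have hm := h2 U A A0 mod mU.
have lev := superlevel_fin mU (riesz_superlevel_fin n_ge2 a_gt0 a_lt1 d0 mG iG).
have inv := marchaud_inversion n_ge2 a_gt0 a_lt1 d0 mG iG.
have est := h1 U g (C2 * A) mU lev hm mg g0 gq.
have mF : measurable_fun setT (convol (gaussn d) G) by apply: measurable_convol => //; mfun.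
have gs0 := @gaussn_ge0 R n; have pw0 := @pw_ge0 R.
rewrite -/G; move: (convol (gaussn d) G) mF inv => F mF inv.
have -> : (c^-1 * (C1 * C2 * (E / (2 * frac_cst n alpha))) * V)%:E = ((c^-1)%:E * (C1 * (C2 * A))%:E)%E.
  by rewrite -EFinM /A; congr EFin; ring.
have cc := ltW c0'; have ci : 0 <= c^-1 by rewrite invr_ge0 ltW.
refine (le_trans _ (lee_wpmul2l _ est)); last by rewrite lee_fin.
rewrite -/U in inv; clearbody U; clear mod hm lev est iG mG G hE h1 h2.
apply: (@le_trans _ _ ((c^-1)%:E * \int[mu]_x ((g x)%:E * (c%:E * `|F x|%:E)))%E).
  rewrite -ge0_integralZl; try side.
  apply: le_integralT; [by nneg|by mfun|by mfun|].
  move=> x; rewrite -!EFinM lee_fin le_eqVlt; apply/orP; left; apply/eqP.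
  by field; exact: lt0r_neq0.
apply: lee_wpmul2l; first by rewrite lee_fin.
apply: (@le_trans _ _ (\int[mu]_x \int[leb]_t ((g x)%:E * ((pw (- a - 1) t)%:E *
   \int[mu]_z (gaussn t z * `|U (x + z) - U x|)%:E)))%E).
  apply: le_integralT; [by nneg|by mfun|by mfun|].
  move=> x; rewrite ge0_integralZl; try side.
  by apply: lee_wpmul2l; [rewrite lee_fin|rewrite cE; exact: inv].
rewrite (@tonelli _ _ _ _ _ mu leb (fun x t => (g x)%:E * ((pw (- a - 1) t)%:E *
   \int[mu]_z (gaussn t z * `|U (x + z) - U x|)%:E))%E); try side.
rewrite le_eqVlt; apply/orP; left; apply/eqP; apply: eq_integral => t _.
rewrite -ge0_integralZl; try side.
by apply: eq_integral => x _; rewrite muleCA.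
Qed.

End weighted_estimate.

(** * Mollification in L^1 *)

Section shift_continuity.
Import HBSimple.
Context (R : realType) (n : nat).
Notation mu := (lebesgue_rV R n).
Notation leb := (@lebesgue_measure R).
Implicit Types (f g : 'rV[R]_n -> R) (x y z w : 'rV[R]_n).
Notation norm1 z := (\sum_(i < n) `|z ord0 i|).

(** Continuity of translations in [L^1], with an affine bound in place of a neighbourhood of 0.
    Integration against a probability density then requires only its first moment, which also covers
    the unbounded support of the Gaussian. *)
Definition shift_continuous f : Prop := forall eta : R, 0 < eta ->
  exists2 L : R, 0 <= L & forall z, (modulus f z <= (eta + L * norm1 z)%:E)%E.

Lemma modulus_perturb f g z : measurable_fun setT f -> measurable_fun setT g ->
  (modulus f z <= modulus g z + 2%:E * \int[mu]_x `|f x - g x|%:E)%E.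
Proof.
move=> mf mg; pose d x := `|f x - g x|%:E.
apply: (@le_trans _ _ (\int[mu]_x ((`|g (x + z) - g x|%:E + d x) + d (x + z)%R))%E).
  apply: le_integralT; [by nneg|by mfun|by rewrite /d; mfun|].
  move=> x; rewrite /d -!EFinD lee_fin.
  move: (f _) (f _) (g _) (g _) => a b c e.
  rewrite (_ : b - a = (e - c) + (b - e) - (a - c)); last by ring.
  by apply: (le_trans (ler_normB _ _)); rewrite [leRHS]addrAC lerD2r ler_normD.
rewrite ge0_integralD; try by rewrite /d; side.
rewrite ge0_integralD; try by rewrite /d; side.
rewrite (integral_rVD z (F := d)); try by rewrite /d; side.
have D0 : (0 <= \int[mu]_x d x)%E by rewrite /d; nneg.
rewrite -addeA (_ : 2%:E = 1 + 1)%E; last by rewrite -EFinD; congr EFin; ring.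
by rewrite ge0_muleDl// mul1e.
Qed.

Lemma shift_continuous_approx f : measurable_fun setT f ->
  (forall eta : R, 0 < eta -> exists g, [/\ measurable_fun setT g, shift_continuous g &
     (\int[mu]_x `|f x - g x|%:E <= eta%:E)%E]) -> shift_continuous f.
Proof.
move=> mf fg eta eta0; have e4 : 0 < eta / 4 by rewrite divr_gt0.
have [g [mg sg gE]] := fg _ e4; have [L L0 hL] := sg (eta / 2) (divr_gt0 eta0 (ltr0Sn _ _)).
exists L => // z; apply: (le_trans (modulus_perturb z mf mg)).
rewrite (_ : (eta + L * norm1 z)%:E = ((eta / 2 + L * norm1 z)%:E + (2 * (eta / 4))%:E)%E); last first.
  by rewrite -EFinD; congr EFin; field.
by apply: leeD => //; rewrite EFinM; apply: lee_wpmul2l.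
Qed.

(** Dominated convergence turns the pointwise limit into an [L^1] limit, under which the property is
    stable. *)
Lemma shift_continuous_dominated (g_ : nat -> 'rV[R]_n -> R) f h : measurable_fun setT f ->
  (forall k, measurable_fun setT (g_ k)) -> (forall k, shift_continuous (g_ k)) ->
  mu.-integrable setT (EFin \o h) -> (forall k x, `|g_ k x| <= h x) ->
  (forall x, g_ ^~ x @ \oo --> f x) -> shift_continuous f.
Proof.
move=> mf mg sg ih gh gf; apply: shift_continuous_approx => // eta eta0.
have gf' x : (EFin \o g_ ^~ x) @ \oo --> (f x)%:E.
  by apply: cvg_EFin; [exact: nearW|exact: gf].
have [||_ + _] := @dominated_convergence _ _ _ mu setT measurableT (fun k => EFin \o g_ k) (EFin \o f) (EFin \o h)
  (fun k => (measurable_EFinP _ _).2 (mg k)) ((measurable_EFinP _ _).2 mf) _ ih.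
- by apply: nearW => x _; exact: gf'.
- by apply: nearW => x k _; rewrite /= lee_fin; exact: gh.
move=> /(_ [set y | (y < eta%:E)%E]) H.
have [k _ hk] : \forall k \near \oo, (\int[mu]_x `|(g_ k x)%:E - (f x)%:E| < eta%:E)%E.
  by apply: H; apply: open_nbhs_nbhs; split; [exact: open_ereal_lt_ereal|rewrite /= lte_fin].
exists (g_ k); split => //; apply: ltW; have := hk _ (leqnn k); apply: le_lt_trans.
rewrite le_eqVlt; apply/orP; left; apply/eqP; apply: eq_integral => x _.
by rewrite distrC.
Qed.

Lemma shift_continuousD f g : measurable_fun setT f -> measurable_fun setT g ->
  shift_continuous f -> shift_continuous g -> shift_continuous (fun x => f x + g x).
Proof.
move=> mf mg sf sg eta eta0; have e2 : 0 < eta / 2 by rewrite divr_gt0.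
have [L L0 hL] := sf _ e2; have [M M0 hM] := sg _ e2.
exists (L + M) => [|z]; first exact: addr_ge0.
apply: (@le_trans _ _ (modulus f z + modulus g z)%E).
  rewrite /modulus -ge0_integralD; try side.
  apply: le_integralT; [by nneg|by mfun|by mfun|].
  by move=> x; rewrite -EFinD lee_fin opprD addrACA ler_normD.
apply: (le_trans (leeD (hL z) (hM z))); rewrite -EFinD lee_fin.
by rewrite le_eqVlt; apply/orP; left; apply/eqP; field.
Qed.

Lemma shift_continuousZ k f : measurable_fun setT f ->
  shift_continuous f -> shift_continuous (fun x => k * f x).
Proof.
move=> mf sf eta eta0; have k1 : 0 < `|k| + 1 by rewrite ltr_wpDl.
have [L L0 hL] := sf _ (divr_gt0 eta0 k1).
exists (`|k| * L) => [|z]; first exact: mulr_ge0.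
have -> : modulus (fun x => k * f x) z = (`|k|%:E * modulus f z)%E.
  rewrite /modulus -ge0_integralZl; try side.
  by apply: eq_integral => x _; rewrite -mulrBr normrM.
apply: (@le_trans _ _ (`|k|%:E * (eta / (`|k| + 1) + L * norm1 z)%:E)%E).
  by apply: lee_wpmul2l; rewrite ?lee_fin.
rewrite -EFinM lee_fin mulrDr mulrA; apply: lerD; last by rewrite mulrA.
by rewrite ler_pdivrMr// mulrC ler_wpM2l ?(ltW eta0)// lerDl.
Qed.

Lemma shift_continuous_sum (I : Type) (s : seq I) (F : I -> 'rV[R]_n -> R) :
  (forall i, measurable_fun setT (F i)) -> (forall i, shift_continuous (F i)) ->
  shift_continuous (fun x => \sum_(i <- s) F i x).
Proof.
move=> mF sF; elim: s => [|i s IH].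
  move=> eta eta0; exists 0 => // z; rewrite mul0r addr0.
  rewrite (_ : modulus _ z = 0%E) ?lee_fin ?(ltW eta0)//.
  by apply: integral0_eq => x _; rewrite !big_nil subrr normr0.
rewrite (_ : (fun x => _) = (fun x => F i x + \sum_(j <- s) F j x)); last first.
  by apply/funext => x; rewrite big_cons.
apply: shift_continuousD => //.
by apply: measurable_sum.
Qed.

Definition itv_indic (lo hi r : R) : R := if (lo <= r) && (r <= hi) then 1 else 0.

Definition ray_box : set (set 'rV[R]_n) :=
  [set A | exists b : 'I_n -> R, A = [set x : 'rV[R]_n | forall i, b i <= x ord0 i]].

(** A half-space [r <= x_i] is the increasing union of the ray boxes whose other lower bounds are
    [-M]. *)
Lemma measurable_ray_box : @measurable _ 'rV[R]_n = <<s ray_box >>.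
Proof.
apply/seteqP; split; last first.
  apply: smallest_sub; first exact: sigma_algebra_measurable.
  move=> _ [b ->]; have -> : [set x : 'rV[R]_n | forall i, b i <= x ord0 i] = [set x : 'rV[R]_n | forall i, `[b i, +oo[%classic (x ord0 i)]; last first.
    by apply: (@measurable_rV_box R n (fun i => `[b i, +oo[%classic)) => i; exact: measurable_itv.
  by apply/seteqP; split => x bx i; have := bx i; rewrite /= in_itv/= andbT.
have mid : measurable_fun setT (idfun : g_sigma_algebraType ray_box -> 'rV[R]_n).
  apply/measurable_fun_rVP => i; apply: (measurability _ (RGenCInfty.measurableE R)).
  move=> _ [_ [r ->] <-]; rewrite setTI.
  rewrite (_ : _ @^-1` _ = \bigcup_(M : nat)
    [set x : 'rV[R]_n | forall j, (if j == i then r else - M%:R) <= x ord0 j]).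
    apply: bigcupT_measurable => M; apply: sub_sigma_algebra.
    by exists (fun j => if j == i then r else - M%:R).
  apply/seteqP; split => [x|x [M _ /(_ i)]] /=; rewrite in_itv/= andbT ?eqxx// => rx.
  exists (\sum_(j < n) (Num.truncn `|x ord0 j|).+1)%N => // j; case: eqP => [->//|_].
  rewrite lerNl; apply: (le_trans (ler_norm _)); rewrite normrN.
  apply: (le_trans (ltW (truncnS_gt _))).
  by rewrite ler_nat (bigD1 j)//= leq_addr.
by move=> A mA; have := mid measurableT A mA; rewrite setTI.
Qed.

Let mitv lo hi : measurable_fun setT (itv_indic lo hi).
Proof. by rewrite /itv_indic; mfun. Qed.
Let itv0 lo hi r : 0 <= itv_indic lo hi r.
Proof. by rewrite /itv_indic; case: ifP. Qed.

Section box.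
Variable N : R.
Hypothesis N0 : 0 <= N.
Let itvE lo hi : lo <= hi -> (\int[leb]_r (itv_indic lo hi r)%:E = (hi - lo)%:E)%E.
Proof.
move=> lh; transitivity (leb `[lo, hi]%classic).
  rewrite -[RHS]mul1e -integral_cst; last exact: measurable_itv.
  apply: integral_setT_ifE => r /=; rewrite in_itv/= /itv_indic; first by move=> ->.
  by move/negP/negbTE => ->.
by rewrite lebesgue_measure_itv/= lte_fin; case: ltgtP lh => // -> _; rewrite subrr.
Qed.

(** A displacement by [s] along axis [i] changes the indicator only within [|s|] of one of the two
    faces orthogonal to that axis. These slabs have total thickness [4 |s|] and cross-section at
    most [(2 N)^(n-1)]. *)
Lemma shift_continuous_box (b : 'I_n -> R) : shift_continuous
  (fun x => \prod_(j < n) itv_indic (Num.max (b j) (- N)) N (x ord0 j)).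
Proof.
pose J j := itv_indic (Num.max (b j) (- N)) N.
pose B : R := 2 * N.
have B0 : 0 <= B by rewrite mulr_ge0.
pose p x := \prod_(j < n) J j (x ord0 j).
have mp : measurable_fun setT p by apply: measurable_prod => j; rewrite /J; mfun.
rewrite -/p => eta eta0; exists (4 * B ^+ n.-1) => [|z]; first by rewrite mulr_ge0 ?exprn_ge0.
apply: (@le_trans _ _ (4 * B ^+ n.-1 * norm1 z)%:E); last by rewrite lee_fin lerDr ltW.
have {1}-> : z = \sum_(i < n) (z ord0 i *: delta_mx ord0 i) by exact: row_sum_delta.
apply: (le_trans (modulus_sum mp _ _)).
rewrite mulr_sumr -sumEFin; apply: lee_sum => i _.
move: (z ord0 i) => {z eta eta0} s.
pose c := Num.max (b i) (- N).
(* The product of these factors majorises the change: two slabs in direction [i], the full interval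
   in the others. *)
pose a' (j : 'I_n) (r : R) : R := if j == i then
  itv_indic (c - `|s|) (c + `|s|) r + itv_indic (N - `|s|) (N + `|s|) r else itv_indic (- N) N r.
have a0 j r : 0 <= a' j r by rewrite /a'; case: ifP => _ //; rewrite addr_ge0.
have ma j : measurable_fun setT (a' j) by rewrite /a'; case: (j == i); mfun.
have ss : 0 <= `|s| by [].
apply: (@le_trans _ _ (\int[mu]_x (\prod_(j < n) a' j (x ord0 j))%:E)%E); last first.
  rewrite integral_rV_prod// (bigD1 i)//= (eq_bigr (fun=> B%:E)) => [|j ji]; last first.
    by rewrite /a' (negbTE ji) itvE ?ge0_cp// /B; congr EFin; ring.
  rewrite /a' eqxx.
  under eq_integral do rewrite EFinD.
  rewrite ge0_integralD; try side.
  rewrite !itvE; try by rewrite lerD2l; lra.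
  rewrite -prod_EFin_cond prodr_const cardC1 card_ord -EFinD -EFinM lee_fin.
  by rewrite le_eqVlt; apply/orP; left; apply/eqP; ring.
apply: le_integralT; [by nneg|by mfun| |].
  by apply/measurable_EFinP; apply: measurable_prod => j; mfun.
move=> x; rewrite lee_fin /p.
rewrite (bigD1 i)//= [X in `|_ - X|](bigD1 i)//= [leRHS](bigD1 i)//=.
rewrite (eq_bigr (fun j => J j (x ord0 j))) => [|j ji]; last first.
  by rewrite !mxE (negbTE ji) andbF mulr0 addr0.
rewrite -mulrBl normrM; apply: ler_pM => //.
- rewrite !mxE !eqxx mulr1 /a' eqxx /J -/c /itv_indic.
  move: (x ord0 i) => r.
  have s1 := ler_norm s; have s2 := ler_norm (- s); rewrite normrN in s2.
  have near_end : ~~ ((c <= r + s) && (r + s <= N)) != ~~ ((c <= r) && (r <= N)) ->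
      (c - `|s| <= r) && (r <= c + `|s|) || (N - `|s| <= r) && (r <= N + `|s|).
    rewrite !negb_and -!ltNge.
    by case: ltP => h1; case: ltP => h2; case: ltP => h3; case: ltP => h4 //= _; apply/orP;
      (left; apply/andP; split; lra) || (right; apply/andP; split; lra).
  have i0 (d : bool) : 0 <= (if d then 1 else 0 : R) by case: d.
  move: near_end; case: (_ && _) => /=; case: (_ && _) => /= h; rewrite ?subrr ?normr0 ?addr_ge0//.
  - by rewrite subr0 normr1; have /orP[->|->] := h isT; rewrite ?lerDl ?lerDr.
  - by rewrite sub0r normrN normr1; have /orP[->|->] := h isT; rewrite ?lerDl ?lerDr.
- rewrite ger0_norm; last by apply: prodr_ge0 => j _; rewrite /J.
  apply: ler_prod => j ji; rewrite {1}/J itv0/= /a' (negbTE ji) /J /itv_indic.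
  case: ifPn => [/andP[h1 h2]|_]; last by case: ifP.
  by rewrite (le_trans _ h1) ?h2// le_max lexx orbT.
Qed.

Definition cube_indic x : R := \prod_(j < n) itv_indic (- N) N (x ord0 j).

Lemma measurable_cube_indic : measurable_fun setT cube_indic.
Proof. by apply: measurable_prod => j; mfun. Qed.
Let mq := measurable_cube_indic.

Lemma cube_indic01 x : 0 <= cube_indic x <= 1.
Proof.
rewrite /cube_indic prodr_ge0//=; apply: prodr_ile1 => j _.
by rewrite itv0/= /itv_indic; case: ifP.
Qed.

Lemma shift_continuous_cube : shift_continuous cube_indic.
Proof.
have := shift_continuous_box (fun=> - N); congr shift_continuous.
by apply/funext => x; apply: eq_bigr => j _; rewrite maxxx.
Qed.

Let cube_fin : mu.-integrable setT (EFin \o cube_indic).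
Proof.
apply: integrable_lt_pinfty => //.
under eq_integral => x _ do rewrite ger0_norm ?(andP (cube_indic01 x)).1//.
rewrite /cube_indic (integral_rV_prod (a := fun=> itv_indic (- N) N))// (eq_bigr (fun=> (2 * N)%:E)) => [|j _]; last first.
  by rewrite itvE ?ge0_cp//; congr EFin; ring.
by rewrite -prod_EFin_cond ltry.
Qed.

(** Dynkin's argument from the boxes. The cube keeps all measures finite: it gives the complement by
    subtraction and dominates the partial sums of a disjoint union. *)
Lemma shift_continuous_indic (A : set 'rV[R]_n) : measurable A ->
  shift_continuous (fun x => \1_A x * cube_indic x).
Proof.
have mind (B : set 'rV[R]_n) : measurable B -> measurable_fun setT (fun x => \1_B x * cube_indic x).
  by move=> mB; apply: measurable_funM => //; exact: measurable_indic.
rewrite measurable_ray_box => mA; move: A mA.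
apply: (dynkin_induction measurable_ray_box).
- move=> _ _ [b ->] [c ->]; exists (fun i => Num.max (b i) (c i)).
  apply/seteqP; split => [x [bx cx] i|x bc]; first by rewrite ge_max bx cx.
  by split => i; have := bc i; rewrite ge_max => /andP[].
- rewrite (_ : (fun x => _) = cube_indic); first exact: shift_continuous_cube.
  by apply/funext => x; rewrite indicT mul1r.
- move=> _ [b ->]; have := shift_continuous_box b; congr shift_continuous.
  apply/funext => x; rewrite indicE; case: (boolP (x \in _)) => [|].
    rewrite inE /= mul1r => bx; apply: eq_bigr => j _.
    by rewrite /itv_indic ge_max bx.
  rewrite notin_setE /= => bx; rewrite mul0r.
  have /existsNP[j /negP bj] : ~ (forall i, b i <= x ord0 i) by [].
  by rewrite (bigD1 j)//= /itv_indic ge_max (negbTE bj) mul0r.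
- move=> B mB sB.
  rewrite (_ : (fun x => _) = fun x => cube_indic x + (- 1) * (\1_B x * cube_indic x)).
    apply: shift_continuousD => //; first by apply: measurable_funM => //; exact: mind.
      exact: shift_continuous_cube.
    by apply: shift_continuousZ => //; exact: mind.
  apply/funext => x; rewrite !indicE in_setC; case: (x \in B) => /=; ring.
- move=> F mF tF sF.
  have sumE x : (exists i0 : {i | F i x}, forall k, \sum_(i < k) (\1_(F i) x * cube_indic x) =
      if (sval i0 < k)%N then cube_indic x else 0) \/
    ((forall k, \sum_(i < k) (\1_(F i) x * cube_indic x) = 0) /\ ~ (\bigcup_i F i) x).
    have [[i _ Fi]|Fx] := pselect ((\bigcup_i F i) x); [left|right].
      exists (exist _ i Fi) => k /=.
      have off (j : 'I_k) : (j : nat) != i -> \1_(F j) x * cube_indic x = 0.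
        move=> ji; rewrite indicE memNset ?mul0r// => Fj.
        move/trivIsetP : tF => /(_ _ _ I I ji); rewrite -subset0.
        by move=> /(_ x (conj Fj Fi)).
      case: ifPn => [ik|].
        rewrite (bigD1 (Ordinal ik))//= big1 => [|j ji]; last by apply: off.
        by rewrite addr0 indicE mem_set// mul1r.
      by rewrite -leqNgt => ki; rewrite big1// => j _; apply: off; rewrite ltn_eqF// (leq_trans (ltn_ord j)).
    split => // k; rewrite big1// => j _; rewrite indicE memNset ?mul0r// => Fj.
    by apply: Fx; exists j.
  apply: (@shift_continuous_dominated (fun k x => \sum_(i < k) (\1_(F i) x * cube_indic x)) _ cube_indic) => //.
  + by apply: mind; exact: bigcupT_measurable.
  + by move=> k; apply: measurable_sum => i; exact: mind.
  + by move=> k; apply: shift_continuous_sum => i; [exact: mind|exact: sF].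
  + move=> k x; have /andP[q0 _] := cube_indic01 x.
    by case: (sumE x) => [[i0 ->]|[-> _]]; [case: ifP|]; rewrite ?normr0 ?(ger0_norm q0).
  + move=> x; case: (sumE x) => [[i0 E]|[E Fx]].
      rewrite indicE mem_set ?mul1r; last by exists (sval i0) => //; exact: (svalP i0).
      apply: cvg_near_cst; exists (sval i0).+1 => // k /= ik.
      by rewrite E ik.
    rewrite indicE memNset// mul0r; apply: cvg_near_cst; apply: nearW => k.
    by rewrite E.
Qed.

End box.

(** An [L^1] approximation by simple functions, each of which is in turn the dominated limit of its
    restrictions to growing cubes. *)
Lemma shift_continuous_integrable f : measurable_fun setT f ->
  mu.-integrable setT (EFin \o f) -> shift_continuous f.
Proof.
move=> mf if_; apply: shift_continuous_approx => // eta eta0.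
have [g_ [ig _ cv]] := approximation_sfun_integrable measurableT if_.
have /cv [k _ hk] : nbhs (0 : \bar R) [set y | (y < eta%:E)%E].
  by apply: open_nbhs_nbhs; split; [exact: open_ereal_lt_ereal|rewrite /= lte_fin].
exists (fun x => g_ k x); split => //; last by apply: ltW; exact: (hk _ (leqnn k)).
have sN (N : nat) : shift_continuous (fun x => g_ k x * cube_indic N%:R x).
  rewrite (_ : (fun x => _) = fun x => \sum_(y <- finmap.enum_fset (fset_set (range (g_ k))))
      (y * (\1_(g_ k @^-1` [set y]) x * cube_indic N%:R x))); last first.
    apply/funext => x; rewrite fimfunE fsbig_finite//= mulr_suml.
    by apply: eq_bigr => y _; rewrite mulrA.
  have mi (y : R) : measurable_fun setT (fun x => \1_(g_ k @^-1` [set y]) x * cube_indic N%:R x).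
    by apply: measurable_funM; [apply: measurable_indic|exact: measurable_cube_indic].
  apply: shift_continuous_sum => y; first by apply: measurable_funM.
  by apply: shift_continuousZ => //; apply: shift_continuous_indic.
apply: (@shift_continuous_dominated (fun N x => g_ k x * cube_indic N%:R x) _ (fun x => `|g_ k x|)) => //.
- by move=> N; apply: measurable_funM => //; exact: measurable_cube_indic.
- by have := integrable_norm (ig k).
- move=> N x; rewrite normrM ler_piMr//.
  by have /andP[c0 c1] := cube_indic01 N%:R x; rewrite ger0_norm.
move=> x; rewrite -[X in _ --> X]mulr1; apply: cvgM; first exact: cvg_cst.
apply: cvg_near_cst; exists (\sum_(j < n) (Num.truncn `|x ord0 j|).+1)%N => // N /= hN.
rewrite /cube_indic big1// => j _; rewrite /itv_indic ifT// -ler_norml.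
apply: (le_trans (ltW (truncnS_gt _))); rewrite ler_nat.
by apply: leq_trans hN; rewrite (bigD1 j)//= leq_addr.
Qed.

End shift_continuity.

Section mollification.
Context (R : realType) (n : nat).
Notation mu := (lebesgue_rV R n).
Implicit Types (x y z w : 'rV[R]_n).
Variable f : 'rV[R]_n -> R.
Hypotheses (mf : measurable_fun setT f) (if_ : mu.-integrable setT (EFin \o f)).

Lemma convol_diff_moment (k : 'rV[R]_n -> R) (K eta L c : R) :
  measurable_fun setT k -> (forall w, 0 <= k w) -> (forall w, k w <= K) ->
  (\int[mu]_z (k z)%:E = 1)%E -> 0 <= eta -> 0 <= L ->
  (forall z, (modulus f z <= (eta + L * \sum_(i < n) `|z ord0 i|)%:E)%E) ->
  (\int[mu]_z (k z * \sum_(i < n) `|z ord0 i|)%:E <= c%:E)%E ->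
  (\int[mu]_x `|convol k f x - f x|%:E <= (eta + L * c)%:E)%E.
Proof.
move=> mk k0 kK k1 eta0 L0 hL hc.
have s0 z : 0 <= \sum_(i < n) `|z ord0 i| by apply: sumr_ge0.
have ms : measurable_fun setT (fun z : 'rV[R]_n => \sum_(i < n) `|z ord0 i|).
  by apply: measurable_sum => i; mfun.
have m0 z := modulus_ge0 f z; have mm := measurable_modulus mf.
apply: (le_trans (convol_diff_le mk k0 kK k1 mf if_)).
apply: (@le_trans _ _ (\int[mu]_z (eta%:E * (k z)%:E + L%:E * (k z * \sum_(i < n) `|z ord0 i|)%:E))%E).
  apply: le_integralT; [by nneg|by mfun|by mfun|].
  move=> z; apply: (le_trans (lee_wpmul2l _ (hL (- z)))); first by rewrite lee_fin.
  rewrite -!EFinM -EFinD lee_fin mulrDr (mulrC eta) lerD2l mulrCA.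
  by under eq_bigr do rewrite mxE normrN.
rewrite ge0_integralD; try side.
rewrite !ge0_integralZl; try side.
by rewrite k1 mule1 EFinD EFinM leeD2l//; apply: lee_wpmul2l.
Qed.

Lemma mollifier_moment (e : R) : 0 < e ->
  (\int[mu]_z (mollifier e z * \sum_(i < n) `|z ord0 i|)%:E <= (n%:R * e)%:E)%E.
Proof.
move=> e0; have mm := @measurable_mollifier R n e e0; have m0 := @mollifier_ge0 R n e.
have s0 z : 0 <= \sum_(i < n) `|z ord0 i| by apply: sumr_ge0.
have ms : measurable_fun setT (fun z : 'rV[R]_n => \sum_(i < n) `|z ord0 i|).
  by apply: measurable_sum => i; mfun.
have ne0 : 0 <= n%:R * e by rewrite mulr_ge0// ltW.
apply: (@le_trans _ _ (\int[mu]_z ((n%:R * e)%:E * (mollifier e z)%:E))%E); last first.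
  by rewrite ge0_integralZl ?integral_mollifier ?mule1//; try side.
apply: le_integralT; [by nneg|by mfun|by mfun|].
move=> z; rewrite -EFinM lee_fin mulrC.
have [/forallP h|] := boolP [forall j, `|z ord0 j| <= e].
  apply: ler_wpM2r => //; rewrite mulr_natl -[n in leRHS]card_ord -sumr_const.
  by apply: ler_sum => j _; exact: h.
rewrite negb_forall => /existsP[j]; rewrite -ltNge => jz.
have -> : mollifier e z = 0 by rewrite /mollifier (bigD1 j)//; rewrite (bump_out (ltW jz)) /= mul0r.
by rewrite !mulr0.
Qed.

(** The heat flow of duration [d] spreads over a distance [sqrt d], so [d = e^2] puts both
    regularisations at the scale [e]. Since the heat flow contracts [L^1], the two errors simply
    add. *)
Lemma mollification_cvg (eta : R) : 0 < eta -> exists e d : R, [/\ 0 < e, 0 < d &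
  (\int[mu]_x `|convol (gaussn d) (convol (mollifier e) f) x - f x|%:E <= eta%:E)%E].
Proof.
move=> eta0; have e4 : 0 < eta / 4 by rewrite divr_gt0.
have [L L0 hL] := shift_continuous_integrable mf if_ e4.
have [C C0 hC] := @gaussn_first_moment R n.
(* Chosen so that with [e = eta / (4 M)] both moment terms, [L n e] and [L C e], are at most
   [eta / 4]; the summand 1 covers [L = 0]. *)
pose M := L * (n%:R + C) + 1.
have M0 : 0 < M by rewrite ltr_wpDl// mulr_ge0// addr_ge0// ltW.
pose e := eta / 4 / M; have e0 : 0 < e by rewrite divr_gt0.
have d0 : 0 < e ^+ 2 by rewrite exprn_gt0.
have Le c : 0 <= c -> c <= n%:R + C -> L * (c * e) <= eta / 4.
  move=> c0 cC; rewrite mulrA /e mulrA ler_pdivrMr// mulrC.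
  apply: ler_wpM2l; first exact: ltW.
  by apply: (@le_trans _ _ (L * (n%:R + C))); rewrite ?ler_wpM2l// lerDl.
exists e, (e ^+ 2); split => //.
have mg : measurable_fun setT (@gaussn R n (e ^+ 2)) by mfun.
have g0 := @gaussn_ge0 R n (e ^+ 2).
have gK w := @gaussn_le R n (e ^+ 2) w d0.
have g1 := @gaussn_integral1 R n _ d0.
have mm := @measurable_mollifier R n e e0; have m0 := @mollifier_ge0 R n e.
have [K K0 mK] := @mollifier_bounded R n e e0.
have m1 := @integral_mollifier R n e e0.
pose G := convol (mollifier e) f.
have mG : measurable_fun setT G by exact: measurable_convol.
have iG : mu.-integrable setT (EFin \o G) by exact: integrable_convol.
have hG : (\int[mu]_x `|G x - f x|%:E <= (eta / 4 + eta / 4)%:E)%E.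
  refine (le_trans (convol_diff_moment mm m0 mK m1 (ltW e4) L0 hL (mollifier_moment e0)) _).
  by rewrite lee_fin lerD2l Le// lerDl ltW.
have hf : (\int[mu]_x `|convol (gaussn (e ^+ 2)) f x - f x|%:E <= (eta / 4 + eta / 4)%:E)%E.
  refine (le_trans (convol_diff_moment mg g0 gK g1 (ltW e4) L0 hL (hC _ d0)) _).
  by rewrite sqrtr_sqr (gtr0_norm e0) lee_fin lerD2l Le ?(ltW C0)// lerDr.
have mcf : measurable_fun setT (convol (gaussn (e ^+ 2)) f) by exact: measurable_convol.
have mcG : measurable_fun setT (convol (gaussn (e ^+ 2)) G) by exact: measurable_convol.
rewrite -/G; apply: (@le_trans _ _ (\int[mu]_x
    (`|convol (gaussn (e ^+ 2)) (fun x => G x - f x) x|%:E + `|convol (gaussn (e ^+ 2)) f x - f x|%:E))%E).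
  have mcd : measurable_fun setT (convol (gaussn (e ^+ 2)) (fun x => G x - f x)).
    by apply: measurable_convol => //; exact: measurable_funB.
  have cE x : convol (gaussn (e ^+ 2)) (fun x => G x - f x) x =
      convol (gaussn (e ^+ 2)) G x - convol (gaussn (e ^+ 2)) f x.
    rewrite /convol -RintegralB//; last 2 first.
    - exact: (convol_integrable mg g0 gK mG iG).
    - exact: (convol_integrable mg g0 gK mf if_).
    by apply: eq_Rintegral => v _; rewrite mulrBr.
  move: (convol _ G) (convol _ f) (convol _ _) cE mcf mcG mcd => u v w uv mu1 mu2 mu3.
  clear - mf uv mu1 mu2 mu3.
  apply: le_integralT; [by nneg|by mfun|by mfun|].
  move=> x; rewrite -EFinD lee_fin uv.
  by rewrite (_ : u x - f x = u x - v x + (v x - f x)) ?ler_normD//; ring.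
have mGf : measurable_fun setT (fun x => G x - f x) by exact: measurable_funB.
have mcd : measurable_fun setT (convol (gaussn (e ^+ 2)) (fun x => G x - f x)).
  by exact: measurable_convol.
have h := le_trans (integral_convol_le mg g0 g1 mGf) hG.
rewrite ge0_integralD//.
- apply: (le_trans (leeD h hf)); rewrite -EFinD lee_fin le_eqVlt; apply/orP; left; apply/eqP.
  by field.
- by move: (convol _ _) mcd => u m; clear - m; mfun.
- by move: (convol _ _) mcf => u m; clear - m mf; mfun.
Qed.

End mollification.

(** * The Sobolev inequality *)

Section sobolev.
Context (R : realType) (n : nat) (alpha : R).
Hypotheses (n_ge2 : (2 <= n)%N) (alpha_gt0 : 0 < alpha) (alpha_lt1 : alpha < 1).
Notation mu := (lebesgue_rV R n).
Implicit Types (x y z w : 'rV[R]_n).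
Let p : R := n%:R / (n%:R - alpha).
Let q : R := n%:R / alpha.

Let n1 : 1 < n%:R :> R. Proof. by rewrite ltr1n. Qed.
Let na : 0 < n%:R - alpha. Proof. by have := n1; have := alpha_lt1; lra. Qed.
Let p_gt1 : 1 < p. Proof. by rewrite ltr_pdivlMr// mul1r ltrBlDr ltrDl. Qed.
Let p_gt0 : 0 < p := lt_trans ltr01 p_gt1.
Let q_gt0 : 0 < q. Proof. by rewrite divr_gt0// (lt_trans ltr01). Qed.
Let pq : (p - 1) * q = p.
Proof. by rewrite /p /q; field; rewrite !lt0r_neq0. Qed.
Let pV : 1 - q^-1 = p^-1.
Proof. by rewrite /p /q; field; rewrite !lt0r_neq0// (lt_trans ltr01). Qed.

(** Boundedness of [g] makes [L^1] convergence of the regularisations sufficient, with an error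
    independent of [C]. *)
Lemma dual_bound (C V K : R) (f g : 'rV[R]_n -> R) : measurable_fun setT f ->
  mu.-integrable setT (EFin \o f) -> measurable_fun setT g ->
  (forall x, 0 <= g x) -> (forall x, g x <= K) ->
  (forall e d : R, 0 < e -> 0 < d ->
    (\int[mu]_x (g x * `|convol (gaussn d) (convol (mollifier e) f) x|)%:E <= (C * V)%:E)%E) ->
  (\int[mu]_x (g x * `|f x|)%:E <= (C * V)%:E)%E.
Proof.
move=> mf if_ mg g0 gK H; have K0 : 0 <= K := le_trans (g0 0) (gK 0).
have K1 : 0 < K + 1 by rewrite ltr_wpDl.
apply/lee_addgt0Pr => eta eta0.
have [e [d [e0 d0 hF]]] := mollification_cvg mf if_ (divr_gt0 eta0 K1).
have hg := H e d e0 d0.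
have mm := @measurable_mollifier R n e e0; have m0 := @mollifier_ge0 R n e.
have [M M0 mM] := @mollifier_bounded R n e e0.
have mF : measurable_fun setT (convol (gaussn d) (convol (mollifier e) f)).
  by apply: measurable_convol; [mfun|exact: measurable_convol].
move: (convol (gaussn d) _) mF hF hg => F mF hF hg.
apply: (@le_trans _ _ (\int[mu]_x ((g x * `|F x|)%:E + K%:E * `|F x - f x|%:E))%E).
  apply: le_integralT; [by nneg|by mfun|by mfun|].
  move=> x; rewrite -EFinM -EFinD lee_fin.
  apply: (@le_trans _ _ (g x * `|F x| + g x * `|F x - f x|)).
    rewrite -mulrDr; apply: ler_wpM2l => //.
    rewrite -{1}(subKr (F x) (f x)); apply: ler_normB.
  by rewrite lerD2l; apply: ler_wpM2r.
rewrite ge0_integralD; try side.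
rewrite ge0_integralZl; try side.
apply: leeD => //; apply: (le_trans (lee_wpmul2l _ hF)); first by rewrite lee_fin.
rewrite -EFinM lee_fin mulrA ler_pdivrMr// mulrC ler_wpM2l// ?(ltW eta0)//.
by rewrite lerDl.
Qed.

(** The duality argument divides by a power of the integral of [|f|^p], whose finiteness is not yet
    known. It is run for [h = min (|f|, N)], for which that integral is at most [N^(p-1)] times the
    [L^1] norm and the extremal weight is bounded; the bound does not depend on [N]. *)
Lemma Lp_bound_of_dual (B : R) (f : 'rV[R]_n -> R) : 0 <= B -> measurable_fun setT f ->
  mu.-integrable setT (EFin \o f) ->
  (forall (g : 'rV[R]_n -> R) (K : R), measurable_fun setT g -> (forall x, 0 <= g x) -> (forall x, g x <= K) ->
     (\int[mu]_x (g x `^ q)%:E <= 1)%E -> (\int[mu]_x (g x * `|f x|)%:E <= B%:E)%E) ->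
  (\int[mu]_x (`|f x| `^ p)%:E <= (B `^ p)%:E)%E.
Proof.
move=> B0 mf if_ H.
pose D (N : nat) := [set x | `|f x| <= N%:R].
have -> : setT = \bigcup_N D N.
  apply/esym; rewrite -subTset => x _; exists (Num.truncn `|f x|).+1 => //.
  by rewrite /D/= ltW// truncnS_gt.
have mD N : measurable (D N).
  rewrite (_ : D N = (fun x => `|f x|) @^-1` `]-oo, N%:R]%classic); last first.
    by apply/seteqP; split => x; rewrite /D/= in_itv.
  have mnf : measurable_fun setT (fun x => `|f x|) by mfun.
  by rewrite -[X in measurable X]setTI; apply: (mnf measurableT); exact: measurable_itv.
apply: integral_bigcup_le => //.
- apply/nondecreasing_seqP => N; apply/subsetPset => x; rewrite /D/= => /le_trans; apply.
  by rewrite ler_nat.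
- by mfun.
move=> N; pose h x := Num.min `|f x| N%:R.
have h0 x : 0 <= h x by rewrite le_min normr_ge0 ler0n.
have mh : measurable_fun setT h by rewrite /h; mfun.
have hf x : h x <= `|f x| by rewrite ge_min lexx.
have hN x : h x <= N%:R by rewrite ge_min lexx orbT.
have p10 : 0 <= p - 1 by rewrite subr_ge0 ltW.
have hp1 x : h x `^ (p - 1) <= N%:R `^ (p - 1) by apply: ge0_ler_powR; rewrite ?nnegrE.
apply: (@le_trans _ _ (\int[mu]_x (h x `^ p)%:E)%E).
  rewrite integral_mkcond; apply: le_integralT.
  - by move=> x; rewrite patchE; case: ifP => // _; rewrite lee_fin powR_ge0.
  - by apply/(measurable_restrictT _ (mD N)); apply: measurable_funTS; mfun.
  - by mfun.
  move=> x; rewrite patchE; case: ifPn => [|_]; last by rewrite lee_fin powR_ge0.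
  by rewrite inE /D/= => fN; rewrite /h min_l.
pose I := (\int[mu]_x (h x `^ p)%:E)%E.
have hpE x : h x `^ p = h x * h x `^ (p - 1) by rewrite mulr_powRB1.
have Ifin : (I < +oo)%E.
  apply: (@le_lt_trans _ _ (\int[mu]_x ((N%:R `^ (p - 1))%:E * `|f x|%:E))%E).
    have c0 : 0 <= N%:R `^ (p - 1) by exact: powR_ge0.
    apply: le_integralT; [by nneg|by mfun|by mfun|].
    by move=> x; rewrite -EFinM lee_fin hpE mulrC; apply: ler_pM; rewrite ?powR_ge0.
  rewrite ge0_integralZl; try side.
  by rewrite lte_mul_pinfty ?lee_fin ?powR_ge0//; exact: (integrableR_fin if_).
have I0 : (0 <= I)%E by apply: integral_ge0 => x _; rewrite lee_fin powR_ge0.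
rewrite -/I; have IE : I = (fine I)%:E by rewrite fineK// ge0_fin_numE.
rewrite IE; move: (fine I) IE => J IE {Ifin}; rewrite lee_fin.
move: I0; rewrite IE lee_fin le_eqVlt => /orP[/eqP<-|J0]; first exact: powR_ge0.
(* The extremal weight of the duality between [L^p] and [L^q]. *)
pose g x := J `^ (- q^-1) * h x `^ (p - 1).
have c0 : 0 <= J `^ (- q^-1) by exact: powR_ge0.
have JB : J `^ p^-1 <= B.
  have mg : measurable_fun setT g by rewrite /g; mfun.
  have g0 x : 0 <= g x by rewrite mulr_ge0 ?powR_ge0.
  have mhp : measurable_fun setT (fun x => (h x `^ p)%:E) by mfun.
  have hp0 x : (0 <= (h x `^ p)%:E)%E by rewrite lee_fin powR_ge0.
  have Ji : 0 <= J^-1 by rewrite invr_ge0 ltW.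
  have gq : (\int[mu]_x (g x `^ q)%:E <= 1)%E.
    rewrite [leLHS](_ : _ = \int[mu]_x ((J^-1)%:E * (h x `^ p)%:E))%E; last first.
      apply: eq_integral => x _; rewrite -EFinM /g powRM ?powR_ge0// -!powRrM pq; congr ((_ * _)%:E).
      by rewrite mulNr mulVf ?lt0r_neq0// powR_inv1 ?(ltW J0).
    rewrite ge0_integralZl; try side.
    by rewrite -/I IE -EFinM mulVf ?lt0r_neq0.
  have hB := H g _ mg g0 (fun x => ler_wpM2l c0 (hp1 x)) gq.
  rewrite -lee_fin; refine (le_trans _ hB).
  apply: (@le_trans _ _ (\int[mu]_x ((J `^ (- q^-1))%:E * (h x `^ p)%:E))%E).
    rewrite ge0_integralZl; try side.
    rewrite -/I IE -EFinM lee_fin -{3}[J]powRr1 ?(ltW J0)// -powRD; last by rewrite lt0r_neq0 ?implybT.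
    by rewrite addrC pV.
  apply: le_integralT; [by nneg|by mfun|by mfun|].
  move=> x; rewrite -EFinM lee_fin /g -mulrA; apply: ler_wpM2l => //.
  by rewrite hpE mulrC; apply: ler_wpM2l; rewrite ?powR_ge0.
rewrite -[leLHS]powRr1 ?(ltW J0)// -(mulVf (lt0r_neq0 p_gt0)) powRrM.
by apply: ge0_ler_powR; rewrite ?nnegrE ?powR_ge0 ?(ltW p_gt0).
Qed.

End sobolev.

Section variation_ge0.
Context (R : realType) (n : nat) (alpha : R).

Lemma test_field0 : test_field (fun _ : 'rV[R]_n => 0 : 'rV[R]_n).
Proof.
split=> [k|].
  elim: k => [|k IH] /=; first by split=> //; exact: cst_continuous.
  split=> [|i]; first exact: cst_continuous.
  split=> [x|]; first exact: derivable_cst.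
  by rewrite (_ : 'D_(_) _ = fun=> 0)//; apply/funext => x; exact: derive_cst.
rewrite /Defs.support (_ : [set x | _] = set0); first by rewrite closure0; exact: compact0.
by apply/seteqP; split => x //=; rewrite eqxx.
Qed.

Lemma frac_variation_ge0 (f : 'rV[R]_n -> R) : (0 <= frac_variation alpha f)%E.
Proof.
apply: ereal_sup_ubound; exists (fun=> 0).
  split; first exact: test_field0.
  rewrite unlock; case: ifPn => // _; apply/ess_supP; apply/nearW => x /=.
  by rewrite /enorm /dotv big1 ?sqrtr0 ?normr0// => i _; rewrite mxE mul0r.
apply: integral0_eq => x _; rewrite /frac_div.
rewrite (_ : Rintegral _ _ _ = 0) ?mulr0//.
rewrite /Rintegral integral0_eq// => y _.
by rewrite /dotv big1 ?mul0r// => i _; rewrite !mxE subrr mulr0.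
Qed.

End variation_ge0.

Section sobolev_embedding.
Context (R : realType) (n : nat) (alpha : R).
Hypotheses (alpha_gt0 : 0 < alpha) (alpha_lt1 : alpha < 1) (n_ge2 : (2 <= n)%N).
Notation mu := (lebesgue_rV R n).
Let p : R := n%:R / (n%:R - alpha).

Lemma BV_measurable_integrable (f : 'rV[R]_n -> R) : BV n alpha f ->
  measurable_fun setT f /\ mu.-integrable setT (EFin \o f).
Proof.
move=> [fL _]; have if_ := (Lfun1_integrable mu f).1 fL; split => //.
exact: (measurable_EFinP _ _).1 (measurable_int mu if_).
Qed.

Let p_gt1 : 1 < p.
Proof.
have n1 : 1 < n%:R :> R by rewrite ltr1n.
have na : 0 < n%:R - alpha by have := alpha_lt1; lra.
by rewrite ltr_pdivlMr// mul1r ltrBlDr ltrDl.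
Qed.
Let p_gt0 : 0 < p := lt_trans ltr01 p_gt1.

Lemma sobolev_inequality : exists2 c : R, 0 < c & forall f : 'rV[R]_n -> R, BV n alpha f ->
  (\int[mu]_x (`|f x| `^ p)%:E <= ((c * fine (frac_variation alpha f)) `^ p)%:E)%E.
Proof.
have [C C0 hC] := weighted_estimate n_ge2 alpha_gt0 alpha_lt1.
exists C => // f fBV; have [mf if_] := BV_measurable_integrable fBV.
have V0 := frac_variation_ge0 alpha f.
have VE : frac_variation alpha f = (fine (frac_variation alpha f))%:E.
  by rewrite fineK// ge0_fin_numE//; exact: fBV.2.
have V0' : 0 <= fine (frac_variation alpha f) by rewrite fine_ge0.
apply: Lp_bound_of_dual => // [|g K mg g0 gK gq]; first by rewrite mulr_ge0// ltW.
apply: (dual_bound mf if_ mg g0 gK) => e d e0 d0.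
by apply: hC => //; rewrite -VE.
Qed.

Lemma Lnorm_EFin (r : R) (f : 'rV[R]_n -> R) :
  ('N[mu]_(r%:E)[EFin \o f] = (\int[mu]_x (`|f x| `^ r)%:E) `^ r^-1)%E.
Proof. by rewrite unlock; congr (_ `^ _)%E; apply: eq_integral => x _; rewrite /= poweR_EFin. Qed.

Lemma poweR_inv_le (r B : R) (I : \bar R) : 0 < r -> 0 <= B -> (0 <= I)%E ->
  (I <= (B `^ r)%:E)%E -> (I `^ r^-1 <= B%:E)%E.
Proof.
move=> r0 B0; case: I => [s| |] // s0 sB.
rewrite poweR_EFin lee_fin -[leRHS](powRr1 B0) -(mulfV (lt0r_neq0 r0)) powRrM.
by apply: ge0_ler_powR; rewrite ?nnegrE ?powR_ge0 ?invr_ge0 ?(ltW r0).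
Qed.

Lemma sobolev_norm : exists2 c : R, 0 < c & forall f : 'rV[R]_n -> R, BV n alpha f ->
  ('N[mu]_(p%:E)[EFin \o f] <= c%:E * frac_variation alpha f)%E.
Proof.
have [C C0 hC] := sobolev_inequality; exists C => // f fBV.
have V0 := frac_variation_ge0 alpha f.
have VE : frac_variation alpha f = (fine (frac_variation alpha f))%:E.
  by rewrite fineK// ge0_fin_numE//; exact: fBV.2.
rewrite VE -EFinM Lnorm_EFin; apply: poweR_inv_le => //.
- by rewrite mulr_ge0 ?fine_ge0// ltW.
- by apply: integral_ge0 => x _; rewrite lee_fin powR_ge0.
- exact: hC.
Qed.

(** With a scale [N] above both the [L^1] norm and the Sobolev bound, adding the two endpoint
    integrals gives at most [2 N^q], hence at most [(2 N)^q] as [q >= 1]. *)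
Lemma Lq_bound (q : R) : 1 <= q -> q <= p -> exists2 C : R, 0 < C &
  forall f : 'rV[R]_n -> R, BV n alpha f ->
    ('N[mu]_(q%:E)[EFin \o f] <= C%:E * BV_norm alpha f)%E.
Proof.
move=> q1 qp; have q0 : 0 < q := lt_le_trans ltr01 q1.
have [c c0 hc] := sobolev_inequality.
exists (2 * (c + 1)) => [|f fBV]; first by rewrite mulr_gt0// addr_gt0.
have [mf if_] := BV_measurable_integrable fBV.
have V0 := frac_variation_ge0 alpha f.
have VE : frac_variation alpha f = (fine (frac_variation alpha f))%:E.
  by rewrite fineK// ge0_fin_numE//; exact: fBV.2.
have N1 : ('N[mu]_1[EFin \o f])%E = (\int[mu]_x `|f x|)%:E.
  by rewrite Lnorm1 EFin_Rintegral_ge0//; exact: (integrableR_fin if_).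
rewrite /BV_norm N1 VE -EFinD -EFinM.
have h := hc f fBV.
move: (fine _) V0 VE h => V V0 VE; rewrite VE lee_fin in V0; move=> h.
set I1 := \int[mu]_x `|f x|; have I10 : 0 <= I1 by exact: Rintegral_ge0.
have I1E : (\int[mu]_x `|f x|%:E = I1%:E)%E.
  by rewrite EFin_Rintegral_ge0//; exact: (integrableR_fin if_).
apply/lee_addgt0Pr => eta eta0.
have IV : 0 <= I1 + V by rewrite addr_ge0.
(* The term [eta / 2] keeps [N] positive when the norm of [f] is 0; [2 N] is then exactly the
   right-hand side plus [eta]. *)
pose N := (c + 1) * (I1 + V) + eta / 2.
have cIV : 0 <= c * (I1 + V) by rewrite mulr_ge0// ltW.
have N0 : 0 < N by rewrite ltr_wpDl ?divr_gt0// mulr_ge0// addr_ge0// ltW.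
have N2 : 0 <= 2 * N by rewrite mulr_ge0// ltW.
have IN : I1 <= N.
  by move: cIV (divr_gt0 eta0 (ltr0Sn R 1)) V0; rewrite /N; lra.
have VN : c * V <= N.
  apply: (@le_trans _ _ (c * (I1 + V))); first by rewrite ler_wpM2l ?(ltW c0)// lerDr.
  by move: (divr_gt0 eta0 (ltr0Sn R 1)) IV; rewrite /N; lra.
rewrite -EFinD Lnorm_EFin (_ : _ + eta = 2 * N); last by rewrite /N; field.
apply: poweR_inv_le => //; first by apply: integral_ge0 => x _; rewrite lee_fin powR_ge0.
have Nq := powR_ge0 N q; have Np : 0 < N `^ p by exact: powR_gt0.
have k1 : 0 <= N `^ q / N by rewrite divr_ge0// ltW.
have k2 : 0 <= N `^ q / N `^ p by rewrite divr_ge0// ltW.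
(* [t^q <= t + t^p] at [t = |f x| / N] *)
apply: (@le_trans _ _ (\int[mu]_x ((N `^ q / N)%:E * `|f x|%:E + (N `^ q / N `^ p)%:E * (`|f x| `^ p)%:E))%E).
  apply: le_integralT; [by nneg|by mfun|by mfun|].
  move=> x; rewrite -!EFinM -EFinD lee_fin.
  move: (normr_ge0 (f x)); move: (`|f x|) => s s0.
  have t0 : 0 <= s / N by rewrite divr_ge0// ltW.
  have sE (r : R) : s `^ r = N `^ r * (s / N) `^ r.
    by rewrite -powRM ?(ltW N0)//; congr (_ `^ _); field; exact: lt0r_neq0.
  rewrite (sE q) (sE p).
  have -> : N `^ q / N * s + N `^ q / N `^ p * (N `^ p * (s / N) `^ p) = N `^ q * (s / N + (s / N) `^ p).
    by field; rewrite !lt0r_neq0.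
  apply: ler_wpM2l => //; move: (s / N) t0 => t t0.
  have [t1|t1] := leP t 1.
    rewrite -[leLHS]addr0; apply: lerD; last exact: powR_ge0.
    move: t0; rewrite le_eqVlt => /orP[/eqP<-|t0]; first by rewrite powR0// lt0r_neq0.
    by apply: ge1r_powR => //; rewrite t0.
  by rewrite -[leLHS]add0r; apply: lerD => //; apply: ler_powR => //; exact: ltW.
rewrite ge0_integralD; try side.
rewrite !ge0_integralZl; try side.
apply: (@le_trans _ _ ((N `^ q / N)%:E * N%:E + (N `^ q / N `^ p)%:E * (N `^ p)%:E)%E).
  apply: leeD; apply: lee_wpmul2l; rewrite ?lee_fin//; first by rewrite I1E lee_fin.
  apply: (le_trans h); rewrite lee_fin; apply: ge0_ler_powR; rewrite ?nnegrE ?(ltW p_gt0) ?(ltW N0)//.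
  by rewrite mulr_ge0// ltW.
rewrite -!EFinM -EFinD lee_fin !divfK ?lt0r_neq0// powRM ?(ltW N0)//.
have -> : N `^ q + N `^ q = 2 * N `^ q by ring.
apply: ler_wpM2r => //.
by rewrite -[leLHS](powRr1 (ler0n R 2)); apply: ler_powR => //; rewrite ler1n.
Qed.

End sobolev_embedding.

Theorem theorem3p9 (R : realType) (n : nat) (alpha : R)
    (alpha_gt0 : 0 < alpha) (alpha_lt1 : alpha < 1) (n_ge2 : (2 <= n)%N) :
  (exists c : R, 0 < c /\
     forall f : 'rV[R]_n -> R, BV n alpha f ->
       ('N[lebesgue_rV R n]_((n%:R / (n%:R - alpha))%:E)[EFin \o f]
         <= c%:E * frac_variation alpha f)%E) /\
  (forall q : R, 1 <= q -> q <= n%:R / (n%:R - alpha) ->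
     BV_continuously_embedded n alpha q).
Proof.
split.
  by have [c c0 hc] := sobolev_norm alpha_gt0 alpha_lt1 n_ge2; exists c.
move=> q q1 qp; have [C C0 hC] := Lq_bound alpha_gt0 alpha_lt1 n_ge2 q1 qp.
split; last by exists C.
move=> f fBV; have [mf if_] := BV_measurable_integrable fBV.
rewrite inE; apply/andP; split; first exact: sub_Lfun_mfun fBV.1.
rewrite inE/=; apply: le_lt_trans (hC f fBV) _.
rewrite lte_mul_pinfty ?lee_fin ?(ltW C0)// /BV_norm lte_add_pinfty//; last exact: fBV.2.
by rewrite Lnorm1; exact: (integrableR_fin if_).
Qed.
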